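(* Let $\Omega\subset\mathbb{R}^2$ be a bounded domain with $C^3$ boundary, $D=(-1,1)\times\Omega$, $\Gamma=[-1,1]\times\partial\Omega$, $\Sigma_{\pm1}=\{\pm1\}\times\Omega$. Fix $\gamma\ge1$, $b_0$ (with $1+(\gamma-1)b_0>0$ if $\gamma>1$), a constant $u^-$ with $c_*<u^-<\sqrt{2(b_0+\frac{1}{\gamma-1})}$ (for $\gamma=1$ the upper bound is $+\infty$), and a constant $c_1\in(0,c_* )$. Consider the problem $$\nabla\cdot\big(\rho(|\nabla\varphi|^2)\nabla\varphi\big)=0\ \text{in } D,\qquad \varphi=-u^-,\ \partial_{x_1}\varphi=u^-\ \text{on }\Sigma_{-1},\qquad |\nabla\varphi|=c_1\ \text{on }\Sigma_1,\qquad \nabla\varphi\cdot n=0\ \text{on }\Gamma,$$ where $n$ is the outward unit normal on $\Gamma$. Consider transonic shock solutions (as defined in the context) which in addition satisfy $\partial_{x_1}\varphi\ge0$ on $\Sigma_{-1}$ and on $\Sigma_1$. Then the problem admits a transonic shock solution if and only if $c_1=u^+$, where $u^+\in(0,c_* )$ is the constant determined by $u^-,b_0,\gamma$ as in the context. Moreover, in that case the solution is unique modulo translation: every such transonic shock solution equals $$\varphi_t(x_1,x_2,x_3)=\begin{cases}u^-x_1,& -1\le x_1<t,\\ u^+(x_1-t)+u^-t,& x_1>t,\end{cases}$$ for some $t\in(-1,1)$.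
   Context: The density is given by the Bernoulli law: $\rho(|\nabla\varphi|^2)=\big(1+(\gamma-1)(b_0-\tfrac12|\nabla\varphi|^2)\big)^{1/(\gamma-1)}$ for $\gamma>1$, and $\rho(|\nabla\varphi|^2)=e^{b_0-\frac12|\nabla\varphi|^2}$ for $\gamma=1$. The critical speed is $c_*=\sqrt{\frac{2}{\gamma+1}(1+(\gamma-1)b_0)}$ for $\gamma>1$ and $c_*=1$ for $\gamma=1$; a flow is subsonic where $|\nabla\varphi|<c_*$ and supersonic where $|\nabla\varphi|>c_*$. The constant $u^+$ is the unique number in $(0,c_* )$ with $\rho((u^+)^2)u^+=\rho((u^-)^2)u^-$. Transonic shock solution: for a $C^1$ function $f$ on $\bar\Omega$ let $S=\{(f(x_2,x_3),x_2,x_3)\in D:(x_2,x_3)\in\Omega\}$, $D^-=\{x\in D:x_1<f(x_2,x_3)\}$, $D^+=\{x\in D:x_1>f(x_2,x_3)\}$. A function $\varphi\in C^{0,1}(D)\cap C^2(D^-\cup D^+)$ is a transonic shock solution if it is supersonic in $D^-$ and subsonic in $D^+$, satisfies the equation in $D^-\cup D^+$ and the boundary conditions pointwise, satisfies the Rankine–Hugoniot condition $\rho(|\nabla\varphi^+|^2)\nabla\varphi^+\cdot\nu=\rho(|\nabla\varphi^-|^2)\nabla\varphi^-\cdot\nu$ on $S$ and the entropy condition $|\nabla\varphi^+|<|\nabla\varphi^-|$ on $S$, where $\nu$ is a normal vector to $S$ and $\varphi^\pm$ are the limits of $\varphi$ on $S$ from $D^\pm$. *)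

(* Defs.v *)
From Stdlib Require Import Reals Lra.
From Coquelicot Require Import Coquelicot.
Open Scope R_scope.

Definition pt2 := (R * R)%type.
Definition pt3 := (R * R * R)%type.

Definition X1 (x : pt3) : R := fst (fst x).
Definition X2 (x : pt3) : R := snd (fst x).
Definition X3 (x : pt3) : R := snd x.
Definition sec (x : pt3) : pt2 := (X2 x, X3 x).

Definition dist2 (p q : pt2) : R :=
  sqrt ((fst p - fst q) ^ 2 + (snd p - snd q) ^ 2).
Definition dist3 (x y : pt3) : R :=
  sqrt ((X1 x - X1 y) ^ 2 + (X2 x - X2 y) ^ 2 + (X3 x - X3 y) ^ 2).
Definition norm3 (v : pt3) : R := sqrt (X1 v ^ 2 + X2 v ^ 2 + X3 v ^ 2).
Definition dot3 (u v : pt3) : R := X1 u * X1 v + X2 u * X2 v + X3 u * X3 v.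

Definition open2 (A : pt2 -> Prop) : Prop :=
  forall p, A p -> exists r, 0 < r /\ forall q, dist2 q p < r -> A q.
Definition closure2 (A : pt2 -> Prop) (p : pt2) : Prop :=
  forall r, 0 < r -> exists q, A q /\ dist2 q p < r.
Definition bdry2 (A : pt2 -> Prop) (p : pt2) : Prop := closure2 A p /\ ~ A p.
Definition bounded2 (A : pt2 -> Prop) : Prop :=
  exists M, forall p, A p -> dist2 p (0, 0) <= M.
Definition connected_open2 (A : pt2 -> Prop) : Prop :=
  forall U V : pt2 -> Prop, open2 U -> open2 V ->
    (forall p, A p -> U p \/ V p) ->
    (forall p, ~ (A p /\ U p /\ V p)) ->
    (forall p, ~ (A p /\ U p)) \/ (forall p, ~ (A p /\ V p)).
Definition domain2 (A : pt2 -> Prop) : Prop :=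
  open2 A /\ (exists p, A p) /\ connected_open2 A.

Definition cont2_on (A : pt2 -> Prop) (h : pt2 -> R) : Prop :=
  forall p, A p -> forall eps, 0 < eps -> exists del, 0 < del /\
    forall q, A q -> dist2 q p < del -> Rabs (h q - h p) < eps.

Definition C3_fun (g : R -> R) : Prop :=
  forall x, ex_derive g x /\ ex_derive (Derive g) x /\
            ex_derive (Derive_n g 2) x /\ continuous (Derive_n g 3) x.

Definition rot (th : R) (v : pt2) : pt2 :=
  (cos th * fst v + sin th * snd v, - sin th * fst v + cos th * snd v).
Definition sub2 (p q : pt2) : pt2 := (fst p - fst q, snd p - snd q).

Definition boundary_chart (Om : pt2 -> Prop) (p : pt2) (th r : R) (g : R -> R) : Prop :=
  0 < r /\ C3_fun g /\ g 0 = 0 /\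
  forall z, dist2 z p < r ->
    (Om z <-> snd (rot th (sub2 z p)) < g (fst (rot th (sub2 z p)))).

Definition C3_boundary (Om : pt2 -> Prop) : Prop :=
  forall p, bdry2 Om p -> exists th r g, boundary_chart Om p th r g.

Definition outward_normal (Om : pt2 -> Prop) (p : pt2) (nu : pt2) : Prop :=
  exists th r g, boundary_chart Om p th r g /\
    nu = rot (- th) (- Derive g 0 / sqrt (1 + (Derive g 0) ^ 2),
                     1 / sqrt (1 + (Derive g 0) ^ 2)).

Definition inD (Om : pt2 -> Prop) (x : pt3) : Prop := -1 < X1 x < 1 /\ Om (sec x).
Definition Sigma_m1 (Om : pt2 -> Prop) (x : pt3) : Prop := X1 x = -1 /\ Om (sec x).
Definition Sigma_1 (Om : pt2 -> Prop) (x : pt3) : Prop := X1 x = 1 /\ Om (sec x).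
Definition Gamma (Om : pt2 -> Prop) (x : pt3) : Prop := -1 <= X1 x <= 1 /\ bdry2 Om (sec x).

Inductive idx := I1 | I2 | I3.

Definition line (i : idx) (h : pt3 -> R) (x : pt3) : R -> R :=
  match i with
  | I1 => fun t => h (t, X2 x, X3 x)
  | I2 => fun t => h (X1 x, t, X3 x)
  | I3 => fun t => h (X1 x, X2 x, t)
  end.
Definition coord (i : idx) (x : pt3) : R :=
  match i with I1 => X1 x | I2 => X2 x | I3 => X3 x end.

Definition dpar (i : idx) (h : pt3 -> R) (x : pt3) : R := Derive (line i h x) (coord i x).
Definition ex_par (i : idx) (h : pt3 -> R) (x : pt3) : Prop := ex_derive (line i h x) (coord i x).

Definition grad (h : pt3 -> R) (x : pt3) : pt3 := (dpar I1 h x, dpar I2 h x, dpar I3 h x).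

Definition cont3_on (A : pt3 -> Prop) (h : pt3 -> R) : Prop :=
  forall y, A y -> forall eps, 0 < eps -> exists del, 0 < del /\
    forall z, A z -> dist3 z y < del -> Rabs (h z - h y) < eps.

Definition C2_on (U : pt3 -> Prop) (h : pt3 -> R) : Prop :=
  (forall x, U x -> forall i j, ex_par i h x /\ ex_par j (dpar i h) x) /\
  cont3_on U h /\ (forall i, cont3_on U (dpar i h)) /\
  (forall i j, cont3_on U (dpar j (dpar i h))).

Definition Lipschitz_on (U : pt3 -> Prop) (h : pt3 -> R) : Prop :=
  exists K, forall x y, U x -> U y -> Rabs (h x - h y) <= K * dist3 x y.

Definition adh3 (A : pt3 -> Prop) (y : pt3) : Prop :=
  forall r, 0 < r -> exists z, A z /\ dist3 z y < r.

Definition lim_in3 (A : pt3 -> Prop) (h : pt3 -> R) (y : pt3) (l : R) : Prop :=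
  adh3 A y /\ forall eps, 0 < eps -> exists del, 0 < del /\
    forall z, A z -> dist3 z y < del -> Rabs (h z - l) < eps.

Definition grad_lim (A : pt3 -> Prop) (h : pt3 -> R) (y : pt3) (L : pt3) : Prop :=
  lim_in3 A (dpar I1 h) y (X1 L) /\ lim_in3 A (dpar I2 h) y (X2 L) /\
  lim_in3 A (dpar I3 h) y (X3 L).

(* pointwise boundary condition P on the gradient at a boundary point y:
   from each side Dm / Dp adjacent to y the gradient has a limit satisfying P *)
Definition bc_grad (Dm Dp : pt3 -> Prop) (h : pt3 -> R) (y : pt3) (P : pt3 -> Prop) : Prop :=
  (adh3 Dm y -> exists L, grad_lim Dm h y L /\ P L) /\
  (adh3 Dp y -> exists L, grad_lim Dp h y L /\ P L).

Definition dens_base (gam b0 q : R) : R := 1 + (gam - 1) * (b0 - q / 2).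

(* Bernoulli law rho(q), q = |grad phi|^2 *)
Definition rho (gam b0 q : R) : R :=
  if Req_EM_T gam 1 then exp (b0 - q / 2)
  else Rpower (dens_base gam b0 q) (1 / (gam - 1)).

Definition cstar (gam b0 : R) : R :=
  if Req_EM_T gam 1 then 1
  else sqrt (2 / (gam + 1) * (1 + (gam - 1) * b0)).

Definition flux (gam b0 : R) (phi : pt3 -> R) (i : idx) (z : pt3) : R :=
  rho gam b0 (norm3 (grad phi z) ^ 2) * dpar i phi z.

Definition potential_eq (gam b0 : R) (phi : pt3 -> R) (x : pt3) : Prop :=
  exists a b c,
    is_derive (line I1 (flux gam b0 phi I1) x) (X1 x) a /\
    is_derive (line I2 (flux gam b0 phi I2) x) (X2 x) b /\
    is_derive (line I3 (flux gam b0 phi I3) x) (X3 x) c /\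
    a + b + c = 0.

Definition C1_closure (Om : pt2 -> Prop) (f : pt2 -> R) : Prop :=
  (forall p, Om p -> ex_derive (fun s => f (s, snd p)) (fst p) /\
                    ex_derive (fun s => f (fst p, s)) (snd p)) /\
  cont2_on (closure2 Om) f /\
  exists F2 F3, cont2_on (closure2 Om) F2 /\ cont2_on (closure2 Om) F3 /\
    forall p, Om p -> Derive (fun s => f (s, snd p)) (fst p) = F2 p /\
                      Derive (fun s => f (fst p, s)) (snd p) = F3 p.

Definition shockS (Om : pt2 -> Prop) (f : pt2 -> R) (x : pt3) : Prop :=
  inD Om x /\ X1 x = f (sec x).
Definition Dminus (Om : pt2 -> Prop) (f : pt2 -> R) (x : pt3) : Prop :=
  inD Om x /\ X1 x < f (sec x).
Definition Dplus (Om : pt2 -> Prop) (f : pt2 -> R) (x : pt3) : Prop :=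
  inD Om x /\ X1 x > f (sec x).

Definition shock_normal (f : pt2 -> R) (p : pt2) : pt3 :=
  (1, - Derive (fun s => f (s, snd p)) (fst p), - Derive (fun s => f (fst p, s)) (snd p)).

Definition transonic_sol (Om : pt2 -> Prop) (gam b0 um c1 : R)
    (phi : pt3 -> R) (f : pt2 -> R) : Prop :=
  let Dm := Dminus Om f in
  let Dp := Dplus Om f in
  C1_closure Om f /\
  Lipschitz_on (inD Om) phi /\
  C2_on (fun x => Dm x \/ Dp x) phi /\
  (forall x, Dm x -> cstar gam b0 < norm3 (grad phi x)) /\
  (forall x, Dp x -> norm3 (grad phi x) < cstar gam b0) /\
  (forall x, Dm x \/ Dp x ->
     0 < dens_base gam b0 (norm3 (grad phi x) ^ 2) /\ potential_eq gam b0 phi x) /\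
  (forall y, Sigma_m1 Om y ->
     lim_in3 (inD Om) phi y (- um) /\
     bc_grad Dm Dp phi y (fun L => X1 L = um /\ 0 <= X1 L)) /\
  (forall y, Sigma_1 Om y ->
     bc_grad Dm Dp phi y (fun L => norm3 L = c1 /\ 0 <= X1 L)) /\
  (forall y, Gamma Om y ->
     bc_grad Dm Dp phi y (fun L => forall nu, outward_normal Om (sec y) nu ->
                                    X2 L * fst nu + X3 L * snd nu = 0)) /\
  (forall s, shockS Om f s -> exists Lm Lp,
     grad_lim Dm phi s Lm /\ grad_lim Dp phi s Lp /\
     rho gam b0 (norm3 Lp ^ 2) * dot3 Lp (shock_normal f (sec s)) =
       rho gam b0 (norm3 Lm ^ 2) * dot3 Lm (shock_normal f (sec s)) /\
     norm3 Lp < norm3 Lm).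

(* the explicit shock solution phi_t (value u^- t at x1 = t by continuity) *)
Definition phi_t (um up t : R) (x : pt3) : R :=
  if Rlt_dec (X1 x) t then um * X1 x else up * (X1 x - t) + um * t.

(* Main.v *)
(** In the supersonic region, translation in [x1] gives a divergence-free current
    (the [x1]-momentum, relative to the uniform state), whose flux through every
    surface that is space-like for the uniform state is a positive definite
    function of the deviation of the gradient.  The Rankine-Hugoniot and entropy
    conditions force the shock to be space-like for the upstream state, so
    integrating this current over small lenses bounded by a space-like cap, the
    wall and possibly the shock propagates the uniform state from the inlet up to
    the shock.

    Behind the shock, [phi] is compared with one-dimensional profiles [H(x1)] with
    [H'' <> 0]: the maximum principle excludes interior extrema of [phi - H], and a
    Hopf barrier in an interior ball excludes extrema on the wall.  On the shock,
    [phi = um f], so that an extremum there is an extremum of [f], where the shock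
    is normal and the gradient is [(up, 0, 0)]; at the outlet the gradient has
    norm [c1].  Hence [c1 = up], and then [phi - up x1] attains its infimum in the
    interior and is constant, by the strong maximum principle and connectedness.
    The shock is therefore planar. *)

From Stdlib Require Import Reals Lra Psatz Classical ClassicalEpsilon Lia.
From Coquelicot Require Import Coquelicot.
Require Import Defs.
Open Scope R_scope.

(** The regularity at the boundary shapes the proof: the gradient only has one-sided limits, and the
    Rankine-Hugoniot and outlet conditions are prescribed over the open cross-section, while extrema
    may sit on the edges where wall, shock and outlet meet. Limit gradients depend continuously on
    the boundary point, which carries these conditions to the edges; the Lipschitz bound gives the
    traces of [phi]. The energy argument uses cutoffs: layers of width [e] carry cutoff derivatives
    of size [1 / e] whose integrals stay bounded as [e] tends to 0, so a vanishing flux suffices on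
    the front and the wall, and a sign suffices on the shock.

    Downstream only [|grad phi| <= cstar] survives in the limit, so ellipticity may degenerate at
    the boundary. But where the limit gradient of [phi - H] vanishes, the speed is that of [H],
    strictly subsonic, and the equation is uniformly elliptic nearby; this makes the Hopf barrier
    available. The profile [up * x1] itself is reached by letting [H''] tend to 0. *)

Ltac Req := match goal with |- ?a = ?b => change (@eq R a b) end.

(** * Elementary bounds and derivative rules on the real line *)

Lemma Rmult_le_abs (x y a b : R) : Rabs x <= a -> Rabs y <= b -> Rabs (x * y) <= a * b.
Proof.
  intros Hx Hy. rewrite Rabs_mult.
  apply Rmult_le_compat; auto using Rabs_pos.
Qed.

Lemma exists_small (a b : R) : 0 < a -> 0 <= b -> exists d, 0 < d /\ b * d <= a.
Proof.
  intros Ha Hb. exists (a / (b + 1)). split.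
  - apply Rdiv_lt_0_compat; lra.
  - apply Rmult_le_reg_r with (b + 1); [lra|].
    replace (b * (a / (b + 1)) * (b + 1)) with (b * a) by (field; lra). nra.
Qed.

Lemma is_derive_Rmult (f g : R -> R) (x a b : R) : is_derive f x a -> is_derive g x b ->
  is_derive (fun t => f t * g t) x (a * g x + f x * b).
Proof. intros Hf Hg. apply (is_derive_mult f g x a b Hf Hg). intros; apply Rmult_comm. Qed.

Lemma is_derive_Rplus (f g : R -> R) (x a b : R) : is_derive f x a -> is_derive g x b ->
  is_derive (fun t => f t + g t) x (a + b).
Proof. intros Hf Hg. apply (is_derive_plus f g x a b Hf Hg). Qed.

Lemma is_derive_Rminus (f g : R -> R) (x a b : R) : is_derive f x a -> is_derive g x b ->
  is_derive (fun t => f t - g t) x (a - b).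
Proof. intros Hf Hg. apply (is_derive_minus f g x a b Hf Hg). Qed.

Lemma is_derive_Rscal (k : R) (f : R -> R) (x a : R) : is_derive f x a ->
  is_derive (fun t => k * f t) x (k * a).
Proof. intros Hf. apply (is_derive_scal f x k a Hf). Qed.

Lemma is_derive_Rcomp (f g : R -> R) (x a b : R) : is_derive f (g x) a -> is_derive g x b ->
  is_derive (fun t => f (g t)) x (a * b).
Proof.
  intros Hf Hg. rewrite Rmult_comm. apply (is_derive_comp f g x a b Hf Hg).
Qed.

Lemma is_derive_Rconst (c x : R) : is_derive (fun _ : R => c) x 0.
Proof. apply (is_derive_const (V := R_NormedModule)). Qed.

(** * The Bernoulli density *)

Section Gas.
Variables gam b0 : R.
Hypothesis gam1 : 1 <= gam.
Hypothesis Kpos : 1 < gam -> 0 < 1 + (gam - 1) * b0.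

Lemma stagnation_pos : 0 < 1 + (gam - 1) * b0.
Proof.
  destruct (Req_dec gam 1) as [->|H]; [lra|]. apply Kpos. lra.
Qed.

Lemma rho_pos q : 0 < rho gam b0 q.
Proof.
  unfold rho. destruct (Req_EM_T gam 1); [apply exp_pos|]. apply exp_pos.
Qed.

(* [dens_base] is the squared sound speed. *)
Lemma is_derive_rho q : 0 < dens_base gam b0 q ->
  is_derive (rho gam b0) q (- rho gam b0 q / (2 * dens_base gam b0 q)).
Proof.
  intros Hd. unfold rho, dens_base in *. destruct (Req_EM_T gam 1) as [->|H].
  - auto_derive; [trivial|]. replace (1 + (1 - 1) * (b0 - q / 2)) with 1 by ring.
    change (b0 + - (q * / 2)) with (b0 - q / 2). field.
  - unfold Rpower. auto_derive; [lra|]. unfold Rminus, Rdiv in *. field. split; lra.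
Qed.

Lemma cstar_sqr : (gam + 1) / 2 * cstar gam b0 ^ 2 = 1 + (gam - 1) * b0.
Proof.
  pose proof stagnation_pos as Hs. unfold cstar. destruct (Req_EM_T gam 1) as [->|H]; [lra|].
  rewrite pow2_sqrt; [field; lra|].
  apply Rmult_le_pos; [|lra]. apply Rlt_le, Rdiv_lt_0_compat; lra.
Qed.

Lemma cstar_pos : 0 < cstar gam b0.
Proof.
  pose proof stagnation_pos as Hs. unfold cstar. destruct (Req_EM_T gam 1) as [->|H]; [lra|].
  apply sqrt_lt_R0. apply Rmult_lt_0_compat; [|lra]. apply Rdiv_lt_0_compat; lra.
Qed.

(** The ellipticity gap: as [dens_base] is the squared sound speed, the flow is slower than the
    local sound speed exactly when it is slower than [cstar]. *)
Lemma dens_sub_sqr q : dens_base gam b0 q - q = (gam + 1) / 2 * (cstar gam b0 ^ 2 - q).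
Proof.
  replace ((gam + 1) / 2 * (cstar gam b0 ^ 2 - q)) with
    ((gam + 1) / 2 * cstar gam b0 ^ 2 - (gam + 1) / 2 * q) by ring.
  rewrite cstar_sqr. unfold dens_base. field.
Qed.

Lemma dens_pos_subsonic q : q <= cstar gam b0 ^ 2 -> 0 < dens_base gam b0 q.
Proof.
  intros Hq. unfold dens_base. pose proof cstar_sqr as H. pose proof cstar_pos as Hc.
  pose proof (pow_lt _ 2 Hc) as H2.
  assert (E : (gam - 1) * q <= (gam - 1) * cstar gam b0 ^ 2)
    by (apply Rmult_le_compat_l; lra).
  lra.
Qed.

Lemma dens_antitone q q' : q <= q' -> dens_base gam b0 q' <= dens_base gam b0 q.
Proof.
  intros H. unfold dens_base.
  assert ((gam - 1) * q <= (gam - 1) * q') by (apply Rmult_le_compat_l; lra). lra.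
Qed.

(** The derivative of the mass flux in the speed [x] is [rho * (c ^ 2 - x ^ 2) / c ^ 2], with [c]
    the local sound speed; it is positive below the critical speed. *)
Lemma mass_flux_increasing a b : 0 <= a -> a < b -> b <= cstar gam b0 ->
  rho gam b0 (a ^ 2) * a < rho gam b0 (b ^ 2) * b.
Proof.
  intros Ha Hab Hb.
  assert (Hd : forall x, a <= x <= b -> 0 < dens_base gam b0 (x ^ 2)).
  { intros x Hx. apply dens_pos_subsonic. apply pow_incr. lra. }
  assert (D : forall x, a <= x <= b -> is_derive (fun x => rho gam b0 (x ^ 2) * x) x
            (rho gam b0 (x ^ 2) * (dens_base gam b0 (x ^ 2) - x ^ 2) / dens_base gam b0 (x ^ 2))).
  { intros x Hx. specialize (Hd x Hx).
    evar_last.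
    - apply (is_derive_mult (fun x => rho gam b0 (x ^ 2)) (fun x => x)).
      + apply (is_derive_comp (rho gam b0) (fun x => x ^ 2)).
        * apply is_derive_rho, Hd.
        * apply is_derive_pow, is_derive_id.
      + apply is_derive_id.
      + intros; apply Rmult_comm.
    - unfold plus, scal, mult, one; simpl. unfold mult; simpl. simpl in Hd. field. lra. }
  destruct (MVT_cor2 (fun x => rho gam b0 (x ^ 2) * x) _ a b Hab
              (fun x Hx => proj1 (is_derive_Reals _ _ _) (D x Hx))) as [c [E Hc]].
  assert (0 < rho gam b0 (c ^ 2) * (dens_base gam b0 (c ^ 2) - c ^ 2) / dens_base gam b0 (c ^ 2)).
  { apply Rdiv_lt_0_compat; [|apply Hd; lra].
    apply Rmult_lt_0_compat; [apply rho_pos|]. rewrite dens_sub_sqr.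
    apply Rmult_lt_0_compat; [lra|]. assert (0 <= c) by lra. nra. }
  nra.
Qed.

(** Identifies the state behind a normal shock. The sign of [q] is left open by the speed bound and
    is forced by the flux relation. *)
Lemma subsonic_speed_unique up m q : 0 < up -> up <= cstar gam b0 -> 
  rho gam b0 (up ^ 2) * up = m -> Rabs q <= cstar gam b0 ->
  rho gam b0 (q ^ 2) * q = m -> q = up.
Proof.
  intros H0 H1 Hm Hq E. pose proof (rho_pos (q ^ 2)) as R1. pose proof (rho_pos (up ^ 2)) as R2.
  assert (0 < q) by nra. rewrite Rabs_right in Hq by lra.
  destruct (Rtotal_order q up) as [L|[L|L]]; [|exact L|].
  - pose proof (mass_flux_increasing q up ltac:(lra) L H1). lra.
  - pose proof (mass_flux_increasing up q ltac:(lra) L Hq). lra.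
Qed.

(* An entropy-admissible discontinuity is space-like for the upstream state:
   the mass flux across it is a unimodal function of the normal velocity, hence
   equal fluxes force the larger normal velocity to exceed the sound speed. *)
Lemma shock_slope um l e2 e3 :
  let q := (um + l) ^ 2 + (l * e2) ^ 2 + (l * e3) ^ 2 in
  0 < um -> 0 < dens_base gam b0 (um ^ 2) -> q < um ^ 2 ->
  rho gam b0 q * ((um + l) + l * e2 ^ 2 + l * e3 ^ 2) = rho gam b0 (um ^ 2) * um ->
  (1 + e2 ^ 2 + e3 ^ 2) * dens_base gam b0 (um ^ 2) < um ^ 2.
Proof.
  intros q Hum Hd Hq RH.
  set (N := 1 + e2 ^ 2 + e3 ^ 2) in *.
  assert (HN : 1 <= N) by (unfold N; nra).
  assert (Hl : l < 0).
  { apply Rnot_le_lt. intros L. unfold q in Hq. nra. }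
  destruct (Rlt_or_le (N * dens_base gam b0 (um ^ 2)) (um ^ 2)) as [H|H]; [exact H|exfalso].
  (* Segment of states from upstream ([t = 0]) to downstream ([t = l]): the jump is normal to the
     shock, [n] is the component along the unnormalised normal and [Q] the squared speed. If the
     shock were not space-like, the mass flux would be strictly increasing on the segment, yet its
     end values agree. *)
  pose (n := fun t => um + t * N).
  pose (Q := fun t => (um + t) ^ 2 + (t * e2) ^ 2 + (t * e3) ^ 2).
  assert (Hnl : 0 < n l).
  { unfold n, N. pose proof (rho_pos q). pose proof (rho_pos (um ^ 2)).
    replace (um + l * (1 + e2 ^ 2 + e3 ^ 2)) with ((um + l) + l * e2 ^ 2 + l * e3 ^ 2) by ring.
    nra. }
  assert (HQ : forall t, l <= t <= 0 -> Q t <= um ^ 2).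
  { intros t Ht. unfold Q, n in *. 
    replace ((um + t) ^ 2 + (t * e2) ^ 2 + (t * e3) ^ 2) with (um ^ 2 + t * (2 * um + t * N))
      by (unfold N; ring).
    assert (l * N <= t * N) by (apply Rmult_le_compat_r; lra).
    assert (0 <= 2 * um + t * N) by lra. nra. }
  assert (Hdt : forall t, l <= t <= 0 -> 0 < dens_base gam b0 (Q t) /\
     dens_base gam b0 (um ^ 2) <= dens_base gam b0 (Q t)).
  { intros t Ht. pose proof (dens_antitone _ _ (HQ t Ht)). lra. }
  assert (D : forall t, l <= t <= 0 -> is_derive (fun t => rho gam b0 (Q t) * n t) t
            (rho gam b0 (Q t) * (N * dens_base gam b0 (Q t) - n t ^ 2) / dens_base gam b0 (Q t))).
  { intros t Ht. destruct (Hdt t Ht) as [Hp _].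
    evar_last.
    - apply (is_derive_mult (fun t => rho gam b0 (Q t)) n).
      + apply (is_derive_comp (rho gam b0) Q).
        * apply is_derive_rho, Hp.
        * unfold Q. auto_derive; [trivial|reflexivity].
      + unfold n. auto_derive; [trivial|reflexivity].
      + intros; apply Rmult_comm.
    - unfold plus, scal, mult; simpl. unfold mult; simpl. unfold n, N. field. lra. }
  destruct (MVT_cor2 (fun t => rho gam b0 (Q t) * n t) _ l 0 Hl
              (fun x Hx => proj1 (is_derive_Reals _ _ _) (D x Hx))) as [c [E Hc]].
  assert (P : 0 < rho gam b0 (Q c) * (N * dens_base gam b0 (Q c) - n c ^ 2) / dens_base gam b0 (Q c)).
  { destruct (Hdt c ltac:(lra)) as [Hp1 Hp2].
    apply Rdiv_lt_0_compat; [|exact Hp1].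
    apply Rmult_lt_0_compat; [apply rho_pos|].
    assert (0 < n c < um) by (unfold n in *; nra). nra. }
  assert (E0 : rho gam b0 (Q 0) * n 0 = rho gam b0 (um ^ 2) * um).
  { unfold Q, n. f_equal; [f_equal|]; ring. }
  assert (E1 : rho gam b0 (Q l) * n l = rho gam b0 (um ^ 2) * um).
  { rewrite <- RH. unfold Q, n, N, q. f_equal; ring. }
  rewrite E0, E1 in E. nra.
Qed.

(* Minus the pressure: the potential whose gradient in [p] is [rho(|p|^2) p]. *)
Definition Gpot (q : R) : R := - (rho gam b0 q * dens_base gam b0 q) / gam.

Lemma is_derive_Gpot q : 0 < dens_base gam b0 q -> is_derive Gpot q (rho gam b0 q / 2).
Proof.
  intros Hd.
  apply (is_derive_ext (fun q => (- / gam) * (rho gam b0 q * dens_base gam b0 q))).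
  { intros t. unfold Gpot. Req. field. lra. }
  evar_last.
  - apply is_derive_Rscal, is_derive_Rmult.
    + apply is_derive_rho, Hd.
    + unfold dens_base. auto_derive; [trivial|reflexivity].
  - Req. unfold dens_base in *. field. lra.
Qed.

(* The hypothesis on [h] makes the covectors [(-1, e2, e3)] time-like for the uniform state. *)
Lemma energy_flux_pos um h :
  0 < um -> 0 < dens_base gam b0 (um ^ 2) -> 0 <= h ->
  (1 + h ^ 2) * dens_base gam b0 (um ^ 2) < um ^ 2 ->
  exists d, 0 < d /\ forall r1 r2 r3 e2 e3,
    Rabs r1 <= d -> Rabs r2 <= d -> Rabs r3 <= d -> e2 ^ 2 + e3 ^ 2 <= h ^ 2 ->
    let q := (um + r1) ^ 2 + r2 ^ 2 + r3 ^ 2 in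
    0 < dens_base gam b0 q /\
    (0 < r1 ^ 2 + r2 ^ 2 + r3 ^ 2 ->
     0 < rho gam b0 q * (- (um + r1) + r2 * e2 + r3 * e3) * r1 + (Gpot q - Gpot (um ^ 2))).
Proof.
  intros Hum Hd0 Hh Hm.
  set (d0 := dens_base gam b0 (um ^ 2)) in *.
  (* Up to a positive factor, the second-order part of the flux at the uniform state is [k * r1 ^ 2
     + 2 * r1 * s + r2 ^ 2 + r3 ^ 2] with [s = r2 * e2 + r3 * e3]. Replacing [k] by the midpoint
     [k1] of [h ^ 2] and [k] keeps this form at least [c] times the square norm and leaves room for
     [dens_base] to grow from [d0] to [D1]; [C0 * d] bounds the relative error. *)
  pose (k := um ^ 2 / d0 - 1).
  assert (Hk : h ^ 2 < k).
  { unfold k. apply Rmult_lt_reg_r with d0; [exact Hd0|].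
    replace ((um ^ 2 / d0 - 1) * d0) with (um ^ 2 - d0) by (field; lra). lra. }
  pose (k1 := (k + h ^ 2) / 2).
  assert (Hk1 : h ^ 2 < k1 < k) by (unfold k1; lra).
  assert (Hh2 : 0 <= h ^ 2) by nra.
  pose (c := (k1 - h ^ 2) / (1 + k1)).
  assert (Hc : 0 < c) by (apply Rdiv_lt_0_compat; lra).
  assert (Ec : c * (1 + k1) = k1 - h ^ 2) by (unfold c; field; lra).
  assert (Hc1 : c < 1) by nra.
  assert (Hck : 0 <= k1 - c) by nra.
  pose (D1 := um ^ 2 / (k1 + 1)).
  assert (ED1 : D1 * (k1 + 1) = um ^ 2) by (unfold D1; field; lra).
  assert (HD1 : d0 < D1).
  { apply Rmult_lt_reg_r with (k1 + 1); [lra|]. rewrite ED1.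
    assert (Ek : (k + 1) * d0 = um ^ 2) by (unfold k; field; lra). nra. }
  pose (C0 := um * (1 + 2 * h) + um + (1 + 2 * h)).
  assert (HC0 : 0 <= C0) by (unfold C0; nra).
  assert (Hcd : 0 < c * (d0 / 2) / 2) by nra.
  destruct (exists_small (c * (d0 / 2) / 2) C0 Hcd HC0) as [s1 [Hs1 Bs1]].
  destruct (exists_small (Rmin (d0 / 2) (D1 - d0)) ((gam - 1) / 2 * (2 * um + 3))) as [s2 [Hs2 Bs2]].
  { apply Rmin_glb_lt; lra. } { nra. }
  pose (d := Rmin 1 (Rmin s1 s2)).
  assert (Hd1 : d <= 1) by apply Rmin_l.
  assert (Hds1 : d <= s1) by (eapply Rle_trans; [apply Rmin_r|apply Rmin_l]).
  assert (Hds2 : d <= s2) by (eapply Rle_trans; [apply Rmin_r|apply Rmin_r]).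
  assert (Hd : 0 < d) by (repeat apply Rmin_glb_lt; lra).
  exists d. split; [exact Hd|]. intros r1 r2 r3 e2 e3 H1 H2 H3 He q.
  pose (Q := fun t => (um + t * r1) ^ 2 + (t * r2) ^ 2 + (t * r3) ^ 2).
  assert (HQ : forall t, 0 <= t <= 1 -> d0 / 2 <= dens_base gam b0 (Q t) <= D1).
  { intros t Ht.
    assert (B : Rabs (Q t - um ^ 2) <= (2 * um + 3) * d).
    { unfold Q. replace ((um + t * r1) ^ 2 + (t * r2) ^ 2 + (t * r3) ^ 2 - um ^ 2) with
        (2 * um * (t * r1) + (t * r1) ^ 2 + (t * r2) ^ 2 + (t * r3) ^ 2) by ring.
      apply Rabs_le_between in H1, H2, H3. 
      assert (- d <= t * r1 <= d) by nra. assert (- d <= t * r2 <= d) by nra.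
      assert (- d <= t * r3 <= d) by nra.
      apply Rabs_le_between. nra. }
    assert (E : dens_base gam b0 (Q t) = d0 - (gam - 1) / 2 * (Q t - um ^ 2)).
    { unfold d0, dens_base. field. }
    rewrite E. pose proof (Rmin_l (d0 / 2) (D1 - d0)). pose proof (Rmin_r (d0 / 2) (D1 - d0)).
    assert (B2 : Rabs ((gam - 1) / 2 * (Q t - um ^ 2)) <= (gam - 1) / 2 * ((2 * um + 3) * d)).
    { apply Rmult_le_abs; [rewrite Rabs_right; lra|exact B]. }
    assert ((gam - 1) / 2 * (2 * um + 3) * d <= (gam - 1) / 2 * (2 * um + 3) * s2)
      by (apply Rmult_le_compat_l; [nra|lra]).
    apply Rabs_le_between in B2. lra. }
  assert (Eq : Q 1 = q) by (unfold Q, q; ring).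
  split; [rewrite <- Eq; specialize (HQ 1 ltac:(lra)); lra|].
  intros Hr.
  pose (s := r2 * e2 + r3 * e3).
  (* The flux is followed along the ray of states leaving the uniform one: it vanishes at [t = 0]
     and its derivative is [rho * t] times the bracket [Br t], a perturbation of the quadratic form
     above. *)
  pose (e := fun t => rho gam b0 (Q t) * (- (um + t * r1) + t * s) * (t * r1) + (Gpot (Q t) - Gpot (um ^ 2))).
  pose (Br := fun t => ((um * r1 + t * (r1 ^ 2 + r2 ^ 2 + r3 ^ 2)) * (um + t * (r1 - s)) * r1)
                       / dens_base gam b0 (Q t) - r1 ^ 2 + 2 * r1 * s + r2 ^ 2 + r3 ^ 2).
  assert (De : forall t, 0 <= t <= 1 -> is_derive e t (rho gam b0 (Q t) * t * Br t)).
  { intros t Ht. pose proof (HQ t Ht) as Hp. assert (Hp0 : 0 < dens_base gam b0 (Q t)) by lra.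
    assert (DQ : is_derive Q t (2 * (um * r1 + t * (r1 ^ 2 + r2 ^ 2 + r3 ^ 2)))).
    { unfold Q. auto_derive; [trivial|ring]. }
    unfold e. evar_last.
    - apply (is_derive_plus (fun t => rho gam b0 (Q t) * (- (um + t * r1) + t * s) * (t * r1))
               (fun t => Gpot (Q t) - Gpot (um ^ 2))).
      + apply (is_derive_mult (fun t => rho gam b0 (Q t) * (- (um + t * r1) + t * s)) (fun t => t * r1)).
        * apply (is_derive_mult (fun t => rho gam b0 (Q t)) (fun t => - (um + t * r1) + t * s)).
          -- apply (is_derive_comp (rho gam b0) Q); [apply is_derive_rho, Hp0|exact DQ].
          -- auto_derive; [trivial|reflexivity].
          -- intros; apply Rmult_comm.
        * auto_derive; [trivial|reflexivity].
        * intros; apply Rmult_comm.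
      + apply (is_derive_minus (fun t => Gpot (Q t)) (fun _ => Gpot (um ^ 2))).
        * apply (is_derive_comp Gpot Q); [apply is_derive_Gpot, Hp0|exact DQ].
        * apply is_derive_const.
    - unfold Br, minus, opp, plus, scal, zero, mult; simpl. unfold mult; simpl. field. lra. }
  destruct (MVT_cor2 e _ 0 1 Rlt_0_1
              (fun x Hx => proj1 (is_derive_Reals _ _ _) (De x Hx))) as [t [E Ht]].
  assert (E0 : e 0 = 0).
  { unfold e. replace (Q 0) with (um ^ 2) by (unfold Q; ring). ring. }
  assert (E1 : e 1 = rho gam b0 q * (- (um + r1) + r2 * e2 + r3 * e3) * r1 + (Gpot q - Gpot (um ^ 2))).
  { unfold e. rewrite Eq. unfold s. ring. }
  rewrite <- E1.
  assert (HB : 0 < Br t).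
  { pose proof (HQ t ltac:(lra)) as Hp. 
    set (w := r1 ^ 2 + r2 ^ 2 + r3 ^ 2) in *.
    set (dd := dens_base gam b0 (Q t)) in *.
    assert (Hs : Rabs s <= 2 * h * d).
    { assert (A2 : Rabs e2 <= h) by (apply Rabs_le_between; nra).
      assert (A3 : Rabs e3 <= h) by (apply Rabs_le_between; nra).
      unfold s. eapply Rle_trans; [apply Rabs_triang|].
      pose proof (Rmult_le_abs _ _ _ _ H2 A2). pose proof (Rmult_le_abs _ _ _ _ H3 A3). lra. }
    assert (X : Rabs ((um * r1 + t * w) * (um + t * (r1 - s)) * r1 - um ^ 2 * r1 ^ 2) <= w * (C0 * d)).
    { replace ((um * r1 + t * w) * (um + t * (r1 - s)) * r1 - um ^ 2 * r1 ^ 2) with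
       (r1 ^ 2 * (t * um * (r1 - s)) + w * (t * um * r1 + (t * r1) * (t * (r1 - s)))) by ring.
      assert (At : Rabs t <= 1) by (rewrite Rabs_right; lra).
      assert (Au : Rabs um <= um) by (rewrite Rabs_right; lra).
      assert (Ars : Rabs (r1 - s) <= (1 + 2 * h) * d).
      { unfold Rminus. eapply Rle_trans; [apply Rabs_triang|]. rewrite Rabs_Ropp. lra. }
      assert (T1 : Rabs (t * um * (r1 - s)) <= 1 * um * ((1 + 2 * h) * d))
        by (repeat apply Rmult_le_abs; assumption).
      assert (T2 : Rabs (t * um * r1) <= 1 * um * d) by (repeat apply Rmult_le_abs; assumption).
      assert (T3 : Rabs ((t * r1) * (t * (r1 - s))) <= (1 * 1) * (1 * ((1 + 2 * h) * d))).
      { repeat apply Rmult_le_abs; try assumption. lra. }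
      assert (W : r1 ^ 2 <= w) by (unfold w; nra).
      assert (W0 : 0 <= r1 ^ 2) by nra.
      assert (T4 : Rabs (t * um * r1 + (t * r1) * (t * (r1 - s))) <= 1 * um * d + (1 * 1) * (1 * ((1 + 2 * h) * d))).
      { eapply Rle_trans; [apply Rabs_triang|]. lra. }
      eapply Rle_trans; [apply Rabs_triang|].
      rewrite !Rabs_mult with (x := w), !Rabs_mult with (x := r1 ^ 2).
      rewrite (Rabs_right (r1 ^ 2)), (Rabs_right w) by lra.
      unfold C0. 
      assert (r1 ^ 2 * Rabs (t * um * (r1 - s)) <= w * (1 * um * ((1 + 2 * h) * d)))
        by (apply Rmult_le_compat; auto using Rabs_pos).
      assert (w * Rabs (t * um * r1 + t * r1 * (t * (r1 - s))) <= w * (1 * um * d + (1 * 1) * (1 * ((1 + 2 * h) * d))))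
        by (apply Rmult_le_compat_l; lra).
      lra. }
    assert (X1' : (k1 + 1) * r1 ^ 2 - w * (c / 2) <= ((um * r1 + t * w) * (um + t * (r1 - s)) * r1) / dd).
    { apply Rmult_le_reg_r with dd; [lra|].
      replace (((um * r1 + t * w) * (um + t * (r1 - s)) * r1) / dd * dd) with
        ((um * r1 + t * w) * (um + t * (r1 - s)) * r1) by (field; lra).
      assert (C0 * d <= C0 * s1) by (apply Rmult_le_compat_l; lra).
      apply Rabs_le_between in X.
      assert (w * (C0 * d) <= w * (c * (d0 / 2) / 2)) by (apply Rmult_le_compat_l; lra).
      assert ((k1 + 1) * r1 ^ 2 * dd <= (k1 + 1) * r1 ^ 2 * D1) by (apply Rmult_le_compat_l; nra).
      assert (w * (c / 2) * (d0 / 2) <= w * (c / 2) * dd) by (apply Rmult_le_compat_l; nra).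
      nra. }
    (* Multiplying by [1 - c] completes the squares in [r2] and [r3]; the equation defining [c]
       makes the leftover coefficient of [r1 ^ 2] equal to [h ^ 2 + c ^ 2 - (e2 ^ 2 + e3 ^ 2)]. *)
    assert (QF : c * w <= k1 * r1 ^ 2 + 2 * r1 * s + r2 ^ 2 + r3 ^ 2).
    { assert (0 <= (1 - c) * (k1 * r1 ^ 2 + 2 * r1 * s + r2 ^ 2 + r3 ^ 2 - c * w)); [|nra].
      replace ((1 - c) * (k1 * r1 ^ 2 + 2 * r1 * s + r2 ^ 2 + r3 ^ 2 - c * w)) with
        ((r1 * e2 + (1 - c) * r2) ^ 2 + (r1 * e3 + (1 - c) * r3) ^ 2
         + r1 ^ 2 * ((k1 - c * (1 + k1)) + c ^ 2 - (e2 ^ 2 + e3 ^ 2))) by (unfold s, w; ring).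
      rewrite Ec. replace (k1 - (k1 - h ^ 2)) with (h ^ 2) by ring.
      assert (0 <= r1 ^ 2 * (h ^ 2 + c ^ 2 - (e2 ^ 2 + e3 ^ 2)))
        by (apply Rmult_le_pos; nra).
      pose proof (pow2_ge_0 (r1 * e2 + (1 - c) * r2)). pose proof (pow2_ge_0 (r1 * e3 + (1 - c) * r3)). lra. }
    unfold Br. fold w. fold dd. nra. }
  pose proof (rho_pos (Q t)).
  assert (0 < rho gam b0 (Q t) * t * Br t) by (repeat apply Rmult_lt_0_compat; lra).
  lra.
Qed.

End Gas.

(** * Continuity and differentiability in three variables *)

Lemma sum3_sqr_le (a b c : R) : sqrt (a ^ 2 + b ^ 2 + c ^ 2) <= Rabs a + Rabs b + Rabs c.
Proof.
  rewrite <- (sqrt_pow2 (Rabs a + Rabs b + Rabs c)).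
  - apply sqrt_le_1_alt.
    pose proof (Rabs_pos a). pose proof (Rabs_pos b). pose proof (Rabs_pos c).
    rewrite <- (pow2_abs a), <- (pow2_abs b), <- (pow2_abs c). nra.
  - pose proof (Rabs_pos a). pose proof (Rabs_pos b). pose proof (Rabs_pos c). lra.
Qed.

Lemma abs_le_sum3_sqr (a b c : R) : Rabs a <= sqrt (a ^ 2 + b ^ 2 + c ^ 2) /\
  Rabs b <= sqrt (a ^ 2 + b ^ 2 + c ^ 2) /\ Rabs c <= sqrt (a ^ 2 + b ^ 2 + c ^ 2).
Proof.
  rewrite <- (sqrt_Rsqr_abs a), <- (sqrt_Rsqr_abs b), <- (sqrt_Rsqr_abs c). unfold Rsqr.
  repeat split; apply sqrt_le_1_alt; nra.
Qed.

Lemma abs_coord_le_dist3 (x y : pt3) :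
  Rabs (X1 x - X1 y) <= dist3 x y /\ Rabs (X2 x - X2 y) <= dist3 x y /\ Rabs (X3 x - X3 y) <= dist3 x y.
Proof. apply abs_le_sum3_sqr. Qed.

Lemma dist3_le_sum (x y : pt3) :
  dist3 x y <= Rabs (X1 x - X1 y) + Rabs (X2 x - X2 y) + Rabs (X3 x - X3 y).
Proof. apply sum3_sqr_le. Qed.

Lemma sum2_sqr (a b : R) : Rabs a <= sqrt (a ^ 2 + b ^ 2) /\ Rabs b <= sqrt (a ^ 2 + b ^ 2) /\
  sqrt (a ^ 2 + b ^ 2) <= Rabs a + Rabs b.
Proof.
  pose proof (abs_le_sum3_sqr a b 0) as H. pose proof (sum3_sqr_le a b 0) as H'.
  rewrite Rabs_R0 in H'. replace (a ^ 2 + b ^ 2 + 0 ^ 2) with (a ^ 2 + b ^ 2) in * by ring. lra.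
Qed.

Lemma locally3 (x : pt3) (P : pt3 -> Prop) :
  locally x P <-> exists r, 0 < r /\ forall z, dist3 z x < r -> P z.
Proof.
  split.
  - intros [e He]. exists e. split; [apply cond_pos|]. intros z Hz. apply He.
    destruct (abs_coord_le_dist3 z x) as [A [B C]]. unfold X1, X2, X3 in *.
    repeat split; unfold ball; simpl; unfold AbsRing_ball, abs, minus, plus, opp; simpl; eapply Rle_lt_trans; eauto.
  - intros [r [Hr H]]. assert (Hr3 : 0 < r / 3) by lra. exists (mkposreal _ Hr3).
    intros [[z1 z2] z3] [[A B] C]. apply H. destruct x as [[x1 x2] x3].
    eapply Rle_lt_trans; [apply dist3_le_sum|]. unfold X1, X2, X3; simpl.
    change (Rabs (z1 - x1) < r / 3) in A. change (Rabs (z2 - x2) < r / 3) in B.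
    change (Rabs (z3 - x3) < r / 3) in C. lra.
Qed.

Lemma locally3_box (x : pt3) (P : pt3 -> Prop) : locally x P -> exists r, 0 < r /\
  forall a b c, Rabs (a - X1 x) < r -> Rabs (b - X2 x) < r -> Rabs (c - X3 x) < r -> P (a, b, c).
Proof.
  intros [e He]. exists e. split; [apply cond_pos|]. intros a b c A B C. apply He.
  repeat split; unfold ball; simpl; unfold AbsRing_ball, abs, minus, plus, opp; simpl; assumption.
Qed.

Lemma locally2 (p : pt2) (P : pt2 -> Prop) :
  locally p P <-> exists r, 0 < r /\ forall z, dist2 z p < r -> P z.
Proof.
  split.
  - intros [e He]. exists e. split; [apply cond_pos|]. intros z Hz. apply He.
    destruct (sum2_sqr (fst z - fst p) (snd z - snd p)) as [A [B C]]. unfold dist2 in Hz.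
    split; unfold ball; simpl; unfold AbsRing_ball, abs, minus, plus, opp; simpl; eapply Rle_lt_trans; eauto.
  - intros [r [Hr H]]. assert (Hr3 : 0 < r / 2) by lra. exists (mkposreal _ Hr3).
    intros [z1 z2] [A B]. apply H. destruct p as [p1 p2].
    destruct (sum2_sqr (z1 - p1) (z2 - p2)) as [_ [_ C]]. unfold dist2; simpl.
    change (Rabs (z1 - p1) < r / 2) in A. change (Rabs (z2 - p2) < r / 2) in B. simpl in C. lra.
Qed.

Lemma locally_R (x : R) (P : R -> Prop) :
  locally x P <-> exists r, 0 < r /\ forall z, Rabs (z - x) < r -> P z.
Proof.
  split.
  - intros [e He]. exists e. split; [apply cond_pos|]. intros z Hz. apply He. exact Hz.
  - intros [r [Hr H]]. exists (mkposreal _ Hr). intros z Hz. apply H. exact Hz.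
Qed.

Lemma filterlim_R {T : Type} (F : (T -> Prop) -> Prop) {FF : Filter F} (h : T -> R) (l : R) :
  filterlim h F (locally l) <-> forall e, 0 < e -> F (fun z => Rabs (h z - l) < e).
Proof.
  split.
  - intros H e He. apply (H (fun u => Rabs (u - l) < e)). apply locally_R. exists e; auto.
  - intros H P HP. apply locally_R in HP. destruct HP as [r [Hr HP]].
    unfold filtermap. eapply filter_imp; [|apply (H r Hr)]. intros z Hz. apply HP, Hz.
Qed.

Lemma filterlim_Rplus {T : Type} (F : (T -> Prop) -> Prop) {FF : Filter F} (f g : T -> R) (a b : R) :
  filterlim f F (locally a) -> filterlim g F (locally b) -> filterlim (fun x => f x + g x) F (locally (a + b)).
Proof.
  intros Hf Hg. apply (filterlim_comp_2 f g Rplus (G := locally a) (H := locally b)); [exact Hf|exact Hg|].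
  apply (filterlim_plus (V := R_NormedModule) a b).
Qed.

Lemma filterlim_Rmult {T : Type} (F : (T -> Prop) -> Prop) {FF : Filter F} (f g : T -> R) (a b : R) :
  filterlim f F (locally a) -> filterlim g F (locally b) -> filterlim (fun x => f x * g x) F (locally (a * b)).
Proof.
  intros Hf Hg. apply (filterlim_comp_2 f g Rmult (G := locally a) (H := locally b)); [exact Hf|exact Hg|].
  apply (filterlim_mult (K := R_AbsRing) a b).
Qed.

Lemma filterlim_cont {T : Type} (F : (T -> Prop) -> Prop) (f : T -> R) (g : R -> R) (a : R) :
  filterlim f F (locally a) -> continuous g a -> filterlim (fun x => g (f x)) F (locally (g a)).
Proof. intros Hf Hg. eapply filterlim_comp; [exact Hf|exact Hg]. Qed.

Lemma filterlim_Ropp {T : Type} (F : (T -> Prop) -> Prop) (f : T -> R) (a : R) :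
  filterlim f F (locally a) -> filterlim (fun x => - f x) F (locally (- a)).
Proof.
  intros Hf. apply (filterlim_cont F f Ropp); [exact Hf|]. apply (continuous_opp (fun x : R => x)), continuous_id.
Qed.

Lemma filterlim_Rminus {T : Type} (F : (T -> Prop) -> Prop) {FF : Filter F} (f g : T -> R) (a b : R) :
  filterlim f F (locally a) -> filterlim g F (locally b) -> filterlim (fun x => f x - g x) F (locally (a - b)).
Proof. intros Hf Hg. apply filterlim_Rplus; [exact FF|exact Hf|apply filterlim_Ropp, Hg]. Qed.

Lemma filterlim_Rconst {T : Type} (F : (T -> Prop) -> Prop) {FF : Filter F} (c : R) :
  filterlim (fun _ : T => c) F (locally c).
Proof. apply filterlim_const. Qed.

Lemma lim_in3_filterlim (A : pt3 -> Prop) (h : pt3 -> R) (y : pt3) (l : R) :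
  lim_in3 A h y l -> filterlim h (within A (locally y)) (locally l).
Proof.
  intros [_ H]. apply filterlim_R; [typeclasses eauto|]. intros e He. destruct (H e He) as [d [Hd H']].
  unfold within. apply locally3. exists d. auto.
Qed.

Lemma adh3_proper (A : pt3 -> Prop) (y : pt3) : adh3 A y -> ProperFilter (within A (locally y)).
Proof.
  intros H. constructor; [|typeclasses eauto].
  intros P HP. unfold within in HP. apply locally3 in HP. destruct HP as [r [Hr HP]].
  destruct (H r Hr) as [z [Az Hz]]. exists z. auto.
Qed.

Definition open3 (A : pt3 -> Prop) : Prop := forall x, A x -> locally x A.

Lemma cont3_on_continuous (A : pt3 -> Prop) (h : pt3 -> R) (x : pt3) :
  open3 A -> A x -> cont3_on A h -> continuous h x.
Proof.
  intros HA Ax Hc. apply filterlim_R; [typeclasses eauto|]. intros e He.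
  destruct (Hc x Ax e He) as [d [Hd H]].
  apply (filter_imp (fun z => A z /\ dist3 z x < d)).
  - intros z [Az Hz]. apply H; assumption.
  - apply filter_and; [apply HA, Ax|]. apply locally3. exists d. auto.
Qed.

Lemma continuous_Rplus {U : UniformSpace} (f g : U -> R) (x : U) :
  continuous f x -> continuous g x -> continuous (fun y => f y + g y) x.
Proof. intros. apply (continuous_plus f g); assumption. Qed.

Lemma continuous_Rmult {U : UniformSpace} (f g : U -> R) (x : U) :
  continuous f x -> continuous g x -> continuous (fun y => f y * g y) x.
Proof. intros. apply (continuous_mult f g); assumption. Qed.

Lemma continuous_Ropp {U : UniformSpace} (f : U -> R) (x : U) :
  continuous f x -> continuous (fun y => - f y) x.
Proof. intros. apply (continuous_opp f); assumption. Qed.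

Lemma continuous_Rminus {U : UniformSpace} (f g : U -> R) (x : U) :
  continuous f x -> continuous g x -> continuous (fun y => f y - g y) x.
Proof. intros. apply (continuous_minus f g); assumption. Qed.

Lemma continuous_X1 (x : pt3) : continuous X1 x.
Proof. apply (continuous_comp (fun z : pt3 => fst z) (fun z : R * R => fst z)); apply continuous_fst. Qed.
Lemma continuous_X2 (x : pt3) : continuous X2 x.
Proof. apply (continuous_comp (fun z : pt3 => fst z) (fun z : R * R => snd z)); [apply continuous_fst|apply continuous_snd]. Qed.
Lemma continuous_X3 (x : pt3) : continuous X3 x.
Proof. apply continuous_snd. Qed.

(* Syntactic dispatch: blind [apply] unfolds the operations of [R] and diverges. *)
Ltac continuous_arith :=
  lazymatch goal with
  | |- continuous (fun x => @?f x + @?g x) _ => apply (continuous_Rplus f g); continuous_arith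
  | |- continuous (fun x => @?f x - @?g x) _ => apply (continuous_Rminus f g); continuous_arith
  | |- continuous (fun x => @?f x * @?g x) _ => apply (continuous_Rmult f g); continuous_arith
  | |- continuous (fun _ => ?c) _ => apply continuous_const
  | |- continuous (fun x => X1 x) _ => apply continuous_X1
  | |- continuous (fun x => X2 x) _ => apply continuous_X2
  | |- continuous (fun x => X3 x) _ => apply continuous_X3
  | |- _ => idtac
  end.

Lemma continuous_pair {U V W : UniformSpace} (f : U -> V) (g : U -> W) (x : U) :
  continuous f x -> continuous g x -> continuous (fun y => (f y, g y)) x.
Proof.
  intros Hf Hg. apply (continuous_comp_2 f g (fun a b => (a, b))); [exact Hf|exact Hg|].
  intros P HP. unfold filtermap. eapply filter_imp; [|exact HP]. intros [a b] H; exact H.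
Qed.

Lemma continuous_sec (x : pt3) : continuous sec x.
Proof. apply continuous_pair; [apply continuous_X2|apply continuous_X3]. Qed.

Lemma is_derive_eps (f : R -> R) (x l : R) : is_derive f x l <->
  forall e, 0 < e -> exists d, 0 < d /\ forall y, Rabs (y - x) < d ->
    Rabs (f y - f x - (y - x) * l) <= e * Rabs (y - x).
Proof.
  split.
  - intros [_ H] e He. specialize (H x (fun P HP => HP) (mkposreal e He)).
    apply locally_R in H. destruct H as [d [Hd H]]. exists d. split; [exact Hd|].
    intros y Hy. specialize (H y Hy).
    unfold minus, plus, opp, scal in H; simpl in H. unfold norm in H; simpl in H.
    unfold mult, abs in H; simpl in H.
    replace (f y - f x - (y - x) * l) with (f y + - f x + - ((y + - x) * l)) by ring. exact H.
  - intros H. split; [apply is_linear_scal_l|].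
    intros z Hz. pose proof (is_filter_lim_locally_unique (V := R_NormedModule) x z Hz) as Ez. subst z.
    intros [e He]. destruct (H e He) as [d [Hd H']]. apply locally_R. exists d. split; [exact Hd|].
    intros y Hy. specialize (H' y Hy).
    unfold minus, plus, opp, scal; simpl. unfold norm; simpl.
    unfold mult, abs; simpl.
    replace (f y + - f x + - ((y + - x) * l)) with (f y - f x - (y - x) * l) by ring. exact H'.
Qed.

Definition is_par (i : idx) (h : pt3 -> R) (x : pt3) (l : R) : Prop :=
  is_derive (line i h x) (coord i x) l.

Lemma line_coord (i : idx) (h : pt3 -> R) (x : pt3) : line i h x (coord i x) = h x.
Proof. destruct x as [[a b] c], i; reflexivity. Qed.

Lemma is_par_dpar i h x l : is_par i h x l -> dpar i h x = l.
Proof. apply is_derive_unique. Qed.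

Lemma is_par_ex_par i h x : ex_par i h x -> is_par i h x (dpar i h x).
Proof. apply Derive_correct. Qed.

Lemma is_par_plus i h k x a b : is_par i h x a -> is_par i k x b -> is_par i (fun y => h y + k y) x (a + b).
Proof. destruct i; apply is_derive_Rplus. Qed.

Lemma is_par_minus i h k x a b : is_par i h x a -> is_par i k x b -> is_par i (fun y => h y - k y) x (a - b).
Proof. destruct i; apply is_derive_Rminus. Qed.

Lemma is_par_mult i h k x a b : is_par i h x a -> is_par i k x b ->
  is_par i (fun y => h y * k y) x (a * k x + h x * b).
Proof.
  intros H K. rewrite <- (line_coord i h x), <- (line_coord i k x).
  destruct i; apply (is_derive_Rmult _ _ _ _ _ H K).
Qed.

Lemma is_par_const i c x : is_par i (fun _ => c) x 0.
Proof. destruct i; apply is_derive_Rconst. Qed.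

Lemma is_par_comp i g h x a b : is_derive g (h x) a -> is_par i h x b -> is_par i (fun y => g (h y)) x (a * b).
Proof.
  intros Hg Hh. rewrite <- (line_coord i h x) in Hg.
  destruct i; apply (is_derive_Rcomp g _ _ _ _ Hg Hh).
Qed.

Definition on_line (i : idx) (x : pt3) (t : R) : pt3 :=
  match i with I1 => (t, X2 x, X3 x) | I2 => (X1 x, t, X3 x) | I3 => (X1 x, X2 x, t) end.

Lemma line_on_line i h x t : line i h x t = h (on_line i x t).
Proof. destruct i; reflexivity. Qed.

Lemma on_line_coord i x : on_line i x (coord i x) = x.
Proof. destruct x as [[a b] c], i; reflexivity. Qed.

Lemma continuous_on_line i x t : continuous (on_line i x) t.
Proof.
  destruct i; unfold on_line; repeat apply continuous_pair;
    (apply continuous_id || apply continuous_const).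
Qed.

Lemma is_par_ext_loc i h k x l : locally x (fun y => h y = k y) -> is_par i h x l -> is_par i k x l.
Proof.
  intros H. apply is_derive_ext_loc.
  assert (C := continuous_on_line i x (coord i x)). rewrite <- (on_line_coord i x) in H.
  apply C in H. unfold filtermap in H. eapply filter_imp; [|exact H].
  intros t Ht. rewrite !line_on_line. exact Ht.
Qed.

(** Partials exist near [x] and are continuous at [x], which gives differentiability at [x]. They
    form an explicit family [D] rather than [dpar], so the closure lemmas below compute them along
    with the function. *)
Definition C1D (h : pt3 -> R) (D : idx -> pt3 -> R) (x : pt3) : Prop :=
  locally x (fun y => forall i, is_par i h y (D i y)) /\ forall i, continuous (D i) x.

Lemma C1D_is_par h D x i : C1D h D x -> is_par i h x (D i x).
Proof. intros [H _]. apply locally_singleton in H. apply H. Qed.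

Lemma Rabs_seg (a b c r : R) : Rmin a b <= c <= Rmax a b -> Rabs (b - a) < r -> Rabs (c - a) < r.
Proof.
  unfold Rmin, Rmax. destruct (Rle_dec a b); intros H K;
  apply Rabs_lt_between in K; apply Rabs_lt_between; lra.
Qed.

Lemma MVT_par (i : idx) (h : pt3 -> R) (D : pt3 -> R) (x : pt3) (b : R) :
  (forall c, Rmin (coord i x) b <= c <= Rmax (coord i x) b -> is_par i h (on_line i x c) (D (on_line i x c))) ->
  exists c, Rmin (coord i x) b <= c <= Rmax (coord i x) b /\ h (on_line i x b) - h x = D (on_line i x c) * (b - coord i x).
Proof.
  intros H.
  assert (H' : forall c, Rmin (coord i x) b <= c <= Rmax (coord i x) b ->
     is_derive (line i h x) c (D (on_line i x c))).
  { intros c Hc. specialize (H c Hc). destruct i; exact H. }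
  destruct (MVT_gen (line i h x) (coord i x) b (fun c => D (on_line i x c))) as [c [Hc E]].
  - intros c Hc. apply H'. lra.
  - intros c Hc. apply continuity_pt_filterlim. apply (ex_derive_continuous (line i h x)).
    eexists. apply H', Hc.
  - exists c. split; [exact Hc|]. rewrite line_coord, line_on_line in E. exact E.
Qed.

(** The increment is telescoped along three coordinate segments in a box around [x], with the mean
    value theorem on each. *)
Lemma C1D_frechet h D x : C1D h D x -> forall e, 0 < e ->
  locally x (fun y => Rabs (h y - h x - (D I1 x * (X1 y - X1 x) + D I2 x * (X2 y - X2 x) + D I3 x * (X3 y - X3 x)))
     <= e * (Rabs (X1 y - X1 x) + Rabs (X2 y - X2 x) + Rabs (X3 y - X3 x))).
Proof.
  intros [HP HC] e He.
  assert (L : locally x (fun y => (forall i, is_par i h y (D i y)) /\ (forall i, Rabs (D i y - D i x) < e))).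
  { apply filter_and; [exact HP|].
    assert (K : forall i, locally x (fun y => Rabs (D i y - D i x) < e)).
    { intros i. exact (proj1 (filterlim_R (locally x) (D i) (D i x)) (HC i) e He). }
    eapply filter_imp; [|apply (filter_and _ _ (K I1) (filter_and _ _ (K I2) (K I3)))].
    intros y [A [B C]] []; assumption. }
  apply locally3_box in L. destruct L as [r [Hr L]].
  apply locally3. exists r. split; [exact Hr|].
  intros [[a b] c] Hy. destruct x as [[x1 x2] x3].
  destruct (abs_coord_le_dist3 (a, b, c) (x1, x2, x3)) as [A [B C]].
  unfold X1, X2, X3 in *; simpl fst in *; simpl snd in *.
  assert (Z : forall u, Rabs (u - u) < r) by (intros; rewrite Rminus_diag, Rabs_R0; exact Hr).
  destruct (MVT_par I1 h (D I1) (x1, b, c) a) as [c1 [Hc1 E1]].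
  { intros u Hu. unfold X1, X2, X3 in Hu; simpl in Hu.
    apply L; unfold X1, X2, X3; simpl; auto; try lra; apply (Rabs_seg _ _ _ _ Hu); unfold X1, X2, X3; simpl; lra. }
  destruct (MVT_par I2 h (D I2) (x1, x2, c) b) as [c2 [Hc2 E2]].
  { intros u Hu. unfold X1, X2, X3 in Hu; simpl in Hu.
    apply L; unfold X1, X2, X3; simpl; auto; try lra; apply (Rabs_seg _ _ _ _ Hu); unfold X1, X2, X3; simpl; lra. }
  destruct (MVT_par I3 h (D I3) (x1, x2, x3) c) as [c3 [Hc3 E3]].
  { intros u Hu. unfold X1, X2, X3 in Hu; simpl in Hu.
    apply L; unfold X1, X2, X3; simpl; auto; try lra; apply (Rabs_seg _ _ _ _ Hu); unfold X1, X2, X3; simpl; lra. }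
  simpl in *. unfold X1, X2, X3 in *; simpl in *.
  replace (h (a, b, c) - h (x1, x2, x3) - (D I1 (x1, x2, x3) * (a - x1) + D I2 (x1, x2, x3) * (b - x2) + D I3 (x1, x2, x3) * (c - x3)))
    with ((D I1 (c1, b, c) - D I1 (x1, x2, x3)) * (a - x1) + (D I2 (x1, c2, c) - D I2 (x1, x2, x3)) * (b - x2)
          + (D I3 (x1, x2, c3) - D I3 (x1, x2, x3)) * (c - x3)) by lra.
  assert (K1 : Rabs (D I1 (c1, b, c) - D I1 (x1, x2, x3)) <= e).
  { apply Rlt_le, L; auto; try lra; apply (Rabs_seg _ _ _ _ Hc1); lra. }
  assert (K2 : Rabs (D I2 (x1, c2, c) - D I2 (x1, x2, x3)) <= e).
  { apply Rlt_le, L; auto; try lra; apply (Rabs_seg _ _ _ _ Hc2); lra. }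
  assert (K3 : Rabs (D I3 (x1, x2, c3) - D I3 (x1, x2, x3)) <= e).
  { apply Rlt_le, L; auto; try lra; apply (Rabs_seg _ _ _ _ Hc3); lra. }
  eapply Rle_trans; [apply Rabs_triang|]. eapply Rle_trans; [apply Rplus_le_compat_r, Rabs_triang|].
  rewrite !Rmult_plus_distr_l.
  apply Rplus_le_compat; [apply Rplus_le_compat|]; apply Rmult_le_abs; auto; lra.
Qed.

Lemma C1D_continuous h D x : C1D h D x -> continuous h x.
Proof.
  intros H. apply filterlim_R; [typeclasses eauto|]. intros e He.
  pose (S := Rabs (D I1 x) + Rabs (D I2 x) + Rabs (D I3 x) + 1).
  assert (HS : 0 < S).
  { unfold S. pose proof (Rabs_pos (D I1 x)). pose proof (Rabs_pos (D I2 x)). pose proof (Rabs_pos (D I3 x)). lra. }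
  pose proof (C1D_frechet h D x H 1 Rlt_0_1) as F.
  assert (K : locally x (fun y => dist3 y x < e / (3 * S))).
  { apply locally3. exists (e / (3 * S)). split; [|auto]. apply Rdiv_lt_0_compat; lra. }
  eapply filter_imp; [|apply (filter_and _ _ F K)].
  intros y [Fy Ky]. destruct (abs_coord_le_dist3 y x) as [A [B C]].
  set (t1 := X1 y - X1 x) in *. set (t2 := X2 y - X2 x) in *. set (t3 := X3 y - X3 x) in *.
  set (d := dist3 y x) in *.
  assert (Ed : d * (3 * S) < e).
  { apply Rmult_lt_reg_r with (/ (3 * S)); [apply Rinv_0_lt_compat; lra|].
    rewrite Rmult_assoc, Rinv_r, Rmult_1_r by lra. exact Ky. }
  assert (B1 : Rabs (D I1 x * t1) <= Rabs (D I1 x) * d) by (apply Rmult_le_abs; lra).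
  assert (B2 : Rabs (D I2 x * t2) <= Rabs (D I2 x) * d) by (apply Rmult_le_abs; lra).
  assert (B3 : Rabs (D I3 x * t3) <= Rabs (D I3 x) * d) by (apply Rmult_le_abs; lra).
  replace (h y - h x) with ((h y - h x - (D I1 x * t1 + D I2 x * t2 + D I3 x * t3)) + (D I1 x * t1 + D I2 x * t2 + D I3 x * t3)) by ring.
  assert (Rabs (D I1 x * t1 + D I2 x * t2 + D I3 x * t3) <= (S - 1) * d).
  { eapply Rle_trans; [apply Rabs_triang|]. eapply Rle_trans; [apply Rplus_le_compat_r, Rabs_triang|]. unfold S; lra. }
  eapply Rle_lt_trans; [apply Rabs_triang|].
  assert (0 <= d) by apply sqrt_pos. unfold S in *. 
  pose proof (Rabs_pos (D I1 x)). pose proof (Rabs_pos (D I2 x)). pose proof (Rabs_pos (D I3 x)). nra.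
Qed.

(** Chain rule, used for the rotated coordinates of a chart and for straight lines in arbitrary
    directions. *)
Lemma is_derive_curve h D (c1 c2 c3 : R -> R) (t d1 d2 d3 : R) :
  is_derive c1 t d1 -> is_derive c2 t d2 -> is_derive c3 t d3 ->
  C1D h D (c1 t, c2 t, c3 t) ->
  is_derive (fun s => h (c1 s, c2 s, c3 s)) t
    (D I1 (c1 t, c2 t, c3 t) * d1 + D I2 (c1 t, c2 t, c3 t) * d2 + D I3 (c1 t, c2 t, c3 t) * d3).
Proof.
  intros H1 H2 H3 HD. apply is_derive_eps. intros e He.
  set (x := (c1 t, c2 t, c3 t)) in *.
  pose (S := Rabs d1 + Rabs d2 + Rabs d3 + 3).
  pose (T := Rabs (D I1 x) + Rabs (D I2 x) + Rabs (D I3 x) + 1).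
  assert (HS : 0 < S) by (unfold S; pose proof (Rabs_pos d1); pose proof (Rabs_pos d2); pose proof (Rabs_pos d3); lra).
  assert (HT : 0 < T).
  { unfold T. pose proof (Rabs_pos (D I1 x)). pose proof (Rabs_pos (D I2 x)). pose proof (Rabs_pos (D I3 x)). lra. }
  destruct (exists_small (e / 2) S ltac:(lra) ltac:(lra)) as [k [Hk Ek]].
  destruct (exists_small (e / 2) T ltac:(lra) ltac:(lra)) as [m0 [Hm0 Em0]].
  pose (m := Rmin m0 1). assert (Hm : 0 < m) by (apply Rmin_glb_lt; lra).
  assert (Hm1 : m <= 1) by apply Rmin_r.
  assert (Em : T * m <= e / 2).
  { eapply Rle_trans; [|exact Em0]. apply Rmult_le_compat_l; [lra|apply Rmin_l]. }
  pose proof (C1D_frechet h D x HD k Hk) as F. 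
  apply locally3_box in F. destruct F as [r [Hr F]].
  pose proof (proj1 (is_derive_eps _ _ _) H1 m Hm) as [e1 [He1 K1]].
  pose proof (proj1 (is_derive_eps _ _ _) H2 m Hm) as [e2 [He2 K2]].
  pose proof (proj1 (is_derive_eps _ _ _) H3 m Hm) as [e3 [He3 K3]].
  assert (HrS : 0 < r / S) by (apply Rdiv_lt_0_compat; lra).
  exists (Rmin (r / S) (Rmin e1 (Rmin e2 e3))). split; [repeat apply Rmin_glb_lt; lra|].
  intros y Hy.
  pose proof (Rlt_le_trans _ _ _ Hy (Rmin_l _ _)) as Hy0.
  pose proof (Rlt_le_trans _ _ _ Hy (Rmin_r _ _)) as Hy'.
  pose proof (Rlt_le_trans _ _ _ Hy' (Rmin_l _ _)) as Hy1.
  pose proof (Rlt_le_trans _ _ _ Hy' (Rmin_r _ _)) as Hy''.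
  pose proof (Rlt_le_trans _ _ _ Hy'' (Rmin_l _ _)) as Hy2.
  pose proof (Rlt_le_trans _ _ _ Hy'' (Rmin_r _ _)) as Hy3.
  specialize (K1 y Hy1). specialize (K2 y Hy2). specialize (K3 y Hy3).
  set (u := Rabs (y - t)) in *. assert (Hu : 0 <= u) by apply Rabs_pos.
  assert (HuS : u * S < r).
  { apply Rmult_lt_reg_r with (/ S); [apply Rinv_0_lt_compat; lra|].
    rewrite Rmult_assoc, Rinv_r, Rmult_1_r by lra. exact Hy0. }
  assert (G : forall c d, Rabs (c y - c t - (y - t) * d) <= m * u -> Rabs (c y - c t) <= (Rabs d + 1) * u).
  { intros c d Hc. replace (c y - c t) with ((c y - c t - (y - t) * d) + (y - t) * d) by ring.
    eapply Rle_trans; [apply Rabs_triang|].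
    assert (Rabs ((y - t) * d) <= u * Rabs d) by (apply Rmult_le_abs; unfold u; lra).
    assert (m * u <= 1 * u) by (apply Rmult_le_compat_r; lra). lra. }
  pose proof (G c1 d1 K1) as G1. pose proof (G c2 d2 K2) as G2. pose proof (G c3 d3 K3) as G3.
  pose proof (Rabs_pos d1) as P1. pose proof (Rabs_pos d2) as P2. pose proof (Rabs_pos d3) as P3.
  assert (B : Rabs d1 + 1 <= S /\ Rabs d2 + 1 <= S /\ Rabs d3 + 1 <= S) by (unfold S; lra).
  assert (Fy : Rabs (h (c1 y, c2 y, c3 y) - h x - (D I1 x * (c1 y - c1 t) + D I2 x * (c2 y - c2 t) + D I3 x * (c3 y - c3 t)))
     <= k * (Rabs (c1 y - c1 t) + Rabs (c2 y - c2 t) + Rabs (c3 y - c3 t))).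
  { apply F; unfold x, X1, X2, X3; simpl; nra. }
  replace (h (c1 y, c2 y, c3 y) - h x - (y - t) * (D I1 x * d1 + D I2 x * d2 + D I3 x * d3)) with
    ((h (c1 y, c2 y, c3 y) - h x - (D I1 x * (c1 y - c1 t) + D I2 x * (c2 y - c2 t) + D I3 x * (c3 y - c3 t)))
     + (D I1 x * (c1 y - c1 t - (y - t) * d1) + D I2 x * (c2 y - c2 t - (y - t) * d2) + D I3 x * (c3 y - c3 t - (y - t) * d3))) by ring.
  eapply Rle_trans; [apply Rabs_triang|].
  assert (Q : Rabs (D I1 x * (c1 y - c1 t - (y - t) * d1) + D I2 x * (c2 y - c2 t - (y - t) * d2) + D I3 x * (c3 y - c3 t - (y - t) * d3)) <= (T - 1) * (m * u)).
  { eapply Rle_trans; [apply Rabs_triang|]. eapply Rle_trans; [apply Rplus_le_compat_r, Rabs_triang|].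
    pose proof (Rmult_le_abs (D I1 x) _ _ _ (Rle_refl _) K1).
    pose proof (Rmult_le_abs (D I2 x) _ _ _ (Rle_refl _) K2).
    pose proof (Rmult_le_abs (D I3 x) _ _ _ (Rle_refl _) K3). unfold T; lra. }
  assert (Q2 : k * (Rabs (c1 y - c1 t) + Rabs (c2 y - c2 t) + Rabs (c3 y - c3 t)) <= (S * k) * u).
  { replace (S * k * u) with (k * (S * u)) by ring. apply Rmult_le_compat_l; [lra|]. unfold S; lra. }
  assert ((S * k) * u <= e / 2 * u) by (apply Rmult_le_compat_r; lra).
  assert ((T * m) * u <= e / 2 * u) by (apply Rmult_le_compat_r; lra).
  assert (0 <= m * u) by nra. lra.
Qed.

Lemma C1D_const c x : C1D (fun _ => c) (fun _ _ => 0) x.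
Proof.
  split; [apply filter_forall; intros y i; apply is_par_const|intros; apply continuous_const].
Qed.

Lemma C1D_plus h D k E x : C1D h D x -> C1D k E x -> C1D (fun y => h y + k y) (fun i y => D i y + E i y) x.
Proof.
  intros [H1 H2] [K1 K2]. split.
  - eapply filter_imp; [|apply (filter_and _ _ H1 K1)]. intros y [A B] i. apply is_par_plus; auto.
  - intros i. apply continuous_Rplus; auto.
Qed.

Lemma C1D_minus h D k E x : C1D h D x -> C1D k E x -> C1D (fun y => h y - k y) (fun i y => D i y - E i y) x.
Proof.
  intros [H1 H2] [K1 K2]. split.
  - eapply filter_imp; [|apply (filter_and _ _ H1 K1)]. intros y [A B] i. apply is_par_minus; auto.
  - intros i. apply continuous_Rminus; auto.
Qed.

Lemma C1D_mult h D k E x : C1D h D x -> C1D k E x ->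
  C1D (fun y => h y * k y) (fun i y => D i y * k y + h y * E i y) x.
Proof.
  intros H K. pose proof (C1D_continuous _ _ _ H) as CH. pose proof (C1D_continuous _ _ _ K) as CK.
  destruct H as [H1 H2], K as [K1 K2]. split.
  - eapply filter_imp; [|apply (filter_and _ _ H1 K1)]. intros y [A B] i. apply is_par_mult; auto.
  - intros i. apply continuous_Rplus; apply continuous_Rmult; auto.
Qed.

Lemma C1D_comp (g g' : R -> R) h D x : locally (h x) (fun u => is_derive g u (g' u)) -> continuous g' (h x) ->
  C1D h D x -> C1D (fun y => g (h y)) (fun i y => g' (h y) * D i y) x.
Proof.
  intros G1 G2 H. pose proof (C1D_continuous _ _ _ H) as C. destruct H as [H1 H2]. split.
  - apply C in G1. unfold filtermap in G1.
    eapply filter_imp; [|apply (filter_and _ _ H1 G1)]. intros y [A B] i. apply is_par_comp; auto.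
  - intros i. apply continuous_Rmult; [|apply H2]. apply (continuous_comp h g'); assumption.
Qed.

Lemma C1D_ext_loc h k D x : locally x (fun y => h y = k y) -> C1D h D x -> C1D k D x.
Proof.
  intros E [H1 H2]. split; [|exact H2].
  apply locally_locally in E.
  eapply filter_imp; [|apply (filter_and _ _ E H1)]. intros y [A B] i.
  eapply is_par_ext_loc; [exact A|apply B].
Qed.

Lemma C1D_ext_D h D E x : locally x (fun y => forall i, D i y = E i y) -> C1D h D x -> C1D h E x.
Proof.
  intros L [H1 H2]. split.
  - eapply filter_imp; [|apply (filter_and _ _ L H1)]. intros y [A B] i. rewrite <- A. apply B.
  - intros i. apply (continuous_ext_loc _ (D i)); [|apply H2].
    eapply filter_imp; [|exact L]. intros y Hy. apply Hy.
Qed.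

Lemma C1D_affine (a b c k : R) x :
  C1D (fun y => a * X1 y + b * X2 y + c * X3 y + k) (fun i _ => match i with I1 => a | I2 => b | I3 => c end) x.
Proof.
  split.
  - apply filter_forall. intros [[y1 y2] y3] i.
    destruct i; unfold is_par, line, X1, X2, X3; simpl; auto_derive; try trivial; ring.
  - intros i. destruct i; apply continuous_const.
Qed.

Lemma C1D_of_C2 (U : pt3 -> Prop) h x : open3 U -> C2_on U h -> U x -> C1D h (fun i => dpar i h) x.
Proof.
  intros HU HC Ux. destruct HC as [HA [HB [HD HE]]]. split.
  - eapply filter_imp; [|apply HU, Ux]. intros y Hy i. apply is_par_ex_par. apply (HA y Hy i i).
  - intros i. apply (cont3_on_continuous U); auto.
Qed.

Lemma C1D_of_C2' (U : pt3 -> Prop) h x i : open3 U -> C2_on U h -> U x ->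
  C1D (dpar i h) (fun j => dpar j (dpar i h)) x.
Proof.
  intros HU HC Ux. destruct HC as [HA [HB [HD HE]]]. split.
  - eapply filter_imp; [|apply HU, Ux]. intros y Hy j. apply is_par_ex_par. apply (HA y Hy i j).
  - intros j. apply (cont3_on_continuous U); auto.
Qed.

(** * Sequential compactness *)

Lemma inv_INR_small (e : R) : 0 < e -> exists N, forall n, (N <= n)%nat -> / (INR n + 1) < e.
Proof.
  intros He. destruct (archimed_cor1 e He) as [N [HN HN0]]. exists N. intros n Hn.
  eapply Rle_lt_trans; [|exact HN]. apply Rinv_le_contravar; [apply lt_0_INR, HN0|].
  apply le_INR in Hn. lra.
Qed.

Lemma inv_INR_pos (n : nat) : 0 < / (INR n + 1).
Proof. apply Rinv_0_lt_compat. pose proof (pos_INR n). lra. Qed.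

Lemma nat_choice {T : Type} (P : nat -> T -> Prop) : (forall n, exists x, P n x) ->
  exists u : nat -> T, forall n, P n (u n).
Proof.
  intros H. exists (fun n => proj1_sig (constructive_indefinite_description _ (H n))).
  intros n. apply proj2_sig.
Qed.

(** The extraction satisfies [n <= psi n], which is all that limits at infinity ask of a
    subsequence. *)
Lemma BW1 (u : nat -> R) (B : R) : (forall n, Rabs (u n) <= B) ->
  exists (psi : nat -> nat) l, (forall n, (n <= psi n)%nat) /\
    filterlim (fun n => u (psi n)) eventually (locally l).
Proof.
  intros H. destruct (Bolzano_Weierstrass u (fun x => - B <= x <= B) (compact_P3 _ _)) as [l Hl].
  { intros n. apply Rabs_le_between, H. }
  assert (K : forall n, exists p, (n <= p)%nat /\ Rabs (u p - l) < / (INR n + 1)).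
  { intros n. destruct (Hl (fun x => Rabs (x - l) < / (INR n + 1)) n) as [p [Hp Hp']].
    - exists (mkposreal _ (inv_INR_pos n)). intros x Hx. exact Hx.
    - exists p. auto. }
  destruct (nat_choice _ K) as [psi Hpsi]. exists psi, l. split; [apply Hpsi|].
  apply filterlim_R; [typeclasses eauto|]. intros e He. destruct (inv_INR_small e He) as [N HN].
  exists N. intros n Hn. eapply Rlt_trans; [apply Hpsi|]. apply HN, Hn.
Qed.

Lemma filterlim_subseq {T : Type} (u : nat -> T) (F : (T -> Prop) -> Prop) (psi : nat -> nat) :
  (forall n, (n <= psi n)%nat) -> filterlim u eventually F -> filterlim (fun n => u (psi n)) eventually F.
Proof.
  intros H Hu P HP. destruct (Hu P HP) as [N HN]. exists N. intros n Hn. apply HN.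
  specialize (H n). lia.
Qed.

Lemma filterlim_pair3 {T : Type} (F : (T -> Prop) -> Prop) {FF : Filter F} (u : T -> pt3) (x : pt3) :
  filterlim (fun n => X1 (u n)) F (locally (X1 x)) ->
  filterlim (fun n => X2 (u n)) F (locally (X2 x)) ->
  filterlim (fun n => X3 (u n)) F (locally (X3 x)) ->
  filterlim u F (locally x).
Proof.
  intros H1 H2 H3 P HP. destruct x as [[a b] c]. apply locally3_box in HP. destruct HP as [r [Hr HP]].
  unfold filtermap.
  pose proof (proj1 (filterlim_R F _ _) H1 r Hr) as K1.
  pose proof (proj1 (filterlim_R F _ _) H2 r Hr) as K2.
  pose proof (proj1 (filterlim_R F _ _) H3 r Hr) as K3.
  eapply filter_imp; [|apply (filter_and _ _ K1 (filter_and _ _ K2 K3))].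
  intros n [A [B C]]. destruct (u n) as [[u1 u2] u3]. apply HP; assumption.
Qed.

Lemma BW3 (u : nat -> pt3) (B : R) :
  (forall n, Rabs (X1 (u n)) <= B /\ Rabs (X2 (u n)) <= B /\ Rabs (X3 (u n)) <= B) ->
  exists (psi : nat -> nat) x, (forall n, (n <= psi n)%nat) /\
    filterlim (fun n => u (psi n)) eventually (locally x).
Proof.
  intros H.
  destruct (BW1 (fun n => X1 (u n)) B (fun n => proj1 (H n))) as [p1 [l1 [A1 L1]]].
  destruct (BW1 (fun n => X2 (u (p1 n))) B (fun n => proj1 (proj2 (H (p1 n))))) as [p2 [l2 [A2 L2]]].
  destruct (BW1 (fun n => X3 (u (p1 (p2 n)))) B (fun n => proj2 (proj2 (H (p1 (p2 n)))))) as [p3 [l3 [A3 L3]]].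
  exists (fun n => p1 (p2 (p3 n))), (l1, l2, l3). split.
  - intros n. specialize (A1 (p2 (p3 n))). specialize (A2 (p3 n)). specialize (A3 n). lia.
  - apply filterlim_pair3; [typeclasses eauto| | |exact L3].
    + apply (filterlim_subseq (fun n => X1 (u (p1 n))) _ (fun n => p2 (p3 n))).
      * intros n. specialize (A2 (p3 n)). specialize (A3 n). lia.
      * apply (filterlim_subseq (fun n => X1 (u (p1 n))) _ (fun n => n)); [auto|].
        exact L1.
    + apply (filterlim_subseq (fun n => X2 (u (p1 (p2 n)))) _ p3); assumption.
Qed.

Lemma filterlim_within_seq (A : pt3 -> Prop) (u : nat -> pt3) (x : pt3) :
  (forall n, A (u n)) -> filterlim u eventually (locally x) -> filterlim u eventually (within A (locally x)).
Proof.
  intros HA H P HP. unfold within in HP. apply H in HP. unfold filtermap in *.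
  eapply filter_imp; [|exact HP]. intros n Hn. apply Hn, HA.
Qed.

Lemma seq_adh3 (A : pt3 -> Prop) (u : nat -> pt3) (x : pt3) :
  (forall n, A (u n)) -> filterlim u eventually (locally x) -> adh3 A x.
Proof.
  intros HA H r Hr. destruct (H (fun z => dist3 z x < r)) as [N HN].
  - apply locally3. exists r; auto.
  - exists (u N). split; [apply HA|]. apply HN. lia.
Qed.

Lemma seq_lim_ge (u : nat -> R) (l c : R) : filterlim u eventually (locally l) ->
  (forall n, c <= u n) -> c <= l.
Proof.
  intros H Hn. apply Rnot_lt_le. intros L.
  destruct (proj1 (filterlim_R eventually u l) H (c - l) ltac:(lra)) as [N HN].
  specialize (HN N (le_n _)). specialize (Hn N). apply Rabs_lt_between in HN. lra.
Qed.

Lemma seq_lim_unique (u : nat -> R) (l l' : R) : filterlim u eventually (locally l) ->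
  filterlim u eventually (locally l') -> l = l'.
Proof. intros H H'. apply (filterlim_locally_unique (V := R_NormedModule) u l l' H H'). Qed.

(** The limit [x] of a maximising sequence may lie outside [A], on a face where only boundary
    conditions are available; hence the sequence is returned along with its limit. *)
Lemma sup_adherent (A : pt3 -> Prop) (h : pt3 -> R) (B C : R) :
  (exists x, A x) ->
  (forall x, A x -> Rabs (X1 x) <= B /\ Rabs (X2 x) <= B /\ Rabs (X3 x) <= B) ->
  (forall x, A x -> h x <= C) ->
  exists M x u, (forall y, A y -> h y <= M) /\ (forall n : nat, A (u n)) /\
    filterlim u eventually (locally x) /\ filterlim (fun n => h (u n)) eventually (locally M).
Proof.
  intros [a Ha] HB HC.
  destruct (completeness (fun r => exists x, A x /\ r = h x)) as [M [HM1 HM2]].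
  { exists C. intros r [x [Ax ->]]. auto. } { exists (h a), a. auto. }
  assert (K : forall n : nat, exists x, A x /\ M - / (INR n + 1) < h x).
  { intros n. apply NNPP. intros N. pose proof (inv_INR_pos n).
    assert (M <= M - / (INR n + 1)); [|lra]. apply HM2. intros r [x [Ax ->]].
    apply Rnot_lt_le. intros L. apply N. exists x. auto. }
  destruct (nat_choice _ K) as [u Hu].
  destruct (BW3 u B (fun n => HB _ (proj1 (Hu n)))) as [psi [x [Hpsi Hx]]].
  assert (HM : forall y, A y -> h y <= M) by (intros y Ay; apply HM1; exists y; auto).
  exists M, x, (fun n => u (psi n)). split; [exact HM|]. split; [intros; apply Hu|]. split; [exact Hx|].
  apply filterlim_R; [typeclasses eauto|]. intros e He. destruct (inv_INR_small e He) as [N HN].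
  exists N. intros n Hn. specialize (HN (psi n)). specialize (Hpsi n).
  destruct (Hu (psi n)) as [A1 A2]. specialize (HM _ A1).
  specialize (HN ltac:(lia)). apply Rabs_lt_between. lra.
Qed.

Lemma evt3 (A : pt3 -> Prop) (h : pt3 -> R) (B : R) :
  (exists x, A x) ->
  (forall x, A x -> Rabs (X1 x) <= B /\ Rabs (X2 x) <= B /\ Rabs (X3 x) <= B) ->
  (forall x, adh3 A x -> A x) -> (forall x, A x -> continuous h x) ->
  exists x, A x /\ forall y, A y -> h y <= h x.
Proof.
  intros HA HB Hcl Hc.
  assert (Bd : exists C, forall x, A x -> h x <= C).
  { apply NNPP. intros N.
    assert (K : forall n : nat, exists x, A x /\ INR n < h x).
    { intros n. apply NNPP. intros N'. apply N. exists (INR n). intros x Ax.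
      apply Rnot_lt_le. intros L. apply N'. exists x; auto. }
    destruct (nat_choice _ K) as [u Hu].
    destruct (BW3 u B (fun n => HB _ (proj1 (Hu n)))) as [psi [x [Hpsi Hx]]].
    assert (Ax : A x) by (apply Hcl, (seq_adh3 A (fun n => u (psi n))); [intros; apply Hu|exact Hx]).
    pose proof (filterlim_comp _ _ _ _ _ _ _ _ Hx (Hc x Ax)) as L.
    destruct (proj1 (filterlim_R eventually _ _) L 1 Rlt_0_1) as [N1 HN1].
    destruct (INR_unbounded (h x + 1)) as [N2 HN2].
    specialize (HN1 (max N1 N2) ltac:(lia)). apply Rabs_lt_between in HN1.
    destruct (Hu (psi (max N1 N2))) as [_ Hn]. specialize (Hpsi (max N1 N2)).
    assert (INR N2 <= INR (psi (max N1 N2))) by (apply le_INR; lia). lra. }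
  destruct Bd as [C HC].
  destruct (sup_adherent A h B C HA HB HC) as [M [x [u [HM [Hu [Hx Hl]]]]]].
  assert (Ax : A x) by (apply Hcl, (seq_adh3 A u); assumption).
  exists x. split; [exact Ax|]. intros y Ay.
  pose proof (filterlim_comp _ _ _ _ _ _ _ _ Hx (Hc x Ax)) as L.
  rewrite (seq_lim_unique _ _ _ L Hl). auto.
Qed.

(** * Iterated integrals and the divergence theorem for compactly supported fields *)

Lemma continuous_RInt_param {U : UniformSpace} (h : U -> R -> R) (a b : R) (t : U) :
  a <= b -> (forall u y, continuous (fun z : U * R => h (fst z) (snd z)) (u, y)) ->
  continuous (fun u => RInt (h u) a b) t.
Proof.
  intros Hab Hc.
  assert (Hc1 : forall u y, continuous (h u) y).
  { intros u y. apply (continuous_comp (fun y => (u, y)) (fun z : U * R => h (fst z) (snd z)) y).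
    - apply continuous_pair; [apply continuous_const|apply continuous_id].
    - apply Hc. }
  apply filterlim_R; [typeclasses eauto|]. intros e He.
  destruct (exists_small (e / 2) (b - a) ltac:(lra) ltac:(lra)) as [e' [He' Ee']].
  assert (K : forall y, exists d : posreal, forall u y', ball t d u -> Rabs (y' - y) < d ->
             Rabs (h u y' - h t y) < e' / 2).
  { intros y. pose proof (proj1 (filterlim_R _ _ _) (Hc t y) (e' / 2) ltac:(lra)) as [d Hd].
    exists d. intros u y' Hu Hy. apply (Hd (u, y')). split; [exact Hu|exact Hy]. }
  pose (delta := fun y => proj1_sig (constructive_indefinite_description _ (K y))).
  assert (Hdelta : forall y u y', ball t (delta y) u -> Rabs (y' - y) < delta y ->
             Rabs (h u y' - h t y) < e' / 2).
  { intros y. apply (proj2_sig (constructive_indefinite_description _ (K y))). }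
  (* Compactness of [[a, b]] replaces the pointwise radii [delta y] by one radius valid for all
     [y]. *)
  destruct (compactness_value_1d a b delta) as [d Hd].
  exists d. intros u Hu.
  assert (Q : forall y, a <= y <= b -> Rabs (h u y - h t y) <= e').
  { intros y Hy. apply NNPP. intros N. apply (Hd y Hy). intros [y0 [_ [Hy0 Hdy0]]]. apply N.
    assert (Hb : ball t (delta y0) u) by (eapply ball_le; [exact Hdy0|exact Hu]).
    pose proof (Hdelta y0 u y Hb Hy0) as A1.
    pose proof (Hdelta y0 t y (ball_center _ _) Hy0) as A2.
    replace (h u y - h t y) with ((h u y - h t y0) - (h t y - h t y0)) by ring.
    unfold Rminus at 1. eapply Rle_trans; [apply Rabs_triang|]. rewrite Rabs_Ropp. lra. }
  assert (E : RInt (h u) a b - RInt (h t) a b = RInt (fun y => h u y - h t y) a b).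
  { symmetry. apply (RInt_minus (h u) (h t)); apply (ex_RInt_continuous (V := R_CompleteNormedModule)); auto. }
  rewrite E. eapply Rle_lt_trans.
  - apply abs_RInt_le_const with (M := e'); [exact Hab| |exact Q].
    apply (ex_RInt_continuous (V := R_CompleteNormedModule)). intros z _. apply continuous_Rminus; apply Hc1.
  - lra.
Qed.

Lemma is_derive_RInt_cont (h d : R -> R -> R) (a b x : R) : a <= b ->
  (forall x y, is_derive (fun u => h u y) x (d x y)) ->
  (forall x y, continuous (fun z : R * R => d (fst z) (snd z)) (x, y)) ->
  (forall x y, continuous (h x) y) ->
  is_derive (fun u => RInt (h u) a b) x (RInt (d x) a b).
Proof.
  intros Hab HD Hd Hh.
  replace (RInt (d x) a b) with (RInt (fun t => Derive (fun u => h u t) x) a b).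
  - apply (is_derive_RInt_param h a b x).
    + apply filter_forall. intros u t _. eexists. apply HD.
    + intros t _. apply continuity_2d_pt_filterlim.
      apply (continuous_ext (fun z : R * R => d (fst z) (snd z))); [|apply Hd].
      intros [u v]. symmetry. apply is_derive_unique, HD.
    + apply filter_forall. intros u. apply (ex_RInt_continuous (V := R_CompleteNormedModule)). intros; apply Hh.
  - apply RInt_ext. intros t _. apply is_derive_unique, HD.
Qed.

(** * Iterated integrals over a box *)

Section Int3.
Variables a1 b1 L : R.
Hypothesis ab1 : a1 <= b1.
Hypothesis L0 : 0 <= L.

(** A volume integral over a box as iterated one-variable integrals: each partial derivative is
    integrated in its own variable, after differentiation under the inner integrals. *)
Definition int3 (H : pt3 -> R) : R :=
  RInt (fun s => RInt (fun y1 => RInt (fun y2 => H (s, y1, y2)) (- L) L) (- L) L) a1 b1.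

Definition cont3 (H : pt3 -> R) : Prop := forall x, continuous H x.

Lemma cont_inner1 H s y1 y2 : cont3 H -> continuous (fun y2 => H (s, y1, y2)) y2.
Proof.
  intros Hc. apply (continuous_comp (fun y => (s, y1, y)) H).
  - apply continuous_pair; [apply continuous_const|apply continuous_id].
  - apply Hc.
Qed.

Lemma cont_inner2 H z : cont3 H ->
  continuous (fun w : R * R => RInt (fun y2 => H (fst w, snd w, y2)) (- L) L) z.
Proof.
  intros Hc. apply (continuous_RInt_param (fun (w : R * R) y2 => H (fst w, snd w, y2))); [lra|].
  intros u y. apply (continuous_ext H); [|apply Hc]. intros [[p q] r]. reflexivity.
Qed.

Lemma cont_inner2' H s y : cont3 H -> continuous (fun y1 => RInt (fun y2 => H (s, y1, y2)) (- L) L) y.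
Proof.
  intros Hc.
  apply (continuous_comp (fun y => (s, y)) (fun w : R * R => RInt (fun y2 => H (fst w, snd w, y2)) (- L) L)).
  - apply continuous_pair; [apply continuous_const|apply continuous_id].
  - apply cont_inner2, Hc.
Qed.

Lemma cont_inner3 H s : cont3 H ->
  continuous (fun s => RInt (fun y1 => RInt (fun y2 => H (s, y1, y2)) (- L) L) (- L) L) s.
Proof.
  intros Hc. apply (continuous_RInt_param (fun s y1 => RInt (fun y2 => H (s, y1, y2)) (- L) L)); [lra|].
  intros u y. apply cont_inner2, Hc.
Qed.

Lemma ex1 H s y1 a b : cont3 H -> ex_RInt (fun y2 => H (s, y1, y2)) a b.
Proof. intros Hc. apply (ex_RInt_continuous (V := R_CompleteNormedModule)). intros; apply cont_inner1, Hc. Qed.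
Lemma ex2 H s a b : cont3 H -> ex_RInt (fun y1 => RInt (fun y2 => H (s, y1, y2)) (- L) L) a b.
Proof. intros Hc. apply (ex_RInt_continuous (V := R_CompleteNormedModule)). intros; apply cont_inner2', Hc. Qed.
Lemma ex3 H a b : cont3 H ->
  ex_RInt (fun s => RInt (fun y1 => RInt (fun y2 => H (s, y1, y2)) (- L) L) (- L) L) a b.
Proof. intros Hc. apply (ex_RInt_continuous (V := R_CompleteNormedModule)). intros; apply cont_inner3, Hc. Qed.

Lemma int3_le H K : cont3 H -> cont3 K -> (forall x, H x <= K x) -> int3 H <= int3 K.
Proof.
  intros CH CK HK.
  apply RInt_le; [exact ab1|apply ex3, CH|apply ex3, CK|]. intros s _.
  apply RInt_le; [lra|apply ex2, CH|apply ex2, CK|]. intros y1 _.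
  apply RInt_le; [lra|apply ex1, CH|apply ex1, CK|]. intros y2 _. apply HK.
Qed.

Lemma int3_plus H K : cont3 H -> cont3 K -> int3 (fun x => H x + K x) = int3 H + int3 K.
Proof.
  intros CH CK. unfold int3.
  rewrite <- (RInt_plus (V := R_CompleteNormedModule)) by (apply ex3; assumption).
  apply RInt_ext. intros s _.
  rewrite <- (RInt_plus (V := R_CompleteNormedModule)) by (apply ex2; assumption).
  apply RInt_ext. intros y1 _.
  rewrite <- (RInt_plus (V := R_CompleteNormedModule)) by (apply ex1; assumption).
  reflexivity.
Qed.

Lemma int3_scal k H : cont3 H -> int3 (fun x => k * H x) = k * int3 H.
Proof.
  intros CH. unfold int3.
  change (k * RInt (fun s => RInt (fun y1 => RInt (fun y2 => H (s, y1, y2)) (- L) L) (- L) L) a1 b1)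
    with (scal k (RInt (fun s => RInt (fun y1 => RInt (fun y2 => H (s, y1, y2)) (- L) L) (- L) L) a1 b1)).
  rewrite <- (RInt_scal (V := R_CompleteNormedModule)) by (apply ex3; assumption).
  apply RInt_ext. intros s _.
  rewrite <- (RInt_scal (V := R_CompleteNormedModule)) by (apply ex2; assumption).
  apply RInt_ext. intros y1 _.
  rewrite <- (RInt_scal (V := R_CompleteNormedModule)) by (apply ex1; assumption).
  reflexivity.
Qed.

Lemma RInt_ge_sub (f : R -> R) (a b c d k : R) : a <= c -> c <= d -> d <= b ->
  (forall x, continuous f x) -> (forall x, 0 <= f x) -> (forall x, c <= x <= d -> k <= f x) ->
  k * (d - c) <= RInt f a b.
Proof.
  intros H1 H2 H3 Hc H0 Hk.
  assert (EX : forall u v, ex_RInt f u v).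
  { intros. apply (ex_RInt_continuous (V := R_CompleteNormedModule)). auto. }
  rewrite <- (RInt_Chasles f a c b) by auto. rewrite <- (RInt_Chasles f c d b) by auto.
  assert (A : 0 <= RInt f a c) by (apply RInt_ge_0; auto).
  assert (B : 0 <= RInt f d b) by (apply RInt_ge_0; auto).
  assert (C : k * (d - c) <= RInt f c d).
  { replace (k * (d - c)) with (RInt (fun _ => k) c d).
    - apply RInt_le; auto. apply ex_RInt_const. intros x Hx. apply Hk. lra.
    - rewrite RInt_const. unfold scal; simpl; unfold mult; simpl. ring. }
  unfold plus; simpl. lra.
Qed.

Lemma int3_ge_sub H c1 d1 c2 d2 c3 d3 k : cont3 H -> (forall x, 0 <= H x) ->
  a1 <= c1 <= d1 -> d1 <= b1 -> - L <= c2 <= d2 -> d2 <= L -> - L <= c3 <= d3 -> d3 <= L ->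
  (forall s y1 y2, c1 <= s <= d1 -> c2 <= y1 <= d2 -> c3 <= y2 <= d3 -> k <= H (s, y1, y2)) ->
  k * (d3 - c3) * (d2 - c2) * (d1 - c1) <= int3 H.
Proof.
  intros CH H0 A1 A1' A2 A2' A3 A3' Hk.
  assert (P1 : forall s y1, 0 <= RInt (fun y2 => H (s, y1, y2)) (- L) L).
  { intros. apply RInt_ge_0; [lra|apply ex1, CH|auto]. }
  assert (P2 : forall s, 0 <= RInt (fun y1 => RInt (fun y2 => H (s, y1, y2)) (- L) L) (- L) L).
  { intros. apply RInt_ge_0; [lra|apply ex2, CH|auto]. }
  apply RInt_ge_sub; try lra; [intros; apply cont_inner3, CH|auto|]. intros s Hs.
  apply RInt_ge_sub; try lra; [intros; apply cont_inner2', CH|auto|]. intros y1 Hy1.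
  apply RInt_ge_sub; try lra; [intros; apply cont_inner1, CH|auto|]. intros y2 Hy2. auto.
Qed.

Lemma RInt_zero (f : R -> R) (a b : R) : (forall x, f x = 0) -> RInt f a b = 0.
Proof.
  intros H. rewrite (RInt_ext f (fun _ => 0)) by (intros; apply H).
  rewrite RInt_const. unfold scal; simpl; unfold mult; simpl. ring.
Qed.

Lemma RInt_is_derive (f d : R -> R) (a b : R) : (forall x, is_derive f x (d x)) ->
  (forall x, continuous d x) -> RInt d a b = f b - f a.
Proof.
  intros H C. apply is_RInt_unique. apply (is_RInt_derive f d); auto.
Qed.

Lemma int3_d3 H D : cont3 D -> (forall s y1 y2, is_derive (fun y => H (s, y1, y)) y2 (D (s, y1, y2))) ->
  (forall s y1, H (s, y1, - L) = 0 /\ H (s, y1, L) = 0) -> int3 D = 0.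
Proof.
  intros CD HD HZ. unfold int3. apply RInt_zero. intros s. apply RInt_zero. intros y1.
  rewrite (RInt_is_derive (fun y => H (s, y1, y))).
  - destruct (HZ s y1). lra.
  - intros; apply HD.
  - intros; apply cont_inner1, CD.
Qed.

Lemma int3_d2 H D : cont3 H -> cont3 D -> (forall s y1 y2, is_derive (fun y => H (s, y, y2)) y1 (D (s, y1, y2))) ->
  (forall s y2, H (s, - L, y2) = 0 /\ H (s, L, y2) = 0) -> int3 D = 0.
Proof.
  intros CH CD HD HZ. unfold int3. apply RInt_zero. intros s.
  rewrite (RInt_is_derive (fun y1 => RInt (fun y2 => H (s, y1, y2)) (- L) L)).
  - rewrite !RInt_zero; [lra|intros; apply HZ|intros; apply HZ].
  - intros y. apply (is_derive_RInt_cont (fun y1 y2 => H (s, y1, y2)) (fun y1 y2 => D (s, y1, y2))); [lra| | |].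
    + intros; apply HD.
    + intros u v. apply (continuous_comp (fun z : R * R => (s, fst z, snd z)) D); [|apply CD].
      repeat apply continuous_pair; [apply continuous_const|apply continuous_fst|apply continuous_snd].
    + intros; apply cont_inner1, CH.
  - intros; apply cont_inner2', CD.
Qed.

Lemma int3_d1 H D : cont3 H -> cont3 D -> (forall s y1 y2, is_derive (fun y => H (y, y1, y2)) s (D (s, y1, y2))) ->
  (forall y1 y2, H (a1, y1, y2) = 0 /\ H (b1, y1, y2) = 0) -> int3 D = 0.
Proof.
  intros CH CD HD HZ. unfold int3.
  rewrite (RInt_is_derive (fun s => RInt (fun y1 => RInt (fun y2 => H (s, y1, y2)) (- L) L) (- L) L)).
  - rewrite !RInt_zero; [lra| |]; intros; apply RInt_zero; intros; apply HZ.
  - intros s.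
    apply (is_derive_RInt_cont (fun s y1 => RInt (fun y2 => H (s, y1, y2)) (- L) L)
             (fun s y1 => RInt (fun y2 => D (s, y1, y2)) (- L) L)); [lra| | |].
    + intros u y1. apply (is_derive_RInt_cont (fun s y2 => H (s, y1, y2)) (fun s y2 => D (s, y1, y2))); [lra| | |].
      * intros; apply HD.
      * intros v w. apply (continuous_comp (fun z : R * R => (fst z, y1, snd z)) D); [|apply CD].
        repeat apply continuous_pair; [apply continuous_fst|apply continuous_const|apply continuous_snd].
      * intros; apply cont_inner1, CH.
    + intros u v. apply cont_inner2, CD.
    + intros; apply cont_inner2', CH.
  - intros; apply cont_inner3, CD.
Qed.

Lemma int3_ext H K : (forall x, H x = K x) -> int3 H = int3 K.
Proof.
  intros E. unfold int3. apply RInt_ext. intros s _. apply RInt_ext. intros y1 _.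
  apply RInt_ext. intros y2 _. apply E.
Qed.

(* Cartesian coordinates of the point with rotated coordinates [(s, y1, y2)] centred at [p]. *)
Definition unrot (p : pt2) (th : R) (x : pt3) : pt3 :=
  (X1 x, fst p + (cos th * X2 x - sin th * X3 x), snd p + (sin th * X2 x + cos th * X3 x)).

Lemma continuous_unrot p th x : continuous (unrot p th) x.
Proof.
  unfold unrot. repeat apply continuous_pair.
  - apply continuous_X1.
  - apply continuous_Rplus; [apply continuous_const|]. apply continuous_Rminus; apply continuous_Rmult;
      (apply continuous_const || apply continuous_X2 || apply continuous_X3).
  - apply continuous_Rplus; [apply continuous_const|]. apply continuous_Rplus; apply continuous_Rmult;
      (apply continuous_const || apply continuous_X2 || apply continuous_X3).
Qed.

Lemma cont3_unrot p th H : cont3 H -> cont3 (fun x => H (unrot p th x)).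
Proof. intros CH x. apply (continuous_comp (unrot p th) H); [apply continuous_unrot|apply CH]. Qed.

Lemma unrot_norm p th x :
  (X2 (unrot p th x) - fst p) ^ 2 + (X3 (unrot p th x) - snd p) ^ 2 = X2 x ^ 2 + X3 x ^ 2.
Proof.
  unfold unrot, X1, X2, X3; simpl. pose proof (sin2_cos2 th) as E. unfold Rsqr in E.
  set (c := cos th) in *. set (s := sin th) in *. set (u := snd (fst x)). set (v := snd x).
  replace ((fst p + (c * u - s * v) - fst p) * ((fst p + (c * u - s * v) - fst p) * 1) +
     (snd p + (s * u + c * v) - snd p) * ((snd p + (s * u + c * v) - snd p) * 1))
    with ((s * s + c * c) * (u * u + v * v)) by ring.
  rewrite E. ring.
Qed.

(** The rotated components of the field are integrated along the rotated axes, where the support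
    condition kills the end values, and [cos ^ 2 + sin ^ 2 = 1] reassembles the divergence. The box
    is rotated so that a strip along a chart graph is thin in the last variable. *)
Lemma divergence_zero p th (F : idx -> pt3 -> R) (D : idx -> idx -> pt3 -> R) :
  (forall i x, C1D (F i) (D i) x) ->
  (forall i x, F i x <> 0 -> a1 < X1 x < b1 /\ (X2 x - fst p) ^ 2 + (X3 x - snd p) ^ 2 < L ^ 2) ->
  int3 (fun x => D I1 I1 (unrot p th x) + D I2 I2 (unrot p th x) + D I3 I3 (unrot p th x)) = 0.
Proof.
  intros HC HS.
  pose (c := cos th). pose (s := sin th).
  assert (CF : forall i, cont3 (fun x => F i (unrot p th x))).
  { intros i. apply cont3_unrot. intros x. eapply C1D_continuous, HC. }
  assert (CD : forall i j, cont3 (fun x => D i j (unrot p th x))).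
  { intros i j. apply cont3_unrot. intros x. apply HC. }
  assert (Z : forall i x, ~ (a1 < X1 x < b1 /\ X2 x ^ 2 + X3 x ^ 2 < L ^ 2) -> F i (unrot p th x) = 0).
  { intros i x N. apply NNPP. intros K. apply N. apply HS in K. rewrite unrot_norm in K.
    destruct K as [K1 K2]. split; [exact K1|exact K2]. }
  assert (Cc : forall k i, cont3 (fun x => k * F i (unrot p th x))).
  { intros k i x. apply continuous_Rmult; [apply continuous_const|apply CF]. }
  assert (Cd : forall k i j, cont3 (fun x => k * D i j (unrot p th x))).
  { intros k i j x. apply continuous_Rmult; [apply continuous_const|apply CD]. }
  assert (D1 : forall i a b t, is_derive (fun y => F i (unrot p th (y, a, b))) t (D i I1 (unrot p th (t, a, b)))).
  { intros i a b t. evar_last.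
    - apply (is_derive_curve (F i) (D i) (fun y => y) (fun _ => fst p + (c * a - s * b)) (fun _ => snd p + (s * a + c * b)) t 1 0 0).
      + apply (is_derive_id (K := R_AbsRing)).
      + apply is_derive_Rconst.
      + apply is_derive_Rconst.
      + apply HC.
    - Req. unfold unrot, X1, X2, X3; simpl. fold c s. ring. }
  assert (D2 : forall i a b t, is_derive (fun y => F i (unrot p th (a, y, b))) t
            (c * D i I2 (unrot p th (a, t, b)) + s * D i I3 (unrot p th (a, t, b)))).
  { intros i a b t. evar_last.
    - apply (is_derive_curve (F i) (D i) (fun y => a) (fun t => fst p + (c * t - s * b)) (fun t => snd p + (s * t + c * b)) t 0 c s).
      + apply is_derive_Rconst.
      + auto_derive; [trivial|ring].
      + auto_derive; [trivial|ring].
      + apply HC.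
    - Req. unfold unrot, X1, X2, X3; simpl. fold c s. ring. }
  assert (D3 : forall i a b t, is_derive (fun y => F i (unrot p th (a, b, y))) t
            (- s * D i I2 (unrot p th (a, b, t)) + c * D i I3 (unrot p th (a, b, t)))).
  { intros i a b t. evar_last.
    - apply (is_derive_curve (F i) (D i) (fun y => a) (fun t => fst p + (c * b - s * t)) (fun t => snd p + (s * b + c * t)) t 0 (- s) c).
      + apply is_derive_Rconst.
      + auto_derive; [trivial|ring].
      + auto_derive; [trivial|ring].
      + apply HC.
    - Req. unfold unrot, X1, X2, X3; simpl. fold c s. ring. }
  assert (J1 : int3 (fun x => D I1 I1 (unrot p th x)) = 0).
  { apply (int3_d1 (fun x => F I1 (unrot p th x))); [apply CF|apply CD|intros; apply D1|].
    intros y1 y2. split; apply Z; unfold X1; simpl; lra. }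
  assert (J2 : int3 (fun x => c * (c * D I2 I2 (unrot p th x) + s * D I2 I3 (unrot p th x))
                            + s * (c * D I3 I2 (unrot p th x) + s * D I3 I3 (unrot p th x))) = 0).
  { apply (int3_d2 (fun x => c * F I2 (unrot p th x) + s * F I3 (unrot p th x))).
    - intros x. apply continuous_Rplus; apply Cc.
    - intros x. continuous_arith; apply CD.
    - intros. apply is_derive_Rplus; apply is_derive_Rscal; apply D2.
    - intros t y2. rewrite !Z; [lra|..]; unfold X1, X2, X3; simpl; nra. }
  assert (J3 : int3 (fun x => - s * (- s * D I2 I2 (unrot p th x) + c * D I2 I3 (unrot p th x))
                            + c * (- s * D I3 I2 (unrot p th x) + c * D I3 I3 (unrot p th x))) = 0).
  { apply (int3_d3 (fun x => - s * F I2 (unrot p th x) + c * F I3 (unrot p th x))).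
    - intros x. continuous_arith; apply CD.
    - intros. apply is_derive_Rplus; apply is_derive_Rscal; apply D3.
    - intros t y2. rewrite !Z; [lra|..]; unfold X1, X2, X3; simpl; nra. }
  replace 0 with (0 + (0 + 0)) by ring. rewrite <- J1 at 1. rewrite <- J2 at 1. rewrite <- J3.
  rewrite <- int3_plus, <- int3_plus; try (intros x; continuous_arith; apply CD).
  apply int3_ext. intros x. pose proof (sin2_cos2 th) as E. unfold Rsqr in E. fold c s in E.
  set (A := D I2 I2 (unrot p th x)). set (B := D I3 I3 (unrot p th x)). 
  replace (D I1 I1 (unrot p th x) + A + B) with (D I1 I1 (unrot p th x) + 1 * A + 1 * B) by ring.
  rewrite <- E. ring.
Qed.

End Int3.

(** * Cutoff functions and the energy identity on a lens *)

(** A continuous bump supported in [[0, 1]]; its primitive [zc] is a C^1 monotone step from 0 to the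
    plateau [zc 1], which is kept symbolic. *)
Definition zd (u : R) : R := Rmax 0 (u * (1 - u)).
Definition zc (x : R) : R := RInt zd 0 x.

Lemma zd_nonneg u : 0 <= zd u.
Proof. apply Rmax_l. Qed.

Lemma zd_left u : u <= 0 -> zd u = 0.
Proof. intros H. apply Rmax_left. nra. Qed.

Lemma zd_right u : 1 <= u -> zd u = 0.
Proof. intros H. apply Rmax_left. nra. Qed.

Lemma zd_pos u : 0 < u < 1 -> 0 < zd u.
Proof. intros H. unfold zd. rewrite Rmax_right; nra. Qed.

Lemma zd_le_1 u : zd u <= 1.
Proof. apply Rmax_lub; nra. Qed.

Lemma continuous_zd u : continuous zd u.
Proof.
  apply (continuous_ext (fun u => (u * (1 - u) + Rabs (u * (1 - u))) / 2)).
  - intros x. unfold zd, Rmax. Req. destruct (Rle_dec 0 (x * (1 - x))).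
    + rewrite Rabs_right; lra.
    + rewrite Rabs_left; lra.
  - assert (C : forall u, continuous (fun u : R => u * (1 - u)) u).
    { intros v. apply (ex_derive_continuous (fun u : R => u * (1 - u))). auto_derive. trivial. }
    apply continuous_Rmult; [|apply continuous_const]. apply continuous_Rplus; [apply C|].
    apply (continuous_comp (fun u : R => u * (1 - u)) Rabs); [apply C|apply continuous_Rabs].
Qed.

Lemma is_derive_zc x : is_derive zc x (zd x).
Proof.
  apply (is_derive_RInt zd zc 0 x).
  - apply filter_forall. intros y. apply (RInt_correct (V := R_CompleteNormedModule)).
    apply (ex_RInt_continuous (V := R_CompleteNormedModule)). intros; apply continuous_zd.
  - apply continuous_zd.
Qed.

Lemma zc_MVT x y : x <= y -> exists c, x <= c <= y /\ zc y - zc x = zd c * (y - x).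
Proof.
  intros H. destruct (MVT_gen zc x y zd) as [c [Hc E]].
  - intros; apply is_derive_zc.
  - intros u _. apply continuity_pt_filterlim, (ex_derive_continuous zc). eexists; apply is_derive_zc.
  - exists c. rewrite Rmin_left, Rmax_right in Hc by lra. auto.
Qed.

Lemma zc_0 : zc 0 = 0.
Proof. apply (RInt_point (V := R_CompleteNormedModule)). Qed.

Lemma zc_left x : x <= 0 -> zc x = 0.
Proof.
  intros H. destruct (zc_MVT x 0 H) as [c [Hc E]]. rewrite zc_0, zd_left in E by lra. lra.
Qed.

Lemma zc_mono x y : x <= y -> zc x <= zc y.
Proof. intros H. destruct (zc_MVT x y H) as [c [Hc E]]. pose proof (zd_nonneg c). nra. Qed.

Lemma zc_right x : 1 <= x -> zc x = zc 1.
Proof.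
  intros H. destruct (zc_MVT 1 x H) as [c [Hc E]]. rewrite (zd_right c) in E by lra. lra.
Qed.

Lemma zc_1_le : zc 1 <= 1.
Proof. destruct (zc_MVT 0 1 ltac:(lra)) as [c [Hc E]]. rewrite zc_0 in E. pose proof (zd_le_1 c). lra. Qed.

Lemma zc_bounds x : 0 <= zc x <= 1.
Proof.
  pose proof zc_1_le. split.
  - destruct (Rle_lt_dec x 0) as [L|L]; [rewrite zc_left; lra|]. rewrite <- zc_0. apply zc_mono; lra.
  - destruct (Rle_lt_dec x 1) as [L|L]; [|rewrite zc_right; lra].
    eapply Rle_trans; [apply (zc_mono x 1 L)|lra].
Qed.

Lemma zc_1_pos : 0 < zc 1.
Proof.
  unfold zc. apply RInt_gt_0; [lra|intros; apply zd_pos; lra|intros; apply continuous_zd].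
Qed.

(** Vanishes up to [e] and is constant from [2 * e] on. Starting at [e] rather than at 0 makes
    products with it vanish near the boundary, so that extension by zero stays C^1. *)
Definition cut (e d : R) : R := zc (d / e - 1).
Definition cut' (e d : R) : R := zd (d / e - 1) / e.

Lemma is_derive_cut e d : 0 < e -> is_derive (cut e) d (cut' e d).
Proof.
  intros He. unfold cut, cut'.
  evar_last; [apply (is_derive_Rcomp zc (fun d => d / e - 1) d (zd (d / e - 1)) (/ e))|].
  - apply is_derive_zc.
  - auto_derive; [lra|]. field. lra.
  - Req. unfold Rdiv. ring.
Qed.

Lemma continuous_cut' e d : 0 < e -> continuous (cut' e) d.
Proof.
  intros He. unfold cut'. apply continuous_Rmult; [|apply continuous_const].
  apply (continuous_comp (fun d => d / e - 1) zd); [|apply continuous_zd].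
  apply continuous_Rminus; [|apply continuous_const]. apply continuous_Rmult; [apply continuous_id|apply continuous_const].
Qed.

Lemma div_le_iff e d c : 0 < e -> (d / e <= c <-> d <= c * e).
Proof.
  intros He. split; intros H.
  - apply Rmult_le_compat_r with (r := e) in H; [|lra]. replace (d / e * e) with d in H by (field; lra). exact H.
  - apply Rmult_le_reg_r with e; [exact He|]. replace (d / e * e) with d by (field; lra). exact H.
Qed.

Lemma cut_left e d : 0 < e -> d <= e -> cut e d = 0 /\ cut' e d = 0.
Proof.
  intros He H. assert (d / e - 1 <= 0) by (assert (d / e <= 1) by (apply div_le_iff; lra); lra).
  unfold cut, cut'. rewrite zc_left, zd_left by assumption. split; [reflexivity|]. unfold Rdiv; ring.
Qed.

Lemma cut_right e d : 0 < e -> 2 * e <= d -> cut e d = zc 1 /\ cut' e d = 0.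
Proof.
  intros He H. assert (1 <= d / e - 1).
  { assert (2 <= d / e); [|lra]. apply Rmult_le_reg_r with e; [exact He|].
    replace (d / e * e) with d by (field; lra). exact H. }
  unfold cut, cut'. rewrite zc_right, zd_right by assumption. split; [reflexivity|]. unfold Rdiv; ring.
Qed.

Lemma cut_bounds e d : 0 <= cut e d <= 1.
Proof. apply zc_bounds. Qed.

Lemma cut'_nonneg e d : 0 < e -> 0 <= cut' e d.
Proof. intros He. apply Rmult_le_pos; [apply zd_nonneg|apply Rlt_le, Rinv_0_lt_compat, He]. Qed.

(** Above the plane [X1 = T], the set where this is positive is a paraboloid cap of height [tau] and
    radius [sqrt tau]. Its slope is at most [2 * sqrt tau], hence the cap is space-like for small
    [tau]. *)
Definition lens (T tau : R) (p : pt2) (x : pt3) : R :=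
  T + tau - X1 x - ((X2 x - fst p) ^ 2 + (X3 x - snd p) ^ 2).

Definition lensD (p : pt2) (i : idx) (x : pt3) : R :=
  match i with I1 => -1 | I2 => - 2 * (X2 x - fst p) | I3 => - 2 * (X3 x - snd p) end.

Lemma C1D_lens T tau p x : C1D (lens T tau p) (lensD p) x.
Proof.
  split.
  - apply filter_forall. intros [[a b] c] i. unfold is_par, lens, line, coord, lensD.
    destruct i; unfold X1, X2, X3; simpl; auto_derive; try trivial; ring.
  - intros i. destruct i; simpl; [apply continuous_const| |]; (apply continuous_Rmult; [apply continuous_const|]);
    (apply continuous_Rminus; [|apply continuous_const]); [apply continuous_X2|apply continuous_X3].
Qed.

Lemma C1D_zero_near (h : pt3 -> R) D x : locally x (fun y => h y = 0 /\ forall i, D i y = 0) -> C1D h D x.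
Proof.
  intros H. apply (C1D_ext_D h (fun _ _ => 0)).
  - eapply filter_imp; [|exact H]. intros y [_ Hy] i. symmetry. apply Hy.
  - apply (C1D_ext_loc (fun _ => 0)).
    + eapply filter_imp; [|exact H]. intros y [Hy _]. symmetry. apply Hy.
    + apply C1D_const.
Qed.

Lemma cont_lt_near (h : pt3 -> R) x c : continuous h x -> h x < c -> locally x (fun y => h y < c).
Proof. intros Hc H. apply (Hc (fun u => u < c)), (open_lt c (h x)), H. Qed.

Definition dotE (E D : idx -> pt3 -> R) (x : pt3) : R :=
  E I1 x * D I1 x + E I2 x * D I2 x + E I3 x * D I3 x.

(** * Vanishing of a signed flux on a lens, by cutoffs *)

Section Lens.
Variables (E : idx -> pt3 -> R) (ED : idx -> idx -> pt3 -> R) (V : pt3 -> Prop).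
Variables (p : pt2) (th T tau C : R) (d : pt3 -> R) (dD : idx -> pt3 -> R) (s : pt3 -> R) (sD : idx -> pt3 -> R).
Hypothesis tau_pos : 0 < tau.
Hypothesis tau_1 : tau <= 1.
Hypothesis d_C1 : forall x, C1D d dD x.
Hypothesis s_C1 : forall x, T < X1 x -> 0 <= lens T tau p x -> 0 < d x -> C1D s sD x /\ (0 < s x -> V x).
Hypothesis E_C1 : forall x, V x -> forall i, C1D (E i) (ED i) x.
Hypothesis E_div : forall x, V x -> ED I1 I1 x + ED I2 I2 x + ED I3 I3 x = 0.
(** The faces of the lens: through the cap and the shock face [s = 0] the flux is merely signed;
    through the front [X1 = T] and the wall [d = 0] it tends to zero. [strip] bounds the integral
    over the wall layer uniformly in [e]. *)
Hypothesis E_top : forall x, V x -> T < X1 x -> 0 <= lens T tau p x -> 0 <= dotE E (lensD p) x.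
Hypothesis E_s : exists e3, 0 < e3 /\ forall x, V x -> T < X1 x -> 0 <= lens T tau p x -> 0 < s x < e3 -> 0 <= dotE E sD x.
Hypothesis E_small : forall del, 0 < del -> exists e0, 0 < e0 /\ forall x, V x -> T < X1 x -> 0 <= lens T tau p x ->
  (X1 x < T + e0 -> Rabs (E I1 x) <= del) /\ (0 < d x < e0 -> Rabs (dotE E dD x) <= del).
Hypothesis strip : exists e1, 0 < e1 /\ forall e, 0 < e < e1 ->
  int3 T (T + tau) (sqrt tau) (fun x => cut' e (d (unrot p th x))) <= C.

(** The cap factor does not depend on [e], so the term in which it is differentiated, [mainT], keeps
    a fixed mass. The derivatives of the other three factors live on layers that shrink with [e]. *)
Definition eta_fun (e : R) (x : pt3) : R :=
  zc (lens T tau p x) * cut e (X1 x - T) * cut e (d x) * cut e (s x).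

Definition etaD (e : R) (j : idx) (x : pt3) : R :=
  (zd (lens T tau p x) * lensD p j x) * cut e (X1 x - T) * cut e (d x) * cut e (s x)
  + zc (lens T tau p x) * (cut' e (X1 x - T) * match j with I1 => 1 | _ => 0 end) * cut e (d x) * cut e (s x)
  + zc (lens T tau p x) * cut e (X1 x - T) * (cut' e (d x) * dD j x) * cut e (s x)
  + zc (lens T tau p x) * cut e (X1 x - T) * cut e (d x) * (cut' e (s x) * sD j x).

Definition mainT (e : R) (x : pt3) : R :=
  zd (lens T tau p x) * cut e (X1 x - T) * cut e (d x) * cut e (s x) * dotE E (lensD p) x.

(** Either the cutoff vanishes near [x], or all data are C^1 at [x]. The tests are ordered: [s] is
    known to be C^1 only where the first three pass. *)
Lemma lens_cases e x : 0 < e ->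
  locally x (fun y => (lens T tau p y < 0 \/ X1 y - T < e \/ d y < e \/ s y < e)) \/
  (V x /\ T < X1 x /\ 0 <= lens T tau p x /\ e <= d x /\ e <= s x /\ C1D s sD x).
Proof.
  intros He.
  destruct (Rlt_le_dec (X1 x - T) e) as [L1|L1].
  { left. eapply filter_imp; [|apply (cont_lt_near (fun y => X1 y - T) x e); [|exact L1]].
    - intros y Hy. simpl in Hy. auto.
    - apply continuous_Rminus; [apply continuous_X1|apply continuous_const]. }
  destruct (Rlt_le_dec (lens T tau p x) 0) as [L2|L2].
  { left. eapply filter_imp; [|apply (cont_lt_near (lens T tau p) x 0); [|exact L2]].
    - intros y Hy. auto.
    - apply (C1D_continuous _ _ _ (C1D_lens T tau p x)). }
  destruct (Rlt_le_dec (d x) e) as [L3|L3].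
  { left. eapply filter_imp; [|apply (cont_lt_near d x e); [|exact L3]].
    - intros y Hy. auto.
    - apply (C1D_continuous _ _ _ (d_C1 x)). }
  destruct (s_C1 x ltac:(lra) L2 ltac:(lra)) as [S1 S2].
  destruct (Rlt_le_dec (s x) e) as [L4|L4].
  { left. eapply filter_imp; [|apply (cont_lt_near s x e); [|exact L4]].
    - intros y Hy. auto.
    - apply (C1D_continuous _ _ _ S1). }
  right. split; [apply S2; lra|]. repeat split; try assumption; try lra; apply S1.
Qed.

Lemma eta_zero e x : 0 < e -> lens T tau p x < 0 \/ X1 x - T < e \/ d x < e \/ s x < e ->
  eta_fun e x = 0 /\ (forall j, etaD e j x = 0) /\ mainT e x = 0.
Proof.
  intros He H. unfold eta_fun, etaD, mainT.
  destruct H as [H|[H|[H|H]]].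
  - rewrite zc_left, zd_left by lra. repeat split; intros; ring.
  - destruct (cut_left e (X1 x - T) He ltac:(lra)) as [A B]. rewrite A, B. repeat split; intros; ring.
  - destruct (cut_left e (d x) He ltac:(lra)) as [A B]. rewrite A, B. repeat split; intros; ring.
  - destruct (cut_left e (s x) He ltac:(lra)) as [A B]. rewrite A, B. repeat split; intros; ring.
Qed.

Lemma C1D_cut e h D x : 0 < e -> C1D h D x -> C1D (fun y => cut e (h y)) (fun j y => cut' e (h y) * D j y) x.
Proof.
  intros He H. apply (C1D_comp (cut e) (cut' e)); [|apply continuous_cut', He|exact H].
  apply filter_forall. intros u. apply is_derive_cut, He.
Qed.

Lemma C1D_eta e x : 0 < e -> C1D s sD x -> C1D (eta_fun e) (etaD e) x.
Proof.
  intros He Hs. unfold eta_fun.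
  assert (HX : C1D (fun y => X1 y - T) (fun j y => match j with I1 => 1 | _ => 0 end) x).
  { apply (C1D_ext_loc (fun y => 1 * X1 y + 0 * X2 y + 0 * X3 y + - T)).
    - apply filter_forall. intros y. Req. ring.
    - apply (C1D_ext_D _ (fun i _ => match i with I1 => 1 | I2 => 0 | I3 => 0 end)); [|apply C1D_affine].
      apply filter_forall. intros y i. destruct i; reflexivity. }
  assert (HL : C1D (fun y => zc (lens T tau p y)) (fun j y => zd (lens T tau p y) * lensD p j y) x).
  { apply (C1D_comp zc zd); [|apply continuous_zd|apply C1D_lens]. apply filter_forall. intros; apply is_derive_zc. }
  pose proof (C1D_mult _ _ _ _ x (C1D_mult _ _ _ _ x (C1D_mult _ _ _ _ x HL (C1D_cut e _ _ x He HX)) (C1D_cut e _ _ x He (d_C1 x)))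
    (C1D_cut e _ _ x He Hs)) as K.
  eapply C1D_ext_D; [|exact K]. apply filter_forall. intros y j. unfold etaD. Req. ring.
Qed.

Lemma C1D_etaE e i x : 0 < e ->
  C1D (fun y => eta_fun e y * E i y) (fun j y => etaD e j y * E i y + eta_fun e y * ED i j y) x.
Proof.
  intros He. destruct (lens_cases e x He) as [H|[Hv [_ [_ [_ [_ Hs]]]]]].
  - apply C1D_zero_near. eapply filter_imp; [|exact H]. intros y Hy.
    destruct (eta_zero e y He Hy) as [A [B _]]. rewrite A. split; [ring|]. intros j. rewrite B. ring.
  - apply (C1D_mult (eta_fun e) (etaD e) (E i) (ED i)); [apply C1D_eta; assumption|apply E_C1, Hv].
Qed.

(** This is the integral of the divergence of [eta_fun e * E], in which [E] itself is
    divergence-free. *)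
Lemma energy_identity e : 0 < e ->
  int3 T (T + tau) (sqrt tau) (fun x => dotE E (etaD e) (unrot p th x)) = 0.
Proof.
  intros He.
  rewrite <- (divergence_zero T (T + tau) (sqrt tau) (sqrt_pos tau) p th (fun i y => eta_fun e y * E i y)
     (fun i j y => etaD e j y * E i y + eta_fun e y * ED i j y)).
  - apply int3_ext. intros y. set (x := unrot p th y). unfold dotE.
    destruct (lens_cases e x He) as [H|[Hv _]].
    + apply locally_singleton in H. destruct (eta_zero e x He H) as [A [B _]]. rewrite A, !B. ring.
    + pose proof (E_div x Hv) as K. replace (ED I3 I3 x) with (- ED I1 I1 x - ED I2 I2 x) by lra. ring.
  - intros i x. apply C1D_etaE, He.
  - intros i x Hx.
    assert (Hn : ~ (lens T tau p x <= 0 \/ X1 x - T <= e)).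
    { intros K. apply Hx. unfold eta_fun. destruct K as [K|K].
      - rewrite (zc_left (lens T tau p x) K). ring.
      - rewrite (proj1 (cut_left e (X1 x - T) He K)). ring. }
    assert (A : 0 < lens T tau p x) by (apply Rnot_le_lt; intros K; apply Hn; auto).
    assert (B : e < X1 x - T) by (apply Rnot_le_lt; intros K; apply Hn; auto).
    unfold lens in A. pose proof (pow2_ge_0 (X2 x - fst p)). pose proof (pow2_ge_0 (X3 x - snd p)).
    rewrite pow2_sqrt by lra. lra.
Qed.

Lemma continuous_dotE_eta e x : 0 < e -> continuous (fun y => dotE E (etaD e) y) x.
Proof.
  intros He. destruct (lens_cases e x He) as [H|[Hv [_ [_ [_ [_ Hs]]]]]].
  - apply (continuous_ext_loc _ (fun _ => 0)); [|apply continuous_const].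
    eapply filter_imp; [|exact H]. intros y Hy. destruct (eta_zero e y He Hy) as [_ [B _]].
    unfold dotE. rewrite !B. Req. ring.
  - assert (CE : forall i, continuous (E i) x) by (intros i; apply (C1D_continuous _ _ _ (E_C1 x Hv i))).
    assert (CD : forall i, continuous (etaD e i) x) by (apply (C1D_eta e x He Hs)).
    unfold dotE. apply continuous_Rplus; [apply continuous_Rplus|]; (apply continuous_Rmult; [apply CE|apply CD]).
Qed.

Lemma continuous_main e x : 0 < e -> continuous (mainT e) x.
Proof.
  intros He. destruct (lens_cases e x He) as [H|[Hv [_ [_ [_ [_ Hs]]]]]].
  - apply (continuous_ext_loc _ (fun _ => 0)); [|apply continuous_const].
    eapply filter_imp; [|exact H]. intros y Hy. destruct (eta_zero e y He Hy) as [_ [_ B]].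
    symmetry; exact B.
  - assert (CE : forall i, continuous (E i) x) by (intros i; apply (C1D_continuous _ _ _ (E_C1 x Hv i))).
    assert (CD : forall i, continuous (lensD p i) x) by (apply (C1D_lens T tau p x)).
    assert (Cc : forall h, continuous h x -> continuous (fun y => cut e (h y)) x).
    { intros h Hh. apply (continuous_comp h (cut e)); [exact Hh|].
      apply (ex_derive_continuous (cut e)). eexists; apply is_derive_cut, He. }
    unfold mainT, dotE.
    apply continuous_Rmult; [|apply continuous_Rplus; [apply continuous_Rplus|]; (apply continuous_Rmult; [apply CE|apply CD])].
    apply continuous_Rmult; [apply continuous_Rmult; [apply continuous_Rmult|]|].
    + apply (continuous_comp (lens T tau p) zd); [apply (C1D_continuous _ _ _ (C1D_lens T tau p x))|apply continuous_zd].
    + apply Cc, continuous_Rminus; [apply continuous_X1|apply continuous_const].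
    + apply Cc, (C1D_continuous _ _ _ (d_C1 x)).
    + apply Cc, (C1D_continuous _ _ _ Hs).
Qed.

Lemma main_nonneg e x : 0 < e -> 0 <= mainT e x.
Proof.
  intros He. destruct (lens_cases e x He) as [H|[Hv [HT [HL [_ [_ Hs]]]]]].
  - apply locally_singleton in H. destruct (eta_zero e x He H) as [_ [_ B]]. lra.
  - unfold mainT. pose proof (zd_nonneg (lens T tau p x)). pose proof (cut_bounds e (X1 x - T)).
    pose proof (cut_bounds e (d x)). pose proof (cut_bounds e (s x)). pose proof (E_top x Hv HT HL).
    repeat apply Rmult_le_pos; lra.
Qed.

(** Although [cut' e] is of order [1 / e], it is the derivative of a function with values in
    [[0, 1]], so its integral is bounded independently of [e]; [4 * tau] is the cross-sectional area
    of the box. *)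
Lemma strip_T e : 0 < e -> int3 T (T + tau) (sqrt tau) (fun x => cut' e (X1 x - T)) <= 4 * tau.
Proof.
  intros He. unfold int3, X1; simpl.
  set (L := sqrt tau). assert (EL : L * L = tau) by (apply sqrt_sqrt; lra).
  rewrite (RInt_ext _ (fun t => (2 * L) * (2 * L) * cut' e (t - T))).
  2:{ intros t _. rewrite !RInt_const. unfold scal; simpl; unfold mult; simpl. Req. ring. }
  rewrite (RInt_is_derive (fun t => (2 * L) * (2 * L) * cut e (t - T))).
  - replace (T - T) with 0 by ring. rewrite (proj1 (cut_left e 0 He ltac:(lra))).
    replace (T + tau - T) with tau by ring. pose proof (cut_bounds e tau). nra.
  - intros t. apply is_derive_Rscal. evar_last; [apply (is_derive_Rcomp (cut e) (fun t => t - T) t (cut' e (t - T)) 1)|].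
    + apply is_derive_cut, He.
    + auto_derive; [trivial|ring].
    + Req; ring.
  - intros t. apply continuous_Rmult; [apply continuous_const|].
    apply (continuous_comp (fun t => t - T) (cut' e)); [|apply continuous_cut', He].
    apply continuous_Rminus; [apply continuous_id|apply continuous_const].
Qed.

(** In the product rule the shock term is nonnegative and is dropped; the front and wall terms carry
    a cutoff derivative supported where the flux is at most [del]. *)
Lemma lower_bound del : 0 < del -> exists e0, 0 < e0 /\ forall e, 0 < e < e0 -> forall x,
  mainT e x <= dotE E (etaD e) x + del * (cut' e (X1 x - T) + cut' e (d x)).
Proof.
  intros Hdel. destruct E_s as [e3 [He3 HEs]]. destruct (E_small del Hdel) as [e4 [He4 HEm]].
  exists (Rmin (e3 / 2) (e4 / 2)). split; [apply Rmin_glb_lt; lra|]. intros e He x.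
  pose proof (Rmin_l (e3 / 2) (e4 / 2)). pose proof (Rmin_r (e3 / 2) (e4 / 2)).
  assert (He0 : 0 < e) by lra.
  pose proof (cut'_nonneg e (X1 x - T) He0) as PT. pose proof (cut'_nonneg e (d x) He0) as Pd.
  pose proof (cut'_nonneg e (s x) He0) as Ps.
  destruct (lens_cases e x He0) as [Hz|[Hv [HT [HL [Hd [Hs _]]]]]].
  - apply locally_singleton in Hz. destruct (eta_zero e x He0 Hz) as [_ [B C']].
    rewrite C'. unfold dotE. rewrite !B. nra.
  - destruct (HEm x Hv HT HL) as [M1 M2].
    pose proof (cut_bounds e (X1 x - T)) as B1. pose proof (cut_bounds e (d x)) as B2.
    pose proof (cut_bounds e (s x)) as B3. pose proof (zc_bounds (lens T tau p x)) as B0.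
    set (w0 := zc (lens T tau p x)) in *. set (w1 := cut e (X1 x - T)) in *.
    set (w2 := cut e (d x)) in *. set (w3 := cut e (s x)) in *.
    set (v1 := cut' e (X1 x - T)) in *. set (v2 := cut' e (d x)) in *. set (v3 := cut' e (s x)) in *.
    assert (Id : dotE E (etaD e) x = mainT e x + (w0 * w2 * w3) * (v1 * E I1 x) + (w0 * w1 * w3) * (v2 * dotE E dD x)
       + (w0 * w1 * w2) * (v3 * dotE E sD x)).
    { unfold dotE, etaD, mainT, dotE. fold w0 w1 w2 w3 v1 v2 v3. ring. }
    rewrite Id.
    assert (K1 : - (del * v1) <= v1 * E I1 x).
    { destruct (Rlt_le_dec (X1 x - T) (2 * e)) as [L|L].
      - specialize (M1 ltac:(lra)). apply Rabs_le_between in M1. nra.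
      - unfold v1. rewrite (proj2 (cut_right e _ He0 L)). lra. }
    assert (K2 : - (del * v2) <= v2 * dotE E dD x).
    { destruct (Rlt_le_dec (d x) (2 * e)) as [L|L].
      - specialize (M2 ltac:(lra)). apply Rabs_le_between in M2. nra.
      - unfold v2. rewrite (proj2 (cut_right e _ He0 L)). lra. }
    assert (K3 : 0 <= v3 * dotE E sD x).
    { destruct (Rlt_le_dec (s x) (2 * e)) as [L|L].
      - apply Rmult_le_pos; [exact Ps|]. apply HEs; auto. lra.
      - unfold v3. rewrite (proj2 (cut_right e _ He0 L)). lra. }
    assert (P3 : forall a b c, 0 <= a <= 1 -> 0 <= b <= 1 -> 0 <= c <= 1 -> 0 <= a * b * c <= 1).
    { intros a b c Ha Hb Hc. assert (0 <= a * b <= 1) by nra. nra. }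
    pose proof (P3 w0 w2 w3 B0 B2 B3) as Q1. pose proof (P3 w0 w1 w3 B0 B1 B3) as Q2. pose proof (P3 w0 w1 w2 B0 B1 B2) as Q3.
    set (k1 := w0 * w2 * w3) in *. set (k2 := w0 * w1 * w3) in *. set (k3 := w0 * w1 * w2) in *.
    assert (R1 : - (del * v1) <= k1 * (v1 * E I1 x)).
    { assert (0 <= del * v1) by nra. destruct (Rle_lt_dec 0 (v1 * E I1 x)); nra. }
    assert (R2 : - (del * v2) <= k2 * (v2 * dotE E dD x)).
    { assert (0 <= del * v2) by nra. destruct (Rle_lt_dec 0 (v2 * dotE E dD x)); nra. }
    assert (R3 : 0 <= k3 * (v3 * dotE E sD x)) by (apply Rmult_le_pos; lra).
    lra.
Qed.

Lemma unrot_inv (x : pt3) : exists y, unrot p th y = x.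
Proof.
  exists (X1 x, cos th * (X2 x - fst p) + sin th * (X3 x - snd p), - sin th * (X2 x - fst p) + cos th * (X3 x - snd p)).
  pose proof (sin2_cos2 th) as K. unfold Rsqr in K. destruct x as [[a b] c]. unfold unrot, X1, X2, X3; simpl.
  f_equal; [f_equal|].
  - replace (fst p + (cos th * (cos th * (b - fst p) + sin th * (c - snd p)) - sin th * (- sin th * (b - fst p) + cos th * (c - snd p))))
      with (fst p + (sin th * sin th + cos th * cos th) * (b - fst p)) by ring. rewrite K. ring.
  - replace (snd p + (sin th * (cos th * (b - fst p) + sin th * (c - snd p)) + cos th * (- sin th * (b - fst p) + cos th * (c - snd p))))
      with (snd p + (sin th * sin th + cos th * cos th) * (c - snd p)) by ring. rewrite K. ring.
Qed.

(** A positive value at [x] would persist on a small box and bound the integral of [mainT e] from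
    below independently of [e], against the upper bound [del * (4 * tau + C)] with [del]
    arbitrary. *)
Lemma lens_energy_zero x : V x -> T < X1 x -> 0 < lens T tau p x -> 0 < d x -> 0 < s x -> dotE E (lensD p) x = 0.
Proof.
  intros Hv HT HL Hd Hs.
  destruct (Rle_lt_or_eq_dec _ _ (E_top x Hv HT ltac:(lra))) as [Hpos|Hz]; [exfalso|auto].
  destruct (s_C1 x HT ltac:(lra) Hd) as [Cs _].
  assert (Ltau : lens T tau p x < tau).
  { unfold lens. pose proof (pow2_ge_0 (X2 x - fst p)). pose proof (pow2_ge_0 (X3 x - snd p)). lra. }
  pose (m := fun y => zd (lens T tau p y) * (zc 1 * zc 1 * zc 1) * dotE E (lensD p) y).
  assert (CE : forall i, continuous (E i) x) by (intros i; apply (C1D_continuous _ _ _ (E_C1 x Hv i))).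
  assert (Cm : continuous m x).
  { assert (CD : forall i, continuous (lensD p i) x) by (apply (C1D_lens T tau p x)).
    unfold m, dotE.
    apply continuous_Rmult; [|apply continuous_Rplus; [apply continuous_Rplus|]; (apply continuous_Rmult; [apply CE|apply CD])].
    apply continuous_Rmult; [|apply continuous_const].
    apply (continuous_comp (lens T tau p) zd); [apply (C1D_continuous _ _ _ (C1D_lens T tau p x))|apply continuous_zd]. }
  pose proof zc_1_pos as Z1. pose proof (zd_pos (lens T tau p x) ltac:(lra)) as Z2.
  assert (Hm : 0 < m x) by (unfold m; repeat apply Rmult_lt_0_compat; assumption).
  pose (k := m x / 2). pose (a := Rmin (X1 x - T) (Rmin (d x) (s x)) / 2).
  assert (Ha : 0 < a /\ a < X1 x - T /\ a < d x /\ a < s x).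
  { unfold a. pose proof (Rmin_l (X1 x - T) (Rmin (d x) (s x))). pose proof (Rmin_r (X1 x - T) (Rmin (d x) (s x))).
    pose proof (Rmin_l (d x) (s x)). pose proof (Rmin_r (d x) (s x)).
    assert (0 < Rmin (X1 x - T) (Rmin (d x) (s x))) by (repeat apply Rmin_glb_lt; lra). lra. }
  assert (Near : locally x (fun y => k < m y /\ a < X1 y - T /\ a < d y /\ a < s y /\ 0 < lens T tau p y)).
  { assert (G : forall (h : pt3 -> R) c, continuous h x -> c < h x -> locally x (fun y => c < h y)).
    { intros h c Hc Hh. apply (Hc (fun u => c < u)), (open_gt c (h x)), Hh. }
    repeat apply filter_and; apply G.
    - exact Cm.
    - unfold k; lra.
    - apply continuous_Rminus; [apply continuous_X1|apply continuous_const].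
    - lra.
    - apply (C1D_continuous _ _ _ (d_C1 x)).
    - lra.
    - apply (C1D_continuous _ _ _ Cs).
    - lra.
    - apply (C1D_continuous _ _ _ (C1D_lens T tau p x)).
    - lra. }
  destruct (unrot_inv x) as [y Ey].
  pose proof (continuous_unrot p th y) as Cu. rewrite <- Ey in Near. apply Cu in Near. unfold filtermap in Near.
  apply locally3_box in Near. destruct Near as [r [Hr Near]].
  assert (Hy0 : unrot p th y = unrot p th (X1 y, X2 y, X3 y)) by (destruct y as [[? ?] ?]; reflexivity).
  assert (L0 : 0 <= sqrt tau) by apply sqrt_pos. assert (EL : sqrt tau * sqrt tau = tau) by (apply sqrt_sqrt; lra).
  set (h := r / 2).
  assert (Box : forall u1 u2 u3, X1 y - h <= u1 <= X1 y + h -> X2 y - h <= u2 <= X2 y + h -> X3 y - h <= u3 <= X3 y + h ->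
     let z := unrot p th (u1, u2, u3) in k < m z /\ a < X1 z - T /\ a < d z /\ a < s z /\ 0 < lens T tau p z).
  { intros u1 u2 u3 A1 A2 A3. apply Near; apply Rabs_lt_between; unfold h in *; lra. }
  assert (InBox : forall u1 u2 u3, X1 y - h <= u1 <= X1 y + h -> X2 y - h <= u2 <= X2 y + h -> X3 y - h <= u3 <= X3 y + h ->
     T <= u1 <= T + tau /\ - sqrt tau <= u2 <= sqrt tau /\ - sqrt tau <= u3 <= sqrt tau).
  { intros u1 u2 u3 A1 A2 A3. destruct (Box u1 u2 u3 A1 A2 A3) as [_ [B1 [_ [_ B2]]]].
    unfold lens in B2. rewrite unrot_norm in B2. unfold unrot, X1, X2, X3 in B1, B2; simpl in B1, B2.
    pose proof (pow2_ge_0 u2). pose proof (pow2_ge_0 u3). simpl in *. split; [lra|]. split; nra. }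
  assert (h0 : 0 < h) by (unfold h; lra).
  pose proof (InBox (X1 y - h) (X2 y - h) (X3 y - h) ltac:(lra) ltac:(lra) ltac:(lra)) as IB1.
  pose proof (InBox (X1 y + h) (X2 y + h) (X3 y + h) ltac:(lra) ltac:(lra) ltac:(lra)) as IB2.
  pose (vol := k * (2 * h) * (2 * h) * (2 * h)).
  assert (Hk : 0 < k) by (unfold k; lra).
  assert (Hvol : 0 < vol) by (unfold vol; repeat apply Rmult_lt_0_compat; lra).
  destruct strip as [e1 [He1 Hstrip]].
  assert (C0 : 0 <= C).
  { eapply Rle_trans; [|apply (Hstrip (e1 / 2)); lra].
    (* A degenerate sub-box yields nonnegativity of the integral. *)
    replace 0 with (0 * (sqrt tau - sqrt tau) * (sqrt tau - sqrt tau) * (T + tau - (T + tau))) by ring.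
    apply int3_ge_sub; try lra.
    - apply (cont3_unrot p th (fun x => cut' (e1 / 2) (d x))). intros z.
      apply (continuous_comp d (cut' (e1 / 2))); [apply (C1D_continuous _ _ _ (d_C1 z))|apply continuous_cut'; lra].
    - intros z. apply cut'_nonneg; lra.
    - intros. apply cut'_nonneg; lra. }
  destruct (exists_small (vol / 2) (4 * tau + C) ltac:(lra) ltac:(lra)) as [del [Hdel Edel]].
  destruct (lower_bound del Hdel) as [e0 [He0 LB]].
  pose (e := Rmin (a / 2) (Rmin e1 e0) / 2).
  assert (He : 0 < e /\ 2 * e <= a /\ e < e1 /\ e < e0).
  { unfold e. pose proof (Rmin_l (a / 2) (Rmin e1 e0)). pose proof (Rmin_r (a / 2) (Rmin e1 e0)).
    pose proof (Rmin_l e1 e0). pose proof (Rmin_r e1 e0).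
    assert (0 < Rmin (a / 2) (Rmin e1 e0)) by (repeat apply Rmin_glb_lt; lra). lra. }
  assert (Cont : forall H : pt3 -> R, (forall z, continuous H z) -> cont3 (fun z => H (unrot p th z))).
  { intros H HH. apply cont3_unrot. exact HH. }
  assert (V1 : vol <= int3 T (T + tau) (sqrt tau) (fun z => mainT e (unrot p th z))).
  { unfold vol. replace (k * (2 * h) * (2 * h) * (2 * h)) with
      (k * ((X3 y + h) - (X3 y - h)) * ((X2 y + h) - (X2 y - h)) * ((X1 y + h) - (X1 y - h))) by ring.
    apply int3_ge_sub; try lra.
    - apply Cont. intros z. apply continuous_main; lra.
    - intros z. apply main_nonneg; lra.
    - intros u1 u2 u3 A1 A2 A3. destruct (Box u1 u2 u3 A1 A2 A3) as [B0 [B1 [B2 [B3 B4]]]].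
      set (z := unrot p th (u1, u2, u3)) in *. unfold m in B0. unfold mainT.
      rewrite (proj1 (cut_right e (X1 z - T) ltac:(lra) ltac:(lra))).
      rewrite (proj1 (cut_right e (d z) ltac:(lra) ltac:(lra))).
      rewrite (proj1 (cut_right e (s z) ltac:(lra) ltac:(lra))). lra. }
  assert (CT : cont3 (fun z => cut' e (X1 z - T))).
  { intros z. apply (continuous_comp (fun z => X1 z - T) (cut' e)); [|apply continuous_cut'; lra].
    apply continuous_Rminus; [apply continuous_X1|apply continuous_const]. }
  assert (Cd : cont3 (fun z => cut' e (d (unrot p th z)))).
  { apply (Cont (fun z => cut' e (d z))). intros z.
    apply (continuous_comp d (cut' e)); [apply (C1D_continuous _ _ _ (d_C1 z))|apply continuous_cut'; lra]. }
  assert (CE2 : cont3 (fun z => dotE E (etaD e) (unrot p th z))).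
  { apply (Cont (fun z => dotE E (etaD e) z)). intros z. apply continuous_dotE_eta; lra. }
  assert (V2 : int3 T (T + tau) (sqrt tau) (fun z => mainT e (unrot p th z)) <= 
      int3 T (T + tau) (sqrt tau) (fun z => dotE E (etaD e) (unrot p th z) + del * (cut' e (X1 z - T) + cut' e (d (unrot p th z))))).
  { apply int3_le; try lra.
    - apply Cont. intros z. apply continuous_main; lra.
    - intros z. apply continuous_Rplus; [apply CE2|]. apply continuous_Rmult; [apply continuous_const|].
      apply continuous_Rplus; [apply CT|apply Cd].
    - intros z. apply (LB e ltac:(lra) (unrot p th z)). }
  rewrite int3_plus in V2; try lra; [|exact CE2|].
  2:{ intros z. apply continuous_Rmult; [apply continuous_const|]. apply continuous_Rplus; [apply CT|apply Cd]. }
  rewrite energy_identity in V2 by lra.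
  rewrite int3_scal in V2; try lra.
  2:{ intros z. apply continuous_Rplus; [apply CT|apply Cd]. }
  rewrite int3_plus in V2; try lra; [|exact CT|exact Cd].
  pose proof (strip_T e ltac:(lra)) as S1. pose proof (Hstrip e ltac:(lra)) as S2.
  assert (del * (int3 T (T + tau) (sqrt tau) (fun z => cut' e (X1 z - T)) + int3 T (T + tau) (sqrt tau) (fun z => cut' e (d (unrot p th z))))
    <= del * (4 * tau + C)) by (apply Rmult_le_compat_l; lra).
  lra.
Qed.

End Lens.

(** * Second-order tests and the Hopf barrier *)

Lemma second_derivative_test (F F' : R -> R) (c : R) :
  locally 0 (fun t => is_derive F t (F' t)) -> is_derive F' 0 c ->
  locally 0 (fun t => F t <= F 0) -> F' 0 = 0 /\ c <= 0.
Proof.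
  intros H1 H2 H3.
  pose proof (filter_and _ _ H1 H3) as HL. apply locally_R in HL. destruct HL as [r [Hr HL]].
  assert (Z : F' 0 = 0).
  { pose proof (proj1 (HL 0 ltac:(rewrite Rminus_diag, Rabs_R0; exact Hr))) as D0.
    pose proof (proj1 (is_derive_eps _ _ _) D0) as E.
    apply NNPP. intros N. assert (P : 0 < Rabs (F' 0)) by (apply Rabs_pos_lt, N).
    destruct (E (Rabs (F' 0) / 2) ltac:(lra)) as [d [Hd K]].
    pose (t := Rmin r d / 2).
    assert (Ht : 0 < t /\ t < r /\ t < d).
    { unfold t. pose proof (Rmin_l r d). pose proof (Rmin_r r d).
      assert (0 < Rmin r d) by (apply Rmin_glb_lt; lra). lra. }
    destruct (Rlt_or_le 0 (F' 0)) as [S|S].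
    - assert (A : Rabs (t - 0) = t) by (rewrite Rminus_0_r, Rabs_right; lra).
      pose proof (K t ltac:(lra)) as Q. pose proof (proj2 (HL t ltac:(lra))) as Q2.
      rewrite A in Q. rewrite (Rabs_right (F' 0)) in Q by lra. apply Rabs_le_between in Q. nra.
    - assert (A : Rabs (- t - 0) = t) by (rewrite Rminus_0_r, Rabs_Ropp, Rabs_right; lra).
      pose proof (K (- t) ltac:(lra)) as Q. pose proof (proj2 (HL (- t) ltac:(lra))) as Q2.
      rewrite A in Q. rewrite (Rabs_left1 (F' 0)) in Q by lra. apply Rabs_le_between in Q.
      assert (F' 0 < 0) by lra. nra. }
  split; [exact Z|]. apply Rnot_lt_le. intros Hc.
  destruct (proj1 (is_derive_eps _ _ _) H2 (c / 2) ltac:(lra)) as [d [Hd K]].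
  pose (t := Rmin r d / 2).
  assert (Ht : 0 < t /\ t < r /\ t < d).
  { unfold t. pose proof (Rmin_l r d). pose proof (Rmin_r r d).
    assert (0 < Rmin r d) by (apply Rmin_glb_lt; lra). lra. }
  assert (AB : forall u, 0 <= u <= t -> Rabs (u - 0) = u) by (intros; rewrite Rminus_0_r, Rabs_right; lra).
  destruct (MVT_cor2 F F' 0 t) as [u [E Hu]]; [lra| |].
  { intros u Hu. apply is_derive_Reals. apply HL. rewrite AB; lra. }
  pose proof (K u ltac:(rewrite AB; lra)) as Q. rewrite AB in Q by lra. rewrite Z in Q.
  apply Rabs_le_between in Q.
  pose proof (proj2 (HL t ltac:(rewrite AB; lra))).
  assert (0 < F' u) by nra. nra.
Qed.

Definition shift (x d : pt3) (t : R) : pt3 := (X1 x + t * X1 d, X2 x + t * X2 d, X3 x + t * X3 d).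

Lemma shift_0 x d : shift x d 0 = x.
Proof. destruct x as [[a b] c]; unfold shift, X1, X2, X3; simpl. f_equal; [f_equal|]; ring. Qed.

Lemma continuous_shift x d t : continuous (shift x d) t.
Proof.
  unfold shift. repeat apply continuous_pair; (apply continuous_Rplus; [apply continuous_const|]);
  (apply continuous_Rmult; [apply continuous_id|apply continuous_const]).
Qed.

Lemma is_derive_shift h D x d t : C1D h D (shift x d t) ->
  is_derive (fun s => h (shift x d s)) t
    (D I1 (shift x d t) * X1 d + D I2 (shift x d t) * X2 d + D I3 (shift x d t) * X3 d).
Proof.
  intros H.
  apply (is_derive_curve h D (fun s => X1 x + s * X1 d) (fun s => X2 x + s * X2 d) (fun s => X3 x + s * X3 d));
    [auto_derive; [trivial|ring]..|exact H].
Qed.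

Definition bilin (B : idx -> idx -> R) (d : pt3) : R :=
  X1 d * (B I1 I1 * X1 d + B I1 I2 * X2 d + B I1 I3 * X3 d) +
  X2 d * (B I2 I1 * X1 d + B I2 I2 * X2 d + B I2 I3 * X3 d) +
  X3 d * (B I3 I1 * X1 d + B I3 I2 * X2 d + B I3 I3 * X3 d).

Definition trace3 (B : idx -> idx -> R) : R := B I1 I1 + B I2 I2 + B I3 I3.

Definition normsq (v : pt3) : R := X1 v ^ 2 + X2 v ^ 2 + X3 v ^ 2.

(* The coefficient matrix [q Id - p p^T] of the potential equation is nonnegative
   when [|p|^2 <= q]. *)
Lemma elliptic_trace (B : idx -> idx -> R) (p : pt3) (q : R) :
  (forall d, bilin B d <= 0) -> normsq p <= q -> q * trace3 B - bilin B p <= 0.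
Proof.
  intros H Hp. destruct p as [[a b] c]. unfold normsq, X1, X2, X3 in Hp; simpl in Hp.
  pose proof (H (1, 0, 0)) as H1. pose proof (H (0, 1, 0)) as H2. pose proof (H (0, 0, 1)) as H3.
  (* Three vectors orthogonal to [p]: the values of [B] on them add up to [|p| ^ 2] times the trace
     minus the value at [p]. The axis vectors control the remaining multiple of the trace. *)
  pose proof (H (b, - a, 0)) as H12. pose proof (H (c, 0, - a)) as H13. pose proof (H (0, c, - b)) as H23.
  unfold bilin, trace3, X1, X2, X3 in *; simpl in *.
  assert (T : B I1 I1 + B I2 I2 + B I3 I3 <= 0) by lra.
  assert (0 <= (q - (a ^ 2 + b ^ 2 + c ^ 2)) * - (B I1 I1 + B I2 I2 + B I3 I3))
    by (apply Rmult_le_pos; simpl; lra).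
  simpl in *. lra.
Qed.

(** The comparison function [g] enters only through its derivatives along lines, so an explicit
    barrier needs no family of partial derivatives of its own. *)
Lemma local_max_test (w : pt3 -> R) (D : idx -> pt3 -> R) (B : idx -> idx -> pt3 -> R)
  (g : pt3 -> R) (g' g'' : pt3 -> R -> R) (x : pt3) :
  locally x (fun y => C1D w D y) -> (forall i, C1D (D i) (B i) x) ->
  (forall d t, is_derive (fun t => g (shift x d t)) t (g' d t)) ->
  (forall d, is_derive (g' d) 0 (g'' d 0)) ->
  locally x (fun y => w y + g y <= w x + g x) ->
  forall d, D I1 x * X1 d + D I2 x * X2 d + D I3 x * X3 d + g' d 0 = 0 /\
            bilin (fun i j => B i j x) d + g'' d 0 <= 0.
Proof.
  intros H1 H2 G1 G2 HM d.
  assert (pull : forall P, locally x P -> locally 0 (fun t => P (shift x d t))).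
  { intros P HP. apply (continuous_shift x d 0). rewrite shift_0. exact HP. }
  pose (F' := fun t => D I1 (shift x d t) * X1 d + D I2 (shift x d t) * X2 d + D I3 (shift x d t) * X3 d + g' d t).
  destruct (second_derivative_test (fun t => w (shift x d t) + g (shift x d t)) F'
              (bilin (fun i j => B i j x) d + g'' d 0)) as [Z C].
  - eapply filter_imp; [|apply (pull _ H1)]. intros t Ht. simpl in Ht.
    apply is_derive_Rplus; [apply is_derive_shift, Ht|apply G1].
  - unfold F'. apply is_derive_Rplus; [|apply G2].
    assert (K : forall i, is_derive (fun t => D i (shift x d t)) 0
               (B i I1 x * X1 d + B i I2 x * X2 d + B i I3 x * X3 d)).
    { intros i. pose proof (is_derive_shift (D i) (B i) x d 0) as K0. rewrite shift_0 in K0. apply K0, H2. }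
    evar_last.
    + apply is_derive_Rplus; [apply is_derive_Rplus|]; (apply is_derive_Rmult; [apply K|apply is_derive_Rconst]).
    + Req. cbv beta. rewrite !shift_0. unfold bilin. ring.
  - eapply filter_imp; [|apply (pull _ HM)]. intros t Ht. rewrite shift_0. exact Ht.
  - unfold F' in Z. rewrite shift_0 in Z. auto.
Qed.

Lemma exp_le_1 x : x <= 0 -> exp x <= 1.
Proof.
  intros [H|H]; [|rewrite H, exp_0; lra]. rewrite <- exp_0. apply Rlt_le, exp_increasing, H.
Qed.

Definition sq3 (x y : pt3) : R := (X1 x - X1 y) ^ 2 + (X2 x - X2 y) ^ 2 + (X3 x - X3 y) ^ 2.

Lemma sq3_nonneg x y : 0 <= sq3 x y.
Proof.
  unfold sq3. pose proof (pow2_ge_0 (X1 x - X1 y)). pose proof (pow2_ge_0 (X2 x - X2 y)).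
  pose proof (pow2_ge_0 (X3 x - X3 y)). lra.
Qed.

Lemma continuous_sq3 y x : continuous (fun x => sq3 x y) x.
Proof.
  apply (continuous_ext (fun x => (X1 x - X1 y) * (X1 x - X1 y) + (X2 x - X2 y) * (X2 x - X2 y) + (X3 x - X3 y) * (X3 x - X3 y))).
  { intros z. unfold sq3. Req. ring. }
  continuous_arith.
Qed.

Lemma dist3_sq3 x y r : 0 < r -> (dist3 x y < r <-> sq3 x y < r ^ 2).
Proof.
  intros Hr. unfold dist3. fold (sq3 x y). split; intros H.
  - rewrite <- (sqrt_sqrt (sq3 x y)) by apply sq3_nonneg.
    pose proof (sqrt_pos (sq3 x y)). nra.
  - rewrite <- (sqrt_pow2 r) by lra. apply sqrt_lt_1_alt. split; [apply sq3_nonneg|exact H].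
Qed.

Lemma open3_sq3 y c : open3 (fun x => sq3 x y < c).
Proof. intros x Hx. apply (continuous_sq3 y x (fun u => u < c)). apply (open_lt c (sq3 x y)), Hx. Qed.

Lemma adh3_le (h : pt3 -> R) (c : R) : (forall x, continuous h x) -> forall x, adh3 (fun x => h x <= c) x -> h x <= c.
Proof.
  intros Hc x Hx. apply Rnot_lt_le. intros L.
  assert (K : locally x (fun y => c < h y)).
  { apply (Hc x (fun u => c < u)). apply (open_gt c (h x)), L. }
  apply locally3 in K. destruct K as [r [Hr K]]. destruct (Hx r Hr) as [z [A B]]. specialize (K z B). lra.
Qed.

Lemma sq3_bounded y r x : 0 <= r -> sq3 x y <= r ^ 2 ->
  let B := Rabs (X1 y) + Rabs (X2 y) + Rabs (X3 y) + r in
  Rabs (X1 x) <= B /\ Rabs (X2 x) <= B /\ Rabs (X3 x) <= B.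
Proof.
  intros Hr H B. unfold sq3 in H.
  assert (forall a b, (a - b) ^ 2 <= r ^ 2 -> Rabs a <= Rabs b + r).
  { intros a b Hab. replace a with ((a - b) + b) at 1 by ring.
    eapply Rle_trans; [apply Rabs_triang|].
    assert (Rabs (a - b) <= r); [|lra]. apply Rabs_le_between. nra. }
  pose proof (Rabs_pos (X1 y)). pose proof (Rabs_pos (X2 y)). pose proof (Rabs_pos (X3 y)).
  pose proof (pow2_ge_0 (X1 x - X1 y)). pose proof (pow2_ge_0 (X2 x - X2 y)). pose proof (pow2_ge_0 (X3 x - X3 y)).
  pose proof (H0 (X1 x) (X1 y) ltac:(lra)). pose proof (H0 (X2 x) (X2 y) ltac:(lra)).
  pose proof (H0 (X3 x) (X3 y) ltac:(lra)). unfold B. lra.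
Qed.

(** * The Hopf barrier in a ball *)

Section Hopf.
Variables (w : pt3 -> R) (D : idx -> pt3 -> R) (B : idx -> idx -> pt3 -> R).
Variables (P : pt3 -> pt3) (q : pt3 -> R).
Variables (y : pt3) (R1 R0 M m Q del : R).
Hypothesis R1pos : 0 < R1.
Hypothesis R0pos : R1 < R0.
Hypothesis mpos : 0 < m.
Hypothesis Qpos : 0 < Q.
Hypothesis delpos : 0 < del.
Hypothesis C1w : forall x, sq3 x y < R0 ^ 2 -> C1D w D x.
Hypothesis C2w : forall x i, sq3 x y < R0 ^ 2 -> C1D (D i) (B i) x.
Hypothesis ell : forall x, sq3 x y < R0 ^ 2 -> normsq (P x) + m <= q x /\ q x <= Q.
Hypothesis subsol : forall x, sq3 x y < R0 ^ 2 ->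
  0 <= q x * trace3 (fun i j => B i j x) - bilin (fun i j => B i j x) (P x).
Hypothesis wM : forall x, sq3 x y < R0 ^ 2 -> w x <= M.
Hypothesis wdel : forall x, sq3 x y <= R1 ^ 2 -> w x <= M - del.

(** Chosen so that [2 * al * m * R1 ^ 2 = 3 * Q + 1 / 2]: outside the ball of radius [R1], the
    second-order term of the barrier [exp (- al * sq3)] beats its trace term, which is at most
    [3 * Q]. *)
Definition hopf_rate : R := (6 * Q + 1) / (4 * m * R1 ^ 2).

(** The comparison takes place on a closed ball with [r < R0], as the hypotheses hold in the open
    ball. At a maximum of [w + g]: in the inner ball the drop [del] pays for the barrier, on the
    sphere the barrier vanishes, and the annulus between is excluded because [w + g] is a strict
    subsolution there. *)
Lemma hopf_inner (r : R) : 0 < r < R0 -> forall x, sq3 x y <= r ^ 2 ->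
  w x <= M - del * (exp (- hopf_rate * sq3 x y) - exp (- hopf_rate * r ^ 2)).
Proof.
  intros Hr. set (al := hopf_rate).
  assert (mR : 0 < 4 * m * R1 ^ 2) by (apply Rmult_lt_0_compat; [lra|nra]).
  assert (Hal : 0 < al) by (unfold al, hopf_rate; apply Rdiv_lt_0_compat; lra).
  assert (Eal : al * (4 * m * R1 ^ 2) = 6 * Q + 1) by (unfold al, hopf_rate; field; lra).
  pose (g := fun x => del * (exp (- al * sq3 x y) - exp (- al * r ^ 2))).
  assert (Hlt : forall x, sq3 x y <= r ^ 2 -> sq3 x y < R0 ^ 2) by (intros; nra).
  destruct (evt3 (fun x => sq3 x y <= r ^ 2) (fun x => w x + g x)
              (Rabs (X1 y) + Rabs (X2 y) + Rabs (X3 y) + r)) as [x [Hx Mx]].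
  - exists y. unfold sq3. rewrite !Rminus_diag. nra.
  - intros x Hx. apply sq3_bounded; [lra|exact Hx].
  - intros x. apply adh3_le. intros; apply continuous_sq3.
  - intros x Hx. apply continuous_Rplus; [eapply C1D_continuous, C1w, Hlt, Hx|].
    unfold g. apply continuous_Rmult; [apply continuous_const|].
    apply continuous_Rminus; [|apply continuous_const].
    apply (continuous_comp (fun x => - al * sq3 x y) exp).
    + apply continuous_Rmult; [apply continuous_const|apply continuous_sq3].
    + apply (ex_derive_continuous exp). eexists. apply is_derive_exp.
  - assert (KEY : w x + g x <= M).
    2:{ intros z Hz. specialize (Mx z Hz). unfold g in *. lra. }
    destruct (Rle_lt_dec (sq3 x y) (R1 ^ 2)) as [L|L].
    { specialize (wdel x L). unfold g.
      assert (exp (- al * sq3 x y) <= 1).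
      { apply exp_le_1. pose proof (sq3_nonneg x y). nra. }
      pose proof (exp_pos (- al * r ^ 2)). nra. }
    destruct (Rle_lt_or_eq_dec _ _ Hx) as [L2|L2].
    2:{ unfold g. rewrite L2. specialize (wM x (Hlt x Hx)). lra. }
    exfalso.
    set (e := exp (- al * sq3 x y)). assert (He : 0 < e) by apply exp_pos.
    set (z1 := X1 x - X1 y). set (z2 := X2 x - X2 y). set (z3 := X3 x - X3 y).
    pose (zd := fun d => z1 * X1 d + z2 * X2 d + z3 * X3 d).
    pose (S := fun d t => (z1 + t * X1 d) ^ 2 + (z2 + t * X2 d) ^ 2 + (z3 + t * X3 d) ^ 2).
    assert (ES : forall d t, sq3 (shift x d t) y = S d t).
    { intros d t. unfold sq3, S, shift, z1, z2, z3, X1, X2, X3; simpl. ring. }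
    assert (ES0 : forall d, S d 0 = sq3 x y) by (intros d; rewrite <- ES, shift_0; reflexivity).
    assert (DS : forall d t, is_derive (S d) t (2 * (zd d + t * normsq d))).
    { intros d t. unfold S. auto_derive; [trivial|]. unfold zd, normsq. ring. }
    assert (DE : forall d t, is_derive (fun t => exp (- al * S d t)) t (exp (- al * S d t) * (- al * (2 * (zd d + t * normsq d))))).
    { intros d t. apply (is_derive_Rcomp exp (fun t => - al * S d t)); [apply is_derive_exp|].
      apply is_derive_Rscal, DS. }
    destruct (ell x (Hlt x Hx)) as [El1 El2].
    (* [Bg] is the Hessian of the barrier at [x]. *)
    pose (Bg := fun i j => del * e * (4 * al ^ 2 * (match i with I1 => z1 | I2 => z2 | I3 => z3 end *
                  match j with I1 => z1 | I2 => z2 | I3 => z3 end)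
                  - 2 * al * (match i, j with I1, I1 | I2, I2 | I3, I3 => 1 | _, _ => 0 end))).
    assert (T : forall d, bilin (fun i j => B i j x + Bg i j) d <= 0).
    { intros d.
      destruct (local_max_test w D B g
                 (fun d t => del * (exp (- al * S d t) * (- al * (2 * (zd d + t * normsq d)))))
                 (fun d t => del * (exp (- al * S d t) * ((- al * (2 * (zd d + t * normsq d))) ^ 2 - 2 * al * normsq d))) x)
        with (d := d) as [_ C].
      - eapply filter_imp; [|apply (open3_sq3 y (R0 ^ 2) x (Hlt x Hx))]. intros z Hz. apply C1w, Hz.
      - intros i. apply C2w, Hlt, Hx.
      - intros d' t. apply (is_derive_ext (fun t => del * (exp (- al * S d' t) - exp (- al * r ^ 2)))).
        { intros u. unfold g. rewrite ES. reflexivity. }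
        apply is_derive_Rscal. evar_last; [apply is_derive_Rminus; [apply DE|apply is_derive_Rconst]|].
        Req. ring.
      - intros d'. apply is_derive_Rscal. evar_last; [apply is_derive_Rmult; [apply DE|]|].
        + apply (is_derive_Rscal (- al) (fun t => 2 * (zd d' + t * normsq d')) 0 (2 * normsq d')).
          auto_derive; [trivial|ring].
        + Req. cbv beta. ring.
      - eapply filter_imp; [|apply (open3_sq3 y (r ^ 2) x L2)]. intros z Hz. apply Mx. lra.
      - rewrite ES0 in C. fold e in C.
        eapply Rle_trans; [|exact C]. apply Req_le. unfold bilin, Bg, zd, normsq. ring. }
    pose proof (elliptic_trace _ (P x) (q x) T ltac:(lra)) as C.
    pose proof (subsol x (Hlt x Hx)) as Sx.
    destruct (P x) as [[p1 p2] p3]. set (qq := q x) in *.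
    assert (E : qq * trace3 (fun i j => B i j x + Bg i j) - bilin (fun i j => B i j x + Bg i j) (p1, p2, p3) =
      (qq * trace3 (fun i j => B i j x) - bilin (fun i j => B i j x) (p1, p2, p3)) +
      del * e * (2 * al * (2 * al * (qq * sq3 x y - (p1 * z1 + p2 * z2 + p3 * z3) ^ 2)
               - (3 * qq - (p1 ^ 2 + p2 ^ 2 + p3 ^ 2))))).
    { unfold trace3, bilin, Bg, sq3, X1, X2, X3; simpl. fold z1 z2 z3. 
      unfold z1, z2, z3, X1, X2, X3. ring. }
    rewrite E in C.
    unfold normsq, X1, X2, X3 in El1; simpl in El1.
    (* Cauchy-Schwarz turns the gap [m] between [q] and [|P| ^ 2] into a lower bound for the
       second-order term of the barrier. *)
    assert (CS : (p1 * z1 + p2 * z2 + p3 * z3) ^ 2 <= (p1 ^ 2 + p2 ^ 2 + p3 ^ 2) * sq3 x y).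
    { unfold sq3. fold z1 z2 z3.
      assert ((p1 ^ 2 + p2 ^ 2 + p3 ^ 2) * (z1 ^ 2 + z2 ^ 2 + z3 ^ 2) - (p1 * z1 + p2 * z2 + p3 * z3) ^ 2 =
        (p1 * z2 - p2 * z1) ^ 2 + (p1 * z3 - p3 * z1) ^ 2 + (p2 * z3 - p3 * z2) ^ 2) by ring.
      pose proof (pow2_ge_0 (p1 * z2 - p2 * z1)). pose proof (pow2_ge_0 (p1 * z3 - p3 * z1)).
      pose proof (pow2_ge_0 (p2 * z3 - p3 * z2)). lra. }
    assert (CS2 : m * (R1 ^ 2) <= qq * sq3 x y - (p1 * z1 + p2 * z2 + p3 * z3) ^ 2).
    { apply Rle_trans with (m * sq3 x y); [apply Rmult_le_compat_l; lra|].
      assert (0 <= R1 ^ 2) by nra.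
      assert (m * sq3 x y <= (qq - (p1 ^ 2 + p2 ^ 2 + p3 ^ 2)) * sq3 x y)
        by (apply Rmult_le_compat_r; simpl; lra). lra. }
    assert (PP : 0 <= p1 ^ 2 + p2 ^ 2 + p3 ^ 2) by nra.
    assert (K : 0 < 2 * al * (qq * sq3 x y - (p1 * z1 + p2 * z2 + p3 * z3) ^ 2) - (3 * qq - (p1 ^ 2 + p2 ^ 2 + p3 ^ 2))).
    { assert (2 * al * (m * R1 ^ 2) <= 2 * al * (qq * sq3 x y - (p1 * z1 + p2 * z2 + p3 * z3) ^ 2))
        by (apply Rmult_le_compat_l; lra).
      replace (2 * al * (m * R1 ^ 2)) with (al * (4 * m * R1 ^ 2) / 2) in H by field.
      rewrite Eal in H. lra. }
    assert (0 < del * e * (2 * al * (2 * al * (qq * sq3 x y - (p1 * z1 + p2 * z2 + p3 * z3) ^ 2)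
               - (3 * qq - (p1 ^ 2 + p2 ^ 2 + p3 ^ 2))))) by (apply Rmult_lt_0_compat; apply Rmult_lt_0_compat; lra).
    lra.
Qed.

(** The limit [r -> R0] of the estimate on closed balls. *)
Lemma hopf_ball : forall x, sq3 x y < R0 ^ 2 ->
  w x <= M - del * (exp (- hopf_rate * sq3 x y) - exp (- hopf_rate * R0 ^ 2)).
Proof.
  intros x Hx. apply Rnot_lt_le. intros L.
  pose (e := (w x - (M - del * (exp (- hopf_rate * sq3 x y) - exp (- hopf_rate * R0 ^ 2)))) / del).
  assert (He : 0 < e) by (apply Rdiv_lt_0_compat; lra).
  assert (Ee : del * e = w x - (M - del * (exp (- hopf_rate * sq3 x y) - exp (- hopf_rate * R0 ^ 2))))
    by (unfold e; field; lra).
  assert (C : continuous (fun r => exp (- hopf_rate * r ^ 2)) R0).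
  { apply (ex_derive_continuous (fun r => exp (- hopf_rate * r ^ 2))). auto_derive. trivial. }
  pose proof (proj1 (filterlim_R (locally R0) _ _) C e He) as K. apply locally_R in K.
  destruct K as [d [Hd K]].
  assert (Hs : sqrt (sq3 x y) < R0).
  { rewrite <- (sqrt_pow2 R0) by lra. apply sqrt_lt_1_alt. split; [apply sq3_nonneg|exact Hx]. }
  pose (r := Rmax (R0 / 2) (Rmax (R0 - d / 2) (sqrt (sq3 x y)))).
  assert (Hr : R0 / 2 <= r /\ R0 - d / 2 <= r /\ sqrt (sq3 x y) <= r /\ r < R0).
  { unfold r. repeat split.
    - apply Rmax_l.
    - eapply Rle_trans; [apply Rmax_l|apply Rmax_r].
    - eapply Rle_trans; [apply Rmax_r|apply Rmax_r].
    - repeat apply Rmax_lub_lt; lra. }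
  specialize (K r ltac:(apply Rabs_lt_between; lra)). apply Rabs_lt_between in K.
  assert (Sx : sq3 x y <= r ^ 2).
  { rewrite <- (sqrt_sqrt (sq3 x y)) by apply sq3_nonneg. pose proof (sqrt_pos (sq3 x y)). nra. }
  pose proof (hopf_inner r ltac:(lra) x Sx) as H. nra.
Qed.

End Hopf.

(** * Boundary geometry of the cross-section *)

Lemma dist2_triangle (p q r : pt2) : dist2 p q <= dist2 p r + dist2 r q.
Proof.
  pose proof (triangle (fst p) (snd p) (fst q) (snd q) (fst r) (snd r)) as H.
  unfold dist_euc, Rsqr in H. unfold dist2.
  replace ((fst p - fst q) ^ 2 + (snd p - snd q) ^ 2) with ((fst p - fst q) * (fst p - fst q) + (snd p - snd q) * (snd p - snd q)) by ring.
  replace ((fst p - fst r) ^ 2 + (snd p - snd r) ^ 2) with ((fst p - fst r) * (fst p - fst r) + (snd p - snd r) * (snd p - snd r)) by ring.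
  replace ((fst r - fst q) ^ 2 + (snd r - snd q) ^ 2) with ((fst r - fst q) * (fst r - fst q) + (snd r - snd q) * (snd r - snd q)) by ring.
  exact H.
Qed.

Lemma dist2_lt_iff (p q : pt2) (r : R) : 0 < r ->
  (dist2 p q < r <-> (fst p - fst q) ^ 2 + (snd p - snd q) ^ 2 < r ^ 2).
Proof.
  intros Hr. unfold dist2. set (S := (fst p - fst q) ^ 2 + (snd p - snd q) ^ 2).
  assert (HS : 0 <= S) by (unfold S; pose proof (pow2_ge_0 (fst p - fst q)); pose proof (pow2_ge_0 (snd p - snd q)); lra).
  split; intros H.
  - rewrite <- (sqrt_sqrt S) by exact HS. pose proof (sqrt_pos S). nra.
  - rewrite <- (sqrt_pow2 r) by lra. apply sqrt_lt_1_alt. split; [exact HS|exact H].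
Qed.

Lemma dist2_refl (p : pt2) : dist2 p p = 0.
Proof. unfold dist2. rewrite !Rminus_diag. replace (0 ^ 2 + 0 ^ 2) with 0 by ring. apply sqrt_0. Qed.

Lemma closure2_incl (A : pt2 -> Prop) p : A p -> closure2 A p.
Proof. intros H r Hr. exists p. rewrite dist2_refl. auto. Qed.

Lemma C3_fun_quadratic g : C3_fun g -> exists C r, 0 <= C /\ 0 < r /\
  forall y, Rabs y < r -> Rabs (g y - g 0 - Derive g 0 * y) <= C * y ^ 2.
Proof.
  intros H.
  assert (C2 : continuous (Derive_n g 2) 0).
  { apply (ex_derive_continuous (Derive_n g 2)), H. }
  destruct (proj1 (locally_R _ _) (proj1 (filterlim_R (locally 0) _ _) C2 1 Rlt_0_1)) as [r [Hr K]].
  exists (Rabs (Derive_n g 2 0) + 1), r. pose proof (Rabs_pos (Derive_n g 2 0)).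
  split; [lra|]. split; [exact Hr|]. intros y Hy.
  destruct (MVT_gen g 0 y (Derive g)) as [c [Hc E]].
  { intros x _. apply Derive_correct, H. }
  { intros x _. apply continuity_pt_filterlim, (ex_derive_continuous g), H. }
  destruct (MVT_gen (Derive g) 0 c (Derive_n g 2)) as [c' [Hc' E']].
  { intros x _. apply (Derive_correct (Derive g)), H. }
  { intros x _. apply continuity_pt_filterlim, (ex_derive_continuous (Derive g)), H. }
  assert (Y0 : Rabs (y - 0) < r) by (rewrite Rminus_0_r; exact Hy).
  pose proof (Rabs_seg _ _ _ _ Hc Y0) as B1.
  pose proof (Rabs_seg _ _ _ _ Hc' B1) as B2. specialize (K c' B2).
  assert (Hcy : Rabs c <= Rabs y).
  { unfold Rmin, Rmax in Hc. destruct (Rle_dec 0 y).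
    - rewrite !Rabs_right by lra. lra.
    - rewrite !Rabs_left1 by lra. lra. }
  replace (g y - g 0 - Derive g 0 * y) with ((Derive g c - Derive g 0) * y) by (rewrite Rmult_minus_distr_r; lra).
  rewrite E', Rminus_0_r.
  assert (Kc : Rabs (Derive_n g 2 c') <= Rabs (Derive_n g 2 0) + 1).
  { replace (Derive_n g 2 c') with ((Derive_n g 2 c' - Derive_n g 2 0) + Derive_n g 2 0) by ring.
    eapply Rle_trans; [apply Rabs_triang|]. lra. }
  rewrite <- (pow2_abs y). replace (Rabs y ^ 2) with (Rabs y * Rabs y) by ring. rewrite <- Rmult_assoc.
  apply Rmult_le_abs; [|lra]. apply Rmult_le_abs; assumption.
Qed.

Definition chart_normal (th m : R) : pt2 :=
  rot (- th) (- m / sqrt (1 + m ^ 2), 1 / sqrt (1 + m ^ 2)).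

Lemma sqrt_1_sqr_pos m : 0 < sqrt (1 + m ^ 2) /\ sqrt (1 + m ^ 2) ^ 2 = 1 + m ^ 2.
Proof.
  assert (0 < 1 + m ^ 2) by (pose proof (pow2_ge_0 m); lra).
  split; [apply sqrt_lt_R0; lra|]. rewrite pow2_sqrt; lra.
Qed.

Lemma chart_normal_dot th m (v : pt2) :
  fst v * fst (chart_normal th m) + snd v * snd (chart_normal th m) =
  (snd (rot th v) - m * fst (rot th v)) / sqrt (1 + m ^ 2).
Proof.
  destruct (sqrt_1_sqr_pos m). unfold chart_normal, rot; cbv [fst snd]. rewrite cos_neg, sin_neg. field. lra.
Qed.

Lemma rot_norm th v : fst (rot th v) ^ 2 + snd (rot th v) ^ 2 = fst v ^ 2 + snd v ^ 2.
Proof.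
  unfold rot; simpl. pose proof (sin2_cos2 th) as E. unfold Rsqr in E.
  replace (fst v * (fst v * 1) + snd v * (snd v * 1)) with ((sin th * sin th + cos th * cos th) * (fst v * fst v + snd v * snd v))
    by (rewrite E; ring). ring.
Qed.

Lemma chart_normal_unit th m : fst (chart_normal th m) ^ 2 + snd (chart_normal th m) ^ 2 = 1.
Proof.
  unfold chart_normal. rewrite rot_norm. cbv [fst snd]. destruct (sqrt_1_sqr_pos m) as [A B].
  set (s := sqrt (1 + m ^ 2)) in *. pose proof (pow2_ge_0 m).
  replace ((- m / s) ^ 2 + (1 / s) ^ 2) with ((1 + m ^ 2) / s ^ 2) by (field; lra).
  rewrite B. field. lra.
Qed.

(** The inequality places [z] in the open disc of radius [R] centred at [p - R * n], which touches
    the boundary at [p]. A graph with quadratic error constant [C] leaves room for radii with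
    [2 * C * R <= 1]; the bounds by [r] and [r1] keep the disc inside the chart. *)
Lemma interior_disc Om p th r g : boundary_chart Om p th r g ->
  let n := chart_normal th (Derive g 0) in
  exists R0, 0 < R0 /\ forall R z, 0 < R <= R0 ->
    (fst z - fst p) ^ 2 + (snd z - snd p) ^ 2 + 2 * R * ((fst z - fst p) * fst n + (snd z - snd p) * snd n) < 0 -> Om z.
Proof.
  intros [Hr [Hg [Hg0 Hch]]] n.
  destruct (C3_fun_quadratic g Hg) as [C [r1 [HC [Hr1 K]]]].
  set (m := Derive g 0) in *. destruct (sqrt_1_sqr_pos m) as [A B]. set (s := sqrt (1 + m ^ 2)) in *.
  assert (s1 : 1 <= s) by (pose proof (pow2_ge_0 m); nra).
  destruct (exists_small 1 (2 * C) Rlt_0_1 ltac:(lra)) as [R1 [HR1 ER1]].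
  exists (Rmin R1 (Rmin (r / 4) (r1 / 4))). split; [repeat apply Rmin_glb_lt; lra|].
  intros R z HR Hz.
  assert (HRb : R <= R1 /\ R <= r / 4 /\ R <= r1 / 4).
  { pose proof (Rmin_l R1 (Rmin (r / 4) (r1 / 4))). pose proof (Rmin_r R1 (Rmin (r / 4) (r1 / 4))).
    pose proof (Rmin_l (r / 4) (r1 / 4)). pose proof (Rmin_r (r / 4) (r1 / 4)). lra. }
  pose (v := sub2 z p).
  change (fst z - fst p) with (fst v) in Hz. change (snd z - snd p) with (snd v) in Hz.
  unfold n in Hz. rewrite chart_normal_dot in Hz. fold s in Hz. rewrite <- (rot_norm th v) in Hz.
  set (y1 := fst (rot th v)) in *. set (y2 := snd (rot th v)) in *.
  pose (k := (y2 - m * y1) / s). assert (Ek : k * s = y2 - m * y1) by (unfold k; field; lra).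
  fold k in Hz.
  assert (Hk : k ^ 2 <= y1 ^ 2 + y2 ^ 2).
  { assert (k ^ 2 * s ^ 2 <= (y1 ^ 2 + y2 ^ 2) * s ^ 2).
    { replace (k ^ 2 * s ^ 2) with ((k * s) ^ 2) by ring. rewrite Ek, B.
      pose proof (pow2_ge_0 (y1 + m * y2)). nra. }
    apply Rmult_le_reg_r with (s ^ 2); [nra|exact H]. }
  assert (Hk2 : - (2 * R) < k < 0) by nra.
  assert (HN : y1 ^ 2 + y2 ^ 2 < (4 * R) ^ 2) by nra.
  assert (Hzr : dist2 z p < r).
  { apply dist2_lt_iff; [lra|]. change (fst v ^ 2 + snd v ^ 2 < r ^ 2). rewrite <- (rot_norm th v).
    fold y1 y2. nra. }
  apply (Hch z Hzr). fold v y1 y2.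
  assert (Hy1 : Rabs y1 < r1) by (apply Rabs_lt_between; nra).
  specialize (K y1 Hy1). rewrite Hg0 in K. fold m in K. apply Rabs_le_between in K.
  assert (2 * R * k * s < - (y1 ^ 2 + y2 ^ 2)) by nra.
  assert (2 * C * R <= 1) by nra.
  assert (X : 2 * R * (y2 - m * y1) < - y1 ^ 2) by (rewrite <- Ek; nra).
  assert (2 * R * (C * y1 ^ 2) <= y1 ^ 2) by nra.
  nra.
Qed.

Lemma boundary_normal Om p : C3_boundary Om -> bdry2 Om p ->
  exists n R0, outward_normal Om p n /\ fst n ^ 2 + snd n ^ 2 = 1 /\ 0 < R0 /\ forall R z, 0 < R <= R0 ->
    (fst z - fst p) ^ 2 + (snd z - snd p) ^ 2 + 2 * R * ((fst z - fst p) * fst n + (snd z - snd p) * snd n) < 0 -> Om z.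
Proof.
  intros HC Hp. destruct (HC p Hp) as [th [r [g Hch]]].
  destruct (interior_disc Om p th r g Hch) as [R0 [HR0 H]].
  exists (chart_normal th (Derive g 0)), R0. split; [exists th, r, g; auto|].
  split; [apply chart_normal_unit|]. auto.
Qed.

Definition slip (Om : pt2 -> Prop) (p : pt2) (L : pt3) : Prop :=
  forall nu, outward_normal Om p nu -> X2 L * fst nu + X3 L * snd nu = 0.

(* The vector [n] is the outward normal if [p] is a boundary point, and [0] if [p] is in [Om]. *)
Lemma inward_directions Om p : open2 Om -> C3_boundary Om -> closure2 Om p ->
  exists n : pt2, (forall L, (bdry2 Om p -> slip Om p L) -> X2 L * fst n + X3 L * snd n = 0) /\
    forall d e, fst d * fst n + snd d * snd n = 0 -> 0 < e -> exists tau, 0 < tau /\ forall t, 0 < t < tau ->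
      Om (fst p + t * (fst d - e * fst n), snd p + t * (snd d - e * snd n)).
Proof.
  intros HO HC Hp. destruct (classic (Om p)) as [Op|Np].
  - exists (0, 0). split; [intros; simpl; ring|]. intros d e _ He. simpl.
    destruct (HO p Op) as [r [Hr H]].
    destruct (exists_small (r / 2) (Rabs (fst d) + Rabs (snd d))) as [tau [Ht Et]];
      [lra|pose proof (Rabs_pos (fst d)); pose proof (Rabs_pos (snd d)); lra|].
    exists tau. split; [exact Ht|]. intros t Htt. apply H.
    destruct (sum2_sqr (t * fst d) (t * snd d)) as [_ [_ S]].
    unfold dist2; simpl.
    replace ((fst p + t * (fst d - e * 0) - fst p) * ((fst p + t * (fst d - e * 0) - fst p) * 1) +
      (snd p + t * (snd d - e * 0) - snd p) * ((snd p + t * (snd d - e * 0) - snd p) * 1)) with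
      ((t * fst d) ^ 2 + (t * snd d) ^ 2) by ring.
    rewrite !Rabs_mult, !(Rabs_right t) in S by lra.
    assert ((Rabs (fst d) + Rabs (snd d)) * t <= (Rabs (fst d) + Rabs (snd d)) * tau).
    { apply Rmult_le_compat_l; [pose proof (Rabs_pos (fst d)); pose proof (Rabs_pos (snd d)); lra|lra]. }
    lra.
  - assert (Bp : bdry2 Om p) by (split; assumption).
    destruct (boundary_normal Om p HC Bp) as [n [R0 [N1 [N2 [HR0 H]]]]].
    exists n. split; [intros L HL; apply HL; assumption|]. intros d e Hd He.
    set (v1 := fst d - e * fst n). set (v2 := snd d - e * snd n).
    assert (Ev : v1 * fst n + v2 * snd n = - e).
    { unfold v1, v2. replace ((fst d - e * fst n) * fst n + (snd d - e * snd n) * snd n) with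
        ((fst d * fst n + snd d * snd n) - e * (fst n ^ 2 + snd n ^ 2)) by ring. rewrite N2, Hd. ring. }
    destruct (exists_small (R0 * e) (v1 ^ 2 + v2 ^ 2)) as [tau [Ht Et]].
    { apply Rmult_lt_0_compat; lra. } { pose proof (pow2_ge_0 v1). pose proof (pow2_ge_0 v2). lra. }
    exists tau. split; [exact Ht|]. intros t Htt. apply (H R0); [lra|]. simpl fst; simpl snd.
    replace (fst p + t * v1 - fst p) with (t * v1) by ring.
    replace (snd p + t * v2 - snd p) with (t * v2) by ring.
    replace ((t * v1) ^ 2 + (t * v2) ^ 2 + 2 * R0 * (t * v1 * fst n + t * v2 * snd n)) with
      (t * (t * (v1 ^ 2 + v2 ^ 2) + 2 * R0 * (v1 * fst n + v2 * snd n))) by ring.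
    rewrite Ev.
    assert (t * (v1 ^ 2 + v2 ^ 2) <= tau * (v1 ^ 2 + v2 ^ 2)).
    { apply Rmult_le_compat_r; [pose proof (pow2_ge_0 v1); pose proof (pow2_ge_0 v2); lra|lra]. }
    assert (0 < R0 * e) by (apply Rmult_lt_0_compat; lra). nra.
Qed.

Lemma Derive_shift (h k : R -> R) a : (forall x, h x = k (a + x)) -> (forall x, ex_derive k x) ->
  forall x, ex_derive h x /\ Derive h x = Derive k (a + x).
Proof.
  intros E Hk x.
  assert (D : is_derive h x (Derive k (a + x))).
  { apply (is_derive_ext (fun u => k (a + u))); [intros; symmetry; apply E|].
    evar_last; [apply (is_derive_Rcomp k (fun u => a + u) x (Derive k (a + x)) 1)|].
    - apply Derive_correct, Hk.
    - auto_derive; [trivial|ring].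
    - Req. ring. }
  split; [eexists; exact D|apply is_derive_unique, D].
Qed.

(** [outward_normal] at [p'] asks for a chart centred at [p']. Recentring the chart of [p] makes the
    slip condition usable at all wall points near [p], with a normal that varies continuously. *)
Lemma boundary_chart_shift Om p th r g p' : boundary_chart Om p th r g -> dist2 p' p < r ->
  snd (rot th (sub2 p' p)) = g (fst (rot th (sub2 p' p))) ->
  outward_normal Om p' (chart_normal th (Derive g (fst (rot th (sub2 p' p))))).
Proof.
  intros [Hr [Hg [Hg0 Hch]]] Hd Hgr.
  set (a := fst (rot th (sub2 p' p))) in *.
  pose (h := fun u => g (a + u) - g a).
  assert (G0 : forall x, ex_derive (fun u => g u - g a) x /\ Derive (fun u => g u - g a) x = Derive g x).
  { intros x. assert (D : is_derive (fun u => g u - g a) x (Derive g x)).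
    { evar_last; [apply is_derive_Rminus; [apply Derive_correct, Hg|apply is_derive_Rconst]|]. Req. ring. }
    split; [eexists; exact D|apply is_derive_unique, D]. }
  assert (S1 : forall x, ex_derive h x /\ Derive h x = Derive g (a + x)).
  { intros x. destruct (Derive_shift h (fun u => g u - g a) a (fun x => eq_refl) (fun x => proj1 (G0 x)) x) as [A B].
    split; [exact A|]. rewrite B. apply G0. }
  assert (S2 : forall x, ex_derive (Derive h) x /\ Derive (Derive h) x = Derive (Derive g) (a + x)).
  { apply Derive_shift; [apply S1|]. intros; apply Hg. }
  assert (S3 : forall x, ex_derive (Derive_n h 2) x /\ Derive (Derive_n h 2) x = Derive (Derive_n g 2) (a + x)).
  { apply Derive_shift; [apply S2|]. intros; apply Hg. }
  assert (E0 : Derive h 0 = Derive g a) by (rewrite (proj2 (S1 0)), Rplus_0_r; reflexivity).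
  exists th, (r - dist2 p' p), h. split.
  - split; [lra|]. split; [|split].
    + intros x. repeat split; [apply S1|apply S2|apply S3|].
      apply (continuous_ext (fun u => Derive_n g 3 (a + u))).
      { intros u. symmetry. apply S3. }
      apply (continuous_comp (fun u => a + u) (Derive_n g 3)); [|apply Hg].
      apply continuous_Rplus; [apply continuous_const|apply continuous_id].
    + unfold h. rewrite Rplus_0_r. ring.
    + intros z Hz. rewrite (Hch z); [|pose proof (dist2_triangle z p p'); lra].
      unfold h. 
      assert (E1 : fst (rot th (sub2 z p)) = a + fst (rot th (sub2 z p'))) by (unfold a, rot, sub2; simpl; ring).
      assert (E2 : snd (rot th (sub2 z p)) = g a + snd (rot th (sub2 z p'))) by (rewrite <- Hgr; unfold rot, sub2; simpl; ring).
      rewrite E1, E2. split; intros; lra.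
  - rewrite E0. reflexivity.
Qed.

(** * One-sided directional derivatives at boundary points *)

Lemma grad_lim_filterlim A h y L : grad_lim A h y L ->
  forall i, filterlim (dpar i h) (within A (locally y)) (locally (coord i L)).
Proof.
  intros [H1 [H2 H3]] i. destruct i; apply lim_in3_filterlim; assumption.
Qed.

Lemma filterlim_shift_within (A : pt3 -> Prop) x d tau : 0 < tau -> (forall t, 0 < t < tau -> A (shift x d t)) ->
  forall P, within A (locally x) P -> exists s, 0 < s <= tau /\ forall t, 0 < t < s -> P (shift x d t).
Proof.
  intros Ht H P HP. unfold within in HP.
  pose proof (continuous_shift x d 0 (fun z => A z -> P z)) as C. rewrite shift_0 in C.
  apply C in HP. unfold filtermap in HP. apply locally_R in HP. destruct HP as [r [Hr HP]].
  exists (Rmin r tau). pose proof (Rmin_l r tau). pose proof (Rmin_r r tau).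
  split; [split; [apply Rmin_glb_lt; lra|lra]|].
  intros t Htt. apply HP; [rewrite Rminus_0_r, Rabs_right; lra|]. apply H. lra.
Qed.

(** [w] has only a limit at [x], so the mean value theorem is applied on [[a, t]], with [a] so small
    that the missing initial piece is below the supposed excess [gap]. *)
Lemma directional_limit (A : pt3 -> Prop) w (D : idx -> pt3 -> R) x d Lam M tau : 0 < tau ->
  (forall t, 0 < t < tau -> A (shift x d t)) -> (forall z, A z -> C1D w D z) ->
  filterlim w (within A (locally x)) (locally M) ->
  (forall i, filterlim (D i) (within A (locally x)) (locally (coord i Lam))) ->
  forall e, 0 < e -> exists s, 0 < s <= tau /\ forall t, 0 < t < s ->
    Rabs (w (shift x d t) - M - t * dot3 Lam d) <= e * t.
Proof.
  intros Ht HA HC HM HD e He.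
  assert (FD : filterlim (fun z => D I1 z * X1 d + D I2 z * X2 d + D I3 z * X3 d) (within A (locally x)) (locally (dot3 Lam d))).
  { unfold dot3. 
    repeat apply filterlim_Rplus; try typeclasses eauto;
      (apply filterlim_Rmult; [typeclasses eauto| |apply filterlim_Rconst; typeclasses eauto]).
    - apply (HD I1).
    - apply (HD I2).
    - apply (HD I3). }
  pose proof (proj1 (filterlim_R _ _ _) FD (e / 2) ltac:(lra)) as K.
  destruct (filterlim_shift_within A x d tau Ht HA _ K) as [s [Hs Ks]].
  exists s. split; [exact Hs|]. intros t Htt. apply Rnot_lt_le. intros L.
  set (dd := dot3 Lam d) in *.
  pose (gap := Rabs (w (shift x d t) - M - t * dd) - e * t). assert (Hgap : 0 < gap) by (unfold gap; lra).
  pose proof (proj1 (filterlim_R _ _ _) HM (gap / 4) ltac:(lra)) as K2.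
  destruct (filterlim_shift_within A x d tau Ht HA _ K2) as [s2 [Hs2 Ks2]].
  destruct (exists_small (gap / 4) (Rabs dd + 1)) as [s3 [Hs3 Es3]]; [lra|pose proof (Rabs_pos dd); lra|].
  pose (a := Rmin (t / 2) (Rmin (s2 / 2) s3)).
  assert (Ha : 0 < a /\ a <= t / 2 /\ a <= s2 / 2 /\ a <= s3).
  { unfold a. pose proof (Rmin_l (t / 2) (Rmin (s2 / 2) s3)). pose proof (Rmin_r (t / 2) (Rmin (s2 / 2) s3)).
    pose proof (Rmin_l (s2 / 2) s3). pose proof (Rmin_r (s2 / 2) s3).
    split; [repeat apply Rmin_glb_lt; lra|lra]. }
  destruct (MVT_cor2 (fun u => w (shift x d u)) (fun u => D I1 (shift x d u) * X1 d + D I2 (shift x d u) * X2 d + D I3 (shift x d u) * X3 d) a t) as [c [E Hc]].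
  { lra. }
  { intros c Hc. apply is_derive_Reals, is_derive_shift, HC, HA. lra. }
  specialize (Ks c ltac:(lra)). specialize (Ks2 a ltac:(lra)). cbv beta in Ks, Ks2.
  set (Dc := D I1 (shift x d c) * X1 d + D I2 (shift x d c) * X2 d + D I3 (shift x d c) * X3 d) in *.
  assert (B1 : Rabs ((Dc - dd) * (t - a)) <= e / 2 * t).
  { apply Rmult_le_abs; [lra|]. rewrite Rabs_right; lra. }
  assert (B2 : Rabs (dd * a) <= Rabs dd * s3) by (apply Rmult_le_abs; [lra|rewrite Rabs_right; lra]).
  assert (Eq : w (shift x d t) - M - t * dd = (w (shift x d a) - M) + (Dc - dd) * (t - a) - dd * a) by lra.
  assert (B : Rabs (w (shift x d t) - M - t * dd) <= gap / 4 + e / 2 * t + Rabs dd * s3).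
  { rewrite Eq. unfold Rminus at 1. eapply Rle_trans; [apply Rabs_triang|]. rewrite Rabs_Ropp.
    eapply Rle_trans; [apply Rplus_le_compat_r, Rabs_triang|]. lra. }
  unfold gap in *. nra.
Qed.

Lemma directional_max (A : pt3 -> Prop) w (D : idx -> pt3 -> R) x d Lam M tau : 0 < tau ->
  (forall t, 0 < t < tau -> A (shift x d t)) -> (forall z, A z -> C1D w D z) ->
  filterlim w (within A (locally x)) (locally M) ->
  (forall i, filterlim (D i) (within A (locally x)) (locally (coord i Lam))) ->
  (forall z, A z -> w z <= M) -> dot3 Lam d <= 0.
Proof.
  intros Ht HA HC HM HD Hmax. apply Rnot_lt_le. intros L.
  destruct (directional_limit A w D x d Lam M tau Ht HA HC HM HD (dot3 Lam d / 2) ltac:(lra)) as [s [Hs K]].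
  specialize (K (s / 2) ltac:(lra)). apply Rabs_le_between in K.
  specialize (Hmax _ (HA (s / 2) ltac:(lra))). nra.
Qed.

(** * Distances and limits at adherent points *)

Definition pt (s : R) (p : pt2) : pt3 := (s, fst p, snd p).

Lemma sec_pt s p : sec (pt s p) = p.
Proof. destruct p; reflexivity. Qed.

Lemma pt_sec x : pt (X1 x) (sec x) = x.
Proof. destruct x as [[a b] c]; reflexivity. Qed.

Lemma norm3_sqr v : norm3 v ^ 2 = normsq v.
Proof.
  unfold norm3. fold (normsq v). rewrite pow2_sqrt; [reflexivity|].
  unfold normsq. pose proof (pow2_ge_0 (X1 v)). pose proof (pow2_ge_0 (X2 v)). pose proof (pow2_ge_0 (X3 v)). lra.
Qed.

Lemma norm3_nonneg v : 0 <= norm3 v.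
Proof. apply sqrt_pos. Qed.

Lemma dist3_sym x y : dist3 x y = dist3 y x.
Proof. unfold dist3. f_equal. ring. Qed.

Lemma dist2_sec x y : dist2 (sec x) (sec y) <= dist3 x y.
Proof.
  unfold dist2, dist3, sec; simpl. apply sqrt_le_1_alt. pose proof (pow2_ge_0 (X1 x - X1 y)). simpl in *. lra.
Qed.

Lemma dist3_pt s s' p p' : dist3 (pt s p) (pt s' p') <= Rabs (s - s') + dist2 p p'.
Proof.
  unfold dist3, dist2, pt, X1, X2, X3; simpl fst; simpl snd.
  set (a := s - s'). set (b := (fst p - fst p') ^ 2 + (snd p - snd p') ^ 2).
  assert (Hb : 0 <= b) by (unfold b; pose proof (pow2_ge_0 (fst p - fst p')); pose proof (pow2_ge_0 (snd p - snd p')); lra).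
  rewrite Rplus_assoc. fold b.
  rewrite <- (sqrt_pow2 (Rabs a + sqrt b)) by (pose proof (Rabs_pos a); pose proof (sqrt_pos b); lra).
  apply sqrt_le_1_alt. rewrite <- (pow2_abs a).
  pose proof (Rabs_pos a). pose proof (sqrt_pos b). pose proof (sqrt_sqrt b Hb). nra.
Qed.

Lemma dist3_triangle x y z : dist3 x z <= dist3 x y + dist3 y z.
Proof.
  unfold dist3. set (a1 := X1 x - X1 y). set (a2 := X2 x - X2 y). set (a3 := X3 x - X3 y).
  set (b1 := X1 y - X1 z). set (b2 := X2 y - X2 z). set (b3 := X3 y - X3 z).
  replace (X1 x - X1 z) with (a1 + b1) by (unfold a1, b1; ring).
  replace (X2 x - X2 z) with (a2 + b2) by (unfold a2, b2; ring).
  replace (X3 x - X3 z) with (a3 + b3) by (unfold a3, b3; ring).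
  set (A := a1 ^ 2 + a2 ^ 2 + a3 ^ 2). set (B := b1 ^ 2 + b2 ^ 2 + b3 ^ 2).
  assert (HA : 0 <= A) by (unfold A; pose proof (pow2_ge_0 a1); pose proof (pow2_ge_0 a2); pose proof (pow2_ge_0 a3); lra).
  assert (HB : 0 <= B) by (unfold B; pose proof (pow2_ge_0 b1); pose proof (pow2_ge_0 b2); pose proof (pow2_ge_0 b3); lra).
  pose proof (sqrt_pos A) as SA. pose proof (sqrt_pos B) as SB.
  pose proof (sqrt_sqrt A HA) as EA. pose proof (sqrt_sqrt B HB) as EB.
  rewrite <- (sqrt_pow2 (sqrt A + sqrt B)) by lra. apply sqrt_le_1_alt.
  assert (CS : a1 * b1 + a2 * b2 + a3 * b3 <= sqrt A * sqrt B).
  { destruct (Rle_lt_dec (a1 * b1 + a2 * b2 + a3 * b3) 0) as [L|L]; [nra|].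
    assert ((a1 * b1 + a2 * b2 + a3 * b3) ^ 2 <= A * B).
    { assert (A * B - (a1 * b1 + a2 * b2 + a3 * b3) ^ 2 =
        (a1 * b2 - a2 * b1) ^ 2 + (a1 * b3 - a3 * b1) ^ 2 + (a2 * b3 - a3 * b2) ^ 2) by (unfold A, B; ring).
      pose proof (pow2_ge_0 (a1 * b2 - a2 * b1)). pose proof (pow2_ge_0 (a1 * b3 - a3 * b1)).
      pose proof (pow2_ge_0 (a2 * b3 - a3 * b2)). lra. }
    apply Rnot_lt_le. intros N.
    assert (0 <= sqrt A * sqrt B) by (apply Rmult_le_pos; lra).
    assert ((sqrt A * sqrt B) ^ 2 = A * B).
    { replace (A * B) with ((sqrt A * sqrt A) * (sqrt B * sqrt B)) by (rewrite EA, EB; reflexivity). ring. }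
    nra. }
  unfold A, B in *. nra.
Qed.

Lemma within_lim_le (A : pt3 -> Prop) (x : pt3) (h : pt3 -> R) (l c : R) : adh3 A x ->
  filterlim h (within A (locally x)) (locally l) -> (forall z, A z -> h z <= c) -> l <= c.
Proof.
  intros Ha H Hc. apply Rnot_lt_le. intros L.
  pose proof (proj1 (filterlim_R _ _ _) H (l - c) ltac:(lra)) as K.
  unfold within in K. apply locally3 in K. destruct K as [r [Hr K]].
  destruct (Ha r Hr) as [z [Az Hz]]. specialize (K z Hz Az). specialize (Hc z Az).
  apply Rabs_lt_between in K. lra.
Qed.

Lemma within_lim_unique (A : pt3 -> Prop) (x : pt3) (h : pt3 -> R) (l l' : R) : adh3 A x ->
  filterlim h (within A (locally x)) (locally l) -> filterlim h (within A (locally x)) (locally l') -> l = l'.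
Proof.
  intros Ha H H'. pose proof (adh3_proper A x Ha).
  apply (filterlim_locally_unique (V := R_NormedModule) h l l' H H').
Qed.

(** One-sided limits depend continuously on the boundary point; this carries boundary conditions to
    edges where they are not prescribed. *)
Lemma within_lim_near (A : pt3 -> Prop) (x : pt3) (h : pt3 -> R) (l e : R) : 0 < e ->
  filterlim h (within A (locally x)) (locally l) -> exists d, 0 < d /\ forall x' l', dist3 x' x < d ->
    adh3 A x' -> filterlim h (within A (locally x')) (locally l') -> Rabs (l' - l) <= e.
Proof.
  intros He H. pose proof (proj1 (filterlim_R _ _ _) H (e / 2) ltac:(lra)) as K.
  unfold within in K. apply locally3 in K. destruct K as [r [Hr K]].
  exists (r / 2). split; [lra|]. intros x' l' Hd Ha H'.
  pose proof (proj1 (filterlim_R _ _ _) H' (e / 2) ltac:(lra)) as K'.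
  unfold within in K'. apply locally3 in K'. destruct K' as [r' [Hr' K']].
  destruct (Ha (Rmin r' (r / 2)) ltac:(apply Rmin_glb_lt; lra)) as [z [Az Hz]].
  pose proof (Rmin_l r' (r / 2)). pose proof (Rmin_r r' (r / 2)).
  pose proof (dist3_triangle z x' x).
  specialize (K z ltac:(lra) Az). specialize (K' z ltac:(lra) Az).
  replace (l' - l) with ((h z - l) - (h z - l')) by ring.
  unfold Rminus at 1. eapply Rle_trans; [apply Rabs_triang|]. rewrite Rabs_Ropp. lra.
Qed.

Lemma coord_normsq_lim {T : Type} (F : (T -> Prop) -> Prop) {FF : Filter F} (g : T -> pt3) (L : pt3) :
  (forall i, filterlim (fun z => coord i (g z)) F (locally (coord i L))) ->
  filterlim (fun z => normsq (g z)) F (locally (normsq L)).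
Proof.
  intros H.
  assert (S : forall i, filterlim (fun z => coord i (g z) ^ 2) F (locally (coord i L ^ 2))).
  { intros i. apply (filterlim_cont F (fun z => coord i (g z)) (fun u => u ^ 2)); [apply H|].
    apply (ex_derive_continuous (fun u : R => u ^ 2)). auto_derive. trivial. }
  unfold normsq. apply filterlim_Rplus; [exact FF| |apply (S I3)].
  apply filterlim_Rplus; [exact FF|apply (S I1)|apply (S I2)].
Qed.

Lemma coord_grad i h z : coord i (grad h z) = dpar i h z.
Proof. destruct i; reflexivity. Qed.

Definition glim (A : pt3 -> Prop) (h : pt3 -> R) (x L : pt3) : Prop :=
  forall i, filterlim (dpar i h) (within A (locally x)) (locally (coord i L)).

Lemma glim_normsq A h x L : glim A h x L ->
  filterlim (fun z => normsq (grad h z)) (within A (locally x)) (locally (normsq L)).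
Proof.
  intros H. apply coord_normsq_lim; [typeclasses eauto|]. intros i.
  apply (filterlim_ext (dpar i h)); [intros; symmetry; apply coord_grad|apply H].
Qed.

Lemma coord_ext (L L' : pt3) : (forall i, coord i L = coord i L') -> L = L'.
Proof.
  intros H. destruct L as [[a b] c], L' as [[a' b'] c'].
  pose proof (H I1). pose proof (H I2). pose proof (H I3). unfold coord, X1, X2, X3 in *; simpl in *. congruence.
Qed.

Lemma glim_unique A h x L L' : adh3 A x -> glim A h x L -> glim A h x L' -> L = L'.
Proof. intros Ha H H'. apply coord_ext. intros i. eapply within_lim_unique; [exact Ha|apply H|apply H']. Qed.

(** For a Lipschitz function, the limit along a single sequence in [B] determines the limit from
    every side. *)
Lemma lipschitz_lim (A B : pt3 -> Prop) (h : pt3 -> R) (x : pt3) (u : nat -> pt3) (M : R) :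
  (forall z, A z -> B z) -> Lipschitz_on B h -> (forall n, B (u n)) -> filterlim u eventually (locally x) ->
  filterlim (fun n => h (u n)) eventually (locally M) -> filterlim h (within A (locally x)) (locally M).
Proof.
  intros HAB [K HK] Hu Hx HM. apply filterlim_R; [typeclasses eauto|]. intros e He.
  destruct (exists_small (e / 4) (Rabs K)) as [d [Hd Ed]]; [lra|apply Rabs_pos|].
  unfold within. apply locally3. exists d. split; [exact Hd|]. intros z Hz Az.
  destruct (Hx (fun y => dist3 y x < d)) as [N1 HN1]; [apply locally3; exists d; auto|].
  destruct (proj1 (filterlim_R eventually _ _) HM (e / 4) ltac:(lra)) as [N2 HN2].
  specialize (HN1 (max N1 N2) ltac:(lia)). specialize (HN2 (max N1 N2) ltac:(lia)).
  set (v := u (max N1 N2)) in *.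
  pose proof (HK z v (HAB z Az) (Hu _)) as L.
  pose proof (dist3_triangle z x v) as T. rewrite (dist3_sym x v) in T.
  pose proof (Rle_abs K). assert (D0 : 0 <= dist3 z v) by apply sqrt_pos.
  assert (K * dist3 z v <= Rabs K * (2 * d)).
  { apply Rle_trans with (Rabs K * dist3 z v); [apply Rmult_le_compat_r; lra|].
    apply Rmult_le_compat_l; [apply Rabs_pos|lra]. }
  replace (h z - M) with ((h z - h v) + (h v - M)) by ring.
  eapply Rle_lt_trans; [apply Rabs_triang|]. lra.
Qed.

Lemma seq_of_adh (A : pt3 -> Prop) x : adh3 A x ->
  exists u : nat -> pt3, (forall n, A (u n)) /\ filterlim u eventually (locally x).
Proof.
  intros H. destruct (nat_choice (fun n z => A z /\ dist3 z x < / (INR n + 1)) (fun n => H _ (inv_INR_pos n))) as [u Hu].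
  exists u. split; [apply Hu|]. intros P HP. apply locally3 in HP. destruct HP as [r [Hr HP]].
  destruct (inv_INR_small r Hr) as [N HN]. exists N. intros n Hn. apply HP.
  eapply Rlt_trans; [apply Hu|]. apply HN, Hn.
Qed.

(** * Gradient limits of a transonic shock solution *)

(** The data of [transonic_sol] under names. [F2] and [F3] extend the partial derivatives of [f] to
    the closure, where the shock meets the wall; [fl_dens] condenses the upper bound on [um] for
    both cases of [gam]. *)
Record flow (Om : pt2 -> Prop) (gam b0 um c1 : R) (phi : pt3 -> R) (f F2 F3 : pt2 -> R) : Prop := {
  fl_open : open2 Om;
  fl_ne : exists p, Om p;
  fl_conn : connected_open2 Om;
  fl_bd : bounded2 Om;
  fl_C3 : C3_boundary Om;
  fl_gam : 1 <= gam;
  fl_stag : 1 < gam -> 0 < 1 + (gam - 1) * b0;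
  fl_um : cstar gam b0 < um;
  fl_dens : 0 < dens_base gam b0 (um ^ 2);
  fl_c1p : 0 < c1;
  fl_c1 : c1 < cstar gam b0;
  fl_f2 : forall p, Om p -> is_derive (fun s => f (s, snd p)) (fst p) (F2 p);
  fl_f3 : forall p, Om p -> is_derive (fun s => f (fst p, s)) (snd p) (F3 p);
  fl_fc : cont2_on (closure2 Om) f;
  fl_F2c : cont2_on (closure2 Om) F2;
  fl_F3c : cont2_on (closure2 Om) F3;
  fl_lip : Lipschitz_on (inD Om) phi;
  fl_C2 : C2_on (fun x => Dminus Om f x \/ Dplus Om f x) phi;
  fl_sup : forall x, Dminus Om f x -> cstar gam b0 < norm3 (grad phi x);
  fl_sub : forall x, Dplus Om f x -> norm3 (grad phi x) < cstar gam b0;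
  fl_pde : forall x, Dminus Om f x \/ Dplus Om f x ->
     0 < dens_base gam b0 (norm3 (grad phi x) ^ 2) /\ potential_eq gam b0 phi x;
  fl_in : forall y, Sigma_m1 Om y -> lim_in3 (inD Om) phi y (- um) /\
     bc_grad (Dminus Om f) (Dplus Om f) phi y (fun L => X1 L = um /\ 0 <= X1 L);
  fl_out : forall y, Sigma_1 Om y ->
     bc_grad (Dminus Om f) (Dplus Om f) phi y (fun L => norm3 L = c1 /\ 0 <= X1 L);
  fl_wall : forall y, Gamma Om y ->
     bc_grad (Dminus Om f) (Dplus Om f) phi y (slip Om (sec y));
  fl_RH : forall s, shockS Om f s -> exists Lm Lp,
     grad_lim (Dminus Om f) phi s Lm /\ grad_lim (Dplus Om f) phi s Lp /\
     rho gam b0 (norm3 Lp ^ 2) * dot3 Lp (1, - F2 (sec s), - F3 (sec s)) =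
       rho gam b0 (norm3 Lm ^ 2) * dot3 Lm (1, - F2 (sec s), - F3 (sec s)) /\
     norm3 Lp < norm3 Lm }.

(** The upper bound on [um] is the speed at which the Bernoulli law reaches vacuum. *)
Lemma upstream_dens gam b0 um : 1 <= gam -> (1 < gam -> 0 < 1 + (gam - 1) * b0) -> cstar gam b0 < um ->
  (1 < gam -> um < sqrt (2 * (b0 + 1 / (gam - 1)))) -> 0 < dens_base gam b0 (um ^ 2).
Proof.
  intros Hg HK Hum Hum2.
  pose proof (cstar_pos gam b0 Hg HK) as Hcp.
  unfold dens_base. destruct (Req_dec gam 1) as [->|N]; [lra|].
  assert (G : 1 < gam) by lra. specialize (Hum2 G). specialize (HK G).
  assert (P : 0 <= 2 * (b0 + 1 / (gam - 1))).
  { replace (2 * (b0 + 1 / (gam - 1))) with (2 * (1 + (gam - 1) * b0) / (gam - 1)) by (field; lra).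
    apply Rlt_le, Rdiv_lt_0_compat; lra. }
  assert (um ^ 2 < 2 * (b0 + 1 / (gam - 1))).
  { rewrite <- (sqrt_sqrt _ P). set (q := sqrt (2 * (b0 + 1 / (gam - 1)))) in *. nra. }
  assert ((gam - 1) * um ^ 2 < (gam - 1) * (2 * (b0 + 1 / (gam - 1)))) by (apply Rmult_lt_compat_l; lra).
  replace ((gam - 1) * (2 * (b0 + 1 / (gam - 1)))) with (2 * ((gam - 1) * b0) + 2) in H0 by (field; lra). lra.
Qed.

Lemma flow_of_sol Om gam b0 um c1 phi f :
  domain2 Om -> bounded2 Om -> C3_boundary Om -> 1 <= gam ->
  (1 < gam -> 0 < 1 + (gam - 1) * b0) -> cstar gam b0 < um ->
  (1 < gam -> um < sqrt (2 * (b0 + 1 / (gam - 1)))) -> 0 < c1 -> c1 < cstar gam b0 ->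
  transonic_sol Om gam b0 um c1 phi f -> exists F2 F3, flow Om gam b0 um c1 phi f F2 F3.
Proof.
  intros [HO [Hne Hcn]] HB HC Hg HK Hum Hum2 Hc0 Hc1
    [[Hf1 [Hf2 [F2 [F3 [HF2 [HF3 HF]]]]]] [S1 [S2 [S3 [S4 [S5 [S6 [S7 [S8 S9]]]]]]]]].
  exists F2, F3. constructor; auto.
  - apply upstream_dens; assumption.
  - intros p Hp. rewrite <- (proj1 (HF p Hp)). apply Derive_correct. apply Hf1, Hp.
  - intros p Hp. rewrite <- (proj2 (HF p Hp)). apply Derive_correct. apply Hf1, Hp.
  - intros s Hs. destruct (S9 s Hs) as [Lm [Lp [A [B [C D]]]]]. exists Lm, Lp.
    unfold shock_normal in C. destruct Hs as [[_ Hs] _]. destruct (HF (sec s) Hs) as [E2 E3].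
    rewrite E2, E3 in C. auto.
Qed.

Section Flow.
Variables (Om : pt2 -> Prop) (gam b0 um c1 : R) (phi : pt3 -> R) (f F2 F3 : pt2 -> R).
Hypothesis fl : flow Om gam b0 um c1 phi f F2 F3.

Local Notation Dm := (Dminus Om f).
Local Notation Dp := (Dplus Om f).
Local Notation cs := (cstar gam b0).

Lemma cs_pos : 0 < cs.
Proof. apply cstar_pos; apply fl. Qed.

Lemma um_pos : 0 < um.
Proof. pose proof cs_pos. pose proof (fl_um _ _ _ _ _ _ _ _ _ fl). lra. Qed.

Lemma locally_Om x : Om (sec x) -> locally x (fun y => Om (sec y)).
Proof.
  intros H. apply (continuous_sec x (fun p => Om p)). apply locally2. apply (fl_open _ _ _ _ _ _ _ _ _ fl), H.
Qed.

Lemma open_inD : open3 (inD Om).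
Proof.
  intros x [H1 H2]. apply filter_and; [|apply locally_Om, H2].
  apply filter_and.
  - apply (continuous_X1 x (fun u => -1 < u)). apply (open_gt (-1) (X1 x)). apply H1.
  - apply (continuous_X1 x (fun u => u < 1)). apply (open_lt 1 (X1 x)). apply H1.
Qed.

Definition fDer (i : idx) (x : pt3) : R := match i with I1 => 0 | I2 => F2 (sec x) | I3 => F3 (sec x) end.

Lemma cont2_on_continuous h x : cont2_on (closure2 Om) h -> Om (sec x) -> continuous (fun y => h (sec y)) x.
Proof.
  intros Hc Hx. apply (continuous_comp sec h); [apply continuous_sec|].
  apply filterlim_R; [typeclasses eauto|]. intros e He.
  destruct (Hc (sec x) (closure2_incl _ _ Hx) e He) as [d [Hd H]].
  destruct (fl_open _ _ _ _ _ _ _ _ _ fl _ Hx) as [r [Hr Hr']].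
  apply locally2. exists (Rmin r d). split; [apply Rmin_glb_lt; lra|]. intros z Hz.
  pose proof (Rmin_l r d). pose proof (Rmin_r r d).
  apply H; [apply closure2_incl, Hr'; lra|lra].
Qed.

Lemma C1D_f x : Om (sec x) -> C1D (fun y => f (sec y)) fDer x.
Proof.
  intros Hx. split.
  - eapply filter_imp; [|apply (locally_Om x Hx)]. intros y Hy i. unfold is_par. destruct i; simpl.
    + exact (is_derive_Rconst (f (sec y)) (X1 y)).
    + apply (fl_f2 _ _ _ _ _ _ _ _ _ fl (sec y) Hy).
    + apply (fl_f3 _ _ _ _ _ _ _ _ _ fl (sec y) Hy).
  - intros i. destruct i; simpl; [apply continuous_const| |]; apply cont2_on_continuous; try exact Hx; apply fl.
Qed.

Lemma open_Dm : open3 Dm.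
Proof.
  intros x [H1 H2]. apply filter_and; [apply open_inD, H1|].
  assert (C : continuous (fun y => f (sec y) - X1 y) x).
  { apply continuous_Rminus; [|apply continuous_X1]. apply (C1D_continuous _ _ _ (C1D_f x (proj2 H1))). }
  eapply filter_imp; [|apply (C (fun u => 0 < u)), (open_gt 0 (f (sec x) - X1 x)); lra].
  cbv beta. intros y Hy. simpl in Hy. lra.
Qed.

Lemma open_Dp : open3 Dp.
Proof.
  intros x [H1 H2]. apply filter_and; [apply open_inD, H1|].
  assert (C : continuous (fun y => f (sec y) - X1 y) x).
  { apply continuous_Rminus; [|apply continuous_X1]. apply (C1D_continuous _ _ _ (C1D_f x (proj2 H1))). }
  eapply filter_imp; [|apply (C (fun u => u < 0)), (open_lt 0 (f (sec x) - X1 x)); lra].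
  cbv beta. intros y Hy. simpl in Hy. lra.
Qed.

Lemma open_Dmp : open3 (fun x => Dm x \/ Dp x).
Proof.
  intros x [H|H].
  - eapply filter_imp; [|apply (open_Dm x H)]. auto.
  - eapply filter_imp; [|apply (open_Dp x H)]. auto.
Qed.

Lemma C1D_phi x : Dm x \/ Dp x -> C1D phi (fun i => dpar i phi) x.
Proof. intros H. apply (C1D_of_C2 (fun x => Dm x \/ Dp x)); [apply open_Dmp|apply fl|exact H]. Qed.

Lemma C1D_dphi x i : Dm x \/ Dp x -> C1D (dpar i phi) (fun j => dpar j (dpar i phi)) x.
Proof. intros H. apply (C1D_of_C2' (fun x => Dm x \/ Dp x)); [apply open_Dmp|apply fl|exact H]. Qed.

Lemma sub_sq x : Dp x -> normsq (grad phi x) < cs ^ 2.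
Proof.
  intros H. rewrite <- norm3_sqr. pose proof (fl_sub _ _ _ _ _ _ _ _ _ fl x H).
  pose proof (norm3_nonneg (grad phi x)). nra.
Qed.

Lemma sup_sq x : Dm x -> cs ^ 2 < normsq (grad phi x).
Proof.
  intros H. rewrite <- norm3_sqr. pose proof (fl_sup _ _ _ _ _ _ _ _ _ fl x H). pose proof cs_pos. nra.
Qed.

Lemma glim_sub x L : adh3 Dp x -> glim Dp phi x L -> normsq L <= cs ^ 2.
Proof.
  intros Ha H. eapply within_lim_le; [exact Ha|apply glim_normsq, H|]. intros z Hz. apply Rlt_le, sub_sq, Hz.
Qed.

(** Otherwise the subsonic region would reach the inlet at [p], where the limit gradient has first
    component [um > cstar]. *)
Lemma f_gt p : Om p -> -1 < f p.
Proof.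
  intros Hp. apply Rnot_le_lt. intros L.
  assert (Ha : adh3 Dp (pt (-1) p)).
  { intros r Hr. exists (pt (-1 + Rmin (r / 2) 1) p).
    assert (0 < Rmin (r / 2) 1) by (apply Rmin_glb_lt; lra).
    pose proof (Rmin_l (r / 2) 1). pose proof (Rmin_r (r / 2) 1). split.
    - unfold Dplus, inD. rewrite sec_pt. unfold pt, X1; simpl. repeat split; try assumption; lra.
    - eapply Rle_lt_trans; [apply dist3_pt|]. rewrite dist2_refl.
      replace (-1 + Rmin (r / 2) 1 - -1) with (Rmin (r / 2) 1) by ring. rewrite Rabs_right; lra. }
  assert (HS : Sigma_m1 Om (pt (-1) p)) by (split; [reflexivity|rewrite sec_pt; exact Hp]).
  destruct (proj2 (proj2 (fl_in _ _ _ _ _ _ _ _ _ fl _ HS)) Ha) as [L' [HL [E _]]].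
  pose proof (glim_sub _ _ Ha (grad_lim_filterlim _ _ _ _ HL)) as B.
  unfold normsq in B. rewrite E in B. pose proof (fl_um _ _ _ _ _ _ _ _ _ fl). pose proof cs_pos.
  pose proof (pow2_ge_0 (X2 L')). pose proof (pow2_ge_0 (X3 L')). nra.
Qed.

(** Otherwise the supersonic region would reach the outlet at [p], where the limit gradient has norm
    [c1 < cstar]. *)
Lemma f_lt p : Om p -> f p < 1.
Proof.
  intros Hp. apply Rnot_le_lt. intros L.
  assert (Ha : adh3 Dm (pt 1 p)).
  { intros r Hr. exists (pt (1 - Rmin (r / 2) 1) p).
    assert (0 < Rmin (r / 2) 1) by (apply Rmin_glb_lt; lra).
    pose proof (Rmin_l (r / 2) 1). pose proof (Rmin_r (r / 2) 1). split.
    - unfold Dminus, inD. rewrite sec_pt. unfold pt, X1; simpl. repeat split; try assumption; lra.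
    - eapply Rle_lt_trans; [apply dist3_pt|]. rewrite dist2_refl.
      replace (1 - Rmin (r / 2) 1 - 1) with (- Rmin (r / 2) 1) by ring. rewrite Rabs_Ropp, Rabs_right; lra. }
  assert (HS : Sigma_1 Om (pt 1 p)) by (split; [reflexivity|rewrite sec_pt; exact Hp]).
  destruct (proj1 (fl_out _ _ _ _ _ _ _ _ _ fl _ HS) Ha) as [L' [HL [E _]]].
  assert (B : - normsq L' <= - cs ^ 2).
  { eapply (within_lim_le Dm); [exact Ha|exact (filterlim_Ropp _ _ _ (glim_normsq Dm phi _ L' (grad_lim_filterlim _ _ _ _ HL)))|].
    intros z Hz. pose proof (sup_sq z Hz). lra. }
  rewrite <- norm3_sqr, E in B. pose proof (fl_c1 _ _ _ _ _ _ _ _ _ fl).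
  pose proof (fl_c1p _ _ _ _ _ _ _ _ _ fl). nra.
Qed.

(** Only weak inequalities pass to wall points: the shock might touch an edge of the cylinder there,
    a case that the later arguments must allow for. *)
Lemma f_bounds p : closure2 Om p -> -1 <= f p <= 1.
Proof.
  intros Hp.
  assert (K : forall e, 0 < e -> exists q, Om q /\ Rabs (f q - f p) < e).
  { intros e He. destruct (fl_fc _ _ _ _ _ _ _ _ _ fl p Hp e He) as [d [Hd H]].
    destruct (Hp d Hd) as [q [Oq Hq]]. exists q. split; [exact Oq|]. apply H; [apply closure2_incl, Oq|exact Hq]. }
  split; apply Rnot_lt_le; intros L.
  - destruct (K (-1 - f p) ltac:(lra)) as [q [Oq Hq]]. pose proof (f_gt q Oq). apply Rabs_lt_between in Hq. lra.
  - destruct (K (f p - 1) ltac:(lra)) as [q [Oq Hq]]. pose proof (f_lt q Oq). apply Rabs_lt_between in Hq. lra.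
Qed.

Lemma adh_closure A x : (forall z, A z -> inD Om z) -> adh3 A x -> -1 <= X1 x <= 1 /\ closure2 Om (sec x).
Proof.
  intros HA Ha. split.
  - split; apply Rnot_lt_le; intros L.
    + destruct (Ha (-1 - X1 x) ltac:(lra)) as [z [Az Hz]]. destruct (HA z Az) as [B _].
      destruct (abs_coord_le_dist3 z x) as [C _].
      pose proof (Rle_abs (X1 z - X1 x)). lra.
    + destruct (Ha (X1 x - 1) ltac:(lra)) as [z [Az Hz]]. destruct (HA z Az) as [B _].
      destruct (abs_coord_le_dist3 z x) as [C _]. rewrite Rabs_minus_sym in C.
      pose proof (Rle_abs (X1 x - X1 z)). lra.
  - intros r Hr. destruct (Ha r Hr) as [z [Az Hz]]. exists (sec z). split; [apply (HA z Az)|].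
    eapply Rle_lt_trans; [apply dist2_sec|exact Hz].
Qed.

Lemma f_near x e : closure2 Om (sec x) -> 0 < e -> exists d, 0 < d /\
  forall z, closure2 Om (sec z) -> dist3 z x < d -> Rabs (f (sec z) - f (sec x)) < e.
Proof.
  intros Hc He. destruct (fl_fc _ _ _ _ _ _ _ _ _ fl (sec x) Hc e He) as [d [Hd H]].
  exists d. split; [exact Hd|]. intros z Cz Hz. apply H; [exact Cz|].
  eapply Rle_lt_trans; [apply dist2_sec|exact Hz].
Qed.

Lemma adh_Dm_le x : adh3 Dm x -> X1 x <= f (sec x).
Proof.
  intros Ha. destruct (adh_closure Dm x (fun z H => proj1 H) Ha) as [_ Hc].
  apply Rnot_lt_le. intros L.
  destruct (f_near x ((X1 x - f (sec x)) / 2) Hc ltac:(lra)) as [d [Hd H]].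
  destruct (Ha (Rmin d ((X1 x - f (sec x)) / 2))) as [z [[Dz Lz] Hz]]; [apply Rmin_glb_lt; lra|].
  pose proof (Rmin_l d ((X1 x - f (sec x)) / 2)). pose proof (Rmin_r d ((X1 x - f (sec x)) / 2)).
  specialize (H z (closure2_incl _ _ (proj2 Dz)) ltac:(lra)). apply Rabs_lt_between in H.
  destruct (abs_coord_le_dist3 z x) as [C _]. apply Rabs_le_between in C. lra.
Qed.

Lemma adh_Dp_ge x : adh3 Dp x -> f (sec x) <= X1 x.
Proof.
  intros Ha. destruct (adh_closure Dp x (fun z H => proj1 H) Ha) as [_ Hc].
  apply Rnot_lt_le. intros L.
  destruct (f_near x ((f (sec x) - X1 x) / 2) Hc ltac:(lra)) as [d [Hd H]].
  destruct (Ha (Rmin d ((f (sec x) - X1 x) / 2))) as [z [[Dz Lz] Hz]]; [apply Rmin_glb_lt; lra|].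
  pose proof (Rmin_l d ((f (sec x) - X1 x) / 2)). pose proof (Rmin_r d ((f (sec x) - X1 x) / 2)).
  specialize (H z (closure2_incl _ _ (proj2 Dz)) ltac:(lra)). apply Rabs_lt_between in H.
  destruct (abs_coord_le_dist3 z x) as [C _]. apply Rabs_le_between in C. lra.
Qed.

Lemma between (a b c d : R) : a < c -> a < d -> b < c -> b < d -> exists s, a < s /\ b < s /\ s < c /\ s < d.
Proof.
  intros. exists ((Rmax a b + Rmin c d) / 2).
  pose proof (Rmax_l a b). pose proof (Rmax_r a b). pose proof (Rmin_l c d). pose proof (Rmin_r c d).
  assert (Rmax a b < Rmin c d) by (apply Rmax_lub_lt; apply Rmin_glb_lt; lra). lra.
Qed.

Lemma adh_Dm x : closure2 Om (sec x) -> -1 <= X1 x <= f (sec x) -> adh3 Dm x.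
Proof.
  intros Hc [H1 H2] r Hr.
  destruct (f_near x (r / 4) Hc ltac:(lra)) as [d [Hd H]].
  destruct (Hc (Rmin d (r / 4))) as [q [Oq Hq]]; [apply Rmin_glb_lt; lra|].
  pose proof (Rmin_l d (r / 4)). pose proof (Rmin_r d (r / 4)).
  specialize (H (pt (X1 x) q)). rewrite sec_pt in H. specialize (H (closure2_incl _ _ Oq)).
  assert (D : dist3 (pt (X1 x) q) x < d).
  { rewrite <- (pt_sec x) at 2. eapply Rle_lt_trans; [apply dist3_pt|]. rewrite Rminus_diag, Rabs_R0. lra. }
  specialize (H D). apply Rabs_lt_between in H. pose proof (f_gt q Oq). pose proof (f_lt q Oq).
  destruct (between (-1) (X1 x - r / 2) (f q) (X1 x + r / 2)) as [s Hs]; try lra.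
  exists (pt s q). split.
  - unfold Dminus, inD. rewrite sec_pt. unfold pt, X1 at 1 2 3; simpl. repeat split; try assumption; lra.
  - rewrite <- (pt_sec x). eapply Rle_lt_trans; [apply dist3_pt|].
    assert (Rabs (s - X1 x) < r / 2) by (apply Rabs_lt_between; lra). lra.
Qed.

Lemma adh_Dp x : closure2 Om (sec x) -> f (sec x) <= X1 x <= 1 -> adh3 Dp x.
Proof.
  intros Hc [H1 H2] r Hr.
  destruct (f_near x (r / 4) Hc ltac:(lra)) as [d [Hd H]].
  destruct (Hc (Rmin d (r / 4))) as [q [Oq Hq]]; [apply Rmin_glb_lt; lra|].
  pose proof (Rmin_l d (r / 4)). pose proof (Rmin_r d (r / 4)).
  specialize (H (pt (X1 x) q)). rewrite sec_pt in H. specialize (H (closure2_incl _ _ Oq)).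
  assert (D : dist3 (pt (X1 x) q) x < d).
  { rewrite <- (pt_sec x) at 2. eapply Rle_lt_trans; [apply dist3_pt|]. rewrite Rminus_diag, Rabs_R0. lra. }
  specialize (H D). apply Rabs_lt_between in H. pose proof (f_gt q Oq). pose proof (f_lt q Oq).
  destruct (between (f q) (X1 x - r / 2) 1 (X1 x + r / 2)) as [s Hs]; try lra.
  exists (pt s q). split.
  - unfold Dplus, inD. rewrite sec_pt. unfold pt, X1 at 1 2 3; simpl. repeat split; try assumption; lra.
  - rewrite <- (pt_sec x). eapply Rle_lt_trans; [apply dist3_pt|].
    assert (Rabs (s - X1 x) < r / 2) by (apply Rabs_lt_between; lra). lra.
Qed.

Lemma glim_interior A x : (forall z, A z -> Dm z \/ Dp z) -> Dm x \/ Dp x -> glim A phi x (grad phi x).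
Proof.
  intros HA Hx i. rewrite coord_grad. 
  eapply filterlim_filter_le_1; [apply filter_le_within|]. apply (C1D_continuous _ _ _ (C1D_dphi x i Hx)).
Qed.

(** Every adherent point is interior, on the inlet, on the shock or on the wall, and each case
    provides a limit gradient; the edges fall under the wall. *)
Lemma glim_Dm_exists x : adh3 Dm x -> exists L, glim Dm phi x L /\
  (bdry2 Om (sec x) -> slip Om (sec x) L) /\ (Sigma_m1 Om x -> X1 L = um).
Proof.
  intros Ha. destruct (adh_closure Dm x (fun z H => proj1 H) Ha) as [Hx Hc].
  pose proof (adh_Dm_le x Ha) as Hf.
  destruct (classic (Om (sec x))) as [HO|HO].
  - assert (NB : ~ bdry2 Om (sec x)) by (intros [_ N]; auto).
    pose proof (f_gt _ HO). pose proof (f_lt _ HO).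
    destruct (Req_dec (X1 x) (-1)) as [E|N1].
    + assert (HS : Sigma_m1 Om x) by (split; assumption).
      destruct (proj1 (proj2 (fl_in _ _ _ _ _ _ _ _ _ fl _ HS)) Ha) as [L [HL [E1 _]]].
      exists L. split; [exact (grad_lim_filterlim _ _ _ _ HL)|]. tauto.
    + assert (N : ~ Sigma_m1 Om x) by (intros [E _]; auto).
      destruct (Rle_lt_or_eq_dec _ _ Hf) as [L|E].
      * assert (Dx : Dm x) by (repeat split; try assumption; lra).
        exists (grad phi x). split; [apply glim_interior; [auto|left; exact Dx]|]. tauto.
      * assert (Sx : shockS Om f x) by (repeat split; try assumption; lra).
        destruct (fl_RH _ _ _ _ _ _ _ _ _ fl x Sx) as [Lm [Lp [A [B _]]]].
        exists Lm. split; [exact (grad_lim_filterlim _ _ _ _ A)|]. tauto.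
  - assert (HB : bdry2 Om (sec x)) by (split; assumption).
    assert (HG : Gamma Om x) by (split; assumption).
    destruct (proj1 (fl_wall _ _ _ _ _ _ _ _ _ fl x HG) Ha) as [L [HL E1]].
    exists L. split; [exact (grad_lim_filterlim _ _ _ _ HL)|]. split; [auto|]. intros [_ O]. tauto.
Qed.

Lemma glim_Dp_exists x : adh3 Dp x -> exists L, glim Dp phi x L /\
  (bdry2 Om (sec x) -> slip Om (sec x) L) /\ (Sigma_1 Om x -> norm3 L = c1 /\ 0 <= X1 L).
Proof.
  intros Ha. destruct (adh_closure Dp x (fun z H => proj1 H) Ha) as [Hx Hc].
  pose proof (adh_Dp_ge x Ha) as Hf.
  destruct (classic (Om (sec x))) as [HO|HO].
  - assert (NB : ~ bdry2 Om (sec x)) by (intros [_ N]; auto).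
    pose proof (f_gt _ HO). pose proof (f_lt _ HO).
    destruct (Req_dec (X1 x) 1) as [E|N1].
    + assert (HS : Sigma_1 Om x) by (split; assumption).
      destruct (proj2 (fl_out _ _ _ _ _ _ _ _ _ fl _ HS) Ha) as [L [HL E1]].
      exists L. split; [exact (grad_lim_filterlim _ _ _ _ HL)|]. tauto.
    + assert (N : ~ Sigma_1 Om x) by (intros [E _]; auto).
      destruct (Rle_lt_or_eq_dec _ _ Hf) as [L|E].
      * assert (Dx : Dp x) by (repeat split; try assumption; lra).
        exists (grad phi x). split; [apply glim_interior; [auto|right; exact Dx]|]. tauto.
      * assert (Sx : shockS Om f x) by (repeat split; try assumption; lra).
        destruct (fl_RH _ _ _ _ _ _ _ _ _ fl x Sx) as [Lm [Lp [A [B _]]]].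
        exists Lp. split; [exact (grad_lim_filterlim _ _ _ _ B)|]. tauto.
  - assert (HB : bdry2 Om (sec x)) by (split; assumption).
    assert (HG : Gamma Om x) by (split; assumption).
    destruct (proj2 (fl_wall _ _ _ _ _ _ _ _ _ fl x HG) Ha) as [L [HL E1]].
    exists L. split; [exact (grad_lim_filterlim _ _ _ _ HL)|]. split; [auto|]. intros [_ O]. tauto.
Qed.

Lemma phi_lim (A : pt3 -> Prop) x : (forall z, A z -> inD Om z) -> inD Om x ->
  filterlim phi (within A (locally x)) (locally (phi x)).
Proof.
  intros HA Hx. apply (lipschitz_lim A (inD Om) phi x (fun _ => x)); auto; [apply fl| |apply filterlim_const].
  apply filterlim_const.
Qed.

(** * Shock relations up to the boundary *)

(** Tangential derivatives agree because [phi] is Lipschitz across the shock: two points that leave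
    the shock along a tangent direction tilted by [- eta] and by [+ eta] are only [2 * eta * t]
    apart. *)
Lemma jump_direction p e2 e3 Lm Lp : Om p -> glim Dm phi (pt (f p) p) Lm -> glim Dp phi (pt (f p) p) Lp ->
  dot3 Lm (F2 p * e2 + F3 p * e3, e2, e3) = dot3 Lp (F2 p * e2 + F3 p * e3, e2, e3).
Proof.
  intros Hp HLm HLp. set (x := pt (f p) p) in *. set (a := F2 p * e2 + F3 p * e3).
  assert (Sx : sec x = p) by apply sec_pt.
  assert (Dx : inD Om x).
  { split; [|rewrite Sx; exact Hp]. pose proof (f_gt p Hp). pose proof (f_lt p Hp). unfold x, pt, X1; simpl. lra. }
  apply NNPP. intros N. set (g := Rabs (dot3 Lm (a, e2, e3) - dot3 Lp (a, e2, e3))).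
  assert (Hg : 0 < g) by (apply Rabs_pos_lt; lra).
  destruct (fl_lip _ _ _ _ _ _ _ _ _ fl) as [K HK].
  (* The tilt changes both directional derivatives and separates the two points; these errors are of
     first order in [t], like the jump itself, so they must be absorbed by [eta]. *)
  destruct (exists_small (g / 4) (Rabs (X1 Lm) + Rabs (X1 Lp) + 2 * Rabs K)) as [eta [Heta Eeta]].
  { lra. } { pose proof (Rabs_pos (X1 Lm)). pose proof (Rabs_pos (X1 Lp)). pose proof (Rabs_pos K). lra. }
  assert (Df : is_derive (fun t => f (sec (shift x (0, e2, e3) t))) 0 a).
  { pose proof (is_derive_shift (fun y => f (sec y)) fDer x (0, e2, e3) 0) as D. rewrite shift_0 in D.
    specialize (D (C1D_f x (proj2 Dx))). evar_last; [exact D|]. Req. unfold fDer. rewrite Sx.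
    unfold a, X1, X2, X3; simpl. ring. }
  destruct (proj1 (is_derive_eps _ _ _) Df (eta / 2) ltac:(lra)) as [d [Hd HDf]].
  rewrite shift_0, Sx in HDf.
  assert (In : forall b, exists tau, 0 < tau /\ forall t, 0 < t < tau -> inD Om (shift x (b, e2, e3) t)).
  { intros b. pose proof (continuous_shift x (b, e2, e3) 0 (inD Om)) as C. rewrite shift_0 in C.
    specialize (C (open_inD x Dx)). unfold filtermap in C. apply locally_R in C. destruct C as [r [Hr C]].
    exists r. split; [exact Hr|]. intros t Ht. apply C. rewrite Rminus_0_r, Rabs_right; lra. }
  assert (Am : exists tau, 0 < tau /\ forall t, 0 < t < tau -> Dm (shift x (a - eta, e2, e3) t)).
  { destruct (In (a - eta)) as [tau [Ht HI]]. exists (Rmin tau d). split; [apply Rmin_glb_lt; lra|].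
    intros t Htt. pose proof (Rmin_l tau d). pose proof (Rmin_r tau d). split; [apply HI; lra|].
    specialize (HDf t ltac:(rewrite Rminus_0_r, Rabs_right; lra)).
    rewrite Rminus_0_r, (Rabs_right t) in HDf by lra. apply Rabs_le_between in HDf.
    assert (E : sec (shift x (a - eta, e2, e3) t) = sec (shift x (0, e2, e3) t)) by reflexivity. rewrite E.
    unfold shift at 1, X1; simpl. nra. }
  assert (Ap : exists tau, 0 < tau /\ forall t, 0 < t < tau -> Dp (shift x (a + eta, e2, e3) t)).
  { destruct (In (a + eta)) as [tau [Ht HI]]. exists (Rmin tau d). split; [apply Rmin_glb_lt; lra|].
    intros t Htt. pose proof (Rmin_l tau d). pose proof (Rmin_r tau d). split; [apply HI; lra|].
    specialize (HDf t ltac:(rewrite Rminus_0_r, Rabs_right; lra)).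
    rewrite Rminus_0_r, (Rabs_right t) in HDf by lra. apply Rabs_le_between in HDf.
    assert (E : sec (shift x (a + eta, e2, e3) t) = sec (shift x (0, e2, e3) t)) by reflexivity. rewrite E.
    unfold shift at 1, X1; simpl. nra. }
  destruct Am as [tm [Htm Am]], Ap as [tp [Htp Ap]].
  destruct (directional_limit Dm phi (fun i => dpar i phi) x (a - eta, e2, e3) Lm (phi x) tm Htm Am
     (fun z H => C1D_phi z (or_introl H)) (phi_lim Dm x (fun z H => proj1 H) Dx) HLm (g / 8) ltac:(lra)) as [sm [Hsm Km]].
  destruct (directional_limit Dp phi (fun i => dpar i phi) x (a + eta, e2, e3) Lp (phi x) tp Htp Ap
     (fun z H => C1D_phi z (or_intror H)) (phi_lim Dp x (fun z H => proj1 H) Dx) HLp (g / 8) ltac:(lra)) as [sp [Hsp Kp]].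
  pose (t := Rmin sm sp / 2).
  assert (Ht : 0 < t /\ t < sm /\ t < sp).
  { unfold t. pose proof (Rmin_l sm sp). pose proof (Rmin_r sm sp). assert (0 < Rmin sm sp) by (apply Rmin_glb_lt; lra). lra. }
  specialize (Km t ltac:(lra)). specialize (Kp t ltac:(lra)).
  pose proof (HK _ _ (proj1 (Am t ltac:(lra))) (proj1 (Ap t ltac:(lra)))) as L.
  set (vm := phi (shift x (a - eta, e2, e3) t)) in *. set (vp := phi (shift x (a + eta, e2, e3) t)) in *.
  assert (Dist : dist3 (shift x (a - eta, e2, e3) t) (shift x (a + eta, e2, e3) t) <= 2 * eta * t).
  { eapply Rle_trans; [apply dist3_le_sum|]. unfold shift, X1, X2, X3; simpl.
    rewrite !Rminus_diag, Rabs_R0.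
    replace (f p + t * (a - eta) - (f p + t * (a + eta))) with (- (2 * eta * t)) by ring.
    rewrite Rabs_Ropp, Rabs_right; nra. }
  assert (D0 : 0 <= dist3 (shift x (a - eta, e2, e3) t) (shift x (a + eta, e2, e3) t)) by apply sqrt_pos.
  assert (L2 : Rabs (vm - vp) <= Rabs K * (2 * eta * t)).
  { eapply Rle_trans; [exact L|]. pose proof (Rle_abs K). pose proof (Rabs_pos K).
    apply Rle_trans with (Rabs K * dist3 (shift x (a - eta, e2, e3) t) (shift x (a + eta, e2, e3) t));
      [apply Rmult_le_compat_r; lra|apply Rmult_le_compat_l; lra]. }
  assert (Em : dot3 Lm (a - eta, e2, e3) = dot3 Lm (a, e2, e3) - eta * X1 Lm) by (unfold dot3, X1, X2, X3; simpl; ring).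
  assert (Ep : dot3 Lp (a + eta, e2, e3) = dot3 Lp (a, e2, e3) + eta * X1 Lp) by (unfold dot3, X1, X2, X3; simpl; ring).
  rewrite Em in Km. rewrite Ep in Kp.
  set (dm := dot3 Lm (a, e2, e3)) in *. set (dp := dot3 Lp (a, e2, e3)) in *.
  assert (B : Rabs (t * (dm - dp)) <= t * (g / 4 + (Rabs (X1 Lm) + Rabs (X1 Lp) + 2 * Rabs K) * eta)).
  { replace (t * (dm - dp)) with (- (vm - phi x - t * (dm - eta * X1 Lm)) + (vp - phi x - t * (dp + eta * X1 Lp))
       + (vm - vp) + t * eta * X1 Lm + t * eta * X1 Lp) by ring.
    assert (T1 : Rabs (t * eta * X1 Lm) <= t * eta * Rabs (X1 Lm)).
    { rewrite Rabs_mult, (Rabs_right (t * eta)); [lra|nra]. }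
    assert (T2 : Rabs (t * eta * X1 Lp) <= t * eta * Rabs (X1 Lp)).
    { rewrite Rabs_mult, (Rabs_right (t * eta)); [lra|nra]. }
    apply Rabs_le_between in Km. apply Rabs_le_between in Kp. apply Rabs_le_between in L2.
    apply Rabs_le_between in T1. apply Rabs_le_between in T2. apply Rabs_le_between. lra. }
  rewrite Rabs_mult, (Rabs_right t) in B by lra. fold g in B.
  apply Rmult_le_reg_l in B; [|lra]. unfold g in *. fold dm dp in B. fold dm dp in Eeta. fold dm dp in Hg. lra.
Qed.

Lemma glim_near A x L : glim A phi x L -> forall e, 0 < e -> exists d, 0 < d /\ forall x' L', dist3 x' x < d ->
  adh3 A x' -> glim A phi x' L' -> forall i, Rabs (coord i L' - coord i L) <= e.
Proof.
  intros H e He.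
  destruct (within_lim_near A x _ _ e He (H I1)) as [d1 [H1 K1]].
  destruct (within_lim_near A x _ _ e He (H I2)) as [d2 [H2 K2]].
  destruct (within_lim_near A x _ _ e He (H I3)) as [d3 [H3 K3]].
  exists (Rmin d1 (Rmin d2 d3)). split; [repeat apply Rmin_glb_lt; assumption|].
  intros x' L' Hd Ha HL i.
  pose proof (Rmin_l d1 (Rmin d2 d3)). pose proof (Rmin_r d1 (Rmin d2 d3)).
  pose proof (Rmin_l d2 d3). pose proof (Rmin_r d2 d3).
  destruct i; [apply (K1 x')|apply (K2 x')|apply (K3 x')]; auto; try lra; apply HL.
Qed.

Lemma adh_shock p : closure2 Om p -> adh3 Dm (pt (f p) p) /\ adh3 Dp (pt (f p) p).
Proof.
  intros Hp. pose proof (f_bounds p Hp).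
  split; [apply adh_Dm|apply adh_Dp]; rewrite sec_pt; try exact Hp; unfold pt, X1; simpl; lra.
Qed.

Lemma continuous_rho q : 0 < dens_base gam b0 q -> continuous (rho gam b0) q.
Proof. intros H. apply (ex_derive_continuous (rho gam b0)). eexists. apply is_derive_rho; [apply fl..|exact H]. Qed.

Lemma dens_sub q : q <= cs ^ 2 -> 0 < dens_base gam b0 q.
Proof. apply dens_pos_subsonic; apply fl. Qed.

(** The Rankine-Hugoniot condition is prescribed over the open cross-section; approximating
    sequences bring it to points where the shock meets the wall. *)
Lemma shock_seq p Lm Lp : closure2 Om p -> glim Dm phi (pt (f p) p) Lm -> glim Dp phi (pt (f p) p) Lp ->
  exists (q : nat -> pt2) (M P : nat -> pt3), 
    (forall n, Om (q n) /\ glim Dm phi (pt (f (q n)) (q n)) (M n) /\ glim Dp phi (pt (f (q n)) (q n)) (P n) /\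
      rho gam b0 (normsq (P n)) * dot3 (P n) (1, - F2 (q n), - F3 (q n)) =
       rho gam b0 (normsq (M n)) * dot3 (M n) (1, - F2 (q n), - F3 (q n))) /\
    (forall i, filterlim (fun n => coord i (M n)) eventually (locally (coord i Lm))) /\
    (forall i, filterlim (fun n => coord i (P n)) eventually (locally (coord i Lp))) /\
    filterlim (fun n => F2 (q n)) eventually (locally (F2 p)) /\
    filterlim (fun n => F3 (q n)) eventually (locally (F3 p)).
Proof.
  intros Hp HLm HLp.
  assert (K : forall n : nat, exists z : pt2 * (pt3 * pt3), let q := fst z in let M := fst (snd z) in let P := snd (snd z) in
     Om q /\ glim Dm phi (pt (f q) q) M /\ glim Dp phi (pt (f q) q) P /\
      rho gam b0 (normsq P) * dot3 P (1, - F2 q, - F3 q) = rho gam b0 (normsq M) * dot3 M (1, - F2 q, - F3 q) /\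
      dist2 q p < / (INR n + 1)).
  { intros n. destruct (Hp _ (inv_INR_pos n)) as [q [Oq Hq]].
    assert (Sx : shockS Om f (pt (f q) q)).
    { pose proof (f_gt q Oq). pose proof (f_lt q Oq). unfold shockS, inD. rewrite sec_pt. unfold pt, X1; simpl.
      repeat split; try assumption; lra. }
    destruct (fl_RH _ _ _ _ _ _ _ _ _ fl _ Sx) as [M [P [A [B [C _]]]]]. rewrite !norm3_sqr, sec_pt in C.
    exists (q, (M, P)). simpl. repeat split; try assumption.
    - exact (grad_lim_filterlim _ _ _ _ A).
    - exact (grad_lim_filterlim _ _ _ _ B). }
  destruct (nat_choice _ K) as [z Hz]. clear K.
  pose (q := fun n => fst (z n)). pose (M := fun n => fst (snd (z n))). pose (P := fun n => snd (snd (z n))).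
  assert (Hq : forall n, Om (q n)) by (intros n; apply Hz).
  assert (Cq : forall h, cont2_on (closure2 Om) h -> filterlim (fun n => h (q n)) eventually (locally (h p))).
  { intros h Hh. apply filterlim_R; [typeclasses eauto|]. intros e He. destruct (Hh p Hp e He) as [d [Hd H]].
    destruct (inv_INR_small d Hd) as [N HN]. exists N. intros n Hn. apply H; [apply closure2_incl, Hq|].
    eapply Rlt_trans; [apply Hz|apply HN, Hn]. }
  assert (Cx : forall d, 0 < d -> eventually (fun n => dist3 (pt (f (q n)) (q n)) (pt (f p) p) < d)).
  { intros d Hd. 
    destruct (proj1 (filterlim_R eventually _ _) (Cq f (fl_fc _ _ _ _ _ _ _ _ _ fl)) (d / 2) ltac:(lra)) as [N1 HN1].
    destruct (inv_INR_small (d / 2) ltac:(lra)) as [N2 HN2]. exists (max N1 N2). intros n Hn.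
    eapply Rle_lt_trans; [apply dist3_pt|]. specialize (HN1 n ltac:(lia)). specialize (HN2 n ltac:(lia)).
    assert (dist2 (q n) p < / (INR n + 1)) by apply Hz. lra. }
  exists q, M, P. split; [|split; [|split; [|split]]].
  - intros n. pose proof (Hz n) as H. simpl in H. fold (q n) (M n) (P n) in H. tauto.
  - intros i. apply filterlim_R; [typeclasses eauto|]. intros e He.
    destruct (glim_near Dm _ _ HLm (e / 2) ltac:(lra)) as [d [Hd H]]. destruct (Cx d Hd) as [N HN].
    exists N. intros n Hn. eapply Rle_lt_trans; [apply (H _ _ (HN n Hn)); [apply adh_shock, closure2_incl, Hq|apply Hz]|lra].
  - intros i. apply filterlim_R; [typeclasses eauto|]. intros e He.
    destruct (glim_near Dp _ _ HLp (e / 2) ltac:(lra)) as [d [Hd H]]. destruct (Cx d Hd) as [N HN].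
    exists N. intros n Hn. eapply Rle_lt_trans; [apply (H _ _ (HN n Hn)); [apply adh_shock, closure2_incl, Hq|apply Hz]|lra].
  - apply Cq, fl.
  - apply Cq, fl.
Qed.

(** Passing to the limit in the flux relation needs [rho] continuous at both states: at [Lp] this
    follows from subsonicity, at [Lm] it is the hypothesis on [dens_base]. *)
Lemma shock_relations p Lm Lp : closure2 Om p -> glim Dm phi (pt (f p) p) Lm -> glim Dp phi (pt (f p) p) Lp ->
  0 < dens_base gam b0 (normsq Lm) ->
  X2 Lm + F2 p * X1 Lm = X2 Lp + F2 p * X1 Lp /\
  X3 Lm + F3 p * X1 Lm = X3 Lp + F3 p * X1 Lp /\
  rho gam b0 (normsq Lp) * dot3 Lp (1, - F2 p, - F3 p) = rho gam b0 (normsq Lm) * dot3 Lm (1, - F2 p, - F3 p).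
Proof.
  intros Hp HLm HLp Hd.
  destruct (shock_seq p Lm Lp Hp HLm HLp) as [q [M [P [H [HM [HP [C2 C3]]]]]]].
  pose proof (HM I1) as M1. pose proof (HM I2) as M2. pose proof (HM I3) as M3.
  pose proof (HP I1) as P1. pose proof (HP I2) as P2. pose proof (HP I3) as P3.
  assert (J : forall n e2 e3, dot3 (M n) (F2 (q n) * e2 + F3 (q n) * e3, e2, e3) = dot3 (P n) (F2 (q n) * e2 + F3 (q n) * e3, e2, e3)).
  { intros n e2 e3. destruct (H n) as [A [B [C _]]]. apply jump_direction; assumption. }
  split; [|split].
  - apply (seq_lim_unique (fun n => X2 (M n) + F2 (q n) * X1 (M n))).
    + apply filterlim_Rplus; [typeclasses eauto|exact M2|]. apply filterlim_Rmult; [typeclasses eauto|exact C2|exact M1].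
    + apply (filterlim_ext (fun n => X2 (P n) + F2 (q n) * X1 (P n))).
      { intros n. pose proof (J n 1 0) as E. unfold dot3, X1, X2, X3 in *; simpl in E. Req. lra. }
      apply filterlim_Rplus; [typeclasses eauto|exact P2|]. apply filterlim_Rmult; [typeclasses eauto|exact C2|exact P1].
  - apply (seq_lim_unique (fun n => X3 (M n) + F3 (q n) * X1 (M n))).
    + apply filterlim_Rplus; [typeclasses eauto|exact M3|]. apply filterlim_Rmult; [typeclasses eauto|exact C3|exact M1].
    + apply (filterlim_ext (fun n => X3 (P n) + F3 (q n) * X1 (P n))).
      { intros n. pose proof (J n 0 1) as E. unfold dot3, X1, X2, X3 in *; simpl in E. Req. lra. }
      apply filterlim_Rplus; [typeclasses eauto|exact P3|]. apply filterlim_Rmult; [typeclasses eauto|exact C3|exact P1].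
  - assert (G : forall (T : nat -> pt3) (L : pt3), (forall i, filterlim (fun n => coord i (T n)) eventually (locally (coord i L))) ->
       0 < dens_base gam b0 (normsq L) ->
       filterlim (fun n => rho gam b0 (normsq (T n)) * dot3 (T n) (1, - F2 (q n), - F3 (q n))) eventually
         (locally (rho gam b0 (normsq L) * dot3 L (1, - F2 p, - F3 p)))).
    { intros T L HT HL. apply filterlim_Rmult; [typeclasses eauto| |].
      - apply (filterlim_cont eventually (fun n => normsq (T n)) (rho gam b0)); [|apply continuous_rho, HL].
        apply coord_normsq_lim; [typeclasses eauto|exact HT].
      - unfold dot3. apply filterlim_Rplus; [typeclasses eauto| |].
        + apply filterlim_Rplus; [typeclasses eauto| |]; (apply filterlim_Rmult; [typeclasses eauto| |]).
          * apply (HT I1).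
          * exact (filterlim_Rconst eventually 1).
          * apply (HT I2).
          * exact (filterlim_Ropp _ _ _ C2).
        + apply filterlim_Rmult; [typeclasses eauto|apply (HT I3)|exact (filterlim_Ropp _ _ _ C3)]. }
    eapply seq_lim_unique.
    + apply (G P Lp HP). apply dens_sub. eapply glim_sub; [apply (adh_shock p Hp)|exact HLp].
    + apply (filterlim_ext (fun n => rho gam b0 (normsq (M n)) * dot3 (M n) (1, - F2 (q n), - F3 (q n)))).
      { intros n. symmetry. apply H. }
      apply (G M Lm HM Hd).
Qed.

Definition Ustate : pt3 := (um, 0, 0).

Lemma normsq_U : normsq Ustate = um ^ 2.
Proof. unfold normsq, Ustate, X1, X2, X3; simpl. ring. Qed.

(** [l] cannot vanish: the downstream limit would then be the supersonic upstream state. *)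
Lemma shock_downstream p Lp : closure2 Om p -> glim Dm phi (pt (f p) p) Ustate -> glim Dp phi (pt (f p) p) Lp ->
  let l := X1 Lp - um in
  l <> 0 /\ X2 Lp = - l * F2 p /\ X3 Lp = - l * F3 p /\
  rho gam b0 (normsq Lp) * (X1 Lp - F2 p * X2 Lp - F3 p * X3 Lp) = rho gam b0 (um ^ 2) * um.
Proof.
  intros Hp HLm HLp l.
  destruct (shock_relations p Ustate Lp Hp HLm HLp) as [E2 [E3 E]].
  { rewrite normsq_U. apply fl. }
  rewrite normsq_U in E. unfold Ustate, dot3, X1, X2, X3 in *; simpl in *.
  pose proof (glim_sub _ _ (proj2 (adh_shock p Hp)) HLp) as B.
  assert (X : snd (fst Lp) = - l * F2 p) by (unfold l; lra).
  assert (Y : snd Lp = - l * F3 p) by (unfold l; lra).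
  split; [|split; [exact X|split; [exact Y|]]].
  - intros Z. unfold normsq, X1, X2, X3 in B. rewrite X, Y, Z in B. unfold l in Z.
    pose proof (fl_um _ _ _ _ _ _ _ _ _ fl). pose proof cs_pos. assert (fst (fst Lp) = um) by lra. rewrite H1 in B. nra.
  - replace (fst (fst Lp) - F2 p * snd (fst Lp) - F3 p * snd Lp) with
      (fst (fst Lp) * 1 + snd (fst Lp) * - F2 p + snd Lp * - F3 p) by ring. rewrite E. ring.
Qed.

(** The entropy inequality stays strict at wall points, since the downstream limit is at most sonic
    and [um > cstar]. *)
Lemma shock_spacelike p : closure2 Om p -> glim Dm phi (pt (f p) p) Ustate ->
  (1 + F2 p ^ 2 + F3 p ^ 2) * dens_base gam b0 (um ^ 2) < um ^ 2.
Proof.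
  intros Hp HLm. destruct (glim_Dp_exists _ (proj2 (adh_shock p Hp))) as [Lp [HLp _]].
  destruct (shock_downstream p Lp Hp HLm HLp) as [_ [E2 [E3 E]]].
  pose proof (glim_sub _ _ (proj2 (adh_shock p Hp)) HLp) as B.
  set (l := X1 Lp - um) in *.
  assert (E1 : X1 Lp = um + l) by (unfold l; ring).
  assert (N : normsq Lp = (um + l) ^ 2 + (l * F2 p) ^ 2 + (l * F3 p) ^ 2).
  { unfold normsq. rewrite E1, E2, E3. ring. }
  apply (shock_slope gam b0 (fl_gam _ _ _ _ _ _ _ _ _ fl) (fl_stag _ _ _ _ _ _ _ _ _ fl) um l (F2 p) (F3 p)).
  - apply um_pos.
  - apply fl.
  - rewrite <- N. pose proof (fl_um _ _ _ _ _ _ _ _ _ fl). pose proof cs_pos. nra.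
  - rewrite <- N, <- E, E1, E2, E3. f_equal. ring.
Qed.

(** * The supersonic region is uniform *)

Local Notation ph i := (dpar i phi).
Local Notation ph2 i j := (dpar j (dpar i phi)).

Definition Nq (z : pt3) : R := ph I1 z * ph I1 z + ph I2 z * ph I2 z + ph I3 z * ph I3 z.

Lemma Nq_normsq z : Nq z = normsq (grad phi z).
Proof. unfold Nq, normsq, grad, X1, X2, X3; simpl. ring. Qed.

Definition NqD (i : idx) (z : pt3) : R := 2 * (ph I1 z * ph2 I1 i z + ph I2 z * ph2 I2 i z + ph I3 z * ph2 I3 i z).

Lemma C1D_Nq x : Dm x \/ Dp x -> C1D Nq NqD x.
Proof.
  intros H.
  pose proof (C1D_plus _ _ _ _ x (C1D_plus _ _ _ _ x (C1D_mult _ _ _ _ x (C1D_dphi x I1 H) (C1D_dphi x I1 H))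
    (C1D_mult _ _ _ _ x (C1D_dphi x I2 H) (C1D_dphi x I2 H))) (C1D_mult _ _ _ _ x (C1D_dphi x I3 H) (C1D_dphi x I3 H))) as K.
  eapply C1D_ext_D; [|exact K]. apply filter_forall. intros y i. unfold NqD. Req. ring.
Qed.

Lemma dens_Nq x : Dm x \/ Dp x -> 0 < dens_base gam b0 (Nq x).
Proof. intros H. rewrite Nq_normsq, <- norm3_sqr. apply (fl_pde _ _ _ _ _ _ _ _ _ fl x H). Qed.

Definition rho' (q : R) : R := - rho gam b0 q / (2 * dens_base gam b0 q).

Lemma continuous_dens q : continuous (dens_base gam b0) q.
Proof. apply (ex_derive_continuous (dens_base gam b0)). unfold dens_base. auto_derive. trivial. Qed.

Lemma locally_dens q : 0 < dens_base gam b0 q -> locally q (fun u => 0 < dens_base gam b0 u).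
Proof. intros H. apply (continuous_dens q (fun u => 0 < u)), (open_gt 0 (dens_base gam b0 q)), H. Qed.

Lemma continuous_rho' q : 0 < dens_base gam b0 q -> continuous rho' q.
Proof.
  intros H. unfold rho', Rdiv. apply continuous_Rmult; [apply continuous_Ropp, continuous_rho, H|].
  apply (continuous_comp (fun q => 2 * dens_base gam b0 q) Rinv).
  - apply continuous_Rmult; [apply continuous_const|apply continuous_dens].
  - apply continuous_Rinv. lra.
Qed.

Definition Amass (i : idx) (z : pt3) : R := rho gam b0 (Nq z) * ph i z.
Definition AmassD (i j : idx) (z : pt3) : R := rho' (Nq z) * NqD j z * ph i z + rho gam b0 (Nq z) * ph2 i j z.

Lemma C1D_Amass x i : Dm x \/ Dp x -> C1D (Amass i) (AmassD i) x.
Proof.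
  intros H. apply (C1D_mult (fun z => rho gam b0 (Nq z)) (fun j z => rho' (Nq z) * NqD j z) (ph i) (fun j => ph2 i j)).
  - apply (C1D_comp (rho gam b0) rho'); [|apply continuous_rho', dens_Nq, H|apply C1D_Nq, H].
    eapply filter_imp; [|apply (locally_dens (Nq x) (dens_Nq x H))]. intros u Hu.
    apply is_derive_rho; [apply fl..|exact Hu].
  - apply C1D_dphi, H.
Qed.

Lemma mass_conservation x : Dm x \/ Dp x -> AmassD I1 I1 x + AmassD I2 I2 x + AmassD I3 I3 x = 0.
Proof.
  intros H. destruct (proj2 (fl_pde _ _ _ _ _ _ _ _ _ fl x H)) as [a [b [c [Ha [Hb [Hc S]]]]]].
  assert (K : forall i l, is_derive (line i (flux gam b0 phi i) x) (coord i x) l -> AmassD i i x = l).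
  { intros i l Hl. pose proof (C1D_is_par _ _ _ i (C1D_Amass x i H)) as P.
    assert (P' : is_par i (Amass i) x l).
    { apply (is_par_ext_loc i (flux gam b0 phi i)); [|exact Hl]. apply filter_forall. intros z.
      unfold flux, Amass. rewrite norm3_sqr, Nq_normsq. reflexivity. }
    rewrite <- (is_par_dpar _ _ _ _ P). apply is_par_dpar, P'. }
  rewrite (K I1 a Ha), (K I2 b Hb), (K I3 c Hc). exact S.
Qed.

Lemma continuity_2d_of_3d (h : pt3 -> R) (g : R * R -> pt3) u v : continuous g (u, v) -> continuous h (g (u, v)) ->
  continuity_2d_pt (fun a b => h (g (a, b))) u v.
Proof.
  intros Hg Hh. apply continuity_2d_pt_filterlim.
  apply (continuous_ext (fun z => h (g z))); [intros [a b]; reflexivity|].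
  apply (continuous_comp g h); assumption.
Qed.

Lemma hessian_sym x i : Dm x \/ Dp x -> ph2 I1 i x = ph2 i I1 x.
Proof.
  intros H. destruct (fl_C2 _ _ _ _ _ _ _ _ _ fl) as [Q1 [_ [_ Q2]]].
  assert (CC : forall i j, continuous (ph2 i j) x) by (intros a b; apply (cont3_on_continuous _ _ x open_Dmp H), Q2).
  destruct x as [[a b] c].
  assert (pull : forall (g : R * R -> pt3) w, continuous g w -> g w = (a, b, c) -> locally w (fun z => Dm (g z) \/ Dp (g z))).
  { intros g w Hg E. apply (Hg (fun y => Dm y \/ Dp y)). rewrite E. apply open_Dmp, H. }
  destruct i; [reflexivity| |].
  - assert (Cg : continuous (fun z : R * R => (fst z, snd z, c) : pt3) (a, b)).
    { repeat apply continuous_pair; [apply continuous_fst|apply continuous_snd|apply continuous_const]. }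
    symmetry. apply (Schwarz (fun u v => phi (u, v, c)) a b).
    + apply locally_2d_locally. eapply filter_imp; [|apply (pull _ _ Cg eq_refl)]. intros [u v] Hu. simpl in Hu |- *.
      pose proof (Q1 _ Hu) as Q. repeat split; [apply (Q I1 I1)|apply (Q I2 I2)|apply (Q I2 I1)|apply (Q I1 I2)].
    + apply (continuity_2d_of_3d (ph2 I2 I1) (fun z => (fst z, snd z, c)) a b Cg (CC I2 I1)).
    + apply (continuity_2d_of_3d (ph2 I1 I2) (fun z => (fst z, snd z, c)) a b Cg (CC I1 I2)).
  - assert (Cg : continuous (fun z : R * R => (fst z, b, snd z) : pt3) (a, c)).
    { repeat apply continuous_pair; [apply continuous_fst|apply continuous_const|apply continuous_snd]. }
    symmetry. apply (Schwarz (fun u v => phi (u, b, v)) a c).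
    + apply locally_2d_locally. eapply filter_imp; [|apply (pull _ _ Cg eq_refl)]. intros [u v] Hu. simpl in Hu |- *.
      pose proof (Q1 _ Hu) as Q. repeat split; [apply (Q I1 I1)|apply (Q I3 I3)|apply (Q I3 I1)|apply (Q I1 I3)].
    + apply (continuity_2d_of_3d (ph2 I3 I1) (fun z => (fst z, b, snd z)) a c Cg (CC I3 I1)).
    + apply (continuity_2d_of_3d (ph2 I1 I3) (fun z => (fst z, b, snd z)) a c Cg (CC I1 I3)).
Qed.

(* The [x1]-momentum current, relative to the uniform state [Ustate]. *)
Definition Ecur (i : idx) (z : pt3) : R :=
  Amass i z * (ph I1 z - um) - match i with I1 => Gpot gam b0 (Nq z) - Gpot gam b0 (um ^ 2) | _ => 0 end.

Definition EcurD (i j : idx) (z : pt3) : R :=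
  AmassD i j z * (ph I1 z - um) + Amass i z * ph2 I1 j z
  - match i with I1 => rho gam b0 (Nq z) / 2 * NqD j z | _ => 0 end.

Lemma C1D_Ecur x i : Dm x -> C1D (Ecur i) (EcurD i) x.
Proof.
  intros H0. assert (H : Dm x \/ Dp x) by auto.
  assert (P : C1D (fun z => Amass i z * (ph I1 z - um)) (fun j z => AmassD i j z * (ph I1 z - um) + Amass i z * (ph2 I1 j z - 0)) x).
  { apply (C1D_mult (Amass i) (AmassD i)); [apply C1D_Amass, H|]. apply (C1D_minus (ph I1) (fun j => ph2 I1 j)); [apply C1D_dphi, H|apply C1D_const]. }
  assert (Q : C1D (fun z => match i with I1 => Gpot gam b0 (Nq z) - Gpot gam b0 (um ^ 2) | _ => 0 end)
             (fun j z => match i with I1 => rho gam b0 (Nq z) / 2 * NqD j z - 0 | _ => 0 end) x).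
  { destruct i; [|apply C1D_const..].
    apply (C1D_minus (fun z => Gpot gam b0 (Nq z)) (fun j z => rho gam b0 (Nq z) / 2 * NqD j z)); [|apply C1D_const].
    apply (C1D_comp (Gpot gam b0) (fun q => rho gam b0 q / 2)); [| |apply C1D_Nq, H].
    - eapply filter_imp; [|apply (locally_dens (Nq x) (dens_Nq x H))]. intros u Hu.
      apply is_derive_Gpot; [apply fl..|exact Hu].
    - apply continuous_Rmult; [apply continuous_rho, dens_Nq, H|apply continuous_const]. }
  eapply C1D_ext_D; [|exact (C1D_minus _ _ _ _ x P Q)].
  apply filter_forall. intros y j. unfold EcurD. destruct i; Req; ring.
Qed.

(** Two cancellations: the factor [ph I1 - um] multiplies the mass balance, and [Amass] paired with
    the gradient of [ph I1] is the [x1]-derivative of the pressure term, by symmetry of the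
    Hessian. *)
Lemma Ecur_div x : Dm x -> EcurD I1 I1 x + EcurD I2 I2 x + EcurD I3 I3 x = 0.
Proof.
  intros H0. assert (H : Dm x \/ Dp x) by auto. unfold EcurD.
  replace (AmassD I3 I3 x) with (- AmassD I1 I1 x - AmassD I2 I2 x) by (pose proof (mass_conservation x H); lra).
  unfold Amass, NqD. rewrite (hessian_sym x I2 H), (hessian_sym x I3 H). field.
Qed.

Lemma phi_inlet : exists K, 0 <= K /\ forall x, inD Om x -> Rabs (phi x + um) <= K * (X1 x + 1).
Proof.
  destruct (fl_lip _ _ _ _ _ _ _ _ _ fl) as [K HK]. exists (Rabs K). split; [apply Rabs_pos|].
  intros x Hx. apply Rnot_lt_le. intros L.
  set (gap := Rabs (phi x + um) - Rabs K * (X1 x + 1)). assert (Hg : 0 < gap) by (unfold gap; lra).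
  assert (HS : Sigma_m1 Om (pt (-1) (sec x))) by (split; [reflexivity|rewrite sec_pt; apply Hx]).
  destruct (proj1 (fl_in _ _ _ _ _ _ _ _ _ fl _ HS)) as [_ Lm].
  destruct (Lm (gap / 2) ltac:(lra)) as [d [Hd H]].
  pose (a := Rmin (d / 2) ((X1 x + 1) / 2)). pose proof (proj1 Hx) as Hx1.
  assert (Ha : 0 < a /\ a < d /\ a < X1 x + 1).
  { unfold a. pose proof (Rmin_l (d / 2) ((X1 x + 1) / 2)). pose proof (Rmin_r (d / 2) ((X1 x + 1) / 2)).
    split; [apply Rmin_glb_lt; lra|lra]. }
  assert (Dz : inD Om (pt (-1 + a) (sec x))).
  { split; [|rewrite sec_pt; apply Hx]. unfold pt, X1 at 1 2; simpl. lra. }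
  specialize (H _ Dz).
  assert (Dd : dist3 (pt (-1 + a) (sec x)) (pt (-1) (sec x)) < d).
  { eapply Rle_lt_trans; [apply dist3_pt|]. rewrite dist2_refl. replace (-1 + a - -1) with a by ring. rewrite Rabs_right; lra. }
  specialize (H Dd). pose proof (HK _ _ Hx Dz) as L2. set (z := pt (-1 + a) (sec x)) in *.
  assert (Dxz : dist3 x z <= X1 x + 1).
  { rewrite <- (pt_sec x). unfold z. eapply Rle_trans; [apply dist3_pt|]. rewrite dist2_refl. 
    rewrite Rabs_right; unfold pt, X1 in *; simpl in *; lra. }
  assert (D0 : 0 <= dist3 x z) by apply sqrt_pos.
  assert (K * dist3 x z <= Rabs K * (X1 x + 1)).
  { pose proof (Rle_abs K). pose proof (Rabs_pos K).
    apply Rle_trans with (Rabs K * dist3 x z); [apply Rmult_le_compat_r; lra|apply Rmult_le_compat_l; lra]. }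
  assert (Rabs (phi x + um) <= Rabs (phi x - phi z) + Rabs (phi z - - um)).
  { replace (phi x + um) with ((phi x - phi z) + (phi z - - um)) by ring. apply Rabs_triang. }
  unfold gap in *. lra.
Qed.

Definition uniform_below (T : R) : Prop := forall x, Dm x -> X1 x < T -> grad phi x = Ustate.

(** The tangential derivatives vanish because [phi + um] is of order [X1 + 1]: a tangential
    direction tilted by [eta] into the domain has a directional derivative of order [eta]. *)
Lemma inlet_state p : Om p -> glim Dm phi (pt (-1) p) Ustate.
Proof.
  intros Hp. pose proof (f_gt p Hp) as Hf. set (x := pt (-1) p).
  assert (Sx : sec x = p) by apply sec_pt.
  assert (Ha : adh3 Dm x).
  { apply adh_Dm; [rewrite Sx; apply closure2_incl, Hp|]. rewrite Sx. unfold x, pt, X1; simpl. lra. }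
  destruct (glim_Dm_exists x Ha) as [L [HL [_ E1]]].
  assert (HS : Sigma_m1 Om x) by (split; [reflexivity|rewrite Sx; exact Hp]).
  specialize (E1 HS). destruct phi_inlet as [K [HK0 HK]].
  assert (Tan : forall e2 e3, X2 L * e2 + X3 L * e3 = 0).
  { intros e2 e3. apply NNPP. intros N. set (g := Rabs (X2 L * e2 + X3 L * e3)).
    assert (Hg : 0 < g) by (apply Rabs_pos_lt, N).
    destruct (exists_small (g / 4) (K + Rabs um)) as [eta [Heta Eeta]]; [lra|pose proof (Rabs_pos um); lra|].
    assert (In : exists tau, 0 < tau /\ forall t, 0 < t < tau -> Dm (shift x (eta, e2, e3) t)).
    { assert (Cc : locally x (fun y => Om (sec y) /\ X1 y < f (sec y))).
      { assert (C : continuous (fun y => f (sec y) - X1 y) x).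
        { apply continuous_Rminus; [|apply continuous_X1].
          apply (C1D_continuous _ _ _ (C1D_f x ltac:(rewrite Sx; exact Hp))). }
        apply filter_and; [apply locally_Om; rewrite Sx; exact Hp|].
        eapply filter_imp; [|apply (C (fun u => 0 < u)), (open_gt 0 (f (sec x) - X1 x)); rewrite Sx; unfold x, pt, X1; simpl; lra].
        cbv beta. intros y Hy. simpl in Hy. lra. }
      pose proof (continuous_shift x (eta, e2, e3) 0 (fun y => Om (sec y) /\ X1 y < f (sec y))) as C. rewrite shift_0 in C.
      specialize (C Cc). unfold filtermap in C. apply locally_R in C. destruct C as [r [Hr C]].
      exists r. split; [exact Hr|]. intros t Ht. destruct (C t ltac:(rewrite Rminus_0_r, Rabs_right; lra)) as [A B].
      pose proof (f_lt _ A). split; [split; [|exact A]|exact B].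
      assert (X1 (shift x (eta, e2, e3) t) = -1 + t * eta) by reflexivity. nra. }
    destruct In as [tau [Htau In]].
    assert (PL : filterlim phi (within Dm (locally x)) (locally (- um))).
    { apply filterlim_R; [typeclasses eauto|]. intros e He.
      destruct (proj1 (fl_in _ _ _ _ _ _ _ _ _ fl _ HS)) as [_ Lm]. destruct (Lm e He) as [d [Hd H]].
      unfold within. apply locally3. exists d. split; [exact Hd|]. intros z Hz Dz. apply H; [apply Dz|exact Hz]. }
    destruct (directional_limit Dm phi (fun i => ph i) x (eta, e2, e3) L (- um) tau Htau In
      (fun z H => C1D_phi z (or_introl H)) PL HL (g / 4) ltac:(lra)) as [s [Hs Ks]].
    specialize (Ks (s / 2) ltac:(lra)). specialize (HK _ (proj1 (In (s / 2) ltac:(lra)))).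
    set (v := phi (shift x (eta, e2, e3) (s / 2))) in *.
    assert (EX : X1 (shift x (eta, e2, e3) (s / 2)) + 1 = s / 2 * eta).
    { unfold shift, x, pt, X1; simpl. ring. }
    rewrite EX in HK.
    assert (ED : dot3 L (eta, e2, e3) = um * eta + (X2 L * e2 + X3 L * e3)).
    { unfold dot3. rewrite E1. unfold X1, X2, X3; simpl. ring. }
    rewrite ED in Ks.
    set (w := X2 L * e2 + X3 L * e3) in *. set (t := s / 2) in *.
    assert (Ht : 0 < t) by (unfold t; lra).
    assert (B : Rabs (t * w) <= t * (g / 4 + (K + Rabs um) * eta)).
    { replace (t * w) with ((v + um) - (v - - um - t * (um * eta + w)) - t * eta * um) by ring.
      assert (T1 : Rabs (t * eta * um) <= t * eta * Rabs um) by (rewrite Rabs_mult, (Rabs_right (t * eta)); nra).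
      apply Rabs_le_between in Ks. apply Rabs_le_between in HK. apply Rabs_le_between in T1.
      apply Rabs_le_between. nra. }
    rewrite Rabs_mult, (Rabs_right t) in B by lra. apply Rmult_le_reg_l in B; [|lra]. fold g in B. lra. }
  pose proof (Tan 1 0) as T2. pose proof (Tan 0 1) as T3.
  replace Ustate with L; [exact HL|]. unfold Ustate. destruct L as [[l1 l2] l3]. unfold X1, X2, X3 in *; simpl in *.
  f_equal; [f_equal|]; lra.
Qed.

(** For [T > -1], points strictly below the front accumulate at the front point and carry the
    uniform state; for [T = -1] there are none, and the inlet state is transported to the closure of
    the cross-section instead. *)
Lemma front_state T p : -1 <= T -> uniform_below T -> closure2 Om p -> T <= f p -> glim Dm phi (pt T p) Ustate.
Proof.
  intros HT HU Hp Hf. set (x := pt T p). assert (Sx : sec x = p) by apply sec_pt.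
  assert (Ha : adh3 Dm x).
  { apply adh_Dm; rewrite Sx; [exact Hp|]. unfold x, pt, X1; simpl. lra. }
  destruct (glim_Dm_exists x Ha) as [L [HL _]].
  replace Ustate with L; [exact HL|]. apply coord_ext. intros i.
  apply Rminus_diag_uniq, NNPP. intros N. set (g := Rabs (coord i L - coord i Ustate)).
  assert (Hg : 0 < g) by (apply Rabs_pos_lt, N).
  destruct (Req_dec T (-1)) as [E|NE].
  - destruct (glim_near Dm x L HL (g / 2) ltac:(lra)) as [d [Hd H]].
    destruct (Hp d Hd) as [q [Oq Hq]].
    assert (Aq : adh3 Dm (pt (-1) q)).
    { apply adh_Dm; rewrite sec_pt; [apply closure2_incl, Oq|]. pose proof (f_gt q Oq). unfold pt, X1; simpl. lra. }
    specialize (H (pt (-1) q) Ustate). 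
    assert (Dq : dist3 (pt (-1) q) x < d).
    { unfold x. rewrite E. eapply Rle_lt_trans; [apply dist3_pt|]. rewrite Rminus_diag, Rabs_R0. lra. }
    specialize (H Dq Aq (inlet_state q Oq) i). rewrite Rabs_minus_sym in H. fold g in H. lra.
  - pose proof (proj1 (filterlim_R _ _ _) (HL i) (g / 2) ltac:(lra)) as K. unfold within in K.
    apply locally3 in K. destruct K as [r [Hr K]].
    destruct (f_near x (r / 4) ltac:(rewrite Sx; exact Hp) ltac:(lra)) as [d [Hd H]].
    destruct (Hp (Rmin d (r / 4))) as [q [Oq Hq]]; [apply Rmin_glb_lt; lra|].
    pose proof (Rmin_l d (r / 4)). pose proof (Rmin_r d (r / 4)).
    specialize (H (pt T q)). rewrite !sec_pt in H. specialize (H (closure2_incl _ _ Oq)). rewrite Sx in H.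
    assert (Dq : dist3 (pt T q) x < d).
    { unfold x. eapply Rle_lt_trans; [apply dist3_pt|]. rewrite Rminus_diag, Rabs_R0. lra. }
    specialize (H Dq). apply Rabs_lt_between in H. pose proof (f_gt q Oq). pose proof (f_lt q Oq).
    destruct (between (-1) (T - r / 2) (f q) T) as [s Hs]; try lra.
    assert (Dz : Dm (pt s q)).
    { unfold Dminus, inD. rewrite sec_pt. unfold pt, X1; simpl. repeat split; try assumption; lra. }
    assert (Hz : dist3 (pt s q) x < r).
    { unfold x. eapply Rle_lt_trans; [apply dist3_pt|]. rewrite Rabs_left by lra. lra. }
    specialize (K _ Hz Dz). rewrite <- coord_grad in K.
    rewrite (HU _ Dz) in K by (unfold pt, X1; simpl; lra). rewrite Rabs_minus_sym in K. fold g in K. lra.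
Qed.

Lemma inD_bounded : exists B, 0 <= B /\ forall x, inD Om x -> Rabs (X1 x) <= B /\ Rabs (X2 x) <= B /\ Rabs (X3 x) <= B.
Proof.
  destruct (fl_bd _ _ _ _ _ _ _ _ _ fl) as [M HM]. exists (Rabs M + 1). split; [pose proof (Rabs_pos M); lra|].
  intros x [H1 H2]. specialize (HM _ H2). unfold dist2, sec in HM; simpl fst in HM; simpl snd in HM.
  rewrite !Rminus_0_r in HM. destruct (sum2_sqr (X2 x) (X3 x)) as [A [B _]].
  pose proof (Rle_abs M). pose proof (Rabs_pos M).
  split; [apply Rabs_le_between; lra|]. lra.
Qed.

(** The filter of slabs [X1 < T + e0] over the whole cross-section, so that limits along it are
    uniform up to the wall. Below [T] the state is already uniform when this is used. *)
Definition Fslab (T : R) (P : pt3 -> Prop) : Prop :=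
  exists e0, 0 < e0 /\ forall x, Dm x -> X1 x < T + e0 -> P x.

Global Instance Fslab_filter T : Filter (Fslab T).
Proof.
  constructor.
  - exists 1. split; [lra|]. auto.
  - intros P Q [a [Ha HP]] [b [Hb HQ]]. exists (Rmin a b). split; [apply Rmin_glb_lt; assumption|].
    intros x Dx Hx. pose proof (Rmin_l a b). pose proof (Rmin_r a b). split; [apply HP|apply HQ]; auto; lra.
  - intros P Q PQ [a [Ha HP]]. exists a. split; [exact Ha|]. intros x Dx Hx. apply PQ, HP; assumption.
Qed.

(** Compactness: a sequence violating the estimate would accumulate at a front point, where the
    limit gradient is known. *)
Lemma slab_limit T : -1 <= T -> uniform_below T -> forall i, filterlim (ph i) (Fslab T) (locally (coord i Ustate)).
Proof.
  intros HT HU i. apply filterlim_R; [typeclasses eauto|]. intros e He. apply NNPP. intros N.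
  assert (K : forall n : nat, exists x, Dm x /\ X1 x < T + / (INR n + 1) /\ ~ Rabs (ph i x - coord i Ustate) < e).
  { intros n. apply NNPP. intros N'. apply N. exists (/ (INR n + 1)). split; [apply inv_INR_pos|].
    intros x Dx Hx. apply NNPP. intros N2. apply N'. exists x. auto. }
  destruct (nat_choice _ K) as [u Hu]. destruct inD_bounded as [B [_ HB]].
  destruct (BW3 u B (fun n => HB _ (proj1 (proj1 (Hu n))))) as [psi [x [Hpsi Hx]]].
  assert (Ge : forall n, T <= X1 (u n)).
  { intros n. apply Rnot_lt_le. intros L. destruct (Hu n) as [A [_ C]]. apply C. rewrite <- coord_grad, (HU _ A L).
    rewrite Rminus_diag, Rabs_R0. exact He. }
  assert (X1x : X1 x = T).
  { pose proof (filterlim_comp _ _ _ _ _ _ _ _ Hx (continuous_X1 x)) as L1.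
    apply Rle_antisym.
    - apply Rnot_lt_le. intros L. destruct (proj1 (filterlim_R eventually _ _) L1 ((X1 x - T) / 2) ltac:(lra)) as [N1 HN1].
      destruct (inv_INR_small ((X1 x - T) / 2) ltac:(lra)) as [N2 HN2].
      specialize (HN1 (max N1 N2) ltac:(lia)). cbv beta in HN1. destruct (Hu (psi (max N1 N2))) as [_ [A _]].
      specialize (HN2 (psi (max N1 N2)) ltac:(specialize (Hpsi (max N1 N2)); lia)). apply Rabs_lt_between in HN1. lra.
    - apply (seq_lim_ge (fun n => X1 (u (psi n)))); [exact L1|]. intros; apply Ge. }
  assert (Ha : adh3 Dm x) by (apply (seq_adh3 Dm (fun n => u (psi n))); [intros n; apply Hu|exact Hx]).
  destruct (adh_closure Dm x (fun z H => proj1 H) Ha) as [_ Hc]. pose proof (adh_Dm_le x Ha) as Hf.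
  pose proof (front_state T (sec x) HT HU Hc ltac:(lra)) as G. rewrite <- X1x, pt_sec in G.
  pose proof (filterlim_within_seq Dm _ x (fun n => proj1 (Hu (psi n))) Hx) as W.
  pose proof (filterlim_comp _ _ _ _ _ _ _ _ W (G i)) as L2.
  destruct (proj1 (filterlim_R eventually _ _) L2 e He) as [N1 HN1]. specialize (HN1 N1 (le_n _)).
  apply (Hu (psi N1)). exact HN1.
Qed.

Lemma Ecur_slab T : -1 <= T -> uniform_below T -> filterlim (Ecur I1) (Fslab T) (locally 0).
Proof.
  intros HT HU. pose proof (slab_limit T HT HU) as S.
  assert (LN : filterlim Nq (Fslab T) (locally (um ^ 2))).
  { replace (um ^ 2) with (um * um + 0 * 0 + 0 * 0) by ring. unfold Nq.
    repeat apply filterlim_Rplus; try typeclasses eauto; (apply filterlim_Rmult; [typeclasses eauto| |]);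
      first [exact (S I1) | exact (S I2) | exact (S I3)]. }
  replace 0 with (rho gam b0 (um ^ 2) * um * (um - um) - (Gpot gam b0 (um ^ 2) - Gpot gam b0 (um ^ 2))) by ring.
  unfold Ecur, Amass. apply filterlim_Rminus; [typeclasses eauto| |].
  - apply filterlim_Rmult; [typeclasses eauto| |].
    + apply filterlim_Rmult; [typeclasses eauto| |exact (S I1)].
      apply (filterlim_cont _ Nq (rho gam b0)); [exact LN|]. apply continuous_rho, fl.
    + apply filterlim_Rminus; [typeclasses eauto|exact (S I1)|apply filterlim_Rconst; typeclasses eauto].
  - apply filterlim_Rminus; [typeclasses eauto| |apply filterlim_Rconst; typeclasses eauto].
    apply (filterlim_cont _ Nq (Gpot gam b0)); [exact LN|].
    apply (ex_derive_continuous (Gpot gam b0)). eexists. apply is_derive_Gpot; [apply fl..|apply fl].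
Qed.

(** Depth below the graph of the chart, measured along the second rotated axis; within the chart
    disc it is positive exactly in the domain. *)
Definition dch (p : pt2) (th : R) (g : R -> R) (x : pt3) : R :=
  g (fst (rot th (sub2 (sec x) p))) - snd (rot th (sub2 (sec x) p)).
Definition dchD (p : pt2) (th : R) (g : R -> R) (i : idx) (x : pt3) : R :=
  let m := Derive g (fst (rot th (sub2 (sec x) p))) in
  match i with I1 => 0 | I2 => m * cos th + sin th | I3 => m * sin th - cos th end.

Lemma C1D_dch p th g x : C3_fun g -> C1D (dch p th g) (dchD p th g) x.
Proof.
  intros Hg. set (c := cos th). set (s := sin th).
  pose (y1 := fun z : pt3 => 0 * X1 z + c * X2 z + s * X3 z + - (c * fst p + s * snd p)).
  pose (y2 := fun z : pt3 => 0 * X1 z + - s * X2 z + c * X3 z + (s * fst p - c * snd p)).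
  assert (E1 : forall z, fst (rot th (sub2 (sec z) p)) = y1 z) by (intros z; unfold rot, sub2, sec, y1; simpl; fold c s; ring).
  assert (E2 : forall z, snd (rot th (sub2 (sec z) p)) = y2 z) by (intros z; unfold rot, sub2, sec, y2; simpl; fold c s; ring).
  apply (C1D_ext_loc (fun z => g (y1 z) - y2 z)).
  { apply filter_forall. intros z. unfold dch. rewrite E1, E2. reflexivity. }
  eapply C1D_ext_D; [|apply C1D_minus; [apply (C1D_comp g (Derive g) y1); [| |apply C1D_affine]|apply C1D_affine]].
  - apply filter_forall. intros z i. unfold dchD. rewrite E1. fold c s. destruct i; Req; ring.
  - apply filter_forall. intros u. apply Derive_correct, Hg.
  - apply (ex_derive_continuous (Derive g)), Hg.
Qed.

(** Slip is a condition at wall points; by compactness it holds approximately in a whole layer. Half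
    of the chart radius keeps the accumulation point inside the chart. *)
Lemma wall_limit p th r g : boundary_chart Om p th r g -> forall del, 0 < del -> exists e0, 0 < e0 /\
  forall x, Dm x -> dist2 (sec x) p < r / 2 -> 0 < dch p th g x < e0 ->
    Rabs (ph I2 x * dchD p th g I2 x + ph I3 x * dchD p th g I3 x) <= del.
Proof.
  intros Hch del Hdel. destruct (Hch) as [Hr [Hg [_ Hiff]]]. apply NNPP. intros N.
  assert (K : forall n : nat, exists x, Dm x /\ dist2 (sec x) p < r / 2 /\ 0 < dch p th g x < / (INR n + 1) /\
     del < Rabs (ph I2 x * dchD p th g I2 x + ph I3 x * dchD p th g I3 x)).
  { intros n. apply NNPP. intros N'. apply N. exists (/ (INR n + 1)). split; [apply inv_INR_pos|].
    intros x Dx Hx Hd. apply Rnot_lt_le. intros L. apply N'. exists x. auto. }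
  destruct (nat_choice _ K) as [u Hu]. destruct inD_bounded as [B [_ HB]].
  destruct (BW3 u B (fun n => HB _ (proj1 (proj1 (Hu n))))) as [psi [x [Hpsi Hx]]].
  pose (v := fun n => u (psi n)).
  assert (Hv : forall n, Dm (v n)) by (intros n; apply Hu).
  assert (Ha : adh3 Dm x) by (apply (seq_adh3 Dm v); assumption).
  destruct (adh_closure Dm x (fun z H => proj1 H) Ha) as [_ Hc].
  destruct (glim_Dm_exists x Ha) as [L [HL [Sl _]]].
  assert (Hd : dist2 (sec x) p < r).
  { destruct (Hx (fun z => dist3 z x < r / 2)) as [N1 HN1]; [apply locally3; exists (r / 2); split; [lra|auto]|].
    specialize (HN1 N1 (le_n _)). cbv beta in HN1. 
    pose proof (dist2_triangle (sec x) p (sec (v N1))). pose proof (dist2_sec x (v N1)). rewrite dist3_sym in H0.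
    destruct (Hu (psi N1)) as [_ [A _]]. fold (v N1) in A, HN1. lra. }
  assert (D0 : dch p th g x = 0).
  { pose proof (filterlim_comp _ _ _ _ _ _ _ _ Hx (C1D_continuous _ _ _ (C1D_dch p th g x Hg))) as Ld.
    apply Rle_antisym.
    - apply Rnot_lt_le. intros Lt. destruct (proj1 (filterlim_R eventually _ _) Ld (dch p th g x / 2) ltac:(lra)) as [N1 HN1].
      destruct (inv_INR_small (dch p th g x / 2) ltac:(lra)) as [N2 HN2].
      specialize (HN1 (max N1 N2) ltac:(lia)). cbv beta in HN1. destruct (Hu (psi (max N1 N2))) as [_ [_ [A _]]].
      specialize (HN2 (psi (max N1 N2)) ltac:(specialize (Hpsi (max N1 N2)); lia)). apply Rabs_lt_between in HN1. lra.
    - apply (seq_lim_ge (fun n => dch p th g (v n))); [exact Ld|]. intros n. apply Rlt_le, (Hu (psi n)). }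
  unfold dch in D0. set (y := rot th (sub2 (sec x) p)) in *.
  assert (NO : ~ Om (sec x)) by (intros O; apply Hiff in O; [fold y in O; lra|exact Hd]).
  assert (HB2 : bdry2 Om (sec x)) by (split; assumption).
  pose proof (boundary_chart_shift Om p th r g (sec x) Hch Hd ltac:(fold y; lra)) as On. fold y in On.
  pose proof (Sl HB2 _ On) as Z. 
  change (X2 L * fst (chart_normal th (Derive g (fst y))) + X3 L * snd (chart_normal th (Derive g (fst y)))) with
   (fst (X2 L, X3 L) * fst (chart_normal th (Derive g (fst y))) + snd (X2 L, X3 L) * snd (chart_normal th (Derive g (fst y)))) in Z.
  rewrite chart_normal_dot in Z. destruct (sqrt_1_sqr_pos (Derive g (fst y))) as [P _].
  assert (Z' : X2 L * dchD p th g I2 x + X3 L * dchD p th g I3 x = 0).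
  { unfold dchD. fold y. set (m := Derive g (fst y)) in *.
    apply Rmult_eq_compat_r with (r := sqrt (1 + m ^ 2)) in Z. unfold Rdiv in Z. rewrite Rmult_assoc, Rinv_l, Rmult_1_r in Z by lra.
    unfold rot in Z; simpl in Z. lra. }
  assert (Lim : filterlim (fun n => ph I2 (v n) * dchD p th g I2 (v n) + ph I3 (v n) * dchD p th g I3 (v n)) eventually (locally 0)).
  { rewrite <- Z'. pose proof (filterlim_within_seq Dm v x Hv Hx) as W.
    apply filterlim_Rplus; [typeclasses eauto| |]; (apply filterlim_Rmult; [typeclasses eauto| |]).
    - exact (filterlim_comp _ _ _ _ _ _ _ _ W (HL I2)).
    - exact (filterlim_comp _ _ _ _ _ _ _ _ Hx (proj2 (C1D_dch p th g x Hg) I2)).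
    - exact (filterlim_comp _ _ _ _ _ _ _ _ W (HL I3)).
    - exact (filterlim_comp _ _ _ _ _ _ _ _ Hx (proj2 (C1D_dch p th g x Hg) I3)). }
  destruct (proj1 (filterlim_R eventually _ _) Lim del Hdel) as [N1 HN1]. specialize (HN1 N1 (le_n _)).
  rewrite Rminus_0_r in HN1. destruct (Hu (psi N1)) as [_ [_ [_ A]]]. fold (v N1) in A. lra.
Qed.

(** Treats interior and wall points alike: over an interior point the depth is the constant 1, so
    the wall cutoff is inactive there. At a wall point the strip bound comes from the rotated
    coordinates, in which the depth is [g y1 - y2]. *)
Lemma depth_function p : closure2 Om p -> exists th r d dD, 0 < r /\ (forall x, C1D d dD x) /\
  (forall x, dD I1 x = 0) /\
  (forall x, dist2 (sec x) p < r -> (Om (sec x) <-> 0 < d x)) /\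
  (forall del, 0 < del -> exists e0, 0 < e0 /\ forall x, Dm x -> dist2 (sec x) p < r -> 0 < d x < e0 ->
    Rabs (ph I2 x * dD I2 x + ph I3 x * dD I3 x) <= del) /\
  (forall T tau, 0 < tau -> exists C e1, 0 < e1 /\ forall e, 0 < e < e1 ->
     int3 T (T + tau) (sqrt tau) (fun x => cut' e (d (unrot p th x))) <= C).
Proof.
  intros Hp. destruct (classic (Om p)) as [Op|Np].
  - destruct (fl_open _ _ _ _ _ _ _ _ _ fl p Op) as [r [Hr H]].
    exists 0, r, (fun _ => 1), (fun _ _ => 0). split; [exact Hr|]. split; [intros; apply C1D_const|].
    split; [reflexivity|]. split; [intros x Hx; split; [lra|intros _; apply H, Hx]|]. split.
    + intros del Hdel. exists 1. split; [lra|]. intros. replace (ph I2 x * 0 + ph I3 x * 0) with 0 by ring. rewrite Rabs_R0. lra.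
    + intros T tau Ht. exists 0, (1 / 2). split; [lra|]. intros e He. unfold int3.
      rewrite RInt_zero; [lra|]. intros s. apply RInt_zero. intros y1. apply RInt_zero. intros y2.
      apply cut_right; lra.
  - destruct (fl_C3 _ _ _ _ _ _ _ _ _ fl p (conj Hp Np)) as [th [r [g Hch]]]. destruct (Hch) as [Hr [Hg [_ Hiff]]].
    exists th, (r / 2), (dch p th g), (dchD p th g). split; [lra|]. split; [intros; apply C1D_dch, Hg|].
    split; [reflexivity|]. split.
    { intros x Hx. rewrite (Hiff (sec x)) by lra. unfold dch. split; intros; lra. }
    split; [apply wall_limit, Hch|].
    intros T tau Ht. exists (2 * sqrt tau * tau), 1. split; [lra|]. intros e He.
    set (L := sqrt tau). assert (L0 : 0 <= L) by apply sqrt_pos.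
    assert (Eq : forall s y1 y2, dch p th g (unrot p th (s, y1, y2)) = g y1 - y2).
    { intros s y1 y2. unfold dch, unrot, sec, X2, X3, sub2, rot; simpl. pose proof (sin2_cos2 th) as E. unfold Rsqr in E.
      f_equal.
      - f_equal. replace (cos th * (fst p + (cos th * y1 - sin th * y2) - fst p) + sin th * (snd p + (sin th * y1 + cos th * y2) - snd p))
          with ((sin th * sin th + cos th * cos th) * y1) by ring. rewrite E; ring.
      - replace (- sin th * (fst p + (cos th * y1 - sin th * y2) - fst p) + cos th * (snd p + (sin th * y1 + cos th * y2) - snd p))
          with ((sin th * sin th + cos th * cos th) * y2) by ring. rewrite E; ring. }
    assert (CH : cont3 (fun x => cut' e (dch p th g (unrot p th x)))).
    { apply (cont3_unrot p th (fun x => cut' e (dch p th g x))). intros x.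
      apply (continuous_comp (dch p th g) (cut' e)); [apply (C1D_continuous _ _ _ (C1D_dch p th g x Hg))|apply continuous_cut'; lra]. }
    (* The integrand is the derivative of a cutoff in the last variable, whence a bound independent
       of [e]. *)
    assert (In1 : forall s y1, RInt (fun y2 => cut' e (dch p th g (unrot p th (s, y1, y2)))) (- L) L <= 1).
    { intros s y1. rewrite (RInt_ext _ (fun y2 => cut' e (g y1 - y2))) by (intros y2 _; rewrite Eq; reflexivity).
      rewrite (RInt_is_derive (fun y2 => - cut e (g y1 - y2))).
      - pose proof (cut_bounds e (g y1 - L)). pose proof (cut_bounds e (g y1 - - L)). lra.
      - intros y. evar_last; [apply (is_derive_ext (fun y => (-1) * cut e (g y1 - y)))|].
        { intros t. Req. ring. }
        { apply is_derive_Rscal. apply (is_derive_Rcomp (cut e) (fun y => g y1 - y) y (cut' e (g y1 - y)) (-1)).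
          - apply is_derive_cut; lra.
          - auto_derive; [trivial|ring]. }
        Req. ring.
      - intros y. apply (continuous_comp (fun y => g y1 - y) (cut' e)); [|apply continuous_cut'; lra].
        apply continuous_Rminus; [apply continuous_const|apply continuous_id]. }
    assert (In2 : forall s, RInt (fun y1 => RInt (fun y2 => cut' e (dch p th g (unrot p th (s, y1, y2)))) (- L) L) (- L) L <= 2 * L).
    { intros s. apply Rle_trans with (RInt (fun _ => 1) (- L) L).
      - apply RInt_le; [lra|apply (ex2 L L0 _ s (- L) L CH)|apply ex_RInt_const|]. intros y1 _. apply In1.
      - rewrite RInt_const. unfold scal; simpl; unfold mult; simpl. lra. }
    unfold int3. apply Rle_trans with (RInt (fun _ => 2 * L) T (T + tau)).
    + apply RInt_le; [lra|apply (ex3 L L0 _ T (T + tau) CH)|apply ex_RInt_const|]. intros s _. apply In2.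
    + rewrite RInt_const. unfold scal; simpl; unfold mult; simpl. apply Req_le. ring.
Qed.

Lemma upstream_supersonic : dens_base gam b0 (um ^ 2) < um ^ 2.
Proof.
  pose proof (dens_sub_sqr gam b0 (fl_gam _ _ _ _ _ _ _ _ _ fl) (fl_stag _ _ _ _ _ _ _ _ _ fl) (um ^ 2)) as E.
  pose proof (fl_um _ _ _ _ _ _ _ _ _ fl). pose proof cs_pos. pose proof (fl_gam _ _ _ _ _ _ _ _ _ fl).
  assert (cs ^ 2 < um ^ 2) by nra. nra.
Qed.

Lemma dotE_Ecur (D : idx -> pt3 -> R) x : D I1 x = -1 ->
  dotE Ecur D x = rho gam b0 (Nq x) * (- (um + (ph I1 x - um)) + ph I2 x * D I2 x + ph I3 x * D I3 x) * (ph I1 x - um)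
    + (Gpot gam b0 (Nq x) - Gpot gam b0 (um ^ 2)).
Proof. intros E. unfold dotE, Ecur, Amass. rewrite E. ring. Qed.

(** Energy argument in a lens based at the front point, bounded by the front, a paraboloid cap, and
    possibly the wall and the shock. The other faces contribute a signed or vanishing flux, so the
    positive definite flux through the cap levels must be zero. *)
Lemma local_uniform T p : -1 <= T -> uniform_below T -> closure2 Om p -> T <= f p ->
  exists r, 0 < r /\ forall x, Dm x -> T < X1 x -> dist3 x (pt T p) < r -> grad phi x = Ustate.
Proof.
  intros HT HU Hp Hf. pose proof (front_state T p HT HU Hp Hf) as HG.
  set (x0 := pt T p) in *. assert (Sx0 : sec x0 = p) by apply sec_pt.
  pose proof (fl_dens _ _ _ _ _ _ _ _ _ fl) as Hd0. set (d0 := dens_base gam b0 (um ^ 2)) in *.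
  pose proof upstream_supersonic as Hsup. fold d0 in Hsup.
  (* slope bound: strictly inside the Mach cone, and above the slope of the shock if it passes through [x0] *)
  assert (Hm0 : exists m0, 0 <= m0 /\ (1 + m0) * d0 < um ^ 2 /\ (f p = T -> F2 p ^ 2 + F3 p ^ 2 <= m0)).
  { destruct (Req_dec (f p) T) as [E|NE].
    - exists (F2 p ^ 2 + F3 p ^ 2). split; [nra|]. split; [|intros; lra].
      rewrite <- Rplus_assoc. apply shock_spacelike; [exact Hp|]. rewrite E. exact HG.
    - exists 0. split; [lra|]. split; [lra|]. intros; contradiction. }
  destruct Hm0 as [m0 [Hm0 [Hm1 Hm2]]].
  (* The midpoint of [m0] and [k] puts the slope bound [h] strictly inside the Mach cone and
     strictly above the slope at [x0] of a shock through [x0]. *)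
  pose (k := um ^ 2 / d0 - 1). assert (Ek : (1 + k) * d0 = um ^ 2) by (unfold k; field; lra).
  assert (Hk : m0 < k) by nra.
  pose (h := sqrt ((m0 + k) / 2)). assert (Eh : h ^ 2 = (m0 + k) / 2) by (apply pow2_sqrt; lra).
  assert (Hh : 0 < h) by (apply sqrt_lt_R0; lra).
  destruct (energy_flux_pos gam b0 (fl_gam _ _ _ _ _ _ _ _ _ fl) (fl_stag _ _ _ _ _ _ _ _ _ fl) um h um_pos Hd0 ltac:(lra)
     ltac:(fold d0; rewrite Eh; nra)) as [del0 [Hdel0 EFP]].
  assert (HN1 : exists r1, 0 < r1 /\ forall x, Dm x -> dist3 x x0 < r1 ->
     (forall i, Rabs (ph i x - coord i Ustate) <= Rmin del0 1) /\ rho gam b0 (Nq x) <= rho gam b0 (um ^ 2) + 1).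
  { assert (A : forall i, within Dm (locally x0) (fun x => Rabs (ph i x - coord i Ustate) < Rmin del0 1)).
    { intros i. apply (proj1 (filterlim_R _ _ _) (HG i)). apply Rmin_glb_lt; lra. }
    assert (LN : filterlim Nq (within Dm (locally x0)) (locally (um ^ 2))).
    { rewrite <- normsq_U. apply (filterlim_ext (fun z => normsq (grad phi z))); [intros; symmetry; apply Nq_normsq|].
      apply glim_normsq, HG. }
    pose proof (filterlim_cont _ Nq (rho gam b0) _ LN (continuous_rho _ Hd0)) as LR.
    pose proof (proj1 (filterlim_R _ _ _) LR 1 Rlt_0_1) as B.
    pose proof (filter_and _ _ (A I1) (filter_and _ _ (A I2) (filter_and _ _ (A I3) B))) as Q.
    unfold within in Q. apply locally3 in Q. destruct Q as [r [Hr Q]]. exists r. split; [exact Hr|].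
    intros x Dx Hx. destruct (Q x Hx Dx) as [A1 [A2 [A3 A4]]]. split.
    - intros []; apply Rlt_le; assumption.
    - apply Rabs_lt_between in A4. lra. }
  destruct HN1 as [r1 [Hr1 N1]].
  (* Either the shock passes through [x0] and its slope stays below [h] nearby, or the layer next to
     the shock misses a small ball around [x0]. *)
  assert (HN2 : exists r2 e3, 0 < r2 /\ 0 < e3 /\ forall x, Dm x -> T < X1 x -> dist3 x x0 < r2 -> f (sec x) - X1 x < e3 ->
     F2 (sec x) ^ 2 + F3 (sec x) ^ 2 <= h ^ 2).
  { destruct (Req_dec (f p) T) as [E|NE].
    - specialize (Hm2 E).
      assert (CF : exists r, 0 < r /\ forall x, closure2 Om (sec x) -> dist3 x x0 < r -> F2 (sec x) ^ 2 + F3 (sec x) ^ 2 < h ^ 2).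
      { pose (e := (h ^ 2 - m0) / (4 * (Rabs (F2 p) + Rabs (F3 p) + 1))).
        pose proof (Rabs_pos (F2 p)) as P2. pose proof (Rabs_pos (F3 p)) as P3.
        assert (He : 0 < e) by (apply Rdiv_lt_0_compat; lra).
        assert (Ee : e * (4 * (Rabs (F2 p) + Rabs (F3 p) + 1)) = h ^ 2 - m0) by (unfold e; field; lra).
        pose (e' := Rmin e (1 / 2)). assert (He' : 0 < e' /\ e' <= e /\ e' <= 1 / 2).
        { unfold e'. pose proof (Rmin_l e (1 / 2)). pose proof (Rmin_r e (1 / 2)). split; [apply Rmin_glb_lt; lra|lra]. }
        destruct (fl_F2c _ _ _ _ _ _ _ _ _ fl p Hp e' ltac:(lra)) as [a [Ha A]].
        destruct (fl_F3c _ _ _ _ _ _ _ _ _ fl p Hp e' ltac:(lra)) as [b [Hb B]].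
        exists (Rmin a b). split; [apply Rmin_glb_lt; lra|]. intros x Cx Hx.
        pose proof (Rmin_l a b). pose proof (Rmin_r a b). pose proof (dist2_sec x x0) as DS. rewrite Sx0 in DS.
        specialize (A _ Cx ltac:(lra)). specialize (B _ Cx ltac:(lra)).
        assert (SQ : forall u v, Rabs (u - v) < e' -> u ^ 2 <= v ^ 2 + e' * (2 * Rabs v + 1 / 2)).
        { intros u v Huv. pose proof (Rle_abs v). pose proof (Rle_abs (- v)). rewrite Rabs_Ropp in H2.
          apply Rabs_lt_between in Huv. set (t := u - v) in *. replace u with (v + t) by (unfold t; ring).
          assert (t * v <= e' * Rabs v).
          { apply Rle_trans with (Rabs (t * v)); [apply Rle_abs|]. rewrite Rabs_mult.
            apply Rmult_le_compat_r; [apply Rabs_pos|]. apply Rabs_le_between. lra. }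
          assert (t ^ 2 <= e' * (1 / 2)) by nra. nra. }
        pose proof (SQ _ _ A) as S2. pose proof (SQ _ _ B) as S3.
        assert (e' * (2 * Rabs (F2 p) + 1 / 2) + e' * (2 * Rabs (F3 p) + 1 / 2) <= (h ^ 2 - m0) / 2).
        { rewrite <- Ee. nra. }
        lra. }
      destruct CF as [r [Hr CF]]. exists r, 1. split; [exact Hr|]. split; [lra|].
      intros x Dx _ Hx _. apply Rlt_le, CF; [apply closure2_incl, Dx|exact Hx].
    - destruct (f_near x0 ((f p - T) / 4) ltac:(rewrite Sx0; exact Hp) ltac:(lra)) as [r [Hr Q]].
      exists (Rmin r ((f p - T) / 4)), ((f p - T) / 4). split; [apply Rmin_glb_lt; lra|]. split; [lra|].
      intros x Dx _ Hx Hs. exfalso. pose proof (Rmin_l r ((f p - T) / 4)). pose proof (Rmin_r r ((f p - T) / 4)).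
      specialize (Q x (closure2_incl _ _ (proj2 (proj1 Dx))) ltac:(lra)). rewrite Sx0 in Q. apply Rabs_lt_between in Q.
      destruct (abs_coord_le_dist3 x x0) as [A _]. change (X1 x0) with T in A. apply Rabs_le_between in A. lra. }
  destruct HN2 as [r2 [e3 [Hr2 [He3 N2]]]].
  destruct (depth_function p Hp) as [th [r3 [d [dD [Hr3 [Cd [Zd [Iff [Wall Strip]]]]]]]]].
  pose (rs := Rmin r1 (Rmin r2 r3)).
  assert (Hrs : 0 < rs /\ rs <= r1 /\ rs <= r2 /\ rs <= r3).
  { unfold rs. pose proof (Rmin_l r1 (Rmin r2 r3)). pose proof (Rmin_r r1 (Rmin r2 r3)).
    pose proof (Rmin_l r2 r3). pose proof (Rmin_r r2 r3). split; [repeat apply Rmin_glb_lt; lra|lra]. }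
  (* [4 * tau <= h ^ 2] makes the cap space-like; the square of [rs / 3] confines the lens to the
     ball of radius [rs]. *)
  pose (tau := Rmin 1 (Rmin (h ^ 2 / 4) ((rs / 3) ^ 2))).
  assert (Htau : 0 < tau /\ tau <= 1 /\ 4 * tau <= h ^ 2 /\ tau <= (rs / 3) ^ 2).
  { unfold tau. pose proof (Rmin_l 1 (Rmin (h ^ 2 / 4) ((rs / 3) ^ 2))). pose proof (Rmin_r 1 (Rmin (h ^ 2 / 4) ((rs / 3) ^ 2))).
    pose proof (Rmin_l (h ^ 2 / 4) ((rs / 3) ^ 2)). pose proof (Rmin_r (h ^ 2 / 4) ((rs / 3) ^ 2)).
    split; [repeat apply Rmin_glb_lt; [lra|nra|nra]|lra]. }
  destruct Htau as [Ht0 [Ht1 [Hth Htr]]].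
  assert (Inl : forall x, T < X1 x -> 0 <= lens T tau p x -> dist3 x x0 < rs /\ dist2 (sec x) p < r3 /\
      (- 2 * (X2 x - fst p)) ^ 2 + (- 2 * (X3 x - snd p)) ^ 2 <= h ^ 2).
  { intros x HX HL. unfold lens in HL. 
    pose proof (pow2_ge_0 (X2 x - fst p)). pose proof (pow2_ge_0 (X3 x - snd p)).
    assert (S : (X2 x - fst p) ^ 2 + (X3 x - snd p) ^ 2 <= tau) by lra.
    assert (T1 : X1 x - T <= tau) by lra.
    assert (tau <= rs / 3) by (destruct (Rle_lt_dec (rs / 3) 1); nra).
    assert (D2 : dist2 (sec x) p < rs / 2).
    { apply dist2_lt_iff; [lra|]. unfold sec; simpl fst; simpl snd. nra. }
    split; [|split; [lra|nra]].
    rewrite <- (pt_sec x). eapply Rle_lt_trans; [apply dist3_pt|]. rewrite Rabs_right; lra. }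
  assert (Pos : forall x (D : idx -> pt3 -> R), Dm x -> dist3 x x0 < rs -> D I1 x = -1 -> D I2 x ^ 2 + D I3 x ^ 2 <= h ^ 2 ->
     0 <= dotE Ecur D x /\ (dotE Ecur D x = 0 -> grad phi x = Ustate)).
  { intros x D Dx Hx E1 E2. destruct (N1 x Dx ltac:(lra)) as [A _].
    pose proof (Rmin_l del0 1). pose proof (A I1) as A1. pose proof (A I2) as A2. pose proof (A I3) as A3.
    unfold Ustate, coord, X1, X2, X3 in A1, A2, A3; simpl in A1, A2, A3. rewrite Rminus_0_r in A2, A3.
    destruct (EFP (ph I1 x - um) (ph I2 x) (ph I3 x) (D I2 x) (D I3 x) ltac:(lra) ltac:(lra) ltac:(lra) E2) as [_ P].
    rewrite (dotE_Ecur D x E1).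
    assert (EN : (um + (ph I1 x - um)) ^ 2 + ph I2 x ^ 2 + ph I3 x ^ 2 = Nq x) by (unfold Nq; ring).
    rewrite EN in P.
    pose proof (pow2_ge_0 (ph I1 x - um)) as S1. pose proof (pow2_ge_0 (ph I2 x)) as S2. pose proof (pow2_ge_0 (ph I3 x)) as S3.
    destruct (Rle_lt_or_eq_dec 0 ((ph I1 x - um) ^ 2 + ph I2 x ^ 2 + ph I3 x ^ 2)) as [L|L]; [lra| |].
    - specialize (P L). split; [lra|]. intros Z. lra.
    - assert (Z1 : ph I1 x - um = 0) by (apply (Rsqr_0_uniq (ph I1 x - um)); unfold Rsqr; lra).
      assert (Z2 : ph I2 x = 0) by (apply Rsqr_0_uniq; unfold Rsqr; lra).
      assert (Z3 : ph I3 x = 0) by (apply Rsqr_0_uniq; unfold Rsqr; lra).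
      apply Rminus_diag_uniq in Z1.
      rewrite <- EN, Z1, Z2, Z3. replace ((um + (um - um)) ^ 2 + 0 ^ 2 + 0 ^ 2) with (um ^ 2) by ring.
      split; [lra|]. intros _. unfold grad, Ustate. rewrite Z1, Z2, Z3. reflexivity. }
  destruct (Strip T tau Ht0) as [C [e1 [He1 HStrip]]].
  exists (tau / 2). split; [lra|]. intros x Dx HX Hd.
  assert (HX2 : X1 x - T < tau / 2).
  { destruct (abs_coord_le_dist3 x x0) as [A _]. change (X1 x0) with T in A. apply Rabs_le_between in A. lra. }
  assert (HD2 : dist2 (sec x) p < tau / 2) by (pose proof (dist2_sec x x0) as Q; rewrite Sx0 in Q; lra).
  apply dist2_lt_iff in HD2; [|lra]. unfold sec in HD2; simpl fst in HD2; simpl snd in HD2.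
  assert (HL : 0 < lens T tau p x) by (unfold lens; nra).
  destruct (Inl x HX ltac:(lra)) as [I1' [I2' I3']].
  apply (Pos x (lensD p) Dx I1' eq_refl I3').
  (* The shock face function [f - X1] has a gradient with first component -1, like the lens, so the
     same positivity serves for both faces. *)
  apply (lens_energy_zero Ecur EcurD Dm p th T tau C d dD (fun y => f (sec y) - X1 y)
     (fun i y => fDer i y - match i with I1 => 1 | _ => 0 end)); auto.
  - intros y Hy HLy Hdy. destruct (Inl y Hy HLy) as [_ [J2 _]].
    assert (Oy : Om (sec y)) by (apply Iff; assumption). split.
    + apply (C1D_minus (fun z => f (sec z)) fDer); [apply C1D_f, Oy|].
      apply (C1D_ext_loc (fun y => 1 * X1 y + 0 * X2 y + 0 * X3 y + 0)).
      { apply filter_forall. intros z. Req. ring. }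
      apply (C1D_ext_D _ (fun i _ => match i with I1 => 1 | I2 => 0 | I3 => 0 end)); [|apply C1D_affine].
      apply filter_forall. intros z i. destruct i; reflexivity.
    + intros Hs. pose proof (f_lt _ Oy). repeat split; try assumption; lra.
  - intros y Dy i. apply C1D_Ecur, Dy.
  - intros y Dy. apply Ecur_div, Dy.
  - intros y Dy Hy HLy. destruct (Inl y Hy HLy) as [J1 [_ J3]]. apply (Pos y (lensD p) Dy J1 eq_refl J3).
  - exists e3. split; [exact He3|]. intros y Dy Hy HLy Hs. destruct (Inl y Hy HLy) as [J1 _].
    apply Pos; [exact Dy|exact J1|unfold fDer; lra|]. unfold fDer. rewrite !Rminus_0_r. apply N2; [exact Dy|exact Hy|lra|lra].
  - intros del Hdel.
    destruct (proj1 (filterlim_R _ _ _) (Ecur_slab T HT HU) del Hdel) as [a [Ha A]].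
    set (Rb := rho gam b0 (um ^ 2) + 1). pose proof (rho_pos gam b0 (um ^ 2)) as Rp.
    assert (HRb : 0 < Rb) by (unfold Rb; lra).
    destruct (Wall (del / Rb)) as [b [Hb B]]; [apply Rdiv_lt_0_compat; lra|].
    exists (Rmin a b). split; [apply Rmin_glb_lt; lra|]. intros y Dy Hy HLy.
    pose proof (Rmin_l a b). pose proof (Rmin_r a b). destruct (Inl y Hy HLy) as [J1 [J2 _]]. split.
    + intros Hy2. specialize (A y Dy ltac:(lra)). rewrite Rminus_0_r in A. lra.
    + intros Hdy. specialize (B y Dy J2 ltac:(lra)). destruct (N1 y Dy ltac:(lra)) as [Q1 Q2].
      specialize (Q1 I1). change (coord I1 Ustate) with um in Q1. pose proof (Rmin_r del0 1).
      (* [dD] has no first component, so only the slip quantity remains. *)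
      assert (Ed : dotE Ecur dD y = rho gam b0 (Nq y) * (ph I1 y - um) * (ph I2 y * dD I2 y + ph I3 y * dD I3 y)).
      { unfold dotE, Ecur, Amass. rewrite Zd. ring. }
      rewrite Ed. replace del with (Rb * 1 * (del / Rb)) by (field; lra).
      pose proof (rho_pos gam b0 (Nq y)).
      apply Rmult_le_abs; [|exact B]. apply Rmult_le_abs; [rewrite Rabs_right; unfold Rb; lra|lra].
  - exists e1. auto.
  - apply Iff; [exact I2'|apply Dx].
  - destruct Dx as [_ Q]. lra.
Qed.

(** Continuation in [x1]: if the supremum [T] of the uniform slabs were below 1, nonuniform points
    would accumulate at a front point, against [local_uniform]. *)
Lemma supersonic_uniform x : Dm x -> grad phi x = Ustate.
Proof.
  pose (S := fun t => -1 <= t <= 1 /\ uniform_below t).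
  destruct (completeness S) as [T [HT1 HT2]].
  - exists 1. intros t [Ht _]. lra.
  - exists (-1). split; [lra|]. intros z [[Hz _] _] L. lra.
  - assert (T1 : -1 <= T).
    { apply HT1. split; [lra|]. intros z [[Hz _] _] L. lra. }
    assert (T2 : T <= 1) by (apply HT2; intros t [Ht _]; lra).
    assert (HU : uniform_below T).
    { intros z Dz Hz. apply NNPP. intros N. assert (T <= X1 z); [|lra].
      apply HT2. intros t [_ Ut]. apply Rnot_lt_le. intros L. apply N, Ut; assumption. }
    destruct (Req_dec T 1) as [E|NE].
    { intros Dx. apply HU; [exact Dx|]. rewrite E. apply Dx. }
    exfalso.
    assert (K : forall n : nat, exists z, Dm z /\ X1 z < T + / (INR n + 1) /\ grad phi z <> Ustate).
    { intros n. apply NNPP. intros N.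
      pose (t := Rmin 1 (T + / (INR n + 1))).
      assert (Ht : t <= 1 /\ t <= T + / (INR n + 1) /\ T < t).
      { unfold t. pose proof (inv_INR_pos n). split; [apply Rmin_l|]. split; [apply Rmin_r|apply Rmin_glb_lt; lra]. }
      assert (S t); [|specialize (HT1 t H); lra].
      split; [lra|]. intros z Dz Hz. apply NNPP. intros N2. apply N. exists z. split; [exact Dz|]. split; [lra|exact N2]. }
    destruct (nat_choice _ K) as [u Hu]. destruct inD_bounded as [B [_ HB]].
    destruct (BW3 u B (fun n => HB _ (proj1 (proj1 (Hu n))))) as [psi [y [Hpsi Hy]]].
    (* Points at height exactly [T] are uniform as well: the limit gradient at such a point is the
       gradient itself. *)
    assert (Gt : forall n, T < X1 (u n)).
    { intros n. destruct (Hu n) as [A [_ C]]. apply Rnot_le_lt. intros L. apply C.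
      destruct (Rle_lt_or_eq_dec _ _ L) as [L'|E]; [apply HU; assumption|].
      pose proof (front_state T (sec (u n)) T1 HU (closure2_incl _ _ (proj2 (proj1 A)))) as G.
      rewrite <- E in G. rewrite pt_sec in G. specialize (G (Rlt_le _ _ (proj2 A))).
      assert (Ha : adh3 Dm (u n)).
      { apply adh_Dm; [apply closure2_incl, A|]. destruct A as [[A1 _] A2]. lra. }
      apply (glim_unique Dm phi (u n)); [exact Ha|apply glim_interior; [auto|left; exact A]|exact G]. }
    pose proof (filterlim_comp _ _ _ _ _ _ _ _ Hy (continuous_X1 y)) as L1.
    assert (X1y : X1 y = T).
    { apply Rle_antisym.
      - apply Rnot_lt_le. intros L. destruct (proj1 (filterlim_R eventually _ _) L1 ((X1 y - T) / 2) ltac:(lra)) as [N1 HN1].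
        destruct (inv_INR_small ((X1 y - T) / 2) ltac:(lra)) as [N2 HN2].
        specialize (HN1 (max N1 N2) ltac:(lia)). cbv beta in HN1. destruct (Hu (psi (max N1 N2))) as [_ [A _]].
        specialize (HN2 (psi (max N1 N2)) ltac:(specialize (Hpsi (max N1 N2)); lia)). apply Rabs_lt_between in HN1. lra.
      - apply (seq_lim_ge (fun n => X1 (u (psi n)))); [exact L1|]. intros n. apply Rlt_le, Gt. }
    assert (Ha : adh3 Dm y) by (apply (seq_adh3 Dm (fun n => u (psi n))); [intros n; apply Hu|exact Hy]).
    destruct (adh_closure Dm y (fun z H => proj1 H) Ha) as [_ Hc]. pose proof (adh_Dm_le y Ha) as Hf.
    destruct (local_uniform T (sec y) T1 HU Hc ltac:(lra)) as [r [Hr Q]]. rewrite <- X1y, pt_sec in Q.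
    destruct (Hy (fun z => dist3 z y < r)) as [N1 HN1]; [apply locally3; exists r; auto|].
    specialize (HN1 N1 (le_n _)). cbv beta in HN1. destruct (Hu (psi N1)) as [A [_ C]]. apply C, Q; auto. rewrite X1y. apply Gt.
Qed.

(** Integration from the inlet along the fibre below [x], which stays in the supersonic region. *)
Lemma supersonic_phi x : Dm x -> phi x = um * X1 x.
Proof.
  intros Dx. destruct phi_inlet as [K [HK0 HK]]. apply Rminus_diag_uniq, NNPP. intros N.
  set (g := Rabs (phi x - um * X1 x)). assert (Hg : 0 < g) by (apply Rabs_pos_lt, N).
  destruct (exists_small (g / 2) (K + Rabs um)) as [a0 [Ha0 Ea0]]; [lra|pose proof (Rabs_pos um); lra|].
  destruct (Dx) as [[Hx1 Ox] Hf].
  pose (a := Rmin a0 ((X1 x + 1) / 2)).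
  assert (Ha : 0 < a /\ a <= a0 /\ a < X1 x + 1).
  { unfold a. pose proof (Rmin_l a0 ((X1 x + 1) / 2)). pose proof (Rmin_r a0 ((X1 x + 1) / 2)).
    split; [apply Rmin_glb_lt; lra|lra]. }
  assert (Fib : forall s, -1 < s <= X1 x -> Dm (pt s (sec x))).
  { intros s Hs. unfold Dminus, inD. rewrite sec_pt. unfold pt, X1 at 1 2 3; simpl. repeat split; try assumption; lra. }
  destruct (MVT_cor2 (fun s => phi (pt s (sec x))) (fun _ => um) (-1 + a) (X1 x)) as [c [E _]]; [lra| |].
  { intros s Hs. apply is_derive_Reals.
    assert (Ds : Dm (pt s (sec x))) by (apply Fib; lra).
    pose proof (C1D_is_par _ _ _ I1 (C1D_phi _ (or_introl Ds))) as P.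
    assert (Eu : ph I1 (pt s (sec x)) = um).
    { pose proof (supersonic_uniform _ Ds) as G. rewrite <- (coord_grad I1), G. reflexivity. }
    cbv beta in P. rewrite Eu in P. exact P. }
  rewrite pt_sec in E. specialize (HK _ (proj1 (Fib (-1 + a) ltac:(lra)))).
  set (v := phi (pt (-1 + a) (sec x))) in *.
  assert (Ev : X1 (pt (-1 + a) (sec x)) + 1 = a) by (unfold pt, X1; simpl; ring). rewrite Ev in HK.
  assert (Eq : phi x - um * X1 x = (v + um) - um * a) by lra.
  assert (B : g <= K * a + Rabs um * a).
  { unfold g. rewrite Eq. unfold Rminus. eapply Rle_trans; [apply Rabs_triang|]. rewrite Rabs_Ropp.
    rewrite (Rabs_mult um a), (Rabs_right a); lra. }
  pose proof (Rabs_pos um). nra.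
Qed.

(** * Comparison with one-dimensional profiles in the subsonic region *)

Variable up : R.
Hypothesis up_pos : 0 < up.
Hypothesis up_sub : up < cs.
Hypothesis up_eq : rho gam b0 (up ^ 2) * up = rho gam b0 (um ^ 2) * um.

Section Profile.
(* [kap = 1] for maxima, [kap = -1] for minima of [phi - H], where [H' s = be + al * s]. *)
Variables kap al be sg : R.
Hypothesis kap_sqr : kap * kap = 1.
Hypothesis kap_al : kap * al <= 0.
Hypothesis prof_sub : forall s, -1 <= s <= 1 -> Rabs (be + al * s) < cs.
Hypothesis sg_le : sg <= 1.

Definition prof (s : R) : R := be * s + al * s ^ 2 / 2.
Definition pw (x : pt3) : R := kap * (phi x - prof (X1 x)).
Definition pwD (i : idx) (x : pt3) : R := kap * (ph i x - match i with I1 => be + al * X1 x | _ => 0 end).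
Definition pwB (i j : idx) (x : pt3) : R := kap * (ph2 i j x - match i, j with I1, I1 => al | _, _ => 0 end).
(** The height [sg] serves two purposes: [sg = 1] gives the whole subsonic region up to the outlet,
    a lower value keeps the comparison away from the outlet. *)
Definition Wreg (x : pt3) : Prop := Dp x /\ X1 x < sg.

Lemma open_Wreg : open3 Wreg.
Proof.
  intros x [H1 H2]. apply filter_and; [apply open_Dp, H1|].
  apply (continuous_X1 x (fun u => u < sg)), (open_lt sg (X1 x)), H2.
Qed.

Lemma C1D_pw x : Dp x -> C1D pw pwD x.
Proof.
  intros H.
  assert (K : C1D (fun y => prof (X1 y)) (fun i y => (be + al * X1 y) * match i with I1 => 1 | I2 => 0 | I3 => 0 end) x).
  { apply (C1D_comp prof (fun s => be + al * s) (fun y => X1 y)).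
    - apply filter_forall. intros u. unfold prof. auto_derive; [trivial|]. field.
    - apply (ex_derive_continuous (fun s => be + al * s)). auto_derive. trivial.
    - apply (C1D_ext_loc (fun y => 1 * X1 y + 0 * X2 y + 0 * X3 y + 0)); [|apply C1D_affine].
      apply filter_forall. intros y. Req. ring. }
  pose proof (C1D_mult _ _ _ _ x (C1D_const kap x) (C1D_minus _ _ _ _ x (C1D_phi x (or_intror H)) K)) as Q.
  eapply C1D_ext_D; [|exact Q]. apply filter_forall. intros y i. unfold pwD. destruct i; Req; ring.
Qed.

Lemma C1D_pwD x i : Dp x -> C1D (pwD i) (pwB i) x.
Proof.
  intros H.
  assert (K : C1D (fun y => match i with I1 => be + al * X1 y | _ => 0 end)
             (fun j y => match i, j with I1, I1 => al | _, _ => 0 end) x).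
  { destruct i; [|apply (C1D_ext_D _ (fun _ _ => 0)); [apply filter_forall; intros y []; reflexivity|apply C1D_const]..].
    apply (C1D_ext_loc (fun y => al * X1 y + 0 * X2 y + 0 * X3 y + be)).
    { apply filter_forall. intros y. Req. ring. }
    apply (C1D_ext_D _ (fun i _ => match i with I1 => al | I2 => 0 | I3 => 0 end)); [|apply C1D_affine].
    apply filter_forall. intros y j. destruct j; reflexivity. }
  pose proof (C1D_mult _ _ _ _ x (C1D_const kap x) (C1D_minus _ _ _ _ x (C1D_dphi x i (or_intror H)) K)) as Q.
  eapply C1D_ext_D; [|exact Q]. apply filter_forall. intros y j. unfold pwB. Req. ring.
Qed.

(** With the gradient of [phi] frozen in its coefficients the equation is linear in the Hessian, so
    subtracting the profile leaves only its second derivative. Thus [kap * al <= 0] makes [pw] a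
    subsolution, strict when [kap * al < 0]. *)
Lemma pw_operator x : Dp x -> dens_base gam b0 (Nq x) * trace3 (fun i j => pwB i j x) - bilin (fun i j => pwB i j x) (grad phi x)
  = - (kap * al) * (dens_base gam b0 (Nq x) - ph I1 x ^ 2).
Proof.
  intros H. pose proof (mass_conservation x (or_intror H)) as E. pose proof (dens_Nq x (or_intror H)) as Hd.
  pose proof (rho_pos gam b0 (Nq x)) as Hr.
  assert (E' : dens_base gam b0 (Nq x) * (ph2 I1 I1 x + ph2 I2 I2 x + ph2 I3 I3 x)
      = (NqD I1 x * ph I1 x + NqD I2 x * ph I2 x + NqD I3 x * ph I3 x) / 2).
  { unfold AmassD, rho' in E. set (dd := dens_base gam b0 (Nq x)) in *. set (rr := rho gam b0 (Nq x)) in *.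
    apply Rmult_eq_reg_l with rr; [|lra].
    apply Rmult_eq_compat_r with (r := dd) in E. rewrite Rmult_0_l in E.
    replace ((- rr / (2 * dd) * NqD I1 x * ph I1 x + rr * ph2 I1 I1 x +
     (- rr / (2 * dd) * NqD I2 x * ph I2 x + rr * ph2 I2 I2 x) + (- rr / (2 * dd) * NqD I3 x * ph I3 x + rr * ph2 I3 I3 x)) * dd)
     with (rr * (dd * (ph2 I1 I1 x + ph2 I2 I2 x + ph2 I3 I3 x)) - rr * ((NqD I1 x * ph I1 x + NqD I2 x * ph I2 x + NqD I3 x * ph I3 x) / 2))
      in E by (field; lra). lra. }
  replace (trace3 (fun i j => pwB i j x)) with (kap * (ph2 I1 I1 x + ph2 I2 I2 x + ph2 I3 I3 x) - kap * al) by (unfold trace3, pwB; ring).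
  rewrite Rmult_minus_distr_l.
  replace (dens_base gam b0 (Nq x) * (kap * (ph2 I1 I1 x + ph2 I2 I2 x + ph2 I3 I3 x))) with
    (kap * (dens_base gam b0 (Nq x) * (ph2 I1 I1 x + ph2 I2 I2 x + ph2 I3 I3 x))) by ring.
  rewrite E'. unfold bilin, pwB, NqD, grad, X1, X2, X3; simpl. field.
Qed.

Lemma dens_gap q : dens_base gam b0 q - q = (gam + 1) / 2 * (cs ^ 2 - q).
Proof. apply dens_sub_sqr; apply fl. Qed.

Lemma gap_pos q : q < cs ^ 2 -> 0 < dens_base gam b0 q - q.
Proof. intros H. rewrite dens_gap. pose proof (fl_gam _ _ _ _ _ _ _ _ _ fl). nra. Qed.

Lemma Nq_sub x : Dp x -> Nq x < cs ^ 2.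
Proof. intros H. rewrite Nq_normsq. apply sub_sq, H. Qed.

Lemma ph1_Nq x : ph I1 x ^ 2 <= Nq x.
Proof. unfold Nq. nra. Qed.

Lemma pw_subsol x : Dp x -> 0 <= - (kap * al) * (dens_base gam b0 (Nq x) - ph I1 x ^ 2).
Proof.
  intros H. pose proof (gap_pos _ (Nq_sub x H)). pose proof (ph1_Nq x). apply Rmult_le_pos; lra.
Qed.

Lemma pw_local_max x : Dp x -> locally x (fun y => pw y <= pw x) ->
  (forall i, pwD i x = 0) /\ (forall d, bilin (fun i j => pwB i j x) d <= 0).
Proof.
  intros H HM.
  assert (K : forall d, pwD I1 x * X1 d + pwD I2 x * X2 d + pwD I3 x * X3 d + 0 = 0 /\ bilin (fun i j => pwB i j x) d + 0 <= 0).
  { apply (local_max_test pw pwD pwB (fun _ => 0) (fun _ _ => 0) (fun _ _ => 0) x).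
    - eapply filter_imp; [|apply (open_Dp x H)]. intros y Hy. apply C1D_pw, Hy.
    - intros i. apply C1D_pwD, H.
    - intros; apply is_derive_Rconst.
    - intros; apply is_derive_Rconst.
    - eapply filter_imp; [|exact HM]. intros y Hy. simpl in Hy. lra. }
  split; [|intros d; specialize (K d); lra].
  pose proof (proj1 (K (1, 0, 0))) as A1. pose proof (proj1 (K (0, 1, 0))) as A2. pose proof (proj1 (K (0, 0, 1))) as A3.
  unfold X1, X2, X3 in *; simpl in *. intros []; lra.
Qed.

Lemma no_interior_max x : kap * al < 0 -> Dp x -> locally x (fun y => pw y <= pw x) -> False.
Proof.
  intros Hs H HM. destruct (pw_local_max x H HM) as [_ T].
  pose proof (elliptic_trace (fun i j => pwB i j x) (grad phi x) (dens_base gam b0 (Nq x)) T) as C.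
  rewrite (pw_operator x H), <- Nq_normsq in C.
  pose proof (gap_pos _ (Nq_sub x H)). pose proof (ph1_Nq x). specialize (C ltac:(lra)). nra.
Qed.

(** At a critical point of [pw] the speed is that of the profile, strictly below [cstar]; this is
    the source of uniform ellipticity. *)
Lemma critical_gradient x : (forall i, pwD i x = 0) -> Nq x = (be + al * X1 x) ^ 2.
Proof.
  intros H. pose proof (H I1) as H1. pose proof (H I2) as H2. pose proof (H I3) as H3. unfold pwD in *.
  assert (kn : kap <> 0) by nra.
  assert (A1 : ph I1 x = be + al * X1 x) by (apply Rmult_integral in H1; destruct H1; [contradiction|lra]).
  assert (A2 : ph I2 x = 0) by (apply Rmult_integral in H2; destruct H2; [contradiction|lra]).
  assert (A3 : ph I3 x = 0) by (apply Rmult_integral in H3; destruct H3; [contradiction|lra]).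
  unfold Nq. rewrite A1, A2, A3. ring.
Qed.

Lemma prof_sub_sqr s : -1 <= s <= 1 -> (be + al * s) ^ 2 < cs ^ 2.
Proof.
  intros Hs. pose proof (prof_sub s Hs) as H. apply Rabs_lt_between in H. nra.
Qed.

(** The ellipticity gap [m] comes from the speed bound [q0]; the value of [dens_base] at rest is the
    upper bound [Q] for the coefficient. *)
Lemma hopf_flow y R1 R0 M q0 del : 0 < R1 -> R1 < R0 -> 0 < del -> q0 < cs ^ 2 ->
  (forall x, sq3 x y < R0 ^ 2 -> Dp x /\ Nq x <= q0 /\ pw x <= M) ->
  (forall x, sq3 x y <= R1 ^ 2 -> pw x <= M - del) ->
  exists a, 0 < a /\ forall x, sq3 x y < R0 ^ 2 -> pw x <= M - del * (exp (- a * sq3 x y) - exp (- a * R0 ^ 2)).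
Proof.
  intros H1 H0 Hdel Hq HB Hin.
  pose (m := dens_base gam b0 q0 - q0). assert (Hm : 0 < m) by (apply gap_pos, Hq).
  pose proof (stagnation_pos gam b0 (fl_gam _ _ _ _ _ _ _ _ _ fl) (fl_stag _ _ _ _ _ _ _ _ _ fl)) as Hst.
  set (Q := 1 + (gam - 1) * b0) in *.
  exists (hopf_rate R1 m Q). split.
  { unfold hopf_rate. apply Rdiv_lt_0_compat; [lra|]. apply Rmult_lt_0_compat; [lra|nra]. }
  apply (hopf_ball pw pwD pwB (grad phi) (fun x => dens_base gam b0 (Nq x))); auto.
  - intros x Hx. apply C1D_pw, HB, Hx.
  - intros x i Hx. apply C1D_pwD, HB, Hx.
  - intros x Hx. destruct (HB x Hx) as [A [B _]]. rewrite <- Nq_normsq.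
    pose proof (fl_gam _ _ _ _ _ _ _ _ _ fl) as G. split.
    + unfold m. pose proof (dens_gap q0). pose proof (dens_gap (Nq x)). nra.
    + unfold Q, dens_base. assert (0 <= Nq x) by (pose proof (ph1_Nq x); pose proof (pow2_ge_0 (ph I1 x)); lra). nra.
  - intros x Hx. rewrite pw_operator by apply HB, Hx. apply pw_subsol, HB, Hx.
  - intros x Hx. apply HB, Hx.
Qed.

Lemma sq3_triangle x y z a b : 0 < a -> 0 < b -> sq3 x y < a ^ 2 -> sq3 y z <= b ^ 2 -> sq3 x z < (a + b) ^ 2.
Proof.
  intros Ha Hb H1 H2. apply (dist3_sq3 x z (a + b)); [lra|].
  apply (dist3_sq3 x y a) in H1; [|lra].
  assert (dist3 y z <= b).
  { unfold dist3. fold (sq3 y z). rewrite <- (sqrt_pow2 b) by lra. apply sqrt_le_1_alt, H2. }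
  pose proof (dist3_triangle x y z). lra.
Qed.

Lemma sq3_sym x y : sq3 x y = sq3 y x.
Proof. unfold sq3. ring. Qed.

(** If [pw] were below [M] at some [y] near [x], the barrier around [y], in a ball with [x] in its
    interior, would push [pw x] below [M]. The barrier is strict throughout the open ball, so no
    touching sphere has to be constructed. *)
Lemma strong_max x M : Wreg x -> (forall y, Wreg y -> pw y <= M) -> pw x = M ->
  exists r, 0 < r /\ forall y, dist3 y x < r -> Wreg y /\ pw y = M.
Proof.
  intros Hx HM Ex.
  assert (Loc : locally x (fun y => pw y <= pw x)).
  { eapply filter_imp; [|apply (open_Wreg x Hx)]. intros y Hy. rewrite Ex. apply HM, Hy. }
  destruct (pw_local_max x (proj1 Hx) Loc) as [Z _]. apply critical_gradient in Z.
  pose proof (proj1 (proj1 (proj1 Hx))) as HX.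
  pose proof (prof_sub_sqr (X1 x) ltac:(lra)) as Hsq. rewrite <- Z in Hsq.
  pose (q0 := (Nq x + cs ^ 2) / 2).
  assert (CN : locally x (fun y => Nq y < q0)).
  { apply cont_lt_near; [|unfold q0; lra]. apply (C1D_continuous _ _ _ (C1D_Nq x (or_intror (proj1 Hx)))). }
  pose proof (filter_and _ _ (open_Wreg x Hx) CN) as K. apply locally3 in K. destruct K as [r [Hr K]].
  exists (r / 2). split; [lra|]. intros y Hy.
  assert (Wy : Wreg y) by (apply K; lra). split; [exact Wy|].
  apply Rle_antisym; [apply HM, Wy|]. apply Rnot_lt_le. intros L.
  pose (del := (M - pw y) / 2). assert (Hdel : 0 < del) by (unfold del; lra).
  assert (Cy : locally y (fun z => pw z < M - del)).
  { apply cont_lt_near; [|unfold del; lra]. apply (C1D_continuous _ _ _ (C1D_pw y (proj1 Wy))). }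
  apply locally3 in Cy. destruct Cy as [r1 [Hr1 Cy]].
  pose (R1 := Rmin (r1 / 2) (r / 4)).
  assert (HR1 : 0 < R1 /\ R1 <= r1 / 2 /\ R1 <= r / 4).
  { unfold R1. split; [apply Rmin_glb_lt; lra|]. split; [apply Rmin_l|apply Rmin_r]. }
  assert (Syx : sq3 y x < (r / 2) ^ 2) by (apply dist3_sq3; lra).
  destruct (hopf_flow y R1 (r / 2) M q0 del) as [a [Ha Q]]; try lra.
  - unfold q0; lra.
  - intros z Hz. destruct (K z) as [A B].
    { apply (dist3_sq3 z x r Hr). replace r with (r / 2 + r / 2) by field. apply (sq3_triangle z y x); lra. }
    split; [apply A|]. split; [lra|apply HM, A].
  - intros z Hz. apply Rlt_le, Cy. apply (dist3_sq3 z y r1 Hr1). nra.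
  - rewrite sq3_sym in Syx. specialize (Q x Syx). rewrite Ex in Q.
    assert (exp (- a * (r / 2) ^ 2) < exp (- a * sq3 x y)) by (apply exp_increasing; nra). nra.
Qed.

Lemma Wreg_adh x : adh3 Wreg x -> closure2 Om (sec x) /\ f (sec x) <= X1 x <= sg.
Proof.
  intros Ha.
  assert (Ap : adh3 Dp x) by (intros r Hr; destruct (Ha r Hr) as [z [[A _] B]]; exists z; auto).
  split; [apply (adh_closure Dp x (fun z H => proj1 H) Ap)|]. split; [apply adh_Dp_ge, Ap|].
  apply Rnot_lt_le. intros L. destruct (Ha (X1 x - sg) ltac:(lra)) as [z [[_ A] B]].
  destruct (abs_coord_le_dist3 z x) as [C _]. apply Rabs_le_between in C. lra.
Qed.

Lemma Wreg_near_below x : closure2 Om (sec x) -> f (sec x) < X1 x -> exists r, 0 < r /\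
  forall z, dist3 z x < r -> Om (sec z) -> X1 z < sg -> Wreg z.
Proof.
  intros Hc Hx. destruct (f_near x ((X1 x - f (sec x)) / 2) Hc ltac:(lra)) as [r [Hr H]].
  exists (Rmin r ((X1 x - f (sec x)) / 2)). split; [apply Rmin_glb_lt; lra|]. intros z Hz Oz Lz.
  pose proof (Rmin_l r ((X1 x - f (sec x)) / 2)). pose proof (Rmin_r r ((X1 x - f (sec x)) / 2)).
  specialize (H z (closure2_incl _ _ Oz) ltac:(lra)). apply Rabs_lt_between in H.
  destruct (abs_coord_le_dist3 z x) as [C _]. apply Rabs_le_between in C.
  pose proof (f_gt _ Oz). repeat split; try assumption; lra.
Qed.

Lemma Wreg_near x : closure2 Om (sec x) -> f (sec x) < X1 x < sg -> exists r, 0 < r /\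
  forall z, dist3 z x < r -> Om (sec z) -> Wreg z.
Proof.
  intros Hc Hx. destruct (Wreg_near_below x Hc (proj1 Hx)) as [r [Hr H]].
  exists (Rmin r (sg - X1 x)). split; [apply Rmin_glb_lt; lra|]. intros z Hz Oz.
  pose proof (Rmin_l r (sg - X1 x)). pose proof (Rmin_r r (sg - X1 x)).
  destruct (abs_coord_le_dist3 z x) as [C _]. apply Rabs_le_between in C. apply H; [lra|exact Oz|lra].
Qed.

Lemma glim_pwD (A : pt3 -> Prop) x L : (forall z, A z -> Dp z) -> glim Dp phi x L ->
  forall i, filterlim (pwD i) (within A (locally x))
    (locally (coord i (kap * (X1 L - (be + al * X1 x)), kap * X2 L, kap * X3 L))).
Proof.
  intros HA HL i.
  assert (G : forall i, filterlim (ph i) (within A (locally x)) (locally (coord i L))).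
  { intros j P HP. specialize (HL j P HP). unfold filtermap, within in *. eapply filter_imp; [|exact HL]. cbv beta. auto. }
  assert (CX : filterlim X1 (within A (locally x)) (locally (X1 x))).
  { eapply filterlim_filter_le_1; [apply filter_le_within|apply continuous_X1]. }
  unfold pwD. destruct i; unfold coord, X1 at 2, X2, X3; simpl.
  - apply filterlim_Rmult; [typeclasses eauto|apply filterlim_Rconst; typeclasses eauto|].
    apply filterlim_Rminus; [typeclasses eauto|exact (G I1)|].
    apply filterlim_Rplus; [typeclasses eauto|apply filterlim_Rconst; typeclasses eauto|].
    apply filterlim_Rmult; [typeclasses eauto|apply filterlim_Rconst; typeclasses eauto|exact CX].
  - apply (filterlim_ext (fun z => kap * ph I2 z)); [intros z; Req; ring|].
    apply filterlim_Rmult; [typeclasses eauto|apply filterlim_Rconst; typeclasses eauto|exact (G I2)].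
  - apply (filterlim_ext (fun z => kap * ph I3 z)); [intros z; Req; ring|].
    apply filterlim_Rmult; [typeclasses eauto|apply filterlim_Rconst; typeclasses eauto|exact (G I3)].
Qed.

Lemma shift_near x d r : 0 < r -> exists tau, 0 < tau /\ forall t, 0 < t < tau -> dist3 (shift x d t) x < r.
Proof.
  intros Hr. pose proof (continuous_shift x d 0 (fun z => dist3 z x < r)) as C. rewrite shift_0 in C.
  assert (K : locally x (fun z => dist3 z x < r)) by (apply locally3; exists r; auto).
  specialize (C K). unfold filtermap in C. apply locally_R in C. destruct C as [tau [Ht C]].
  exists tau. split; [exact Ht|]. intros t Htt. apply C. rewrite Rminus_0_r, Rabs_right; lra.
Qed.

(** At a wall maximum the first-order conditions make the limit gradient of [pw] vanish, the slip
    condition covering the normal direction. The speed is then that of the profile, so the equation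
    is uniformly elliptic nearby, and a barrier in a tangent ball contradicts the vanishing normal
    derivative. *)
Lemma wall_hopf x M : bdry2 Om (sec x) -> f (sec x) < X1 x < sg ->
  (forall y, Wreg y -> pw y < M) -> filterlim pw (within Wreg (locally x)) (locally M) -> False.
Proof.
  intros HB Hx HM Lim. pose proof (proj1 HB) as Hc. pose proof (f_bounds _ Hc) as Fb.
  assert (Ap : adh3 Dp x) by (apply adh_Dp; [exact Hc|lra]).
  destruct (glim_Dp_exists x Ap) as [L [HL [Sl _]]]. specialize (Sl HB).
  destruct (Wreg_near x Hc Hx) as [r [Hr Near]].
  pose proof (glim_pwD Wreg x L (fun z H => proj1 H) HL) as GL.
  set (Lam := (kap * (X1 L - (be + al * X1 x)), kap * X2 L, kap * X3 L) : pt3) in *.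
  assert (C1 : forall z, Wreg z -> C1D pw pwD z) by (intros z Hz; apply C1D_pw, Hz).
  assert (ZL : Lam = (0, 0, 0)).
  { destruct (inward_directions Om (sec x) (fl_open _ _ _ _ _ _ _ _ _ fl) (fl_C3 _ _ _ _ _ _ _ _ _ fl) Hc) as [n [Hn Dir]].
    pose proof (Hn L (fun _ => Sl)) as SlN.
    (* By slip, [Lam] has no normal component, so [Lam] minus the normal points inward and has the
       same product with [Lam] as [Lam] itself. *)
    pose (d := (X1 Lam, X2 Lam - 1 * fst n, X3 Lam - 1 * snd n) : pt3).
    destruct (Dir (X2 Lam, X3 Lam) 1) as [tau [Ht HO]]; [|lra|].
    { unfold Lam, X2 at 1, X3 at 1; simpl. replace (kap * X2 L * fst n + kap * X3 L * snd n) with (kap * (X2 L * fst n + X3 L * snd n)) by ring.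
      rewrite SlN. ring. }
    destruct (shift_near x d r Hr) as [tau2 [Ht2 HN]].
    assert (D0 : dot3 Lam d <= 0).
    { apply (directional_max Wreg pw pwD x d Lam M (Rmin tau tau2)); auto.
      - apply Rmin_glb_lt; lra.
      - intros t Htt. pose proof (Rmin_l tau tau2). pose proof (Rmin_r tau tau2).
        apply Near; [apply HN; lra|]. exact (HO t ltac:(lra)).
      - intros z Hz. apply Rlt_le, HM, Hz. }
    assert (E : dot3 Lam d = normsq Lam).
    { unfold dot3, normsq, d, Lam, X1 at 2 3, X2 at 2 3, X3 at 2 3; simpl. unfold X1 at 1 2, X2 at 1 2, X3 at 1 2; simpl.
      unfold X1, X2, X3 in *; simpl in *.
      replace (kap * snd (fst L) * (kap * snd (fst L) - 1 * fst n) + kap * snd L * (kap * snd L - 1 * snd n)) with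
        (kap * snd (fst L) * (kap * snd (fst L)) + kap * snd L * (kap * snd L) - kap * (snd (fst L) * fst n + snd L * snd n)) by ring.
      rewrite Rplus_assoc.
      replace (kap * snd (fst L) * (kap * snd (fst L) - 1 * fst n) + kap * snd L * (kap * snd L - 1 * snd n)) with
        (kap * snd (fst L) * (kap * snd (fst L)) + kap * snd L * (kap * snd L) - kap * (snd (fst L) * fst n + snd L * snd n)) by ring.
      rewrite SlN. ring. }
    rewrite E in D0. unfold normsq in D0.
    pose proof (pow2_ge_0 (X1 Lam)). pose proof (pow2_ge_0 (X2 Lam)). pose proof (pow2_ge_0 (X3 Lam)).
    apply coord_ext. intros i. transitivity 0; [|destruct i; reflexivity].
    apply Rsqr_0_uniq. unfold Rsqr. destruct i; unfold coord; lra. }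
  assert (kn : kap <> 0) by nra.
  assert (HN : normsq L < cs ^ 2).
  { assert (Z1 : kap * (X1 L - (be + al * X1 x)) = 0) by exact (f_equal X1 ZL).
    assert (Z2 : kap * X2 L = 0) by exact (f_equal X2 ZL). assert (Z3 : kap * X3 L = 0) by exact (f_equal X3 ZL).
    apply Rmult_integral in Z1. apply Rmult_integral in Z2. apply Rmult_integral in Z3.
    destruct Z1 as [?|Z1]; [contradiction|]. destruct Z2 as [?|Z2]; [contradiction|]. destruct Z3 as [?|Z3]; [contradiction|].
    unfold normsq. replace (X1 L) with (be + al * X1 x) by lra. rewrite Z2, Z3.
    pose proof (prof_sub_sqr (X1 x) ltac:(lra)). lra. }
  pose (q0 := (normsq L + cs ^ 2) / 2).
  assert (NN : exists r2, 0 < r2 /\ forall z, Dp z -> dist3 z x < r2 -> Nq z <= q0).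
  { pose proof (proj1 (filterlim_R _ _ _) (glim_normsq Dp phi x L HL) ((cs ^ 2 - normsq L) / 2) ltac:(lra)) as K.
    unfold within in K. apply locally3 in K. destruct K as [r2 [Hr2 K]]. exists r2. split; [exact Hr2|].
    intros z Dz Hz. specialize (K z Hz Dz). apply Rabs_lt_between in K. rewrite Nq_normsq. unfold q0. lra. }
  destruct NN as [r2 [Hr2 NN]].
  destruct (boundary_normal Om (sec x) (fl_C3 _ _ _ _ _ _ _ _ _ fl) HB) as [n [Rb [_ [Nn [HRb Disc]]]]].
  pose (R := Rmin Rb (Rmin (r / 4) (r2 / 4))).
  assert (HR : 0 < R /\ R <= Rb /\ R <= r / 4 /\ R <= r2 / 4).
  { unfold R. pose proof (Rmin_l Rb (Rmin (r / 4) (r2 / 4))). pose proof (Rmin_r Rb (Rmin (r / 4) (r2 / 4))).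
    pose proof (Rmin_l (r / 4) (r2 / 4)). pose proof (Rmin_r (r / 4) (r2 / 4)).
    split; [repeat apply Rmin_glb_lt; lra|lra]. }
  pose (d := (0, - fst n, - snd n) : pt3). pose (y := shift x d R).
  assert (Syx : sq3 y x <= R ^ 2).
  { unfold y, sq3, shift, d, X1, X2, X3; simpl. 
    replace ((fst (fst x) + R * 0 - fst (fst x)) * ((fst (fst x) + R * 0 - fst (fst x)) * 1) +
      (snd (fst x) + R * - fst n - snd (fst x)) * ((snd (fst x) + R * - fst n - snd (fst x)) * 1) +
      (snd x + R * - snd n - snd x) * ((snd x + R * - snd n - snd x) * 1)) with (R * R * (fst n ^ 2 + snd n ^ 2)) by ring.
    rewrite Nn. lra. }
  assert (Ball : forall z, sq3 z y < R ^ 2 -> Wreg z /\ Nq z <= q0).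
  { intros z Hz. assert (Hd : dist3 z x < 2 * R).
    { apply dist3_sq3; [lra|]. replace (2 * R) with (R + R) by ring. apply (sq3_triangle z y x); lra. }
    assert (Wz : Wreg z).
    { apply Near; [lra|]. apply (Disc R (sec z)); [lra|].
      unfold y, sq3, shift, d, X1, X2, X3 in Hz; simpl in Hz. unfold sec, X2, X3; simpl.
      set (z1 := fst (fst z)) in *. set (z2 := snd (fst z)) in *. set (z3 := snd z) in *.
      set (u1 := fst (fst x)) in *. set (u2 := snd (fst x)) in *. set (u3 := snd x) in *.
      pose proof (pow2_ge_0 (z1 - (u1 + R * 0))).
      assert (E : (z2 - (u2 + R * - fst n)) * ((z2 - (u2 + R * - fst n)) * 1) + (z3 - (u3 + R * - snd n)) * ((z3 - (u3 + R * - snd n)) * 1) =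
         (z2 - u2) ^ 2 + (z3 - u3) ^ 2 + 2 * R * ((z2 - u2) * fst n + (z3 - u3) * snd n) + R * R * (fst n ^ 2 + snd n ^ 2)) by ring.
      rewrite Nn in E. simpl in *. lra. }
    split; [exact Wz|]. apply NN; [apply Wz|lra]. }
  (* Compactness of the half-size ball makes the pointwise strict inequality a uniform drop
     [del]. *)
  destruct (evt3 (fun z => sq3 z y <= (R / 2) ^ 2) pw (Rabs (X1 y) + Rabs (X2 y) + Rabs (X3 y) + R / 2)) as [xm [Hxm Mxm]].
  - exists y. unfold sq3. rewrite !Rminus_diag. nra.
  - intros z Hz. apply sq3_bounded; [lra|exact Hz].
  - intros z. apply adh3_le. intros; apply continuous_sq3.
  - intros z Hz. apply (C1D_continuous _ _ _ (C1D_pw z (proj1 (proj1 (Ball z ltac:(nra)))))).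
  - pose proof (HM xm (proj1 (Ball xm ltac:(nra)))) as Lm.
    pose (del := M - pw xm). assert (Hdel : 0 < del) by (unfold del; lra).
    destruct (hopf_flow y (R / 2) R M q0 del) as [a [Ha Q]]; try lra.
    + unfold q0; lra.
    + intros z Hz. destruct (Ball z Hz) as [A B]. split; [apply A|]. split; [exact B|apply Rlt_le, HM, A].
    + intros z Hz. specialize (Mxm z Hz). unfold del. lra.
    + (* along the inner normal [pw] drops at least linearly, against the vanishing derivative *)
      set (k := del * exp (- a * R ^ 2) * (a * R)).
      assert (Hk : 0 < k).
      { unfold k. pose proof (exp_pos (- a * R ^ 2)). repeat apply Rmult_lt_0_compat; lra. }
      assert (Sq : forall t, sq3 (shift x d t) y = (R - t) ^ 2).
      { intros t. unfold y, sq3, shift, d, X1, X2, X3; simpl.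
        replace ((fst (fst x) + t * 0 - (fst (fst x) + R * 0)) * ((fst (fst x) + t * 0 - (fst (fst x) + R * 0)) * 1) +
          (snd (fst x) + t * - fst n - (snd (fst x) + R * - fst n)) * ((snd (fst x) + t * - fst n - (snd (fst x) + R * - fst n)) * 1) +
          (snd x + t * - snd n - (snd x + R * - snd n)) * ((snd x + t * - snd n - (snd x + R * - snd n)) * 1)) with
          ((R - t) * (R - t) * (fst n ^ 2 + snd n ^ 2)) by ring. rewrite Nn. ring. }
      destruct (directional_limit Wreg pw pwD x d Lam M R) with (e := k / 2) as [s [Hs Ks]]; auto; try lra.
      { intros t Ht. apply Ball. rewrite Sq. nra. }
      pose (t := s / 2). specialize (Ks t ltac:(unfold t; lra)). rewrite ZL in Ks.
      assert (D0 : dot3 (0, 0, 0) d = 0) by (unfold dot3, X1, X2, X3; simpl; ring). rewrite D0, Rmult_0_r, Rminus_0_r in Ks.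
      assert (Ht : 0 < t < R) by (unfold t; lra).
      pose proof (Q (shift x d t)) as Qt. rewrite Sq in Qt. specialize (Qt ltac:(nra)).
      apply Rabs_le_between in Ks.
      assert (EX : exp (- a * (R - t) ^ 2) = exp (- a * R ^ 2) * exp (a * (2 * R * t - t ^ 2))).
      { rewrite <- exp_plus. f_equal. ring. }
      pose proof (exp_ineq1_le (a * (2 * R * t - t ^ 2))) as EI.
      pose proof (exp_pos (- a * R ^ 2)) as EP.
      assert (K0 : R * t <= 2 * R * t - t ^ 2) by nra.
      assert (K1 : a * (R * t) <= a * (2 * R * t - t ^ 2)) by (apply Rmult_le_compat_l; lra).
      assert (K2 : exp (- a * R ^ 2) * (a * R * t) <= exp (- a * (R - t) ^ 2) - exp (- a * R ^ 2)).
      { rewrite EX. replace (exp (- a * R ^ 2) * exp (a * (2 * R * t - t ^ 2)) - exp (- a * R ^ 2)) with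
          (exp (- a * R ^ 2) * (exp (a * (2 * R * t - t ^ 2)) - 1)) by ring.
        apply Rmult_le_compat_l; lra. }
      assert (K3 : k * t <= del * (exp (- a * (R - t) ^ 2) - exp (- a * R ^ 2))).
      { unfold k. replace (del * exp (- a * R ^ 2) * (a * R) * t) with (del * (exp (- a * R ^ 2) * (a * R * t))) by ring.
        apply Rmult_le_compat_l; lra. }
      nra.
Qed.

Lemma pw_lipschitz : Lipschitz_on (inD Om) pw.
Proof.
  destruct (fl_lip _ _ _ _ _ _ _ _ _ fl) as [K HK]. exists (K + (Rabs be + Rabs al)). intros x y Hx Hy.
  specialize (HK x y Hx Hy). destruct (abs_coord_le_dist3 x y) as [C _].
  assert (Ak : Rabs kap = 1).
  { assert (Rabs kap * Rabs kap = 1) by (rewrite <- Rabs_mult, kap_sqr, Rabs_R1; reflexivity).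
    pose proof (Rabs_pos kap). nra. }
  unfold pw. rewrite <- Rmult_minus_distr_l, Rabs_mult, Ak, Rmult_1_l.
  replace (phi x - prof (X1 x) - (phi y - prof (X1 y))) with
    ((phi x - phi y) - (be + al * ((X1 x + X1 y) / 2)) * (X1 x - X1 y)) by (unfold prof; field).
  unfold Rminus at 1. eapply Rle_trans; [apply Rabs_triang|]. rewrite Rabs_Ropp.
  assert (Rabs ((be + al * ((X1 x + X1 y) / 2)) * (X1 x - X1 y)) <= (Rabs be + Rabs al) * dist3 x y).
  { apply Rmult_le_abs; [|exact C]. eapply Rle_trans; [apply Rabs_triang|]. apply Rplus_le_compat_l.
    rewrite <- (Rmult_1_r (Rabs al)). apply Rmult_le_abs; [lra|]. apply Rabs_le_between.
    destruct Hx as [Hx _], Hy as [Hy _]. lra. }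
  lra.
Qed.

Lemma glim_Dm_U x : glim Dm phi x Ustate.
Proof.
  intros i. apply filterlim_R; [typeclasses eauto|]. intros e He. unfold within. apply filter_forall. intros z Hz.
  rewrite <- coord_grad, (supersonic_uniform z Hz), Rminus_diag, Rabs_R0. exact He.
Qed.

(** Upstream [phi = um * x1], and Lipschitz continuity transfers the value to the other side. *)
Lemma shock_trace (A : pt3 -> Prop) p : (forall z, A z -> inD Om z) -> closure2 Om p ->
  filterlim phi (within A (locally (pt (f p) p))) (locally (um * f p)).
Proof.
  intros HA Hp. destruct (seq_of_adh Dm _ (proj1 (adh_shock p Hp))) as [u [Hu Lu]].
  apply (lipschitz_lim A (inD Om) phi _ u); auto; [apply fl|intros n; apply Hu|].
  apply (filterlim_ext (fun n => um * X1 (u n))); [intros n; symmetry; apply supersonic_phi, Hu|].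
  apply filterlim_Rmult; [typeclasses eauto|apply filterlim_Rconst; typeclasses eauto|].
  exact (filterlim_comp _ _ _ _ _ _ _ _ Lu (continuous_X1 _)).
Qed.

Lemma prof_continuous s : continuous prof s.
Proof. apply (ex_derive_continuous prof). unfold prof. auto_derive. trivial. Qed.

Lemma pw_shock_trace (A : pt3 -> Prop) p : (forall z, A z -> inD Om z) -> closure2 Om p ->
  filterlim pw (within A (locally (pt (f p) p))) (locally (kap * (um * f p - prof (f p)))).
Proof.
  intros HA Hp. unfold pw. apply filterlim_Rmult; [typeclasses eauto|apply filterlim_Rconst; typeclasses eauto|].
  apply filterlim_Rminus; [typeclasses eauto|apply shock_trace; assumption|].
  apply (filterlim_cont _ X1 prof); [|apply prof_continuous].
  eapply filterlim_filter_le_1; [apply filter_le_within|exact (continuous_X1 (pt (f p) p))].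
Qed.

(** Strictness of the profile excludes interior maxima and the Hopf argument excludes the wall, so
    the shock and the slice [X1 = sg] remain. *)
Lemma location : kap * al < 0 -> (exists x, Wreg x) -> exists M x, (forall y, Wreg y -> pw y <= M) /\
  adh3 Wreg x /\ filterlim pw (within Wreg (locally x)) (locally M) /\
  (X1 x = f (sec x) \/ (f (sec x) < X1 x /\ X1 x = sg)).
Proof.
  intros Hs [x1 Hx1]. destruct inD_bounded as [B [HB0 HB]]. destruct pw_lipschitz as [K HK].
  destruct (sup_adherent Wreg pw B (pw x1 + Rabs K * (6 * B))) as [M [x [u [HM [Hu [Lu LM]]]]]].
  - exists x1. exact Hx1.
  - intros z Hz. apply HB, Hz.
  - intros z Hz. specialize (HK z x1 (proj1 (proj1 Hz)) (proj1 (proj1 Hx1))).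
    destruct (HB z (proj1 (proj1 Hz))) as [A1 [A2 A3]]. destruct (HB x1 (proj1 (proj1 Hx1))) as [C1 [C2 C3]].
    pose proof (dist3_le_sum z x1) as D.
    assert (forall a b, Rabs a <= B -> Rabs b <= B -> Rabs (a - b) <= 2 * B).
    { intros a b Ha Hb. unfold Rminus. eapply Rle_trans; [apply Rabs_triang|]. rewrite Rabs_Ropp. lra. }
    pose proof (H _ _ A1 C1). pose proof (H _ _ A2 C2). pose proof (H _ _ A3 C3).
    assert (D0 : 0 <= dist3 z x1) by apply sqrt_pos.
    assert (K * dist3 z x1 <= Rabs K * (6 * B)).
    { pose proof (Rle_abs K). pose proof (Rabs_pos K).
      apply Rle_trans with (Rabs K * dist3 z x1); [apply Rmult_le_compat_r; lra|apply Rmult_le_compat_l; lra]. }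
    apply Rabs_le_between in HK. lra.
  - assert (Ha : adh3 Wreg x) by (apply (seq_adh3 Wreg u); assumption).
    assert (Lim : filterlim pw (within Wreg (locally x)) (locally M)).
    { apply (lipschitz_lim Wreg (inD Om) pw x u); auto.
      - intros z Hz. apply Hz.
      - exists K. exact HK.
      - intros n. apply Hu. }
    destruct (Wreg_adh x Ha) as [Hc Hx].
    exists M, x. split; [exact HM|]. split; [exact Ha|]. split; [exact Lim|].
    destruct (Req_dec (X1 x) (f (sec x))) as [E|NE]; [auto|]. right.
    assert (Lf : f (sec x) < X1 x) by lra. split; [exact Lf|].
    apply NNPP. intros N. assert (Lg : X1 x < sg) by lra. pose proof (f_bounds _ Hc) as Fb.
    assert (NI : forall y, Wreg y -> pw y < M).
    { intros y Hy. destruct (Rle_lt_or_eq_dec _ _ (HM y Hy)) as [L|E]; [exact L|exfalso].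
      apply (no_interior_max y Hs (proj1 Hy)). eapply filter_imp; [|apply (open_Wreg y Hy)].
      intros z Hz. rewrite E. apply HM, Hz. }
    destruct (classic (Om (sec x))) as [O|NO].
    + assert (Wx : Wreg x) by (repeat split; try assumption; lra).
      assert (E : pw x = M).
      { apply (within_lim_unique Wreg x pw); [exact Ha| |exact Lim].
        eapply filterlim_filter_le_1; [apply filter_le_within|].
        apply (C1D_continuous _ _ _ (C1D_pw x (proj1 Wx))). }
      specialize (NI x Wx). lra.
    + apply (wall_hopf x M); auto. split; assumption.
Qed.

(** Carries the outlet condition to the edge with the wall. *)
Lemma outlet_norm p L : closure2 Om p -> glim Dp phi (pt 1 p) L -> normsq L = c1 ^ 2 /\ 0 <= X1 L.
Proof.
  intros Hp HL.
  assert (Ad : forall q, closure2 Om q -> adh3 Dp (pt 1 q)).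
  { intros q Hq. apply adh_Dp; rewrite sec_pt; [exact Hq|]. pose proof (f_bounds q Hq). unfold pt, X1; simpl. lra. }
  assert (K : forall n : nat, exists z : pt2 * pt3, Om (fst z) /\ dist2 (fst z) p < / (INR n + 1) /\
      glim Dp phi (pt 1 (fst z)) (snd z) /\ norm3 (snd z) = c1 /\ 0 <= X1 (snd z)).
  { intros n. destruct (Hp _ (inv_INR_pos n)) as [q [Oq Hq]].
    destruct (glim_Dp_exists _ (Ad q (closure2_incl _ _ Oq))) as [L' [HL' [_ HS]]].
    destruct HS as [S1 S2]; [split; [reflexivity|rewrite sec_pt; exact Oq]|].
    exists (q, L'). auto. }
  destruct (nat_choice _ K) as [z Hz].
  assert (Lim : forall i, filterlim (fun n => coord i (snd (z n))) eventually (locally (coord i L))).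
  { intros i. apply filterlim_R; [typeclasses eauto|]. intros e He.
    destruct (glim_near Dp _ _ HL (e / 2) ltac:(lra)) as [d [Hd H]]. destruct (inv_INR_small d Hd) as [N HN].
    exists N. intros n Hn. destruct (Hz n) as [A [B [C _]]]. specialize (HN n Hn).
    assert (Dd : dist3 (pt 1 (fst (z n))) (pt 1 p) < d).
    { eapply Rle_lt_trans; [apply dist3_pt|]. rewrite Rminus_diag, Rabs_R0. lra. }
    specialize (H _ _ Dd (Ad _ (closure2_incl _ _ A)) C i). lra. }
  split.
  - apply (seq_lim_unique (fun n => normsq (snd (z n)))).
    + apply coord_normsq_lim; [typeclasses eauto|exact Lim].
    + apply (filterlim_ext (fun _ => c1 ^ 2)); [|apply filterlim_const].
      intros n. destruct (Hz n) as [_ [_ [_ [E _]]]]. rewrite <- norm3_sqr, E. reflexivity.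
  - apply (seq_lim_ge (fun n => X1 (snd (z n)))); [exact (Lim I1)|]. intros n. apply Hz.
Qed.

Lemma slip_inward p : closure2 Om p -> exists n : pt2,
  (forall s L, f p <= s <= 1 -> glim Dp phi (pt s p) L -> X2 L * fst n + X3 L * snd n = 0) /\
  forall d e, fst d * fst n + snd d * snd n = 0 -> 0 < e -> exists tau, 0 < tau /\ forall t, 0 < t < tau ->
      Om (fst p + t * (fst d - e * fst n), snd p + t * (snd d - e * snd n)).
Proof.
  intros Hp.
  destruct (inward_directions Om p (fl_open _ _ _ _ _ _ _ _ _ fl) (fl_C3 _ _ _ _ _ _ _ _ _ fl) Hp) as [n [Hn Dir]].
  exists n. split; [|exact Dir]. intros s L Hs HL. apply Hn. intros HB.
  assert (Ap : adh3 Dp (pt s p)) by (apply adh_Dp; rewrite sec_pt; [exact Hp|unfold pt, X1; simpl; lra]).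
  destruct (glim_Dp_exists _ Ap) as [L' [HL' [Sl _]]]. rewrite sec_pt in Sl.
  rewrite (glim_unique Dp phi _ L L' Ap HL HL'). apply Sl, HB.
Qed.

(** Moving back from the outlet at a small rate [e] while moving sideways shows that the
    cross-sectional part of the limit gradient vanishes; its norm and sign then give first component
    [c1], and the purely backward direction gives the inequality. *)
Lemma outlet_max p M : sg = 1 -> closure2 Om p -> f p < 1 -> (forall y, Wreg y -> pw y <= M) ->
  filterlim pw (within Wreg (locally (pt 1 p))) (locally M) -> 0 <= kap * (c1 - (be + al)).
Proof.
  intros Esg Hp Hf HM Lim. set (x := pt 1 p) in *. assert (Sx : sec x = p) by apply sec_pt.
  pose proof (f_bounds p Hp) as Fb.
  assert (Ap : adh3 Dp x) by (apply adh_Dp; rewrite Sx; [exact Hp|unfold x, pt, X1; simpl; lra]).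
  destruct (glim_Dp_exists x Ap) as [L [HL _]].
  destruct (outlet_norm p L Hp HL) as [NL PL].
  destruct (slip_inward p Hp) as [n [Sl Dir]]. specialize (Sl 1 L ltac:(lra) HL).
  destruct (Wreg_near_below x) as [r [Hr Near]]; [rewrite Sx; exact Hp|rewrite Sx; unfold x, pt, X1; simpl; lra|].
  pose proof (glim_pwD Wreg x L (fun z H => proj1 H) HL) as GL.
  set (Lam := (kap * (X1 L - (be + al * X1 x)), kap * X2 L, kap * X3 L) : pt3) in *.
  assert (Key : forall v1 v2 e, v1 * fst n + v2 * snd n = 0 -> 0 < e -> X2 Lam * v1 + X3 Lam * v2 <= e * X1 Lam).
  { intros v1 v2 e Hv He. destruct (Dir (v1, v2) e Hv He) as [tau [Ht HO]].
    pose (d := (- e, v1 - e * fst n, v2 - e * snd n) : pt3).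
    destruct (shift_near x d r Hr) as [tau2 [Ht2 HN]].
    assert (D0 : dot3 Lam d <= 0).
    { apply (directional_max Wreg pw pwD x d Lam M (Rmin tau tau2)); auto.
      - apply Rmin_glb_lt; lra.
      - intros t Htt. pose proof (Rmin_l tau tau2). pose proof (Rmin_r tau tau2).
        apply Near; [apply HN; lra|exact (HO t ltac:(lra))|]. rewrite Esg. unfold shift, x, pt, d, X1; simpl. nra.
      - intros z Hz. apply C1D_pw, Hz. }
    assert (E : dot3 Lam d = - e * X1 Lam + (X2 Lam * v1 + X3 Lam * v2) - e * kap * (X2 L * fst n + X3 L * snd n)).
    { unfold dot3, d, Lam, X1, X2, X3; simpl. ring. }
    rewrite E, Sl in D0. lra. }
  assert (Pos : 0 <= X1 Lam).
  { specialize (Key 0 0 1). rewrite !Rmult_0_l, !Rmult_0_r, Rplus_0_r in Key. specialize (Key eq_refl Rlt_0_1). lra. }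
  assert (Z : X2 Lam * X2 Lam + X3 Lam * X3 Lam <= 0).
  { apply Rnot_lt_le. intros Lt.
    destruct (exists_small ((X2 Lam * X2 Lam + X3 Lam * X3 Lam) / 2) (X1 Lam) ltac:(lra) Pos) as [e [He Ee]].
    specialize (Key (X2 Lam) (X3 Lam) e). 
    assert (Hv : X2 Lam * fst n + X3 Lam * snd n = 0).
    { unfold Lam, X2 at 1, X3 at 1; simpl. replace (kap * X2 L * fst n + kap * X3 L * snd n) with (kap * (X2 L * fst n + X3 L * snd n)) by ring.
      rewrite Sl. ring. }
    specialize (Key Hv He). lra. }
  assert (kn : kap <> 0) by nra.
  assert (Z2 : kap * X2 L = 0) by (change (X2 Lam = 0); nra).
  assert (Z3 : kap * X3 L = 0) by (change (X3 Lam = 0); nra).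
  apply Rmult_integral in Z2. apply Rmult_integral in Z3.
  destruct Z2 as [?|Z2]; [contradiction|]. destruct Z3 as [?|Z3]; [contradiction|].
  unfold normsq in NL. rewrite Z2, Z3 in NL. pose proof (fl_c1p _ _ _ _ _ _ _ _ _ fl).
  assert (EL : X1 L = c1) by nra.
  assert (EX : X1 Lam = kap * (X1 L - (be + al * 1))) by reflexivity. rewrite EL, Rmult_1_r in EX. lra.
Qed.

Lemma f_trace (h : pt2 -> R) (s : R) p : closure2 Om p -> cont2_on (closure2 Om) h ->
  filterlim (fun x => h (sec x)) (within (fun x => Om (sec x)) (locally (pt s p))) (locally (h p)).
Proof.
  intros Hp Hc. apply filterlim_R; [typeclasses eauto|]. intros e He. destruct (Hc p Hp e He) as [d [Hd H]].
  unfold within. apply locally3. exists d. split; [exact Hd|]. intros z Hz Oz. apply H; [apply closure2_incl, Oz|].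
  pose proof (dist2_sec z (pt s p)) as Q. rewrite sec_pt in Q. lra.
Qed.

Lemma fDer_trace s p : closure2 Om p -> forall i,
  filterlim (fDer i) (within (fun x => Om (sec x)) (locally (pt s p))) (locally (coord i (0, F2 p, F3 p))).
Proof.
  intros Hp i. destruct i.
  - exact (filterlim_Rconst (within (fun x => Om (sec x)) (locally (pt s p))) 0).
  - exact (f_trace F2 s p Hp (fl_F2c _ _ _ _ _ _ _ _ _ fl)).
  - exact (f_trace F3 s p Hp (fl_F3c _ _ _ _ _ _ _ _ _ fl)).
Qed.

(** At a wall point the downstream slip condition becomes one on the gradient of [f], because
    [l <> 0]. The first-order condition along inward directions then makes this gradient vanish; the
    shock is normal there and the mass flux singles out [up]. *)
Lemma shock_extremum p : closure2 Om p -> (forall q, Om q -> kap * f q <= kap * f p) ->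
  F2 p = 0 /\ F3 p = 0 /\ glim Dp phi (pt (f p) p) (up, 0, 0).
Proof.
  intros Hp Hext. pose proof (f_bounds p Hp) as Fb.
  destruct (glim_Dp_exists _ (proj2 (adh_shock p Hp))) as [L [HL _]].
  destruct (shock_downstream p L Hp (glim_Dm_U _) HL) as [Hl [E2 [E3 E]]].
  destruct (slip_inward p Hp) as [n [Sl Dir]]. specialize (Sl (f p) L ltac:(lra) HL).
  set (l := X1 L - um) in *.
  assert (Fn : F2 p * fst n + F3 p * snd n = 0).
  { rewrite E2, E3 in Sl. replace (- l * F2 p * fst n + - l * F3 p * snd n) with (- l * (F2 p * fst n + F3 p * snd n)) in Sl by ring.
    apply Rmult_integral in Sl. destruct Sl as [Sl|Sl]; [lra|exact Sl]. }
  destruct (Dir (kap * F2 p, kap * F3 p) 1) as [tau [Ht HO]]; [|lra|].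
  { simpl. replace (kap * F2 p * fst n + kap * F3 p * snd n) with (kap * (F2 p * fst n + F3 p * snd n)) by ring.
    rewrite Fn. ring. }
  pose (d := (0, kap * F2 p - 1 * fst n, kap * F3 p - 1 * snd n) : pt3).
  assert (D0 : dot3 (0, kap * F2 p, kap * F3 p) d <= 0).
  { apply (directional_max (fun x => Om (sec x)) (fun x => kap * f (sec x)) (fun i x => kap * fDer i x) (pt (f p) p) d _ (kap * f p) tau); auto.
    - intros z Hz. pose proof (C1D_mult _ _ _ _ z (C1D_const kap z) (C1D_f z Hz)) as Q.
      eapply C1D_ext_D; [|exact Q]. apply filter_forall. intros y i. Req. ring.
    - apply filterlim_Rmult; [typeclasses eauto|apply filterlim_Rconst; typeclasses eauto|].
      apply f_trace; [exact Hp|apply fl].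
    - intros i. replace (coord i (0, kap * F2 p, kap * F3 p)) with (kap * coord i (0, F2 p, F3 p)).
      + apply filterlim_Rmult; [typeclasses eauto|apply filterlim_Rconst; typeclasses eauto|apply fDer_trace, Hp].
      + destruct i; unfold coord, X1, X2, X3; simpl; ring. }
  assert (E0 : dot3 (0, kap * F2 p, kap * F3 p) d = (kap * kap) * (F2 p ^ 2 + F3 p ^ 2) - kap * (F2 p * fst n + F3 p * snd n)).
  { unfold dot3, d, X1, X2, X3; simpl. ring. }
  rewrite E0, kap_sqr, Fn in D0.
  assert (Z2 : F2 p = 0) by nra. assert (Z3 : F3 p = 0) by nra.
  split; [exact Z2|]. split; [exact Z3|]. rewrite Z2, Z3 in *.
  assert (X2L : X2 L = 0) by lra. assert (X3L : X3 L = 0) by lra.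
  assert (NL : normsq L = X1 L ^ 2) by (unfold normsq; rewrite X2L, X3L; ring).
  pose proof (glim_sub _ _ (proj2 (adh_shock p Hp)) HL) as B. rewrite NL in B, E.
  assert (EL : X1 L = up).
  { apply (subsonic_speed_unique gam b0 (fl_gam _ _ _ _ _ _ _ _ _ fl) (fl_stag _ _ _ _ _ _ _ _ _ fl) up (rho gam b0 (um ^ 2) * um)); auto; [lra| |].
    - pose proof cs_pos. apply Rabs_le_between. nra.
    - rewrite <- E. f_equal. ring. }
  replace (up, 0, 0) with L; [exact HL|]. destruct L as [[l1 l2] l3]. unfold X1, X2, X3 in *; simpl in *. congruence.
Qed.

Lemma shock_max p M : closure2 Om p -> (forall q, Om q -> kap * f q <= kap * f p) -> f p < sg ->
  (forall y, Wreg y -> pw y <= M) -> filterlim pw (within Wreg (locally (pt (f p) p))) (locally M) ->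
  kap * (up - (be + al * f p)) <= 0.
Proof.
  intros Hp Hext Hsg HM Lim. destruct (shock_extremum p Hp Hext) as [Z2 [Z3 HL]].
  set (x := pt (f p) p) in *. pose proof (glim_pwD Wreg x _ (fun z H => proj1 H) HL) as GL.
  destruct (slip_inward p Hp) as [n [_ Dir]].
  destruct (Dir (0, 0) 1) as [tau [Ht HO]]; [simpl; ring|lra|].
  pose (d := (1, 0 - 1 * fst n, 0 - 1 * snd n) : pt3).
  (* As the gradient of [f] vanishes at [p], the shock rises at rate at most 1/2 along the path,
     which climbs at rate 1 and so enters [Wreg]. *)
  destruct (directional_limit (fun x => Om (sec x)) (fun y => f (sec y)) fDer x d (0, F2 p, F3 p) (f p) tau) with (e := 1 / 2)
    as [s [Hs Ks]]; auto; try lra.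
  - intros z Hz. apply C1D_f, Hz.
  - apply f_trace; [exact Hp|apply fl].
  - apply fDer_trace, Hp.
  - assert (D0 : dot3 (kap * (X1 (up, 0, 0) - (be + al * X1 x)), kap * X2 (up, 0, 0), kap * X3 (up, 0, 0)) d <= 0).
    { apply (directional_max Wreg pw pwD x d _ M (Rmin s (sg - f p))); auto.
      - apply Rmin_glb_lt; lra.
      - intros t Htt. pose proof (Rmin_l s (sg - f p)). pose proof (Rmin_r s (sg - f p)).
        assert (Oz : Om (sec (shift x d t))) by exact (HO t ltac:(lra)).
        specialize (Ks t ltac:(lra)). rewrite Z2, Z3 in Ks.
        assert (E0 : dot3 (0, 0, 0) d = 0) by (unfold dot3, X1, X2, X3; simpl; ring). rewrite E0, Rmult_0_r, Rminus_0_r in Ks.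
        apply Rabs_le_between in Ks. pose proof (f_gt _ Oz).
        assert (EX : X1 (shift x d t) = f p + t) by (unfold shift, x, pt, d, X1; simpl; ring).
        repeat split; try assumption; rewrite EX; lra.
      - intros z Hz. apply C1D_pw, Hz. }
    assert (E : dot3 (kap * (X1 (up, 0, 0) - (be + al * X1 x)), kap * X2 (up, 0, 0), kap * X3 (up, 0, 0)) d = kap * (up - (be + al * f p))).
    { unfold dot3, d, x, pt, X1, X2, X3; simpl. ring. }
    rewrite E in D0. exact D0.
Qed.

(** On the shock [pw] equals [kap] times [um * f - prof f], and the latter increases with [f] since
    the profile is slower than [um]; maximising [pw] thus means extremising [f] among the shock
    points below the slice. *)
Lemma shock_extremal_value p M : closure2 Om p -> f p <= sg ->
  (forall y, Wreg y -> pw y <= M) -> adh3 Wreg (pt (f p) p) -> filterlim pw (within Wreg (locally (pt (f p) p))) (locally M) ->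
  M = kap * (um * f p - prof (f p)) /\ forall q, closure2 Om q -> f q < sg -> kap * f q <= kap * f p.
Proof.
  intros Hp Hsg HM Ha Lim.
  assert (EM : M = kap * (um * f p - prof (f p))).
  { apply (within_lim_unique Wreg (pt (f p) p) pw); [exact Ha|exact Lim|]. apply pw_shock_trace; [intros z Hz; apply Hz|exact Hp]. }
  split; [exact EM|]. intros q Hq Hfq.
  assert (Aq : adh3 Wreg (pt (f q) q)).
  { intros r Hr. destruct (proj2 (adh_shock q Hq) (Rmin r (sg - f q))) as [z [Dz Hz]]; [apply Rmin_glb_lt; lra|].
    pose proof (Rmin_l r (sg - f q)). pose proof (Rmin_r r (sg - f q)). exists z. split; [|lra]. split; [exact Dz|].
    destruct (abs_coord_le_dist3 z (pt (f q) q)) as [C _]. change (X1 (pt (f q) q)) with (f q) in C.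
    apply Rabs_le_between in C. lra. }
  pose proof (within_lim_le Wreg _ pw _ M Aq (pw_shock_trace Wreg q (fun z Hz => proj1 (proj1 Hz)) Hq) HM) as LE.
  rewrite EM in LE. pose proof (f_bounds p Hp) as Bp. pose proof (f_bounds q Hq) as Bq.
  assert (G : um * f p - prof (f p) - (um * f q - prof (f q)) = (um - (be + al * ((f p + f q) / 2))) * (f p - f q)) by (unfold prof; field).
  pose proof (prof_sub ((f p + f q) / 2) ltac:(lra)) as PS. apply Rabs_lt_between in PS.
  pose proof (fl_um _ _ _ _ _ _ _ _ _ fl). set (c := um - (be + al * ((f p + f q) / 2))) in *.
  assert (Hc : 0 < c) by (unfold c; lra).
  assert (0 <= c * (kap * f p - kap * f q)); [|nra].
  replace (c * (kap * f p - kap * f q)) with (kap * (c * (f p - f q))) by ring. rewrite <- G. lra.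
Qed.

End Profile.

(** * The exit speed and rigidity of the subsonic region *)

Lemma affine_sub al be : Rabs (be - al) < cs -> Rabs (be + al) < cs ->
  forall s, -1 <= s <= 1 -> Rabs (be + al * s) < cs.
Proof.
  intros H1 H2 s Hs. apply Rabs_lt_between in H1. apply Rabs_lt_between in H2. apply Rabs_lt_between.
  destruct (Rle_lt_dec 0 al); nra.
Qed.

(** Collects the alternatives with the inequality that each face imposes on the slope of the
    profile: a slope violating the inequality of one face forces the extremum onto the other. *)
Lemma profile_step kap al be sg : kap * kap = 1 -> kap * al < 0 -> Rabs (be - al) < cs -> Rabs (be + al) < cs ->
  sg <= 1 -> (exists x, Wreg sg x) ->
  exists M p, (forall y, Wreg sg y -> pw kap al be y <= M) /\ closure2 Om p /\
  ((f p <= sg /\ M = kap * (um * f p - prof al be (f p)) /\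
    (forall q, closure2 Om q -> f q < sg -> kap * f q <= kap * f p) /\
    (f p < sg -> (forall q, Om q -> kap * f q <= kap * f p) -> kap * (up - (be + al * f p)) <= 0)) \/
   (f p < sg /\ adh3 (Wreg sg) (pt sg p) /\ filterlim (pw kap al be) (within (Wreg sg) (locally (pt sg p))) (locally M) /\
    (sg = 1 -> 0 <= kap * (c1 - (be + al))))).
Proof.
  intros Hk Hs A1 A2 Hsg Hne.
  pose proof (affine_sub al be A1 A2) as Sub.
  destruct (location kap al be sg Hk ltac:(lra) Sub Hsg Hs Hne) as [M [x [HM [Ha [Lim [E|[L E]]]]]]].
  - exists M, (sec x). split; [exact HM|]. destruct (Wreg_adh sg x Ha) as [Hc Hx]. split; [exact Hc|]. left.
    assert (Ex : pt (f (sec x)) (sec x) = x) by (rewrite <- E; apply pt_sec).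
    destruct (shock_extremal_value kap al be sg Sub Hsg (sec x) M Hc ltac:(lra) HM ltac:(rewrite Ex; exact Ha) ltac:(rewrite Ex; exact Lim)) as [EM Ext].
    split; [lra|]. split; [exact EM|]. split; [exact Ext|]. intros Lt Ext'.
    apply (shock_max kap al be sg Hk Hsg (sec x) M Hc Ext' Lt HM). rewrite Ex. exact Lim.
  - exists M, (sec x). split; [exact HM|]. destruct (Wreg_adh sg x Ha) as [Hc Hx]. split; [exact Hc|]. right.
    assert (Ex : pt sg (sec x) = x) by (rewrite <- E; apply pt_sec). rewrite Ex.
    split; [lra|]. split; [exact Ha|]. split; [exact Lim|]. intros E1.
    apply (outlet_max kap al be sg Hk Hsg (sec x) M E1 Hc ltac:(lra) HM). rewrite <- E1, Ex. exact Lim.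
Qed.

Lemma Wreg_1 x : Wreg 1 x <-> Dp x.
Proof. split; [intros H; apply H|]. intros H. split; [exact H|]. apply H. Qed.

Lemma Dp_fiber p s : Om p -> f p < s < 1 -> Dp (pt s p).
Proof.
  intros Hp Hs. pose proof (f_gt p Hp). unfold Dplus, inD. rewrite sec_pt. unfold pt, X1; simpl.
  repeat split; try assumption; lra.
Qed.

Lemma Dp_nonempty : exists x, Wreg 1 x.
Proof.
  destruct (fl_ne _ _ _ _ _ _ _ _ _ fl) as [p Hp]. pose proof (f_lt p Hp). exists (pt ((f p + 1) / 2) p).
  apply Wreg_1, Dp_fiber; [exact Hp|lra].
Qed.

(** The slope of the chosen profiles lies strictly between [up] and [c1] everywhere, so the
    inequalities on the shock and at the outlet both fail when [c1 <> up]. *)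
Lemma exit_speed : c1 = up.
Proof.
  pose proof (fl_c1p _ _ _ _ _ _ _ _ _ fl) as C0. pose proof (fl_c1 _ _ _ _ _ _ _ _ _ fl) as C1.
  destruct (fl_ne _ _ _ _ _ _ _ _ _ fl) as [p1 Hp1].
  assert (B1 : Rabs ((up + c1) / 2 - (c1 - up) / 6) < cs) by (apply Rabs_lt_between; lra).
  assert (B2 : Rabs ((up + c1) / 2 + (c1 - up) / 6) < cs) by (apply Rabs_lt_between; lra).
  destruct (Rtotal_order c1 up) as [L|[E|L]]; [exfalso|exact E|exfalso].
  - destruct (profile_step 1 ((c1 - up) / 6) ((up + c1) / 2) 1 ltac:(lra) ltac:(lra) B1 B2 ltac:(lra) Dp_nonempty)
      as [M [p [HM [Hp [[Hf [_ [Ext Sh]]]|[Hf [_ [_ Out]]]]]]]].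
    + assert (Ext' : forall q, Om q -> 1 * f q <= 1 * f p) by (intros q Hq; apply Ext; [apply closure2_incl, Hq|apply f_lt, Hq]).
      pose proof (f_bounds p Hp) as Fb.
      destruct (Rle_lt_or_eq_dec _ _ Hf) as [Lt|E1].
      * specialize (Sh Lt Ext'). nra.
      (* The shock may touch the outlet at a wall point; the limit gradient there has norm both [up]
         and [c1]. *)
      * destruct (shock_extremum 1 ltac:(lra) p Hp Ext') as [_ [_ G]]. rewrite E1 in G.
        destruct (outlet_norm p _ Hp G) as [N _]. unfold normsq, X1, X2, X3 in N; simpl in N. nra.
    + specialize (Out eq_refl). lra.
  - destruct (profile_step (-1) ((c1 - up) / 6) ((up + c1) / 2) 1 ltac:(lra) ltac:(lra) B1 B2 ltac:(lra) Dp_nonempty)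
      as [M [p [HM [Hp [[Hf [_ [Ext Sh]]]|[Hf [_ [_ Out]]]]]]]].
    + assert (Ext' : forall q, Om q -> -1 * f q <= -1 * f p) by (intros q Hq; apply Ext; [apply closure2_incl, Hq|apply f_lt, Hq]).
      pose proof (f_bounds p Hp) as Fb. pose proof (Ext' p1 Hp1). pose proof (f_lt p1 Hp1).
      specialize (Sh ltac:(lra) Ext'). nra.
    + specialize (Out eq_refl). lra.
Qed.

Lemma quad_bound s : -1 <= s <= 1 -> 0 <= s ^ 2 <= 1.
Proof. intros H. nra. Qed.

(** The profile has slope between [up - 2 * e] and [up - e], which rules out the outlet; the minimum
    is on the shock, at a minimum of [f]. The point depends on [e] but the value of [f] there does
    not, so [e] can tend to 0. *)
Lemma subsonic_lower_bound : exists p0, closure2 Om p0 /\ f p0 < 1 /\ (forall q, Om q -> f p0 <= f q) /\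
  forall x, Dp x -> (um - up) * f p0 <= phi x - up * X1 x.
Proof.
  pose proof exit_speed as EC. destruct (fl_ne _ _ _ _ _ _ _ _ _ fl) as [p1 Hp1].
  assert (Step : forall e, 0 < e -> 2 * e < up -> exists p, closure2 Om p /\ f p < 1 /\
     (forall q, closure2 Om q -> f q < 1 -> f p <= f q) /\
     forall x, Dp x -> (um - up) * f p <= phi x - up * X1 x + 4 * e).
  { intros e He Hu.
    destruct (profile_step (-1) (e / 2) (up - 3 * e / 2) 1) as [M [p [HM [Hp [[Hf [EM [Ext _]]]|[Hf [_ [_ Out]]]]]]]];
      try lra; try (apply Rabs_lt_between; lra); try apply Dp_nonempty.
    assert (Ext' : forall q, closure2 Om q -> f q < 1 -> f p <= f q) by (intros q Hq Lq; specialize (Ext q Hq Lq); lra).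
    exists p. split; [exact Hp|]. split; [pose proof (Ext' p1 (closure2_incl _ _ Hp1) (f_lt p1 Hp1)); pose proof (f_lt p1 Hp1); lra|].
    split; [exact Ext'|]. intros x Hx. specialize (HM x (proj2 (Wreg_1 x) Hx)). rewrite EM in HM.
    unfold pw, prof in HM. pose proof (f_bounds p Hp) as Fb. pose proof (proj1 (proj1 Hx)) as Xb.
    pose proof (quad_bound (f p) ltac:(lra)). pose proof (quad_bound (X1 x) ltac:(lra)).
    set (s := X1 x) in *. set (s0 := f p) in *.
    (* The profile differs from [up * s] by [e * (- 3 / 2 * s + s ^ 2 / 4)], whose oscillation on
       [[-1, 1]] is below [4 * e]. *)
    assert (e * (- 3 / 2 * s + s ^ 2 / 4 - (- 3 / 2 * s0 + s0 ^ 2 / 4)) >= e * - 4).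
    { apply Rle_ge, Rmult_le_compat_l; lra. }
    lra. }
  destruct (Step (up / 4) ltac:(lra) ltac:(lra)) as [p0 [Hp0 [L0 [E0 _]]]].
  exists p0. split; [exact Hp0|]. split; [exact L0|]. split; [intros q Hq; apply E0; [apply closure2_incl, Hq|apply f_lt, Hq]|].
  intros x Hx. apply Rnot_lt_le. intros Lt.
  pose (g := (um - up) * f p0 - (phi x - up * X1 x)).
  pose (e := Rmin (g / 8) (up / 4)).
  assert (He : 0 < e /\ e <= g / 8 /\ e <= up / 4).
  { unfold e. split; [apply Rmin_glb_lt; unfold g; lra|]. split; [apply Rmin_l|apply Rmin_r]. }
  destruct (Step e ltac:(lra) ltac:(lra)) as [p [Hp [Lp [Ep Q]]]].
  assert (f p = f p0) by (apply Rle_antisym; [apply Ep|apply E0]; assumption).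
  specialize (Q x Hx). rewrite H in Q. unfold g in *. lra.
Qed.

Definition pw0 : pt3 -> R := pw (-1) 0 up.

Lemma pw0_eq x : pw0 x = - (phi x - up * X1 x).
Proof. unfold pw0, pw, prof. field. Qed.

Lemma up_const_sub s : -1 <= s <= 1 -> Rabs (up + 0 * s) < cs.
Proof. intros _. apply Rabs_lt_between. lra. Qed.

(** Here the profile is steeper than [up], which rules out the shock, and the region is cut midway
    between the lowest shock height and the outlet. The minimum sits on that slice, so
    [phi - up * x1] nearly reaches its lower bound away from both shock and outlet. *)
Lemma slice_almost p0 : closure2 Om p0 -> f p0 < 1 -> (forall q, Om q -> f p0 <= f q) ->
  forall e, 0 < e -> 3 * e < cs - up -> exists z, Dp z /\ Rabs (X1 z - (f p0 + 1) / 2) < e /\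
    phi z - up * X1 z <= (um - up) * f p0 + 6 * e.
Proof.
  intros Hp0 Hf0 Hmin e He Hcs. set (sg := (f p0 + 1) / 2). pose proof (f_bounds p0 Hp0) as Fb0.
  assert (Hne : exists x, Wreg sg x).
  { destruct (fl_fc _ _ _ _ _ _ _ _ _ fl p0 Hp0 (sg - f p0)) as [d [Hd H]]; [unfold sg; lra|].
    destruct (Hp0 d Hd) as [q [Oq Hq]]. specialize (H q (closure2_incl _ _ Oq) Hq). apply Rabs_lt_between in H.
    exists (pt ((f q + sg) / 2) q). split; [apply Dp_fiber; [exact Oq|unfold sg in *; lra]|]. unfold pt, X1; simpl. lra. }
  destruct (profile_step (-1) (e / 2) (up + 2 * e) sg) as [M [p [HM [Hp [[Hf [EM [Ext Sh]]]|[Hf [Ha [Lim _]]]]]]]];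
    try lra; try (apply Rabs_lt_between; lra); try (unfold sg; lra); try exact Hne.
  - exfalso. pose proof (Ext p0 Hp0 ltac:(unfold sg; lra)) as E0. pose proof (f_bounds p Hp) as Fb.
    assert (Lt : f p < sg) by (unfold sg; lra).
    assert (Ext' : forall q, Om q -> -1 * f q <= -1 * f p) by (intros q Hq; specialize (Hmin q Hq); lra).
    specialize (Sh Lt Ext'). nra.
  - assert (A0 : adh3 (Wreg sg) (pt (f p0) p0)).
    { intros r Hr. destruct (proj2 (adh_shock p0 Hp0) (Rmin r (sg - f p0))) as [z [Dz Hz]]; [apply Rmin_glb_lt; unfold sg; lra|].
      pose proof (Rmin_l r (sg - f p0)). pose proof (Rmin_r r (sg - f p0)). exists z. split; [|lra]. split; [exact Dz|].
      destruct (abs_coord_le_dist3 z (pt (f p0) p0)) as [C _]. change (X1 (pt (f p0) p0)) with (f p0) in C.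
      apply Rabs_le_between in C. lra. }
    pose proof (within_lim_le (Wreg sg) _ _ _ M A0 (pw_shock_trace (-1) (e / 2) (up + 2 * e) (Wreg sg) p0 (fun z Hz => proj1 (proj1 Hz)) Hp0) HM) as LE.
    pose proof (proj1 (filterlim_R _ _ _) Lim e He) as K. unfold within in K. apply locally3 in K. destruct K as [r [Hr K]].
    destruct (Ha (Rmin r e)) as [z [Wz Hz]]; [apply Rmin_glb_lt; lra|].
    pose proof (Rmin_l r e). pose proof (Rmin_r r e). specialize (K z ltac:(lra) Wz). apply Rabs_lt_between in K.
    exists z. split; [apply Wz|]. split.
    + destruct (abs_coord_le_dist3 z (pt sg p)) as [C _]. change (X1 (pt sg p)) with sg in C. lra.
    + unfold pw, prof in K, LE. pose proof (proj1 (proj1 (proj1 Wz))) as Xb.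
      pose proof (quad_bound (f p0) ltac:(lra)). pose proof (quad_bound (X1 z) ltac:(lra)).
      set (s := X1 z) in *. set (s0 := f p0) in *.
      assert (e * (2 * s + s ^ 2 / 4 - (2 * s0 + s0 ^ 2 / 4)) <= e * 5) by (apply Rmult_le_compat_l; lra).
      lra.
Qed.

(** Almost minimisers accumulate on the slice. The limit is not a shock point, as the trace at that
    height differs from the lower bound; at a wall point the Hopf argument for the profile [up * x1]
    would apply. Hence the bound is attained inside. *)
Lemma subsonic_touch p0 : closure2 Om p0 -> f p0 < 1 -> (forall q, Om q -> f p0 <= f q) ->
  (forall x, Dp x -> (um - up) * f p0 <= phi x - up * X1 x) ->
  exists x, Dp x /\ phi x - up * X1 x = (um - up) * f p0.
Proof.
  intros Hp0 Hf0 Hmin LB. set (m0 := (um - up) * f p0) in *. set (sg := (f p0 + 1) / 2).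
  pose (c := (cs - up) / 4).
  assert (K : forall n : nat, exists z, Dp z /\ Rabs (X1 z - sg) < c * / (INR n + 1) /\ phi z - up * X1 z <= m0 + 6 * (c * / (INR n + 1))).
  { intros n. pose proof (inv_INR_pos n). assert (Hc : 0 < c) by (unfold c; lra).
    assert (/ (INR n + 1) <= 1).
    { rewrite <- Rinv_1. apply Rinv_le_contravar; [lra|]. pose proof (pos_INR n). lra. }
    apply slice_almost; auto; [apply Rmult_lt_0_compat; lra|]. unfold c in *. nra. }
  destruct (nat_choice _ K) as [u Hu]. destruct inD_bounded as [B [_ HB]].
  destruct (BW3 u B (fun n => HB _ (proj1 (proj1 (Hu n))))) as [psi [x [Hpsi Hx]]].
  pose (v := fun n => u (psi n)).
  assert (Hv : forall n, Dp (v n)) by (intros n; apply Hu).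
  assert (Hc : 0 < c) by (unfold c; lra).
  assert (Small : forall e, 0 < e -> eventually (fun n => c * / (INR (psi n) + 1) < e)).
  { intros e He. destruct (inv_INR_small (e / c)) as [N HN]; [apply Rdiv_lt_0_compat; lra|].
    exists N. intros n Hn. specialize (HN (psi n) ltac:(specialize (Hpsi n); lia)).
    apply Rmult_lt_compat_l with (r := c) in HN; [|exact Hc]. replace (c * (e / c)) with e in HN by (field; lra). exact HN. }
  assert (X1x : X1 x = sg).
  { apply (seq_lim_unique (fun n => X1 (v n))); [exact (filterlim_comp _ _ _ _ _ _ _ _ Hx (continuous_X1 x))|].
    apply filterlim_R; [typeclasses eauto|]. intros e He. eapply filter_imp; [|apply (Small e He)]. intros n Hn.
    eapply Rlt_trans; [apply (Hu (psi n))|exact Hn]. }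
  assert (LimW : filterlim (fun n => pw0 (v n)) eventually (locally (- m0))).
  { apply filterlim_R; [typeclasses eauto|]. intros e He. eapply filter_imp; [|apply (Small (e / 6) ltac:(lra))]. intros n Hn.
    rewrite pw0_eq. pose proof (LB (v n) (Hv n)). destruct (Hu (psi n)) as [_ [_ A]]. fold (v n) in A.
    apply Rabs_lt_between. lra. }
  pose proof (seq_adh3 Dp v x Hv Hx) as Ha.
  assert (Lip : Lipschitz_on (inD Om) pw0) by (apply pw_lipschitz; lra).
  assert (Lim : forall A : pt3 -> Prop, (forall z, A z -> inD Om z) -> filterlim pw0 (within A (locally x)) (locally (- m0))).
  { intros A HA. apply (lipschitz_lim A (inD Om) pw0 x v); auto. intros n. apply Hv. }
  destruct (adh_closure Dp x (fun z H => proj1 H) Ha) as [_ Hcl]. pose proof (adh_Dp_ge x Ha) as Hf.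
  pose proof (fl_um _ _ _ _ _ _ _ _ _ fl) as Hum.
  assert (Lf : f (sec x) < X1 x).
  { destruct (Rle_lt_or_eq_dec _ _ Hf) as [L|E]; [exact L|exfalso].
    assert (Ex : pt (f (sec x)) (sec x) = x) by (rewrite E; apply pt_sec).
    pose proof (pw_shock_trace (-1) 0 up Dp (sec x) (fun z H => proj1 H) Hcl) as T. rewrite Ex in T.
    pose proof (within_lim_unique Dp x pw0 _ _ Ha (Lim Dp (fun z H => proj1 H)) T) as EQ.
    rewrite E, X1x in EQ. unfold prof, m0, sg in EQ. nra. }
  assert (Hsg1 : X1 x < 1) by (rewrite X1x; unfold sg; lra).
  destruct (classic (exists y, Dp y /\ phi y - up * X1 y = m0)) as [Y|N]; [exact Y|exfalso].
  assert (NI : forall y, Wreg 1 y -> pw (-1) 0 up y < - m0).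
  { intros y Hy. apply Wreg_1 in Hy. pose proof (pw0_eq y) as E. unfold pw0 in E. rewrite E. pose proof (LB y Hy).
    destruct (Rle_lt_or_eq_dec _ _ H) as [L|Eq]; [lra|]. exfalso. apply N. exists y. auto. }
  destruct (classic (Om (sec x))) as [O|NO].
  - pose proof (f_gt _ O) as Fg.
    assert (Dx : Dp x) by (repeat split; try assumption; lra).
    assert (E : pw0 x = - m0).
    { apply (within_lim_unique Dp x pw0); [exact Ha| |apply Lim; intros z Hz; apply Hz].
      eapply filterlim_filter_le_1; [apply filter_le_within|]. apply (C1D_continuous _ _ _ (C1D_pw (-1) 0 up x Dx)). }
    specialize (NI x (proj2 (Wreg_1 x) Dx)). unfold pw0 in E. lra.
  - apply (wall_hopf (-1) 0 up 1 ltac:(lra) ltac:(lra) up_const_sub ltac:(lra) x (- m0)); auto.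
    + split; assumption.
    + apply (Lim (Wreg 1)). intros z Hz. apply Hz.
Qed.

(** Connectedness of an interval: the indicator of [g] has zero derivative, so the mean value
    theorem makes it constant. *)
Lemma locally_const_interval (g : R -> Prop) a b :
  (forall s, a < s < b -> g s -> locally s g) -> (forall s, a < s < b -> ~ g s -> locally s (fun u => ~ g u)) ->
  forall s t, a < s < b -> a < t < b -> g s -> g t.
Proof.
  intros H1 H2 s t Hs Ht Gs. apply NNPP. intros N.
  pose (chi := fun u => if excluded_middle_informative (g u) then 1 else 0).
  assert (D : forall u, a < u < b -> is_derive chi u 0).
  { intros u Hu. apply (is_derive_ext_loc (fun _ => chi u)); [|apply is_derive_Rconst].
    unfold chi. destruct (excluded_middle_informative (g u)) as [G|G].
    - eapply filter_imp; [|apply (H1 u Hu G)]. intros v Hv. destruct (excluded_middle_informative (g v)); [reflexivity|contradiction].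
    - eapply filter_imp; [|apply (H2 u Hu G)]. intros v Hv. destruct (excluded_middle_informative (g v)); [contradiction|reflexivity]. }
  assert (In : forall c, Rmin s t <= c <= Rmax s t -> a < c < b).
  { intros c Hc. unfold Rmin, Rmax in Hc. destruct (Rle_dec s t); lra. }
  destruct (MVT_gen chi s t (fun _ => 0)) as [c [_ E]].
  - intros c Hc. apply D, In. lra.
  - intros c Hc. apply continuity_pt_filterlim, (ex_derive_continuous chi). eexists. apply D, In, Hc.
  - unfold chi in E. destruct (excluded_middle_informative (g s)); [|contradiction].
    destruct (excluded_middle_informative (g t)); [contradiction|lra].
Qed.

(** The contact set [Z] is open by the strong maximum principle and relatively closed; connectedness
    is used on the fibres over the cross-section, then on the cross-section itself. Equality of the
    two traces on the shock then makes [f] constant. *)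
Lemma subsonic_uniform : exists t, -1 < t < 1 /\ (forall p, Om p -> f p = t) /\
  forall x, Dp x -> phi x = up * (X1 x - t) + um * t.
Proof.
  destruct subsonic_lower_bound as [p0 [Hp0 [Hf0 [Hmin LB]]]].
  destruct (subsonic_touch p0 Hp0 Hf0 Hmin LB) as [x1 [Dx1 Ex1]].
  set (m0 := (um - up) * f p0) in *.
  pose (Z := fun x => Dp x /\ phi x - up * X1 x = m0).
  assert (Zopen : forall x, Z x -> locally x Z).
  { intros x [Dx Ex]. destruct (strong_max (-1) 0 up 1 ltac:(lra) ltac:(lra) up_const_sub x (- m0)) as [r [Hr H]].
    - apply Wreg_1, Dx.
    - intros y Hy. pose proof (pw0_eq y) as E. unfold pw0 in E. rewrite E. apply Wreg_1 in Hy. specialize (LB y Hy). lra.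
    - pose proof (pw0_eq x) as E. unfold pw0 in E. rewrite E. lra.
    - apply locally3. exists r. split; [exact Hr|]. intros y Hy. destruct (H y Hy) as [A B]. apply Wreg_1 in A.
      pose proof (pw0_eq y) as E. unfold pw0 in E. rewrite E in B. split; [exact A|lra]. }
  assert (Zclosed : forall x, Dp x -> ~ Z x -> locally x (fun y => Dp y /\ ~ Z y)).
  { intros x Dx Nx.
    assert (Lt : pw0 x < - m0).
    { rewrite pw0_eq. specialize (LB x Dx). destruct (Rle_lt_or_eq_dec _ _ LB) as [L|E]; [lra|]. exfalso. apply Nx. split; auto. }
    assert (C : continuous pw0 x) by apply (C1D_continuous _ _ _ (C1D_pw (-1) 0 up x Dx)).
    eapply filter_imp; [|apply (filter_and _ _ (open_Dp x Dx) (cont_lt_near pw0 x (- m0) C Lt))].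
    intros y [A Bq]. split; [exact A|]. intros [_ E]. rewrite pw0_eq in Bq. lra. }
  assert (Cpt : forall p s, continuous (fun u => pt u p) s).
  { intros p s. unfold pt. repeat apply continuous_pair; (apply continuous_id || apply continuous_const). }
  assert (Cq : forall s p, continuous (fun q => pt s q) p).
  { intros s p. unfold pt. repeat apply continuous_pair; [apply continuous_const|apply continuous_fst|apply continuous_snd]. }
  assert (Fiber : forall p s t, Om p -> f p < s < 1 -> f p < t < 1 -> Z (pt s p) -> Z (pt t p)).
  { intros p s t Op Hs Ht. apply (locally_const_interval (fun u => Z (pt u p)) (f p) 1); auto.
    - intros u Hu Zu. apply (Cpt p u Z), Zopen, Zu.
    - intros u Hu Nu. apply (Cpt p u (fun y => ~ Z y)).
      eapply filter_imp; [|apply (Zclosed (pt u p) (Dp_fiber p u Op Hu) Nu)]. intros y Hy. apply Hy. }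
  (* Projections of open sets; they are disjoint over [Om] because each fibre lies entirely inside
     or entirely outside [Z]. *)
  pose (U := fun p => exists s, Z (pt s p)). pose (V := fun p => exists s, Dp (pt s p) /\ ~ Z (pt s p)).
  assert (DpOm : forall s p, Dp (pt s p) -> Om p /\ f p < s < 1).
  { intros s p [[A B] C]. rewrite sec_pt in B, C. unfold pt, X1 in A, C; simpl in A, C. split; [exact B|lra]. }
  assert (All : forall x, Dp x -> Z x).
  { assert (Conn := fl_conn _ _ _ _ _ _ _ _ _ fl U V).
    destruct Conn as [NU|NV].
    - intros p [s Zs]. apply locally2. eapply filter_imp; [|apply (Cq s p Z), Zopen, Zs]. intros q Hq. exists s. exact Hq.
    - intros p [s [Ds Ns]]. apply locally2.
      eapply filter_imp; [|apply (Cq s p (fun y => Dp y /\ ~ Z y)), (Zclosed _ Ds Ns)]. intros q Hq. exists s. exact Hq.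
    - intros p Op. pose proof (f_lt p Op). assert (D : Dp (pt ((f p + 1) / 2) p)) by (apply Dp_fiber; [exact Op|lra]).
      destruct (classic (Z (pt ((f p + 1) / 2) p))) as [A|A]; [left; eexists; exact A|right; eexists; split; [exact D|exact A]].
    - intros p [Op [[s Zs] [t [Dt Nt]]]]. apply Nt. destruct (DpOm s p (proj1 Zs)) as [_ Bs]. destruct (DpOm t p Dt) as [_ Bt].
      apply (Fiber p s t); assumption.
    - exfalso. apply (NU (sec x1)). split; [apply Dx1|]. exists (X1 x1). rewrite pt_sec. split; assumption.
    - intros x Dx. apply NNPP. intros Nx. apply (NV (sec x)). split; [apply Dx|]. exists (X1 x). rewrite pt_sec. auto. }
  pose proof (fl_um _ _ _ _ _ _ _ _ _ fl) as Hum.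
  assert (Fc : forall p, Om p -> f p = f p0).
  { intros p Op. pose proof (closure2_incl _ _ Op) as Cp. destruct (adh_shock p Cp) as [_ Ap].
    pose proof (shock_trace Dp p (fun z H => proj1 H) Cp) as T1.
    assert (T2 : filterlim phi (within Dp (locally (pt (f p) p))) (locally (up * f p + m0))).
    { apply filterlim_R; [typeclasses eauto|]. intros e He.
      assert (C : filterlim (fun z => up * X1 z + m0) (within Dp (locally (pt (f p) p))) (locally (up * f p + m0))).
      { eapply filterlim_filter_le_1; [apply filter_le_within|].
        apply (continuous_Rplus (fun z => up * X1 z) (fun _ => m0)); [|apply continuous_const].
        apply continuous_Rmult; [apply continuous_const|apply continuous_X1]. }
      pose proof (proj1 (filterlim_R _ _ _) C e He) as K. unfold within in *. eapply filter_imp; [|exact K].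
      intros z Hz Dz. specialize (Hz Dz). destruct (All z Dz) as [_ E]. replace (phi z) with (up * X1 z + m0) by lra. exact Hz. }
    pose proof (within_lim_unique Dp _ phi _ _ Ap T1 T2) as E. unfold m0 in E. nra. }
  destruct (fl_ne _ _ _ _ _ _ _ _ _ fl) as [p1 Hp1]. pose proof (f_gt p1 Hp1) as G1. rewrite (Fc p1 Hp1) in G1.
  exists (f p0). split; [lra|]. split; [exact Fc|]. intros x Dx. destruct (All x Dx) as [_ E]. unfold m0 in E. lra.
Qed.

Lemma flow_is_phi_t : exists t, -1 < t < 1 /\ forall x, inD Om x -> phi x = phi_t um up t x.
Proof.
  destruct subsonic_uniform as [t [Ht [Hf Hphi]]]. exists t. split; [exact Ht|]. intros x Hx.
  pose proof (Hf _ (proj2 Hx)) as Ft. unfold phi_t. destruct (Rlt_dec (X1 x) t) as [L|L].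
  - apply supersonic_phi. split; [exact Hx|lra].
  - destruct (Req_dec (X1 x) t) as [E|N].
    (* On the shock plane itself the value comes from the continuity of [phi]. *)
    + rewrite E. replace (up * (t - t) + um * t) with (um * t) by ring.
      assert (Ex : pt (f (sec x)) (sec x) = x) by (rewrite Ft, <- E; apply pt_sec).
      pose proof (closure2_incl _ _ (proj2 Hx)) as Cx.
      pose proof (shock_trace Dm (sec x) (fun z H => proj1 H) Cx) as T. pose proof (proj1 (adh_shock (sec x) Cx)) as A.
      rewrite Ex in T, A. rewrite <- Ft.
      apply (within_lim_unique Dm x phi); [exact A| |exact T]. apply phi_lim; [intros z Hz; apply Hz|exact Hx].
    + apply Hphi. split; [exact Hx|]. lra.
Qed.

End Flow.

(** * The explicit solution with a planar shock *)

Section PlanarShock.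
Variables (Om : pt2 -> Prop) (gam b0 um up : R).
Hypothesis gam_ge : 1 <= gam.
Hypothesis stag : 1 < gam -> 0 < 1 + (gam - 1) * b0.
Hypothesis um_sup : cstar gam b0 < um.
Hypothesis um_dens : 0 < dens_base gam b0 (um ^ 2).
Hypothesis up0 : 0 < up.
Hypothesis up_lt : up < cstar gam b0.
Hypothesis flux_eq : rho gam b0 (up ^ 2) * up = rho gam b0 (um ^ 2) * um.

Let phi0 : pt3 -> R := phi_t um up 0.
Let flat : pt2 -> R := fun _ => 0.

(** Writing the potential as [spd] times [X1] treats both sides of the shock at once. *)
Definition spd (x : pt3) : R := if Rlt_dec (X1 x) 0 then um else up.

Lemma phi0_eq x : phi0 x = spd x * X1 x.
Proof. unfold phi0, phi_t, spd. destruct (Rlt_dec (X1 x) 0); ring. Qed.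

Lemma spd_near x : X1 x <> 0 -> locally x (fun y => spd y = spd x /\ X1 y <> 0).
Proof.
  intros H. unfold spd. destruct (Rlt_dec (X1 x) 0) as [L|L].
  - eapply filter_imp; [|apply (cont_lt_near X1 x 0 (continuous_X1 x) L)]. intros y Hy.
    destruct (Rlt_dec (X1 y) 0); [split; [reflexivity|lra]|lra].
  - assert (L' : 0 < X1 x) by lra.
    eapply filter_imp; [|apply (continuous_X1 x (fun u => 0 < u)), (open_gt 0 (X1 x)), L']. intros y Hy. simpl in Hy.
    destruct (Rlt_dec (X1 y) 0); [lra|split; [reflexivity|lra]].
Qed.

Lemma is_par_phi0 x i : X1 x <> 0 -> is_par i phi0 x (match i with I1 => spd x | _ => 0 end).
Proof.
  intros H. apply (is_par_ext_loc i (fun y => spd x * X1 y + 0 * X2 y + 0 * X3 y + 0)).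
  - eapply filter_imp; [|apply (spd_near x H)]. intros y [E _]. rewrite phi0_eq, E. Req. ring.
  - exact (C1D_is_par _ _ x i (C1D_affine (spd x) 0 0 0 x)).
Qed.

Lemma dpar_phi0 x i : X1 x <> 0 -> dpar i phi0 x = match i with I1 => spd x | _ => 0 end.
Proof. intros H. apply is_par_dpar, is_par_phi0, H. Qed.

Lemma grad_phi0 x : X1 x <> 0 -> grad phi0 x = (spd x, 0, 0).
Proof. intros H. unfold grad. rewrite !dpar_phi0 by exact H. reflexivity. Qed.

Lemma dpar_phi0_near x i : X1 x <> 0 -> locally x (fun y => dpar i phi0 y = dpar i phi0 x).
Proof.
  intros H. eapply filter_imp; [|apply (spd_near x H)]. intros y [E Hy]. rewrite !dpar_phi0 by assumption.
  destruct i; [exact E|reflexivity..].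
Qed.

Lemma is_par_dpar_phi0 x i j : X1 x <> 0 -> is_par j (dpar i phi0) x 0.
Proof.
  intros H. apply (is_par_ext_loc j (fun _ => dpar i phi0 x)); [|apply is_par_const].
  eapply filter_imp; [|apply (dpar_phi0_near x i H)]. intros y E. symmetry. exact E.
Qed.

Lemma norm3_axis a : 0 <= a -> norm3 (a, 0, 0) = a.
Proof.
  intros Ha. unfold norm3, X1, X2, X3; simpl. replace (a * (a * 1) + 0 * (0 * 1) + 0 * (0 * 1)) with (a ^ 2) by ring.
  apply sqrt_pow2, Ha.
Qed.

Lemma spd_bounds x : 0 < spd x <= um.
Proof. unfold spd. destruct (Rlt_dec (X1 x) 0); lra. Qed.

Lemma locally_const_cont (A : pt3 -> Prop) (h : pt3 -> R) :
  (forall y, A y -> locally y (fun z => h z = h y)) -> cont3_on A h.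
Proof.
  intros H y Ay e He. specialize (H y Ay). apply locally3 in H. destruct H as [r [Hr H]].
  exists r. split; [exact Hr|]. intros z _ Hz. rewrite (H z Hz), Rminus_diag, Rabs_R0. exact He.
Qed.

Lemma phi0_lip x y : Rabs (phi0 x - phi0 y) <= um * dist3 x y.
Proof.
  destruct (abs_coord_le_dist3 x y) as [C _]. apply Rle_trans with (um * Rabs (X1 x - X1 y)); [|apply Rmult_le_compat_l; lra].
  rewrite !phi0_eq. unfold spd. destruct (Rlt_dec (X1 x) 0), (Rlt_dec (X1 y) 0).
  - rewrite <- Rmult_minus_distr_l, Rabs_mult, (Rabs_right um) by lra. lra.
  - rewrite (Rabs_left1 (X1 x - X1 y)) by lra. rewrite Rabs_left1; nra.
  - rewrite (Rabs_right (X1 x - X1 y)) by lra. rewrite Rabs_right; nra.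
  - rewrite <- Rmult_minus_distr_l, Rabs_mult, (Rabs_right up) by lra. apply Rmult_le_compat_r; [apply Rabs_pos|lra].
Qed.

Lemma cond_nz x : Dminus Om flat x \/ Dplus Om flat x -> X1 x <> 0.
Proof. unfold Dminus, Dplus, flat. intros [[_ H]|[_ H]]; lra. Qed.

Lemma spd_Dm x : Dminus Om flat x -> spd x = um.
Proof. intros [_ H]. unfold flat in H. unfold spd. destruct (Rlt_dec (X1 x) 0); [reflexivity|lra]. Qed.

Lemma spd_Dp x : Dplus Om flat x -> spd x = up.
Proof. intros [_ H]. unfold flat in H. unfold spd. destruct (Rlt_dec (X1 x) 0); [lra|reflexivity]. Qed.

Lemma phi0_C2 : C2_on (fun x => Dminus Om flat x \/ Dplus Om flat x) phi0.
Proof.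
  split; [|split; [|split]].
  - intros x Hx i j. apply cond_nz in Hx. split; [eexists; apply is_par_phi0, Hx|eexists; apply is_par_dpar_phi0, Hx].
  - intros y Hy e He. destruct (exists_small (e / 2) um) as [d [Hd Ed]]; [lra|lra|].
    exists d. split; [exact Hd|]. intros z _ Hz. pose proof (phi0_lip z y).
    assert (um * dist3 z y <= um * d) by (apply Rmult_le_compat_l; lra). lra.
  - intros i. apply locally_const_cont. intros y Hy. apply dpar_phi0_near, cond_nz, Hy.
  - intros i j. apply locally_const_cont. intros y Hy. apply cond_nz in Hy.
    eapply filter_imp; [|apply (spd_near y Hy)]. intros z [_ Hz].
    rewrite (is_par_dpar _ _ _ _ (is_par_dpar_phi0 z i j Hz)), (is_par_dpar _ _ _ _ (is_par_dpar_phi0 y i j Hy)). reflexivity.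
Qed.

Lemma grad_lim_const (A : pt3 -> Prop) y c : adh3 A y -> (forall z, A z -> X1 z <> 0 /\ spd z = c) -> grad_lim A phi0 y (c, 0, 0).
Proof.
  intros Ha HA. unfold grad_lim, lim_in3.
  repeat split; try exact Ha; intros e He; exists 1; (split; [lra|]); intros z Az _; destruct (HA z Az) as [N E];
    rewrite dpar_phi0 by exact N; unfold X1, X2, X3; simpl; rewrite ?E, Rminus_diag, Rabs_R0; exact He.
Qed.

(** Makes the inlet and outlet conditions vacuous for the region on the far side of the shock. *)
Lemma far_not_adh (A : pt3 -> Prop) y c : (forall z, A z -> c <= Rabs (X1 z - X1 y)) -> 0 < c -> ~ adh3 A y.
Proof.
  intros H Hc Ha. destruct (Ha c Hc) as [z [Az Hz]]. specialize (H z Az). destruct (abs_coord_le_dist3 z y) as [C _]. lra.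
Qed.

Lemma planar_shock : transonic_sol Om gam b0 um up phi0 flat.
Proof.
  assert (Hu : 0 < um) by lra. pose proof (cstar_pos gam b0 gam_ge stag) as Hcs.
  assert (GDm : forall y, adh3 (Dminus Om flat) y -> grad_lim (Dminus Om flat) phi0 y (um, 0, 0)).
  { intros y Ha. apply grad_lim_const; [exact Ha|]. intros z Hz. split; [apply cond_nz; left; exact Hz|apply spd_Dm, Hz]. }
  assert (GDp : forall y, adh3 (Dplus Om flat) y -> grad_lim (Dplus Om flat) phi0 y (up, 0, 0)).
  { intros y Ha. apply grad_lim_const; [exact Ha|]. intros z Hz. split; [apply cond_nz; right; exact Hz|apply spd_Dp, Hz]. }
  split; [|split; [|split; [|split; [|split; [|split; [|split; [|split; [|split]]]]]]]].
  - split; [|split].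
    + intros p _. split; (eexists; apply (is_derive_Rconst 0)).
    + intros p _ e He. exists 1. split; [lra|]. intros q _ _. unfold flat. rewrite Rminus_diag, Rabs_R0. exact He.
    + exists (fun _ => 0), (fun _ => 0).
      assert (Z : cont2_on (closure2 Om) (fun _ => 0)).
      { intros p _ e He. exists 1. split; [lra|]. intros q _ _. rewrite Rminus_diag, Rabs_R0. exact He. }
      split; [exact Z|]. split; [exact Z|]. intros p _. unfold flat. split; apply Derive_const.
  - exists um. intros x y _ _. apply phi0_lip.
  - apply phi0_C2.
  - intros x Hx. rewrite grad_phi0 by (apply cond_nz; left; exact Hx). rewrite (spd_Dm x Hx), norm3_axis; lra.
  - intros x Hx. rewrite grad_phi0 by (apply cond_nz; right; exact Hx). rewrite (spd_Dp x Hx), norm3_axis; lra.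
  - intros x Hx. pose proof (cond_nz x Hx) as N. split.
    + rewrite grad_phi0 by exact N. rewrite norm3_axis by (pose proof (spd_bounds x); lra).
      destruct Hx as [Hx|Hx]; [rewrite (spd_Dm x Hx); exact um_dens|rewrite (spd_Dp x Hx)].
      apply dens_pos_subsonic; [exact gam_ge|exact stag|]. nra.
    + assert (F : forall i, is_par i (flux gam b0 phi0 i) x 0).
      { intros i. apply (is_par_ext_loc i (fun _ => flux gam b0 phi0 i x)); [|apply is_par_const].
        eapply filter_imp; [|apply (spd_near x N)]. intros y [E Ny]. unfold flux.
        rewrite !grad_phi0, !dpar_phi0 by assumption. rewrite E. reflexivity. }
      exists 0, 0, 0. split; [exact (F I1)|]. split; [exact (F I2)|]. split; [exact (F I3)|ring].
  - intros y [Hy Oy]. split; [|split].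
    + split.
      * intros r Hr. exists (pt (-1 + Rmin (r / 2) 1) (sec y)).
        assert (0 < Rmin (r / 2) 1) by (apply Rmin_glb_lt; lra). pose proof (Rmin_l (r / 2) 1). pose proof (Rmin_r (r / 2) 1). split.
        -- split; [unfold pt, X1; simpl; lra|rewrite sec_pt; exact Oy].
        -- rewrite <- (pt_sec y) at 2. rewrite Hy. eapply Rle_lt_trans; [apply dist3_pt|]. rewrite dist2_refl.
           replace (-1 + Rmin (r / 2) 1 - -1) with (Rmin (r / 2) 1) by ring. rewrite Rabs_right; lra.
      * intros e He. destruct (exists_small (e / 2) um) as [d [Hd Ed]]; [lra|lra|].
        exists d. split; [exact Hd|]. intros z _ Hz. pose proof (phi0_lip z y) as L.
        assert (Ey : phi0 y = - um).
        { rewrite phi0_eq. unfold spd. rewrite Hy. destruct (Rlt_dec (-1) 0); lra. }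
        rewrite Ey in L. assert (um * dist3 z y <= um * d) by (apply Rmult_le_compat_l; lra). lra.
    + intros Ha. exists (um, 0, 0). split; [apply GDm, Ha|]. unfold X1; simpl. lra.
    + intros Ha. exfalso. apply (far_not_adh (Dplus Om flat) y 1); [|lra|exact Ha]. intros z [_ Hz]. unfold flat in Hz.
      rewrite Hy, Rabs_right; lra.
  - intros y [Hy Oy]. split.
    + intros Ha. exfalso. apply (far_not_adh (Dminus Om flat) y 1); [|lra|exact Ha]. intros z [_ Hz]. unfold flat in Hz.
      rewrite Hy, Rabs_left1; lra.
    + intros Ha. exists (up, 0, 0). split; [apply GDp, Ha|]. rewrite norm3_axis by lra. unfold X1; simpl. lra.
  - intros y Hy. split.
    + intros Ha. exists (um, 0, 0). split; [apply GDm, Ha|]. intros nu _. unfold X2, X3; simpl. ring.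
    + intros Ha. exists (up, 0, 0). split; [apply GDp, Ha|]. intros nu _. unfold X2, X3; simpl. ring.
  - intros s [[Hs Os] Hf]. unfold flat in Hf. exists (um, 0, 0), (up, 0, 0).
    assert (E : s = pt 0 (sec s)) by (rewrite <- Hf; symmetry; apply pt_sec).
    assert (Am : adh3 (Dminus Om flat) s).
    { intros r Hr. assert (0 < Rmin (r / 2) (1 / 2)) by (apply Rmin_glb_lt; lra).
      pose proof (Rmin_l (r / 2) (1 / 2)). pose proof (Rmin_r (r / 2) (1 / 2)).
      exists (pt (- Rmin (r / 2) (1 / 2)) (sec s)). split.
      - unfold Dminus, inD, flat. rewrite sec_pt. unfold pt, X1; simpl. repeat split; try assumption; lra.
      - rewrite E at 2. eapply Rle_lt_trans; [apply dist3_pt|]. rewrite dist2_refl, Rminus_0_r, Rabs_Ropp, Rabs_right; lra. }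
    assert (Ap : adh3 (Dplus Om flat) s).
    { intros r Hr. assert (0 < Rmin (r / 2) (1 / 2)) by (apply Rmin_glb_lt; lra).
      pose proof (Rmin_l (r / 2) (1 / 2)). pose proof (Rmin_r (r / 2) (1 / 2)).
      exists (pt (Rmin (r / 2) (1 / 2)) (sec s)). split.
      - unfold Dplus, inD, flat. rewrite sec_pt. unfold pt, X1; simpl. repeat split; try assumption; lra.
      - rewrite E at 2. eapply Rle_lt_trans; [apply dist3_pt|]. rewrite dist2_refl, Rminus_0_r, Rabs_right; lra. }
    split; [apply GDm, Am|]. split; [apply GDp, Ap|]. rewrite !norm3_axis by lra. split; [|lra].
    unfold dot3, shock_normal, X1, X2, X3; simpl. simpl in flux_eq. rewrite !Rmult_1_r in *. rewrite !Rmult_0_l, !Rplus_0_r. exact flux_eq.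
Qed.

End PlanarShock.

Theorem theorem1p1 (Om : pt2 -> Prop) (gam b0 um c1 up : R) :
  domain2 Om -> bounded2 Om -> C3_boundary Om ->
  1 <= gam ->
  (1 < gam -> 0 < 1 + (gam - 1) * b0) ->
  cstar gam b0 < um ->
  (1 < gam -> um < sqrt (2 * (b0 + 1 / (gam - 1)))) ->
  0 < c1 -> c1 < cstar gam b0 ->
  (* up is u^+ : the number in (0, c_* ) with rho(up^2) up = rho(um^2) um *)
  0 < up -> up < cstar gam b0 ->
  rho gam b0 (up ^ 2) * up = rho gam b0 (um ^ 2) * um ->
  ((exists (phi : pt3 -> R) (f : pt2 -> R), transonic_sol Om gam b0 um c1 phi f)
     <-> c1 = up) /\
  (forall (phi : pt3 -> R) (f : pt2 -> R), transonic_sol Om gam b0 um c1 phi f ->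
     exists t, -1 < t < 1 /\ forall x, inD Om x -> phi x = phi_t um up t x).
Proof.
  intros HD HB HC Hg HK Hum Hum2 Hc0 Hc1 Hup0 Hup1 Heq.
  assert (Fl : forall phi f, transonic_sol Om gam b0 um c1 phi f -> exists F2 F3, flow Om gam b0 um c1 phi f F2 F3)
    by (intros phi f; apply flow_of_sol; assumption).
  split; [split|].
  - intros [phi [f Hs]]. destruct (Fl phi f Hs) as [F2 [F3 fl]].
    exact (exit_speed Om gam b0 um c1 phi f F2 F3 fl up Hup0 Hup1 Heq).
  - intros ->. exists (phi_t um up 0), (fun _ => 0). apply planar_shock; auto.
    apply (upstream_dens gam b0 um); auto.
  - intros phi f Hs. destruct (Fl phi f Hs) as [F2 [F3 fl]].
    exact (flow_is_phi_t Om gam b0 um c1 phi f F2 F3 fl up Hup0 Hup1 Heq).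
Qed.
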